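(* Let $\mathcal{Q}_c^{n+1}$ be a space form of constant sectional curvature $c\le 0$, and let $M^n$ be a complete, noncompact, orientable, properly immersed hypersurface of $\mathcal{Q}_c^{n+1}$. Assume that $S_r\ge 0$, $S_r\not\equiv 0$ and $S_{r+1}\equiv 0$ on $M$ for some integer $r$ with $0\le r\le n-1$. Then $\int_M S_r\,dM=\infty$.
   Context: A space form $\mathcal{Q}_c^{n+1}$ is a complete, simply connected Riemannian manifold of dimension $n+1$ with constant sectional curvature $c$. Fix a unit normal field along the (isometric) immersion and let $\lambda_1,\dots,\lambda_n$ be the eigenvalues of the corresponding shape operator $A$ (principal curvatures). Define $S_0=1$, $S_r=\sum_{i_1<\dots<i_r}\lambda_{i_1}\cdots\lambda_{i_r}$ for $1\le r\le n$, and $S_r=0$ for $r\ge n+1$. $dM$ is the Riemannian volume element of $M$. *)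

(* Defs.v *)
From HB Require Import structures.
From mathcomp Require Import all_boot all_order all_algebra.
From mathcomp Require Import all_classical all_reals all_analysis.

Set Implicit Arguments.
Unset Strict Implicit.
Unset Printing Implicit Defensive.

Import Order.TTheory GRing.Theory Num.Theory.
Import numFieldNormedType.Exports.

Local Open Scope classical_set_scope.
Local Open Scope ring_scope.

(* Tangent vectors are row vectors of coordinates, so linear maps act on the
   right: by [deriveEjacobian], ['D_v f y = v *m 'J f y]. *)

Section Calculus.
Context {R : realType} {n : nat}.

Definition partial {V : normedModType R} (i : 'I_n) (f : 'rV[R]_n -> V)
  : 'rV[R]_n -> V := fun y => 'D_(delta_mx 0 i) f y.

Fixpoint Ck_on {V : normedModType R} (k : nat) (D : set 'rV[R]_n)
    (f : 'rV[R]_n -> V) : Prop :=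
  (forall y, D y -> {for y, continuous f}) /\
  match k with
  | 0%N => True
  | k'.+1 => forall i : 'I_n,
      (forall y, D y -> derivable f y (delta_mx 0 i)) /\
      Ck_on k' D (partial i f)
  end.

(* Only meant for open [D]; [f] may be arbitrary outside [D]. *)
Definition smooth_on {V : normedModType R} (D : set 'rV[R]_n)
  (f : 'rV[R]_n -> V) : Prop := forall k, Ck_on k D f.

End Calculus.

(* Integral over R^n against Lebesgue measure, as an iterated integral; it is
   only used for nonnegative Borel functions (Tonelli). *)
Fixpoint lebesgue_integral_rV {R : realType} (n : nat) :
    ('rV[R]_n -> \bar R) -> \bar R :=
  match n with
  | 0%N => fun f => f 0
  | k.+1 => fun f =>
      (\int[lebesgue_measure]_(t in [set: R])
         lebesgue_integral_rV (fun v : 'rV[R]_k =>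
           f (row_mx (const_mx t : 'rV[R]_1) v)))%E
  end.

Section Manifolds.
Context {R : realType}.

Record chart (n : nat) (T : topologicalType) := Chart {
  chart_dom : set T;
  chart_map :> T -> 'rV[R]_n;
  chart_inv : 'rV[R]_n -> T;
  chart_dom_open : open chart_dom;
  chart_img_open : open (chart_map @` chart_dom);
  chart_mapK : forall p, chart_dom p -> chart_inv (chart_map p) = p;
  chart_map_continuous :
    forall p, chart_dom p -> {for p, continuous chart_map};
  chart_inv_continuous :
    forall y, (chart_map @` chart_dom) y -> {for y, continuous chart_inv}
}.

Definition transition n T (c d : chart n T) : 'rV[R]_n -> 'rV[R]_n :=
  fun y => d (chart_inv c y).

Definition smooth_transition n T (c d : chart n T) : Prop :=
  smooth_on (c @` (chart_dom c `&` chart_dom d)) (transition c d).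

(* Manifolds are nonempty (the base point carries no meaning: it only serves
   the library's measurable types) and not assumed connected. *)
Record smoothManifold (n : nat) := SmoothManifold {
  carrier :> ptopologicalType;
  manifold_hausdorff : hausdorff_space carrier;
  manifold_second_countable : @second_countable carrier;
  atlas : set (chart n carrier);
  chart_at : carrier -> chart n carrier;
  chart_at_atlas : forall p, atlas (chart_at p);
  chart_at_dom : forall p, chart_dom (chart_at p) p;
  atlas_smooth : forall c d, atlas c -> atlas d -> smooth_transition c d
}.

(* [metric c p i j] is g(d_i, d_j) at [p] in the coordinates of [c]; it is
   meaningful only for [c] in the atlas and [p] in its domain. *)
Record riemannianManifold (n : nat) := RiemannianManifold {
  manifold_of :> smoothManifold n;
  metric : chart n manifold_of -> manifold_of -> 'M[R]_n;
  metric_sym : forall c p, atlas c -> chart_dom c p ->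
    (metric c p)^T = metric c p;
  metric_pos : forall c p, atlas c -> chart_dom c p ->
    forall v : 'rV[R]_n, v != 0 -> 0 < (v *m metric c p *m v^T) 0 0;
  metric_smooth : forall c, atlas c ->
    smooth_on (c @` chart_dom c) (fun y => metric c (chart_inv c y));
  metric_change : forall c d p, atlas c -> atlas d ->
    chart_dom c p -> chart_dom d p ->
    metric c p = 'J (transition c d) (c p) *m metric d p
                 *m ('J (transition c d) (c p))^T
}.

(* Orientability: the smooth structure contains a covering family of charts
   with positive transition Jacobians (not necessarily a subfamily of the given
   atlas, whose charts may have disconnected domains). *)
Definition orientable n (M : smoothManifold n) : Prop :=
  exists A : set (chart n M),
    [/\ forall c d, A c -> atlas d ->
          smooth_transition c d /\ smooth_transition d c,
        forall p, exists2 c, A c & chart_dom c p &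
        forall c d p, A c -> A d -> chart_dom c p -> chart_dom d p ->
          0 < \det ('J (transition c d) (c p))].

Definition simply_connected (T : topologicalType) : Prop :=
  (forall p q : T, exists g : R -> T,
     [/\ {within `[0, 1], continuous g}, g 0 = p & g 1 = q]) /\
  (forall g : R -> T, {within `[0, 1], continuous g} -> g 0 = g 1 ->
     exists H : R * R -> T,
       [/\ {within `[0, 1] `*` `[0, 1], continuous H},
           forall t, t \in `[0, 1] -> H (0, t) = g t,
           forall t, t \in `[0, 1] -> H (1, t) = g 0 &
           forall s, s \in `[0, 1] -> H (s, 0) = g 0 /\ H (s, 1) = g 0]).

Definition proper_map (T U : topologicalType) (f : T -> U) : Prop :=
  continuous f /\ forall K : set U, compact K -> compact (f @^-1` K).

End Manifolds.

Arguments chart R n T : clear implicits.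
Arguments smoothManifold R n : clear implicits.
Arguments riemannianManifold R n : clear implicits.

Section RiemannianGeometry.
Context {R : realType} {n : nat} (M : riemannianManifold R n).

Definition C1_curve (g : R -> M) : Prop :=
  continuous g /\
  forall (d : chart R n M) (t : R), atlas d -> chart_dom d (g t) ->
    derivable (d \o g : R -> 'rV[R]_n) t 1 /\
    {for t, continuous (derive1 (d \o g : R -> 'rV[R]_n))}.

Definition speed (g : R -> M) (t : R) : R :=
  let d := chart_at (g t) in
  let v := derive1 (d \o g : R -> 'rV[R]_n) t in
  Num.sqrt ((v *m metric d (g t) *m v^T) 0 0).

Definition curve_length (g : R -> M) : \bar R :=
  (\int[lebesgue_measure]_(t in `[0%R, 1%R]) (speed g t)%:E)%E.

(* Piecewise C^1 curves give the same infimum (reparametrize with vanishing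
   velocity at the corners); it is +oo between distinct components. *)
Definition riemannian_dist (p q : M) : \bar R :=
  ereal_inf [set curve_length g | g in
    [set g : R -> M | [/\ C1_curve g, g 0 = p & g 1 = q]]].

Definition riemannian_complete : Prop :=
  forall u : nat -> M,
    (forall e : R, 0 < e -> exists N : nat, forall i j : nat,
       (N <= i)%N -> (N <= j)%N -> (riemannian_dist (u i) (u j) < e%:E)%E) ->
    exists p : M, u @ \oo --> p.

Definition metric_coord (c : chart R n M) (y : 'rV[R]_n) : 'M[R]_n :=
  metric c (chart_inv c y).

(* Levi-Civita connection: nabla_{d_i} d_j = sum_k (christoffel c i j k) d_k. *)
Definition christoffel (c : chart R n M) (i j k : 'I_n) (y : 'rV[R]_n) : R :=
  2^-1 * \sum_l invmx (metric_coord c y) k l *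
    (partial i (fun z => metric_coord c z j l) y
     + partial j (fun z => metric_coord c z i l) y
     - partial l (fun z => metric_coord c z i j) y).

(* R(d_i, d_j) d_k = sum_l (curvature c i j k l) d_l, for the convention
   R(X, Y) Z = nabla_X nabla_Y Z - nabla_Y nabla_X Z - nabla_[X,Y] Z. *)
Definition curvature (c : chart R n M) (i j k l : 'I_n) (y : 'rV[R]_n) : R :=
  partial i (christoffel c j k l) y - partial j (christoffel c i k l) y
  + \sum_m (christoffel c j k m y * christoffel c i m l y
            - christoffel c i k m y * christoffel c j m l y).

Definition inner (c : chart R n M) (y u v : 'rV[R]_n) : R :=
  (u *m metric_coord c y *m v^T) 0 0.

(* <R(u, v) v, u> / (|u|^2 |v|^2 - <u, v>^2) *)
Definition sectional_curvature (c : chart R n M) (y u v : 'rV[R]_n) : R :=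
  inner c y
    (\row_l \sum_i \sum_j \sum_k u 0 i * v 0 j * v 0 k * curvature c i j k l y)
    u
  / (inner c y u u * inner c y v v - inner c y u v ^+ 2).

Definition constant_sectional_curvature (kappa : R) : Prop :=
  forall (c : chart R n M) (p : M), atlas c -> chart_dom c p ->
  forall u v : 'rV[R]_n, row_free (col_mx u v) ->
    sectional_curvature c (c p) u v = kappa.

Definition space_form (kappa : R) : Prop :=
  [/\ riemannian_complete, @simply_connected R M
    & constant_sectional_curvature kappa].

Definition borel : Type := g_sigma_algebraType (@open M).
HB.instance Definition _ := Measurable.on borel.

(* [mu] is the Riemannian volume measure: sqrt (det g) dy in every chart. This
   determines [mu], since countably many charts cover [M]. *)
Definition is_volume (mu : {measure set borel -> \bar R}) : Prop :=
  forall (c : chart R n M) (A : set borel), atlas c -> measurable A ->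
    A `<=` (chart_dom c : set borel) ->
    mu A = lebesgue_integral_rV (fun y : 'rV[R]_n =>
      (\1_(c @` (A : set M)) y * Num.sqrt (\det (metric_coord c y)))%:E).

End RiemannianGeometry.

Section Hypersurfaces.
Context {R : realType} {n : nat}.
Variables (M : riemannianManifold R n) (Q : riemannianManifold R n.+1).
Variable (x : M -> Q).

Definition map_coord (c : chart R n M) (d : chart R n.+1 Q)
  : 'rV[R]_n -> 'rV[R]_n.+1 := fun y => d (x (chart_inv c y)).

Definition overlap (c : chart R n M) (d : chart R n.+1 Q) : set 'rV[R]_n :=
  c @` (chart_dom c `&` x @^-1` chart_dom d).

Definition differential_coord (c : chart R n M) (d : chart R n.+1 Q) (p : M)
  : 'M[R]_(n, n.+1) := 'J (map_coord c d) (c p).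

Definition smooth_map : Prop :=
  continuous x /\
  forall c d, atlas c -> atlas d -> smooth_on (overlap c d) (map_coord c d).

Definition immersion : Prop :=
  smooth_map /\
  forall c d p, atlas c -> atlas d -> chart_dom c p -> chart_dom d (x p) ->
    row_free (differential_coord c d p).

Definition isometric : Prop :=
  forall c d p, atlas c -> atlas d -> chart_dom c p -> chart_dom d (x p) ->
    metric c p = differential_coord c d p *m metric d (x p)
                 *m (differential_coord c d p)^T.

(* A vector field along [x], i.e. a section of the pull-back of TQ: [N d p] are
   the coordinates in the chart [d] of a vector of T_(x p) Q. *)
Definition smooth_field_along (N : chart R n.+1 Q -> M -> 'rV[R]_n.+1) : Prop :=
  (forall d d' p, atlas d -> atlas d' ->
     chart_dom d (x p) -> chart_dom d' (x p) ->
     N d' p = N d p *m 'J (transition d d') (d (x p))) /\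
  (forall c d, atlas c -> atlas d ->
     smooth_on (overlap c d) (fun y => N d (chart_inv c y))).

Definition unit_normal_field (N : chart R n.+1 Q -> M -> 'rV[R]_n.+1) : Prop :=
  [/\ smooth_field_along N,
      forall d p, atlas d -> chart_dom d (x p) ->
        (N d p *m metric d (x p) *m (N d p)^T) 0 0 = 1 &
      forall c d p, atlas c -> atlas d -> chart_dom c p -> chart_dom d (x p) ->
        differential_coord c d p *m metric d (x p) *m (N d p)^T = 0].

(* Row [i] holds the coordinates of the covariant derivative in [Q] of [N]
   along d_i. *)
Definition covariant_derivative (N : chart R n.+1 Q -> M -> 'rV[R]_n.+1)
    (c : chart R n M) (d : chart R n.+1 Q) (p : M) : 'M[R]_(n, n.+1) :=
  \matrix_(i, k)
    (partial i (fun y => N d (chart_inv c y) 0 k) (c p)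
     + \sum_a \sum_b differential_coord c d p i a * N d p 0 b
         * christoffel d a b k (d (x p))).

(* A d_i = sum_j (shape_operator N c d p i j) d_j, where dx (A v) is the
   tangential part of - nabla_v N: the j-th component is obtained from the
   products - <nabla_{d_i} N, dx d_k> by raising [k] with the metric of [M]. *)
Definition shape_operator (N : chart R n.+1 Q -> M -> 'rV[R]_n.+1)
    (c : chart R n M) (d : chart R n.+1 Q) (p : M) : 'M[R]_n :=
  - covariant_derivative N c d p *m metric d (x p)
    *m (differential_coord c d p)^T *m invmx (metric c p).

(* [lam 0 p, ..., lam n.-1 p] are the eigenvalues of the shape operator at [p],
   with multiplicity. *)
Definition principal_curvatures (N : chart R n.+1 Q -> M -> 'rV[R]_n.+1)
    (lam : 'I_n -> M -> R) : Prop :=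
  forall p, char_poly (shape_operator N (chart_at p) (chart_at (x p)) p)
            = \prod_i ('X - (lam i p)%:P).

End Hypersurfaces.

(* The elementary symmetric functions; S_0 = 1 and S_r = 0 for r > n. *)
Definition S_ {R : realType} {n : nat} {M : Type} (lam : 'I_n -> M -> R)
    (r : nat) (p : M) : R :=
  \sum_(I : {set 'I_n} | #|I| == r) \prod_(i in I) lam i p.

(* Main.v *)
(** On the simply connected space form Q the system Hess f = - kappa f g is
integrable: its first-order jets are the parallel sections of a connection that
is flat because the curvature is constant.  Integrating it along paths gives
f : Q -> R^(n+1) with f = 0 and df orthonormal at a base point, and then
(df)^T g^-1 df + kappa f^T f = 1 everywhere.  As kappa <= 0, f is a local
diffeomorphism which lifts rays, since Q is complete, so f is proper.

On M, put X = f o x and let nu be the image of the unit normal.  Both are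
functions with values in R^(n+1), with d nu = - A dX, and
c := sqrt (1 - kappa |X|^2) is their conformal defect.  For each t, replacing the
i-th row of d(X - t nu) by X in det [nu; d(X - t nu)] defines the components of a
vector density, whose divergence is computed by the Piola identity alone.  Its
coefficient of order r in t, extracted by interpolation at n + 1 nodes, is the
contraction of the gradient of |X|^2 with the Newton tensor P_r, and has
divergence proportional to (n - r) S_r when S_(r+1) = 0.

Newton's inequality (real-rootedness of \prod_i (1 + lambda_i t) and of its
derivatives) shows that 0 <= P_r <= (n - r) S_r when S_r >= 0 and S_(r+1) = 0.
Testing the divergence against max(0, 1 - e ln (1 + |X|^2))^2 / c, which has compact
support because x and f are proper, bounds the integral of the squared cutoff
times S_r / c^2 by 4 e times the integral of S_r.  If the latter were finite,
letting e tend to 0 would force S_r = 0. *)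
From HB Require Import structures.
Require Import Defs.
From mathcomp Require Import all_boot all_order all_algebra.
From mathcomp Require Import all_classical all_reals all_analysis.
From mathcomp Require Import perm ring lra.

Set Implicit Arguments.
Unset Strict Implicit.
Unset Printing Implicit Defensive.

Import Order.TTheory GRing.Theory Num.Theory.
Import numFieldNormedType.Exports.

Local Open Scope classical_set_scope.
Local Open Scope ring_scope.


(** * Calculus in several variables *)

(** For [kappa < 0] the functions sought are the spatial coordinates of a hyperboloid in Minkowski
    space, and the conserved matrix says that they come from a Lorentz-orthonormal frame. The time
    coordinate is left out because [sqrt (1 - kappa |f|^2)] recovers it, so everything lives in
    R^(n+1) and [kappa = 0] needs no separate treatment. The gain is that covariant derivatives
    disappear: the Hessian equation turns the Weingarten equation into an identity between ordinary
    derivatives, and the Codazzi equation, the usual reason for Newton tensors to be divergence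
    free, becomes the symmetry of second partial derivatives. The time coordinate is also the ratio
    of the determinant density to the Riemannian one. The test function is divided by it to cancel
    this ratio, and differentiating the quotient is what leaves the weight [S_r / c^2]. The
    logarithm in the cutoff answers the bound [2 |X|^2 (n - r) S_r] of the gradient term: a slope of
    order [e / (1 + |X|^2)] keeps the product below a multiple of [e S_r], whatever the size of
    [X]. *)

Lemma is_derive_line (R : realType) (X V : normedModType R) (f : X -> V)
    (x v : X) (t : R) : derivable f (x + t *: v) v ->
  is_derive t 1 (fun s : R => f (x + s *: v)) ('D_v f (x + t *: v)).
Proof.
move=> df; have E : (fun s : R => s^-1 *: (((fun s : R => f (x + s *: v)) \o
    shift t) (s *: (1 : R)) - f (x + t *: v))) =
    (fun s => s^-1 *: ((f \o shift (x + t *: v)) (s *: v) - f (x + t *: v))).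
  apply/funext => s /=; congr (_ *: (f _ - _)).
  by rewrite [s *: (1 : R)]mulr1 scalerDl addrCA.
by apply: DeriveDef; rewrite /derivable /derive E.
Qed.

(** Parametrizing the segment by [t * d] with [t] in the unit interval covers [d] of either sign and
    [d = 0]. *)
Lemma line_MVT (R : realType) (X : normedModType R) (f : X -> R) (x v : X)
    (d : R) :
  (forall t : R, 0 <= t <= 1 -> derivable f (x + (t * d) *: v) v) ->
  exists2 t : R, 0 <= t <= 1 & f (x + d *: v) - f x = d * 'D_v f (x + (t * d) *: v).
Proof.
move=> df; pose g (s : R) := f (x + (s * d) *: v).
have dg (s : R) : 0 <= s <= 1 -> is_derive s 1 g ('D_v f (x + (s * d) *: v) * d).
  move=> /df /is_derive_line h.
  apply: (@is_derive1_comp R (fun u => f (x + u *: v)) (fun s => s * d)) => //.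
  by apply: is_derive_eq; rewrite scaler0 add0r /GRing.scale /= mulr1.
have [|| t t01] := @MVT_segment R g (fun s => 'D_v f (x + (s * d) *: v) * d) 0 1 ler01.
- by move=> s; rewrite in_itv /= => /andP[s0 s1]; apply: dg; rewrite !ltW.
- apply: derivable_within_continuous => s; rewrite in_itv /= => s01.
  by have [] := dg _ s01.
rewrite /g mul1r mul0r scale0r addr0 subr0 mulr1 mulrC => E; exists t => //.
Qed.

(** * Strict differentiability of functions of class C^1 *)

Section Strict.
Context {R : realType} {n : nat}.
Implicit Types (z : 'rV[R]_n) (f : 'rV[R]_n -> R).

Lemma rV_normP (z : 'rV[R]_n) (e : R) : 0 <= e ->
  `|z| <= e <-> forall i, `|z 0 i| <= e.
Proof.
move=> e0; rewrite [`|z|]mx_normrE; split=> [h i|h].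
  by apply: le_trans h; rewrite (bigD1 (0, i)) //= le_max lexx.
by apply/bigmax_leP; split=> // -[i j] _ /=; rewrite ord1.
Qed.

Lemma rV_coord_le z i : `|z 0 i| <= `|z|.
Proof. by apply: (rV_normP z (normr_ge0 z)).1. Qed.

Lemma ballE (V : normedModType R) (x y : V) (e : R) :
  ball x e y = (`|x - y| < e) :> Prop.
Proof. by rewrite -ball_normE. Qed.

Lemma rV_ballP z z' (e : R) : 0 < e ->
  ball z e z' <-> forall i, `|z 0 i - z' 0 i| < e.
Proof.
move=> e0; rewrite ballE [`|_|]mx_normrE; split=> [h i|h].
  apply: le_lt_trans h; rewrite (bigD1 (0, i)) //= le_max.
  by rewrite !mxE lexx.
by apply/bigmax_ltP; split=> // -[i j] _ /=; rewrite ord1 !mxE.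
Qed.

Lemma convex_lt (a b t r : R) : a < r -> b < r -> 0 <= t <= 1 ->
  (1 - t) * a + t * b < r.
Proof.
move=> ar br /andP[t0 t1]; case: (leP a b) => ab.
  by apply: le_lt_trans br; nra.
by apply: le_lt_trans ar; nra.
Qed.

(** The passage from [z] to [z'] changes one coordinate at a time, with one use of the mean value
    theorem per step. Balls of the sup norm are boxes, so the mixed points [mix s], with the
    coordinates in [s] already replaced, stay in the ball. In the applications [c] is the gradient
    at the centre. *)
Lemma strictC1 f z0 (r : R) (c : 'I_n -> R) (e : R) :
  (forall z i, ball z0 r z -> derivable f z (delta_mx 0 i)) ->
  (forall z i, ball z0 r z -> `|partial i f z - c i| <= e) ->
  forall z z', ball z0 r z -> ball z0 r z' ->
  `|f z' - f z - \sum_i (z' 0 i - z 0 i) * c i| <= n%:R * e * `|z' - z|.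
Proof.
move=> df dc z z' bz bz'.
have r0 : 0 < r by move: bz; rewrite ballE; exact: le_lt_trans.
pose mix (s : seq 'I_n) : 'rV_n := \row_i if i \in s then z' 0 i else z 0 i.
suff main (s : seq 'I_n) : uniq s ->
    `|f (mix s) - f z - \sum_(i <- s) (z' 0 i - z 0 i) * c i|
    <= (size s)%:R * e * `|z' - z|.
  have := main (enum 'I_n) (enum_uniq _); rewrite size_enum_ord.
  rewrite big_enum /=; congr (`|f _ - _ - _| <= _).
  by apply/rowP => i; rewrite mxE mem_enum.
elim: s => [_|i s IH /andP[si us]].
  rewrite big_nil subr0 mul0r mul0r.
  have -> : mix [::] = z by apply/rowP => i; rewrite mxE.
  by rewrite subrr normr0.
pose v : 'rV[R]_n := delta_mx 0 i; pose d := z' 0 i - z 0 i.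
have mixE : mix (i :: s) = mix s + d *: v.
  apply/rowP => j; rewrite !mxE inE eqxx /=; case: eqVneq => [->|ji] /=.
    by rewrite (negbTE si) mulr1 /d addrC subrK.
  by rewrite mulr0 addr0.
have bmix t : 0 <= t <= 1 -> ball z0 r (mix s + (t * d) *: v).
  move=> /andP[t0 t1]; apply/rV_ballP => // j; rewrite !mxE eqxx /=.
  have := (rV_ballP z0 z r0).1 bz j; have := (rV_ballP z0 z' r0).1 bz' j.
  case: eqVneq => [->|ji] /=; last by rewrite mulr0 addr0; case: ifP.
  rewrite (negbTE si) mulr1 /d => /ltr_normlP[h1 h2] /ltr_normlP[h3 h4].
  have t01 : 0 <= t <= 1 by rewrite t0.
  apply/ltr_normlP; split.
    by have := convex_lt h3 h1 t01; apply: le_lt_trans; lra.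
  by have := convex_lt h4 h2 t01; apply: le_lt_trans; lra.
have [t t01 E] := line_MVT (fun t h => df _ i (bmix t h)).
have {}IH := IH us.
rewrite big_cons mixE /= -/d.
have -> : f (mix s + d *: v) - f z - (d * c i + \sum_(j <- s) (z' 0 j - z 0 j) * c j)
  = (f (mix s) - f z - \sum_(j <- s) (z' 0 j - z 0 j) * c j)
    + d * (partial i f (mix s + (t * d) *: v) - c i).
  by rewrite mulrBr /partial -E; ring.
have dE : d = z' 0 i - z 0 i by []. clearbody d.
apply: le_trans (ler_normD _ _) _.
rewrite -natr1 !mulrDl mul1r; apply: lerD => //.
rewrite -/v normrM (mulrC e); apply: ler_pM => //; last exact: dc _ _ (bmix t t01).
by have := rV_coord_le (z' - z) i; rewrite !mxE -dE.
Qed.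

Lemma Ck_continuous (V : normedModType R) k D (f : 'rV[R]_n -> V) y :
  Ck_on k D f -> D y -> {for y, continuous f}.
Proof. by case: k => [|k] [h _]; exact: h. Qed.

Lemma Ck_derivable (V : normedModType R) k D (f : 'rV[R]_n -> V) y i :
  Ck_on k.+1 D f -> D y -> derivable f y (delta_mx 0 i).
Proof. by move=> [_ /(_ i)[+ _]]; exact. Qed.

Lemma Ck_partial (V : normedModType R) k D (f : 'rV[R]_n -> V) i :
  Ck_on k.+1 D f -> Ck_on k D (partial i f).
Proof. by move=> [_ /(_ i)[_ +]]. Qed.

Lemma Ck_pred (V : normedModType R) k D (f : 'rV[R]_n -> V) :
  Ck_on k.+1 D f -> Ck_on k D f.
Proof.
elim: k f => [|k IH] f; first by move=> [h _]; split.
move=> hf; split=> [y|i]; first exact: Ck_continuous hf.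
split=> [y|]; first exact: Ck_derivable hf.
exact/IH/Ck_partial.
Qed.

Lemma Ck_sub (V : normedModType R) k D D' (f : 'rV[R]_n -> V) :
  D' `<=` D -> Ck_on k D f -> Ck_on k D' f.
Proof.
move=> DD; elim: k f => [|k IH] f hf.
  by split=> // y /DD; exact: Ck_continuous hf.
split=> [y /DD|i]; first exact: Ck_continuous hf.
split=> [y /DD|]; first exact: Ck_derivable hf.
  exact/IH/Ck_partial.
Qed.

Lemma partial_near (V : normedModType R) (f g : 'rV[R]_n -> V) y i :
  (\forall z \near y, f z = g z) -> partial i f y = partial i g y.
Proof.
move=> fg; apply: near_eq_derive fg.
Qed.

Lemma derivable_near (V : normedModType R) (f g : 'rV[R]_n -> V) y i :
  (\forall z \near y, f z = g z) -> derivable f y (delta_mx 0 i) ->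
  derivable g y (delta_mx 0 i).
Proof.
move=> fg; apply: near_eq_derivable fg.
Qed.

Lemma eq_near (T : topologicalType) (D : set T) (U : Type) (f g : T -> U) (y : T) :
  open D -> (forall z : T, D z -> f z = g z) -> D y -> \forall z \near y, f z = g z.
Proof.
move=> oD fg Dy; near=> z; apply: fg; near: z.
by apply: open_nbhs_nbhs; split.
Unshelve. all: by end_near. Qed.

Lemma continuous_near (T U : topologicalType) (D : set T) (f g : T -> U) (y : T) :
  open D -> (forall z : T, D z -> f z = g z) -> D y -> {for y, continuous f} ->
  {for y, continuous g}.
Proof.
move=> oD fg Dy; rewrite /prop_for /continuous_at (fg _ Dy); apply: cvg_trans.
exact: near_eq_cvg (eq_near oD fg Dy).
Qed.

Lemma Ck_ext (V : normedModType R) k D (f g : 'rV[R]_n -> V) :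
  open D -> (forall y, D y -> f y = g y) -> Ck_on k D f -> Ck_on k D g.
Proof.
move=> oD; elim: k f g => [|k IH] f g fg hf.
  by split=> // y Dy; exact: continuous_near oD fg Dy (Ck_continuous hf Dy).
split=> [y Dy|i]; first exact: continuous_near oD fg Dy (Ck_continuous hf Dy).
split=> [y Dy|].
  by apply: derivable_near (eq_near oD fg Dy) _; exact: Ck_derivable hf Dy.
apply: IH (Ck_partial i hf) => y Dy.
by apply: partial_near; exact: eq_near oD fg Dy.
Qed.


Lemma C1_strict D f y (e : R) : open D -> Ck_on 1 D f -> D y -> 0 < e ->
  exists2 r : R, 0 < r & ball y r `<=` D /\ forall z z',
  ball y r z -> ball y r z' ->
  `|f z' - f z - \sum_i (z' 0 i - z 0 i) * partial i f y| <= e * `|z' - z|.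
Proof.
(* The error is shared by [n] coordinates; dividing by [n.+1] also covers dimension 0. *)
move=> oD hf Dy e0; pose e' := e / n.+1%:R; have e'0 : 0 < e' by rewrite divr_gt0.
have : \forall z \near y, D z /\ forall i, `|partial i f z - partial i f y| <= e'.
  near=> z; split.
    by near: z; apply: open_nbhs_nbhs; split.
  near: z; apply: filter_forall => i.
  have /cvgrPdist_le /(_ _ e'0) := Ck_continuous (Ck_partial i hf) Dy.
  by apply: filterS => z; rewrite distrC.
move/nbhs_ballP => [r r0 br]; exists r => //; split; first by move=> z /br[].
move=> z z' bz bz'.
apply: le_trans (@strictC1 f y r (fun i => partial i f y) e' _ _ z z' bz bz') _.
- by move=> x i /br[Dx _]; exact: Ck_derivable hf Dx.
- by move=> x i /br[_]; exact.
apply: ler_wpM2r => //; rewrite /e' mulrCA ler_piMr ?ltW //.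
by rewrite ltr_pdivrMr // mul1r ltr_nat.
Unshelve. all: by end_near. Qed.

Definition grad f y (h : 'rV[R]_n) : R := \sum_i h 0 i * partial i f y.

Lemma grad_is_linear f y : linear (grad f y).
Proof.
move=> a u v; rewrite /grad scaler_sumr -big_split /=.
by apply: eq_bigr => i _; rewrite !mxE mulrDl -mulrA.
Qed.
HB.instance Definition _ f y :=
  GRing.isLinear.Build R 'rV[R]_n R _ (grad f y) (grad_is_linear f y).

Lemma rV_linear_continuous (V : normedModType R) (f : {linear 'rV[R]_n -> V}) :
  continuous f.
Proof.
have E : (f : _ -> _) = fun x => \sum_i x 0 i *: f (delta_mx 0 i).
  apply/funext => x; rewrite {1}(row_sum_delta x) linear_sum.
  by apply: eq_bigr => i _; rewrite linearZ.
rewrite E => x; apply: (@cvg_big V 'I_n +%R 0 xpredT _ _ _ _ _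
  (fun i => x 0 i *: f (delta_mx 0 i)) (nbhs_filter x)) => [|i _].
  exact: add_continuous.
apply: cvgZr_tmp.
exact: coord_continuous.
Qed.

Lemma C1_diff D f y : open D -> Ck_on 1 D f -> D y ->
  differentiable f y /\ ('d f y = grad f y :> ('rV[R]_n -> R)).
Proof.
move=> oD hf Dy.
have cg : continuous (grad f y) by exact: rV_linear_continuous.
have H (e : R) : 0 < e -> \forall z \near (0 : 'rV[R]_n),
    `|f (z + y) - (f y + grad f y z)| <= e * `|z|.
  move=> e0; have [r r0 [_ h]] := C1_strict oD hf Dy e0.
  apply/nbhs_ballP; exists r => // z bz0.
  have bz : ball y r (z + y).
    by move: bz0; rewrite !ballE opprD addrCA subrr addr0 add0r.
  have := h y (z + y) (ballxx _ r0) bz; rewrite addrK opprD addrA.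
  by congr (`| _ - _ | <= _ ); apply: eq_bigr => i _; rewrite !mxE addrK.
have df : ('d f y = grad f y :> ('rV[R]_n -> R)).
  by apply: (@diff_unique R _ _ f (grad f y) y cg); apply/eqaddoP => e /H.
by split=> //; apply/diff_locallyP; rewrite df; split=> //; apply/eqaddoP => e /H.
Qed.

Lemma Ck1 k D (f : 'rV[R]_n -> R) : Ck_on k.+1 D f -> Ck_on 1 D f.
Proof. by elim: k => // k IH /Ck_pred. Qed.

(** The composite is restricted to the line through [x] in the direction [v], so [T] is asked only
    for one directional derivative while [f] has to be differentiable. *)
Lemma chain_is_derive (X : normedModType R) (T : X -> 'rV[R]_n) f (x v : X) :
  differentiable f (T x) -> 'd f (T x) = grad f (T x) :> ('rV[R]_n -> R) ->
  derivable T x v -> is_derive x v (f \o T) (grad f (T x) ('D_v T x)).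
Proof.
move=> df dfE dT.
have x0 : x + 0 *: v = x by rewrite scale0r addr0.
have dT0 : is_derive (0 : R) 1 (fun s : R => T (x + s *: v)) ('D_v T x).
  have := @is_derive_line R X _ T x v 0; rewrite x0 => h; exact: h.
have dT1 : differentiable (fun s : R => T (x + s *: v)) 0.
  by apply/derivable1_diffP; case: dT0.
have T0 : T (x + 0 *: v) = T x by rewrite x0.
have dc : differentiable (f \o (fun s : R => T (x + s *: v))) 0.
  by apply: differentiable_comp; rewrite //= T0.
have E : (fun s : R => s^-1 *: (((f \o (fun s : R => T (x + s *: v))) \o
    shift 0) (s *: (1 : R)) - (f \o (fun s : R => T (x + s *: v))) 0)) =
    (fun s => s^-1 *: (((f \o T) \o shift x) (s *: v) - (f \o T) x)).
  apply/funext => s /=; congr (_ *: (f (T _) - f _)); last by rewrite T0.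
  by rewrite [s *: (1 : R)]mulr1 addr0 addrC.
have D1 : derivable (f \o (fun s : R => T (x + s *: v))) 0 1.
  exact/derivable1_diffP.
apply: DeriveDef; first by rewrite /derivable -E.
have -> : 'D_v (f \o T) x = 'D_1 (f \o (fun s : R => T (x + s *: v))) 0.
  by rewrite /derive E.
rewrite deriveE // diff_comp //=; last by rewrite T0.
rewrite T0 dfE; congr (grad f _ _).
by have [_ <-] := dT0; rewrite deriveE.
Qed.

End Strict.

(** * Stability of the classes C^k under algebraic operations and composition *)

Section CkAlgebra.
Context {R : realType}.

Lemma rV_continuous (T : topologicalType) m (f : T -> 'rV[R]_m) (y : T) :
  (forall a, {for y, continuous (fun z => f z 0 a)}) -> {for y, continuous f}.
Proof.
move=> h; apply/cvgrPdist_le => e e0.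
have : \forall z \near y, forall a : 'I_m, `|f y 0 a - f z 0 a| <= e.
  apply: filter_forall => a.
  by have /cvgrPdist_le/(_ _ e0) := h a.
apply: filterS => z hz; apply/rV_normP; first exact: ltW.
by move=> a; rewrite !mxE.
Qed.

Lemma coord_for_continuous (T : topologicalType) m n (f : T -> 'M[R]_(m, n)) (y : T) i a :
  {for y, continuous f} -> {for y, continuous (fun z => f z i a)}.
Proof.
move=> h; exact: (@continuous_comp _ _ _ f (fun z => z i a)) _ h (@coord_continuous _ _ _ i a _).
Qed.

Context {n : nat}.
Implicit Types (f g : 'rV[R]_n -> R) (D : set 'rV[R]_n).

Lemma partialD f g y i : derivable f y (delta_mx 0 i) -> derivable g y (delta_mx 0 i) ->
  partial i (fun z => f z + g z) y = partial i f y + partial i g y.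
Proof. exact: deriveD. Qed.

Lemma partialM f g y i : derivable f y (delta_mx 0 i) -> derivable g y (delta_mx 0 i) ->
  partial i (fun z => f z * g z) y = f y * partial i g y + g y * partial i f y.
Proof. exact: deriveM. Qed.

Lemma partial_cst (c : R) i : partial i (fun _ : 'rV[R]_n => c) = fun _ => 0.
Proof. by apply/funext => y; exact: derive_cst. Qed.

Lemma Ck_cst k D (c : R) : Ck_on k D (fun _ => c).
Proof.
elim: k c => [|k IH] c; first by split=> // y _; exact: cst_continuous.
split=> [y _|i]; first exact: cst_continuous.
by split=> [y _|]; [exact: derivable_cst|rewrite partial_cst].
Qed.

Lemma coord_is_derive y (v : 'rV[R]_n) j : is_derive y v (fun z => z 0 j) (v 0 j).
Proof.
apply: DeriveDef; first by apply: diff_derivable; exact: differentiable_coord.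
have := derive_mx (@derivable_id R _ y v).
by rewrite derive_id => /rowP/(_ j); rewrite mxE.
Qed.

Lemma partial_coord j i :
  partial i (fun y : 'rV[R]_n => y 0 j) = fun _ => (j == i)%:R.
Proof.
apply/funext => y; have [_ E] := coord_is_derive y (delta_mx 0 i) j.
by rewrite /partial E mxE eqxx.
Qed.

Lemma Ck_coord k D j : Ck_on k D (fun y => y 0 j).
Proof.
case: k => [|k]; first by split=> // y _; exact: coord_continuous.
split=> [y _|i]; first exact: coord_continuous.
split=> [y _|]; first by have [] := coord_is_derive y (delta_mx 0 i) j.
by rewrite partial_coord; exact: Ck_cst.
Qed.

Variables (D : set 'rV[R]_n) (oD : open D).

Lemma CkD k f g : Ck_on k D f -> Ck_on k D g -> Ck_on k D (fun y => f y + g y).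
Proof.
elim: k f g => [|k IH] f g hf hg.
  split=> // y Dy; exact: continuousD (Ck_continuous hf Dy) (Ck_continuous hg Dy).
split=> [y Dy|i].
  exact: continuousD (Ck_continuous hf Dy) (Ck_continuous hg Dy).
split=> [y Dy|].
  by apply: derivableD; [exact: Ck_derivable hf Dy|exact: Ck_derivable hg Dy].
apply: Ck_ext (IH _ _ (Ck_partial i hf) (Ck_partial i hg)) => // y Dy.
by rewrite partialD //; [exact: Ck_derivable hf Dy|exact: Ck_derivable hg Dy].
Qed.

Lemma CkM k f g : Ck_on k D f -> Ck_on k D g -> Ck_on k D (fun y => f y * g y).
Proof.
elim: k f g => [|k IH] f g hf hg.
  split=> // y Dy; exact: continuousM (Ck_continuous hf Dy) (Ck_continuous hg Dy).
split=> [y Dy|i].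
  exact: continuousM (Ck_continuous hf Dy) (Ck_continuous hg Dy).
split=> [y Dy|].
  by apply: derivableM; [exact: Ck_derivable hf Dy|exact: Ck_derivable hg Dy].
apply: Ck_ext (CkD (IH _ _ (Ck_pred hf) (Ck_partial i hg))
                   (IH _ _ (Ck_pred hg) (Ck_partial i hf))) => // y Dy.
by rewrite partialM //; [exact: Ck_derivable hf Dy|exact: Ck_derivable hg Dy].
Qed.

Lemma CkN k f : Ck_on k D f -> Ck_on k D (fun y => - f y).
Proof.
move=> hf; apply: Ck_ext (CkM (Ck_cst k D (-1)) hf) => // y _.
by rewrite mulN1r.
Qed.

Lemma CkB k f g : Ck_on k D f -> Ck_on k D g -> Ck_on k D (fun y => f y - g y).
Proof. by move=> hf hg; exact: CkD hf (CkN hg). Qed.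

Lemma Ck_sum (I : Type) (s : seq I) (P : pred I) k (f : I -> 'rV[R]_n -> R) :
  (forall i, P i -> Ck_on k D (f i)) -> Ck_on k D (fun y => \sum_(i <- s | P i) f i y).
Proof.
move=> h; elim: s => [|i s IH].
  by apply: Ck_ext (Ck_cst k D 0) => // y _; rewrite big_nil.
case Pi: (P i); last by apply: Ck_ext IH => // y _; rewrite big_cons Pi.
by apply: Ck_ext (CkD (h i Pi) IH) => // y _; rewrite big_cons Pi.
Qed.

Lemma Ck_prod (I : Type) (s : seq I) (P : pred I) k (f : I -> 'rV[R]_n -> R) :
  (forall i, P i -> Ck_on k D (f i)) -> Ck_on k D (fun y => \prod_(i <- s | P i) f i y).
Proof.
move=> h; elim: s => [|i s IH].
  by apply: Ck_ext (Ck_cst k D 1) => // y _; rewrite big_nil.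
case Pi: (P i); last by apply: Ck_ext IH => // y _; rewrite big_cons Pi.
by apply: Ck_ext (CkM (h i Pi) IH) => // y _; rewrite big_cons Pi.
Qed.

Lemma Ck_det m k (A : 'rV[R]_n -> 'M[R]_m) :
  (forall i j, Ck_on k D (fun y => A y i j)) -> Ck_on k D (fun y => \det (A y)).
Proof.
move=> h; apply: Ck_sum => s _; apply: CkM; first exact: Ck_cst.
by apply: Ck_prod => i _; exact: h.
Qed.

Lemma CkV k f : (forall y, D y -> f y != 0) -> Ck_on k D f ->
  Ck_on k D (fun y => (f y)^-1).
Proof.
move=> f0; elim: k => [|k IH] hf.
  by split=> // y Dy; exact: continuousV (f0 _ Dy) (Ck_continuous hf Dy).
split=> [y Dy|i].
  by exact: continuousV (f0 _ Dy) (Ck_continuous hf Dy).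
split=> [y Dy|].
  by apply: derivableV; [exact: f0|exact: Ck_derivable hf Dy].
have h := IH (Ck_pred hf).
apply: Ck_ext (CkN (CkM (CkM h h) (Ck_partial i hf))) => // y Dy.
rewrite /partial deriveV ?f0 //; last exact: Ck_derivable hf Dy.
by rewrite -exprVn expr2 scaleNr.
Qed.

Lemma C1_is_derive f y (v : 'rV[R]_n) : Ck_on 1 D f -> D y ->
  is_derive y v f (grad f y v).
Proof.
move=> hf Dy; have [d1 d2] := C1_diff oD hf Dy.
apply: DeriveDef; first exact: diff_derivable.
by apply: etrans (deriveE v d1) _; rewrite d2.
Qed.

Lemma C1_derive_line f (y h : 'rV[R]_n) (t : R) : Ck_on 1 D f -> D (y + t *: h) ->
  is_derive t 1 (fun s : R => f (y + s *: h)) (grad f (y + t *: h) h).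
Proof.
move=> hf Dy; have [d1 d2] := C1_is_derive h hf Dy.
by rewrite -d2; exact: is_derive_line.
Qed.

Lemma chain_partial m (T : 'rV[R]_n -> 'rV[R]_m) (E : set 'rV[R]_m) (f : 'rV[R]_m -> R) y i :
  open E -> Ck_on 1 E f -> E (T y) -> 
  (forall a, derivable (fun z => T z 0 a) y (delta_mx 0 i)) ->
  is_derive y (delta_mx 0 i) (fun z => f (T z))
    (\sum_a partial i (fun z => T z 0 a) y * partial a f (T y)).
Proof.
move=> oE hf ET dT; have [d1 d2] := C1_diff oE hf ET.
have dTy : derivable T y (delta_mx 0 i).
  by apply/derivable_mxP => j a; rewrite (ord1 j); exact: dT.
have := chain_is_derive d1 d2 dTy; congr is_derive; apply: eq_bigr => a _.
by rewrite (derive_mx dTy) mxE.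
Qed.

Lemma Ck_comp m k (T : 'rV[R]_n -> 'rV[R]_m) (E : set 'rV[R]_m) (f : 'rV[R]_m -> R) :
  open E -> (forall y, D y -> E (T y)) -> Ck_on k E f ->
  (forall a, Ck_on k D (fun y => T y 0 a)) -> Ck_on k D (fun y => f (T y)).
Proof.
move=> oE TE; elim: k f => [|k IH] f hf hT.
  split=> // y Dy; apply: (@continuous_comp _ _ _ T f).
    by apply: rV_continuous => a; exact: Ck_continuous (hT a) Dy.
  by exact: Ck_continuous hf (TE _ Dy).
have hd y i : D y -> is_derive y (delta_mx 0 i) (fun z => f (T z))
    (\sum_a partial i (fun z => T z 0 a) y * partial a f (T y)).
  move=> Dy; apply: chain_partial (Ck1 hf) (TE _ Dy) _ => // a.
  exact: Ck_derivable (hT a) Dy.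
split=> [y Dy|i].
  apply: (@continuous_comp _ _ _ T f).
    by apply: rV_continuous => a; exact: Ck_continuous (hT a) Dy.
  by exact: Ck_continuous hf (TE _ Dy).
split=> [y Dy|]; first by have [] := hd y i Dy.
apply: (@Ck_ext _ _ _ k D (fun y => \sum_a partial i (fun z => T z 0 a) y * partial a f (T y))) => //.
  by move=> y /(hd y i)[_ <-].
apply: Ck_sum => a _; apply: CkM; first exact: Ck_partial.
by apply: IH; [exact: Ck_partial|move=> b; exact: Ck_pred].
Qed.

End CkAlgebra.

(** * Symmetry of second partial derivatives *)

Section Schwarz.
Context {R : realType} {n : nat}.
Implicit Types (f : 'rV[R]_n -> R) (D : set 'rV[R]_n).

Lemma is_derive_translate (X V : normedModType R) (f : X -> V) (x w v : X) :
  derivable f (x + w) v -> is_derive x v (fun z => f (z + w)) ('D_v f (x + w)).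
Proof.
move=> df; have E : (fun s : R => s^-1 *: (((fun z => f (z + w)) \o shift x) (s *: v) - f (x + w)))
   = (fun s : R => s^-1 *: ((f \o shift (x + w)) (s *: v) - f (x + w))).
  by apply/funext => s /=; rewrite addrA.
by apply: DeriveDef; rewrite /derivable /derive E.
Qed.

Lemma dist_half (a b c e : R) : `|c - a| <= e / 2 -> `|b - a| <= e / 2 ->
  `|b - c| <= e.
Proof.
by move=> /ler_normlP[h1 h2] /ler_normlP[h3 h4]; apply/ler_normlP; split; lra.
Qed.

Lemma dist_half' (a b c e : R) : `|a - b| <= e / 2 -> `|a - c| <= e / 2 ->
  `|b - c| <= e.
Proof.
by move=> /ler_normlP[h1 h2] /ler_normlP[h3 h4]; apply/ler_normlP; split; lra.
Qed.

(** Two mean value theorems: one for [g z = f (z + h e_j) - f z] in the direction [e_i], then one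
    for [partial i f] in the direction [e_j]. *)
Lemma second_difference D f y (i j : 'I_n) (r h : R) : ball y r `<=` D ->
  Ck_on 2 D f -> 0 < h -> h + h < r ->
  exists2 z, ball y r z &
    f (y + h *: delta_mx 0 i + h *: delta_mx 0 j) - f (y + h *: delta_mx 0 i)
    - (f (y + h *: delta_mx 0 j) - f y) = h * (h * partial j (partial i f) z).
Proof.
move=> bD hf h0 hr; have r0 : 0 < r by lra.
have d1 (a : 'I_n) : `|delta_mx 0 a : 'rV[R]_n| <= 1.
  by apply/rV_normP => // b; rewrite mxE /=; case: eqP; rewrite ?normr1 ?normr0.
have inb (s t : R) : 0 <= s <= 1 -> 0 <= t <= 1 ->
    ball y r (y + (s * h) *: delta_mx 0 i + (t * h) *: delta_mx 0 j).
  move=> /andP[s0 s1] /andP[t0 t1]; rewrite ballE !opprD !addrA subrr sub0r -opprD normrN.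
  apply: le_lt_trans (ler_normD _ _) _; apply: le_lt_trans hr; apply: lerD.
    rewrite normrZ ger0_norm; last by rewrite mulr_ge0 // ltW.
    rewrite -[leRHS]mulr1; apply: ler_pM => //; first by rewrite mulr_ge0 // ltW.
  by rewrite ler_piMl // ltW.
  rewrite normrZ ger0_norm; last by rewrite mulr_ge0 // ltW.
  rewrite -[leRHS]mulr1; apply: ler_pM => //; first by rewrite mulr_ge0 // ltW.
  by rewrite ler_piMl // ltW.
have i1 : 0 <= (1 : R) <= 1 by rewrite ler01 lexx.
have i0 : 0 <= (0 : R) <= 1 by rewrite ler01 lexx.
pose g z := f (z + h *: delta_mx 0 j) - f z.
have dg t : 0 <= t <= 1 -> is_derive (y + (t * h) *: delta_mx 0 i) (delta_mx 0 i) g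
   (partial i f (y + (t * h) *: delta_mx 0 i + h *: delta_mx 0 j)
    - partial i f (y + (t * h) *: delta_mx 0 i)).
  move=> t01; apply: is_deriveB.
    apply: is_derive_translate; apply: Ck_derivable hf _; apply: bD.
    by have := inb t 1 t01 i1; rewrite mul1r.
  apply: DeriveDef => //; apply: Ck_derivable hf _; apply: bD.
  by have := inb t 0 t01 i0; rewrite mul0r scale0r addr0.
have [t t01 Et] : exists2 t : R, 0 <= t <= 1 & g (y + h *: delta_mx 0 i) - g y =
    h * 'D_(delta_mx 0 i) g (y + (t * h) *: delta_mx 0 i).
  by apply: line_MVT => t /dg[].
pose w := y + (t * h) *: delta_mx 0 i : 'rV[R]_n.
have [s s01 Es] : exists2 s : R, 0 <= s <= 1 &
    partial i f (w + h *: delta_mx 0 j) - partial i f w =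
    h * 'D_(delta_mx 0 j) (partial i f) (w + (s * h) *: delta_mx 0 j).
  apply: line_MVT => s s01; apply: Ck_derivable (Ck_partial i hf) _; apply: bD.
  exact: inb.
exists (w + (s * h) *: delta_mx 0 j); first exact: inb.
by rewrite /g in Et; rewrite Et; have [_ ->] := dg t t01; rewrite Es.
Qed.

(** The second difference is symmetric in [i] and [j], so the two mixed partials take a common value
    at two points [z] and [z'] near [y]; continuity brings both points back to [y]. *)
Lemma partialC D f y (i j : 'I_n) : open D -> Ck_on 2 D f -> D y ->
  partial i (partial j f) y = partial j (partial i f) y.
Proof.
move=> oD hf Dy; apply/eqP; rewrite -subr_eq0 -normr_le0; apply/ler_addgt0Pr => e e0.
rewrite add0r; pose e' := e / 2; have e'0 : 0 < e' by rewrite divr_gt0.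
have cont a b : \forall z \near y,
    `|partial a (partial b f) y - partial a (partial b f) z| <= e'.
  have /cvgrPdist_le := Ck_continuous (Ck_partial a (Ck_partial b hf)) Dy.
  by apply.
have : \forall z \near y, [/\ D z,
   `|partial j (partial i f) y - partial j (partial i f) z| <= e' &
   `|partial i (partial j f) y - partial i (partial j f) z| <= e'].
  by apply: filterS3 (open_nbhs_nbhs (conj oD Dy)) (cont j i) (cont i j) => z.
move=> /nbhs_ballP[r /= r0 br].
have bD : ball y r `<=` D by move=> z /br[].
pose h := r / 3; have h0 : 0 < h by rewrite divr_gt0.
have hr : h + h < r by rewrite /h; lra.
have [z bz Ez] := second_difference i j bD hf h0 hr.
have [z' bz' Ez'] := second_difference j i bD hf h0 hr.
have [_ h1 _] := br _ bz; have [_ _ h2] := br _ bz'.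
have E : partial j (partial i f) z = partial i (partial j f) z'.
  apply: (mulfI (lt0r_neq0 h0)); apply: (mulfI (lt0r_neq0 h0)).
  apply: etrans (esym Ez) (etrans _ Ez').
  have -> : y + h *: delta_mx 0 i + h *: delta_mx 0 j
    = y + h *: delta_mx 0 j + h *: delta_mx 0 i by rewrite addrAC.
  have aux (a b c d : R) : a - b - (c - d) = a - c - (b - d) by ring.
  exact: aux.
move: h1 h2; rewrite E; move: (partial i _ z') (partial i _ y) (partial j _ y) => a b c.
exact: dist_half.
Qed.

End Schwarz.

(** * Derivatives of sums, products and determinants *)

Section DetDerivative.
Context {R : realType} {X : normedModType R}.
Implicit Types (x v : X).

Lemma is_derive_bigsum (I : Type) (s : seq I) (f : I -> X -> R) (df : I -> R) x v :
  (forall i, is_derive x v (f i) (df i)) ->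
  is_derive x v (fun z => \sum_(i <- s) f i z) (\sum_(i <- s) df i).
Proof.
move=> h; elim: s => [|i s IH].
  rewrite big_nil (_ : (fun _ => _) = cst 0); first exact: is_derive_cst.
  by apply/funext => z; rewrite big_nil.
rewrite big_cons (_ : (fun _ => _) = f i + (fun z => \sum_(i <- s) f i z)).
  exact: is_deriveD.
by apply/funext => z; rewrite big_cons.
Qed.

Lemma is_deriveMl (c : R) (f : X -> R) (df : R) x v :
  is_derive x v f df -> is_derive x v (fun z => c * f z) (c * df).
Proof.
move=> h; have := @is_deriveM R X (cst c) f x v 0 df (is_derive_cst c x v) h.
by rewrite scaler0 addr0; exact.
Qed.

Lemma is_derive_prod m (g : 'I_m -> X -> R) (dg : 'I_m -> R) x v :
  (forall i, is_derive x v (g i) (dg i)) ->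
  is_derive x v (fun z => \prod_i g i z)
    (\sum_i \prod_j (if j == i then dg j else g j x)).
Proof.
elim: m g dg => [|m IH] g dg h.
  rewrite big_ord0 (_ : (fun _ => _) = cst 1); first exact: is_derive_cst.
  by apply/funext => z; rewrite big_ord0.
rewrite (_ : (fun _ => _) = g ord0 * (fun z => \prod_i g (lift ord0 i) z)); last first.
  by apply/funext => z; rewrite big_ord_recl.
apply: is_derive_eq; first exact: is_deriveM (h ord0) (IH _ _ (fun i => h (lift ord0 i))).
rewrite big_ord_recl addrC big_ord_recl eqxx; congr (_ + _).
  by rewrite /GRing.scale /= mulrC; congr (_ * _); apply: eq_bigr.
rewrite /GRing.scale /= mulr_sumr; apply: eq_bigr => i _; rewrite big_ord_recl /=.
by congr (_ * _); apply: eq_bigr => j _.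
Qed.

Lemma is_derive_det m (A : X -> 'M[R]_m) (dA : 'M[R]_m) x v :
  (forall i j, is_derive x v (fun z => A z i j) (dA i j)) ->
  is_derive x v (fun z => \det (A z))
    (\sum_i \det (\matrix_(k, l) (if k == i then dA k l else A x k l))).
Proof.
move=> h; pose dP (s : {perm 'I_m}) : R :=
  \sum_i \prod_j (if j == i then dA j (s j) else A x j (s j)).
have dP' (s : {perm 'I_m}) : is_derive x v (fun z => (-1) ^+ s * \prod_i A z i (s i))
    ((-1) ^+ s * dP s).
  apply: is_derive_eq.
    apply: (@is_deriveM _ _ (cst ((-1) ^+ s)) (fun z => \prod_i A z i (s i))).
    by apply: is_derive_prod => i; exact: h.
  by rewrite /= scaler0 addr0.
apply: is_derive_eq; first exact: is_derive_bigsum dP'.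
rewrite exchange_big /=; apply: eq_bigr => s _.
rewrite /dP mulr_sumr; apply: eq_bigr => i _.
by congr (_ * _); apply: eq_bigr => j _; rewrite mxE.
Qed.

End DetDerivative.

Section CkMatrix.
Context {R : realType} {n : nat} (D : set 'rV[R]_n) (oD : open D).

Lemma Ck_mulmx m p q k (A : 'rV[R]_n -> 'M[R]_(m, p)) (B : 'rV[R]_n -> 'M[R]_(p, q)) :
  (forall i j, Ck_on k D (fun y => A y i j)) ->
  (forall i j, Ck_on k D (fun y => B y i j)) ->
  forall i j, Ck_on k D (fun y => (A y *m B y) i j).
Proof.
move=> hA hB i j; apply: (@Ck_ext _ _ _ k D (fun y => \sum_l A y i l * B y l j)) => //.
  by move=> y _; rewrite mxE.
by apply: Ck_sum => // l _; apply: CkM.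
Qed.

(** Cramer's rule expresses the inverse by determinants of entries. *)
Lemma Ck_invmx m k (A : 'rV[R]_n -> 'M[R]_m) :
  (forall y, D y -> A y \in unitmx) ->
  (forall i j, Ck_on k D (fun y => A y i j)) ->
  forall i j, Ck_on k D (fun y => invmx (A y) i j).
Proof.
move=> hU hA i j.
apply: (@Ck_ext _ _ _ k D (fun y => (\det (A y))^-1 * ((-1) ^+ (j + i) *
   \det (\matrix_(a, b) A y (lift j a) (lift i b))))) => //.
  move=> y Dy; rewrite /invmx hU // !mxE /cofactor; congr (_ * (_ * \det _)).
  by apply/matrixP => a b; rewrite !mxE.
apply: CkM => //.
  apply: CkV => //; last exact: Ck_det.
  by move=> y Dy; have := hU y Dy; rewrite unitmxE unitfE.
apply: CkM => //; first exact: Ck_cst.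
apply: Ck_det => // a b; apply: Ck_ext (hA (lift j a) (lift i b)) => // y _.
by rewrite mxE.
Qed.

Lemma Ck_entry m q k (A : 'rV[R]_n -> 'M[R]_(m, q)) i j :
  Ck_on k D A -> Ck_on k D (fun y => A y i j).
Proof.
elim: k A => [|k IH] A hA.
  by split=> // y Dy; apply: coord_for_continuous; exact: Ck_continuous hA Dy.
split=> [y Dy|l].
  by apply: coord_for_continuous; exact: Ck_continuous hA Dy.
have dA y : D y -> derivable A y (delta_mx 0 l) by move=> Dy; exact: Ck_derivable hA Dy.
split=> [y Dy|]; first by have /derivable_mxP := dA y Dy; exact.
apply: Ck_ext (IH _ (Ck_partial l hA)) => // y Dy.
by rewrite /partial (derive_mx (dA y Dy)) mxE.
Qed.

End CkMatrix.

(** * Parallel frames of a flat connection *)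

Lemma near_forall (T : topologicalType) (I : finType) (P : I -> T -> Prop) (x : T) :
  (forall i, \forall y \near x, P i y) -> \forall y \near x, forall i, P i y.
Proof. by move=> h; exact: filter_forall. Qed.

(** * Connectedness and compactness of the unit interval *)

Section IntervalTool.
Context {R : realType}.

(** Connectedness in the form of an induction: near each [t] the property passes between any two
    points, in both directions, which covers openness and closedness at once. *)
Lemma itv_induction (P : R -> Prop) : P 0 ->
  (forall t : R, 0 <= t <= 1 -> exists2 e : R, 0 < e & forall t1 t2 : R,
     0 <= t1 <= 1 -> 0 <= t2 <= 1 -> `|t1 - t| < e -> `|t2 - t| < e ->
     P t1 -> P t2) ->
  forall t : R, 0 <= t <= 1 -> P t.
Proof.
move=> P0 loc; pose S := [set t : R | 0 <= t <= 1 /\ forall u, 0 <= u <= t -> P u].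
have S0 : S 0.
  split=> [|u /andP[u0 u1]]; first by rewrite lexx ler01.
  by have -> : u = 0 by apply/eqP; rewrite eq_le u1.
have Sub : has_sup S by split; [exists 0|exists 1 => t [/andP[]]].
have s0 : 0 <= sup S by apply: ub_le_sup => //; case: Sub.
have s1 : sup S <= 1 by apply: ge_sup; [exists 0|move=> t [/andP[]]].
have s01 : 0 <= sup S <= 1 by rewrite s0.
have [e e0 he] := loc _ s01.
have [t [t01 tP] ts] := sup_adherent e0 Sub.
have tle : t <= sup S by apply: ub_le_sup => //; case: Sub.
have Pt : P t by apply: tP; case/andP: t01 => ->; rewrite lexx.
have near u : 0 <= u <= 1 -> u < sup S + e -> P u.
  move=> /andP[u0 u1] us; have [ut|tu] := leP u t; first by apply: tP; rewrite u0.
  apply: he Pt; rewrite ?u0 //; first by apply/ltr_normlP; split; lra.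
  by apply/ltr_normlP; split; lra.
have {}s1 : sup S = 1.
  apply/eqP; rewrite eq_le s1 leNgt; apply/negP => slt.
  pose v := sup S + Num.min (e / 2) (1 - sup S).
  have m0 : 0 < Num.min (e / 2) (1 - sup S).
    by rewrite lt_min; apply/andP; split; lra.
  have m1 : Num.min (e / 2) (1 - sup S) <= e / 2 by rewrite ge_min lexx.
  have m2 : Num.min (e / 2) (1 - sup S) <= 1 - sup S by rewrite ge_min lexx orbT.
  have : v <= sup S.
    apply: ub_le_sup; first by case: Sub.
    rewrite /v; split=> [|u /andP[u0 uv]]; first by apply/andP; split; lra.
    by apply: near; [apply/andP; split; lra|lra].
  by rewrite /v; lra.
by move=> u /andP[u0 u1]; apply: near; rewrite ?u0 //; lra.
Qed.

(** Compactness in the form of an induction: the property carried along is uniformity on the initial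
    segment up to [t]. *)
Lemma itv_near (T : Type) (F : set_system T) (FF : Filter F) (Q : R -> T -> Prop) :
  (forall t : R, 0 <= t <= 1 -> exists2 e : R, 0 < e &
     \forall k \near F, forall s : R, 0 <= s <= 1 -> `|s - t| < e -> Q s k) ->
  \forall k \near F, forall t : R, 0 <= t <= 1 -> Q t k.
Proof.
move=> loc; pose P (t : R) := \forall k \near F, forall s : R, 0 <= s <= t -> Q s k.
suff : P 1 by [].
have P0 : P 0.
  have [|e e0] := loc 0; first by rewrite lexx ler01.
  apply: filterS => k h s /andP[h1 h2]; have -> : s = 0 by apply/eqP; rewrite eq_le h2.
  by apply: h; rewrite ?lexx ?ler01 // subrr normr0.
apply: (@itv_induction P) => //; last by rewrite ler01 lexx.
move=> t t01; have [e e0 h] := loc t t01; exists e => // t1 t2 t1b t2b d1 d2 P1.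
apply: filterS2 h P1 => k h1 h2 s /andP[s0 s2].
have [st|ts] := leP s t1; first by apply: h2; rewrite s0.
apply: h1; first by rewrite s0 /=; case/andP: t2b => _; apply: le_trans.
move: d1 d2 => /ltr_normlP[d1 d1'] /ltr_normlP[d2 d2'].
by apply/ltr_normlP; split; lra.
Qed.

(** Precomposition with this retraction turns a map that is continuous on the unit interval into one
    that is continuous on the whole line. *)
Definition clamp (t : R) : R := Num.max 0 (Num.min t 1).

Lemma clampP (t : R) : 0 <= clamp t <= 1.
Proof.
rewrite /clamp le_max lexx /= ge_max ler01 /=.
by rewrite ge_min lexx orbT.
Qed.

Lemma clamp_id (t : R) : 0 <= t <= 1 -> clamp t = t.
Proof. by move=> /andP[t0 t1]; rewrite /clamp (min_idPl t1) (max_idPr t0). Qed.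

Lemma clampK (t : R) : clamp (clamp t) = clamp t.
Proof. exact: clamp_id (clampP t). Qed.

Lemma clamp_continuous : continuous clamp.
Proof.
move=> t; have h (a : R) : {for t, continuous (fun s : R => Num.min s a)}.
  by apply: continuous_min; [exact: cvg_id|exact: cst_continuous].
apply: (@continuous_comp _ _ _ (fun s : R => Num.min s 1) (fun s : R => Num.max 0 s)) => //.
by apply: continuous_max; [exact: cst_continuous|exact: cvg_id].
Qed.

End IntervalTool.

Section DeriveMx.
Context {R : realType} {X : normedModType R}.

Lemma is_derive_mxP m n (M : X -> 'M[R]_(m, n)) (dM : 'M[R]_(m, n)) (x v : X) :
  is_derive x v M dM <-> forall i j, is_derive x v (fun z => M z i j) (dM i j).
Proof.
split=> [[d1 d2] i j|h].
  apply: DeriveDef; first by have /derivable_mxP := d1; exact.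
  by rewrite -d2 (derive_mx d1) mxE.
have d : derivable M x v by apply/derivable_mxP => i j; case: (h i j).
apply: DeriveDef => //; rewrite (derive_mx d); apply/matrixP => i j.
by rewrite mxE; case: (h i j).
Qed.

Lemma is_derive_mulmx m n p (A : X -> 'M[R]_(m, n)) (B : X -> 'M[R]_(n, p)) dA dB (x v : X) :
  is_derive x v A dA -> is_derive x v B dB ->
  is_derive x v (fun z => A z *m B z) (dA *m B x + A x *m dB).
Proof.
move=> /is_derive_mxP hA /is_derive_mxP hB; apply/is_derive_mxP => i j.
rewrite (_ : (fun _ => _) = fun z => \sum_k A z i k * B z k j); last first.
  by apply/funext => z; rewrite mxE.
apply: is_derive_eq.
  apply: is_derive_bigsum => k; exact: is_deriveM.
rewrite !mxE -big_split /=; apply: eq_bigr => k _.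
by rewrite /GRing.scale /= addrC (mulrC (B x k j)).
Qed.

Lemma norm_mulmx_le p q (u : 'rV[R]_p) (M : 'M[R]_(p, q)) (e : R) : 0 <= e ->
  (forall a b, `|M a b| <= e) -> `|u *m M| <= p%:R * e * `|u|.
Proof.
move=> e0 hM; apply/rV_normP; first by rewrite !mulr_ge0.
move=> b; rewrite mxE; apply: le_trans (ler_norm_sum _ _ _) _.
rewrite -mulrA mulr_natl; have -> : (e * `|u|) *+ p = \sum_(i < p) e * `|u|.
  by rewrite sumr_const card_ord.
apply: ler_sum => a _.
by rewrite normrM mulrC; apply: ler_pM => //; exact: rV_coord_le.
Qed.

End DeriveMx.

(** * Linear differential equations on the unit interval *)

Section LinearODE.
Context {R : realType}.

Lemma antiderivative (g : R -> R) : continuous g ->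
  exists G : R -> R, forall t : R, 0 <= t -> is_derive t 1 G (g t).
Proof.
move=> cg; exists (fun x => \int[lebesgue_measure]_(t in `[(-1)%R, x]) g t)%R.
move=> t t0; have tu : t < t + 1 by lra.
have ig : lebesgue_measure.-integrable `[(-1)%R, t + 1] (EFin \o g).
  apply: continuous_compact_integrable; first exact: segment_compact.
  exact: continuous_subspaceT.
have at1 : -1 < t by lra.
have [d1 d2] := continuous_FTC1_closed tu ig at1 (cg t).
by apply: (DeriveDef d1); rewrite -d2 derive1E.
Qed.

Lemma itv_MVT (f : R -> R) (M t : R) : 0 <= t <= 1 ->
  (forall s : R, 0 <= s <= 1 -> exists2 d, is_derive s 1 f d & `|d| <= M) ->
  `|f t - f 0| <= M.
Proof.
move=> /andP[t0 t1] h.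
have [s s01 E] : exists2 s : R, 0 <= s <= 1 & f (0 + t *: (1 : R)) - f 0 = t * 'D_1 f (0 + (s * t) *: (1 : R)).
  apply: line_MVT => s /andP[s0 s1]; rewrite add0r [_ *: _]mulr1.
  by have [|d []] := h (s * t); first by rewrite mulr_ge0 //= mulr_ile1.
move: E; rewrite !add0r ![_ *: _]mulr1 => ->.
case/andP: s01 => s0 s1.
have [|d [_ ->] dM] := h (s * t); first by rewrite mulr_ge0 //= mulr_ile1.
rewrite normrM ger0_norm //; apply: le_trans dM.
by rewrite ler_piMl.
Qed.

Variables (q : nat) (B : R -> 'M[R]_q).
Hypothesis Bc : forall i j, continuous (fun t => B t i j).
Hypothesis B2 : forall (t : R) (u : 'rV[R]_q), 0 <= t <= 1 -> `|u *m B t| <= 2^-1 * `|u|.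

(** One Picard step: [w] is [u0] plus the primitive of [v B], frozen outside the unit interval. The
    unfrozen primitive [w0] is remembered because it keeps two-sided derivatives at 0 and 1. *)
Let picard (u0 : 'rV[R]_q) (v w : R -> 'rV[R]_q) :=
  [/\ continuous w, forall t, w (clamp t) = w t, w 0 = u0 &
   exists2 w0 : R -> 'rV[R]_q, forall t : R, 0 <= t <= 1 -> w0 t = w t &
     forall t : R, 0 <= t <= 1 -> is_derive t 1 w0 (v t *m B t)].

Let picard_exists u0 v : continuous v -> exists w, picard u0 v w.
Proof.
move=> cv.
have cg j : continuous (fun t => (v t *m B t) 0 j).
  move=> t; rewrite (_ : (fun _ => _) = fun t => \sum_k v t 0 k * B t k j); last first.
    by apply/funext => s; rewrite mxE.
  apply: (@cvg_big R 'I_q +%R 0 xpredT _ _ _ _ _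
    (fun k => v t 0 k * B t k j) (nbhs_filter t)) => [|k _]; first exact: add_continuous.
  apply: continuousM; last exact: Bc.
  by apply: coord_for_continuous; exact: cv.
have [G hG] := choice (fun j => antiderivative (cg j)).
pose w0 t : 'rV[R]_q := u0 + \row_j (G j t - G j 0).
have dw0 (t : R) : 0 <= t <= 1 -> is_derive t 1 w0 (v t *m B t).
  move=> /andP[t0 t1]; apply/is_derive_mxP => i j; rewrite (ord1 i).
  rewrite (_ : (fun _ => _) = cst (u0 0 j - G j 0) + G j); last first.
    by apply/funext => s; rewrite /w0 !mxE /= !fctE /cst addrA addrAC.
  by have h := hG j t t0; apply: is_derive_eq; rewrite add0r.
exists (w0 \o clamp); split=> [t|t||].
- apply: continuous_comp; first exact: clamp_continuous.
  have [+ _] := dw0 _ (clampP t).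
  by move=> /derivable1_diffP/differentiable_continuous.
- by rewrite /= clampK.
- rewrite /= clamp_id ?lexx ?ler01 // /w0; apply/rowP => j.
  by rewrite !mxE subrr addr0.
- by exists w0 => // t t01 /=; rewrite clamp_id.
Qed.

Let picard_contract u0 v w v' w' (M : R) : picard u0 v w -> picard u0 v' w' ->
  (forall t, `|v t - v' t| <= M) -> forall t, `|w t - w' t| <= M / 2.
Proof.
move=> [_ wcl w0 [W W1 W2]] [_ wcl' w0' [W' W1' W2']] h t.
have M0 : 0 <= M by apply: le_trans (h 0).
rewrite -wcl -wcl'; move: (clamp t) (clampP t) => {}t t01.
rewrite -W1 // -W1' //; apply/rV_normP; first by rewrite divr_ge0.
move=> j; pose f s := (W s - W' s) 0 j.
have f0 : f 0 = 0.
  by rewrite /f W1 ?W1' ?lexx ?ler01 // w0 w0' subrr mxE.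
rewrite -[X in `|X|]subr0 -[X in _ - X]f0; apply: (itv_MVT (f := f)) => // s s01.
exists (((v s - v' s) *m B s) 0 j).
  have : is_derive s 1 (W - W') (v s *m B s - v' s *m B s).
    by have h1 := W2 s s01; have h2 := W2' s s01; exact: is_deriveB.
  by rewrite -mulmxBl => /is_derive_mxP/(_ 0 j).
apply: le_trans (rV_coord_le _ _) _; apply: le_trans (B2 _ s01) _.
by rewrite mulrC ler_wpM2r // h.
Qed.

(** [C + C] is the sum of the series with terms [C / 2 ^ k]. *)
Lemma geometric_cvg (V : completeNormedModType R) (a : nat -> V) (C : R) :
  (forall k, `|a k.+1 - a k| <= C / 2 ^+ k) ->
  exists l, forall k, `|l - a k| <= (C + C) / 2 ^+ k.
Proof.
move=> h; have C0 : 0 <= C.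
  by have := h 0%N; rewrite expr0 divr1; apply: le_trans.
have h2 k j : `|a (j + k)%N - a k| <= (C + C) / 2 ^+ k - (C + C) / 2 ^+ (j + k).
  elim: j => [|j IH]; first by rewrite add0n !subrr normr0.
  have -> : a (j.+1 + k)%N - a k = (a (j + k).+1 - a (j + k)%N) + (a (j + k)%N - a k).
    by rewrite addrA subrK.
  apply: le_trans (ler_normD _ _) _; apply: le_trans (lerD (h _) IH) _.
  rewrite addSn exprS invfM; set x := (2 ^+ (j + k))^-1; set y := (2 ^+ k)^-1.
  by lra.
have h3 k j : `|a (j + k)%N - a k| <= (C + C) / 2 ^+ k.
  apply: le_trans (h2 k j) _; rewrite gerBl.
  by rewrite divr_ge0 ?exprn_ge0 // addr_ge0.
have small (e : R) : 0 < e -> exists k, (C + C) / 2 ^+ k < e.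
  move=> e0; pose c := (C + C) / e.
  have [k hk] : exists k : nat, c < k%:R.
    by exists (Num.truncn c).+1; exact: truncnS_gt.
  exists k; rewrite ltr_pdivrMr ?exprn_gt0 //.
  rewrite -ltr_pdivrMl // mulrC; apply: lt_le_trans hk _.
  by rewrite -natrX ler_nat ltnW // ltn_expl.
have ca : cvgn a.
  apply/cauchy_cvgP; apply: cauchy_exP => e e0; have [k hk] := small e e0.
  exists (a k); exists k => // j /= kj; rewrite ballE distrC.
  by rewrite -(subnK kj); apply: le_lt_trans (h3 k _) hk.
exists (limn a) => k.
have cd : `|a j - a k| @[j --> \oo] --> `|limn a - a k|.
  by apply: cvg_norm; apply: cvgB => //; exact: cvg_cst.
rewrite -(cvg_lim _ cd) //; apply: limr_le; first by apply/cvg_ex; eexists; exact: cd.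
exists k => // j /= kj.
by rewrite -(subnK kj).
Qed.

Lemma geometric_cvg_rV p (a : nat -> 'rV[R]_p) (C : R) :
  (forall k, `|a k.+1 - a k| <= C / 2 ^+ k) ->
  exists l : 'rV[R]_p, forall k, `|l - a k| <= (C + C) / 2 ^+ k.
Proof.
move=> h; have C0 : 0 <= C.
  by have := h 0%N; rewrite expr0 divr1; apply: le_trans.
have hj j k : `|a k.+1 0 j - a k 0 j| <= C / 2 ^+ k.
  by apply: le_trans (h k); have := rV_coord_le (a k.+1 - a k) j; rewrite !mxE.
have [l hl] := choice (fun j => @geometric_cvg R (fun k => a k 0 j) C (hj j)).
exists (\row_j l j) => k; apply/rV_normP => [|j]; last by rewrite !mxE.
by rewrite divr_ge0 ?exprn_ge0 // addr_ge0.
Qed.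

(** The factor one half in [B2] makes the Picard step contract on the whole interval, so the
    interval is never subdivided; the users of the lemma shrink their domain to obtain [B2]. *)
Lemma linear_ode (u0 : 'rV[R]_q) : exists u : R -> 'rV[R]_q,
  u 0 = u0 /\ forall t : R, 0 <= t <= 1 -> is_derive t 1 u (u t *m B t).
Proof.
(* The value [v] is a default for functions without a Picard step; the iterates are continuous and
   never meet it. *)
pose F (v : R -> 'rV[R]_q) : R -> 'rV[R]_q := 
  if pselect (exists w, picard u0 v w) is left h then projT1 (cid h) else v.
have FP v : continuous v -> picard u0 v (F v).
  move=> cv; rewrite /F; case: pselect => [h|[]]; first exact: projT2 (cid h).
  exact: picard_exists.
pose u (k : nat) := iter k F (fun=> u0).
have uc k : continuous (u k).
  elim: k => [|k IH]; first by move=> t; exact: cst_continuous.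
  by case: (FP _ IH).
have up k : picard u0 (u k) (u k.+1) by exact: FP.
have [C hC] : exists C, forall t, `|u 1%N t - u 0%N t| <= C.
  have [_ ucl _ _] := up 0%N.
  have c1 : {within `[0, 1 : R], continuous (fun t => `|u 1%N t - u0|)}.
    apply: continuous_subspaceT => t; apply: cvg_norm; apply: cvgB; first exact: uc.
    exact: cvg_cst.
  have [c _ hc] := EVT_max ler01 c1.
  exists `|u 1%N c - u0| => t; rewrite -ucl; apply: hc; rewrite in_itv /=; exact: clampP.
have hk k t : `|u k.+1 t - u k t| <= C / 2 ^+ k.
  elim: k t => [|k IH] t; first by rewrite expr0 divr1.
  by rewrite exprSr invfM mulrA; exact: picard_contract (up k.+1) (up k) IH t.
have [l hl] := choice (fun t => geometric_cvg_rV (a := fun k => u k t) (fun k => hk k t)).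
have C0 : 0 <= C by apply: le_trans (hC 0).
have small (e : R) : 0 < e -> exists k, (C + C) / 2 ^+ k < e.
  move=> e0; pose c := (C + C) / e.
  exists (Num.truncn c).+1; rewrite ltr_pdivrMr ?exprn_gt0 //.
  rewrite -ltr_pdivrMl // mulrC; apply: lt_le_trans (truncnS_gt c) _.
  by rewrite -natrX ler_nat ltnW // ltn_expl.
have lc : continuous l.
  move=> t; apply/cvgrPdist_lt => e e0; have [|k ke] := small (e / 3).
    by rewrite divr_gt0.
  have /cvgrPdist_lt/(_ (e / 3)) := uc k t; rewrite divr_gt0 // => /(_ isT).
  apply: filterS => s hs; have := hl t k; have := hl s k.
  rewrite (distrC (l s)) => h1 h2.
  have -> : l t - l s = (l t - u k t) + ((u k t - u k s) + (u k s - l s)).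
    by rewrite !addrA !subrK.
  apply: le_lt_trans (ler_normD _ _) _.
  have := ler_normD (u k t - u k s) (u k s - l s); lra.
have [w wp] := picard_exists u0 lc.
(* The limit is a fixed point: the Picard step of [l] and [l] itself are both close to the late
   iterates. *)
have wl t : w t = l t.
  apply/eqP; rewrite -subr_eq0 -normr_le0; apply/ler_addgt0Pr => e e0; rewrite add0r.
  have [|k ke] := small (e / 2); first by rewrite divr_gt0.
  have := picard_contract wp (up k) (fun s => hl s k) t.
  have := hl t k.+1; rewrite distrC exprS invfM mulrA.
  have -> : w t - l t = (w t - u k.+1 t) + (u k.+1 t - l t) by rewrite addrA subrK.
  have := ler_normD (w t - u k.+1 t) (u k.+1 t - l t).
  have : 0 <= (C + C) / 2 ^+ k by rewrite divr_ge0 ?exprn_ge0 // addr_ge0.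
  rewrite mulrAC; move: ((C + C) / _) ke => x; lra.
have [_ _ w0 [W W1 W2]] := wp.
exists W; split; first by rewrite W1 ?lexx ?ler01.
by move=> t t01; rewrite W1 // wl; exact: W2.
Qed.

(** At a maximum point [c] of [|e|] the mean value bound reads [|e c| <= |e c| / 2 + d]. Absorbing
    the half replaces the exponential of the usual inequality. *)
Lemma gronwall (e r : R -> 'rV[R]_q) (d : R) :
  (forall t : R, 0 <= t <= 1 -> is_derive t 1 e (e t *m B t + r t)) ->
  (forall t : R, 0 <= t <= 1 -> `|r t| <= d) -> e 0 = 0 ->
  forall t : R, 0 <= t <= 1 -> `|e t| <= d + d.
Proof.
move=> de hr e0.
have c1 : {within `[0, 1 : R], continuous (fun t => `|e t|)}.
  apply: continuous_in_subspaceT => t; rewrite inE /= in_itv /= => t01.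
  have [+ _] := de t t01.
  by move=> /derivable1_diffP/differentiable_continuous ct; apply: cvg_norm.
have [c + hc] := EVT_max ler01 c1; rewrite in_itv /= => c01.
have hm (s : R) : 0 <= s <= 1 -> `|e s| <= `|e c| by move=> s01; apply: hc; rewrite in_itv.
have d0 : 0 <= d by apply: le_trans (hr 0 _) => //; rewrite lexx ler01.
suff : `|e c| <= 2^-1 * `|e c| + d.
  by move=> h t /hm; move: `|e c| `|e t| h => a b; lra.
apply/rV_normP; first by rewrite addr_ge0 // mulr_ge0.
move=> j; have -> : e c 0 j = e c 0 j - e 0 0 j by rewrite e0 mxE subr0.
apply: (itv_MVT (f := fun s => e s 0 j)) => // s s01.
have /is_derive_mxP/(_ 0 j) h := de s s01.
exists ((e s *m B s + r s) 0 j) => //.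
apply: le_trans (rV_coord_le _ _) _; apply: le_trans (ler_normD _ _) _.
apply: lerD; last exact: hr.
by apply: le_trans (B2 _ s01) _; apply: ler_wpM2l => //; exact: hm.
Qed.

End LinearODE.

(** * Integrability of flat connections *)

Section Frobenius.

Context {R : realType} {m q : nat}.
Variables (D : set 'rV[R]_m) (A : 'I_m -> 'rV[R]_m -> 'M[R]_q).
Hypothesis oD : open D.
Hypothesis A1 : forall i a b, Ck_on 1 D (fun y => A i y a b).

(** The connection form at [y] evaluated on the tangent vector [h]. *)
Definition contract (h y : 'rV[R]_m) : 'M[R]_q := \sum_i h 0 i *: A i y.

Definition parallel (E : set 'rV[R]_m) (u : 'rV[R]_m -> 'rV[R]_q) :=
  forall y, E y -> {for y, continuous u} /\
    forall i, is_derive y (delta_mx 0 i) u (u y *m A i y).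

Lemma contractD h k y : contract (h + k) y = contract h y + contract k y.
Proof.
by rewrite /contract -big_split /=; apply: eq_bigr => i _; rewrite mxE scalerDl.
Qed.

Definition lin_mulmx_contract (y : 'rV[R]_m) (w : 'rV[R]_q) (k : 'rV[R]_m) : 'rV[R]_q :=
  w *m contract k y.

Lemma lin_mulmx_contract_linear y w : linear (lin_mulmx_contract y w).
Proof.
move=> c k l; rewrite /lin_mulmx_contract contractD mulmxDr; congr (_ + _).
rewrite scalemxAr; congr (_ *m _); rewrite /contract scaler_sumr.
by apply: eq_bigr => i _; rewrite mxE scalerA.
Qed.
HB.instance Definition _ y w := GRing.isLinear.Build R 'rV[R]_m 'rV[R]_q _
  (lin_mulmx_contract y w) (lin_mulmx_contract_linear y w).

Lemma contractE h y a b : contract h y a b = \sum_i h 0 i * A i y a b.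
Proof. by rewrite /contract summxE; apply: eq_bigr => i _; rewrite mxE. Qed.

Lemma fin_bound (T : finType) (f : T -> R) : exists2 K : R, 0 <= K & forall t, `|f t| <= K.
Proof.
exists (\sum_t `|f t|) => [|t]; first exact: sumr_ge0.
by rewrite (bigD1 t) //= lerDl sumr_ge0.
Qed.

Lemma contract_bound y0 : D y0 -> exists2 C : R, 0 < C & \forall y \near y0,
  D y /\ forall h (u : 'rV[R]_q), `|u *m contract h y| <= C * `|h| * `|u|.
Proof.
move=> Dy0.
have [K K0 hK] := fin_bound (fun t : 'I_m * 'I_q * 'I_q => A t.1.1 y0 t.1.2 t.2).
exists (q%:R * (m%:R * (K + 1)) + 1); first by rewrite ltr_wpDl // !mulr_ge0 // addr_ge0.
have H : \forall y \near y0, forall t : 'I_m * 'I_q * 'I_q, `|A t.1.1 y t.1.2 t.2| <= K + 1.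
  apply: (near_forall (P := fun (t : 'I_m * 'I_q * 'I_q) y => `|A t.1.1 y t.1.2 t.2| <= K + 1)) => -[[i a] b].
  have /cvgrPdist_le/(_ 1 ltr01) := Ck_continuous (A1 i a b) Dy0.
  apply: filterS => y /= hy; have /= h := hK (i, a, b).
  have -> : A i y a b = A i y0 a b - (A i y0 a b - A i y a b) by rewrite subKr.
  by apply: le_trans (ler_normB _ _) _; exact: lerD.
apply: filterS2 (open_nbhs_nbhs (conj oD Dy0)) H => y Dy hA; split=> // h u.
have e0 : 0 <= m%:R * (K + 1) * `|h| by rewrite !mulr_ge0 // addr_ge0.
apply: le_trans (norm_mulmx_le u e0 _) _ => [a b|].
  rewrite contractE; apply: le_trans (ler_norm_sum _ _ _) _.
  rewrite -mulrA mulr_natl; have -> : ((K + 1) * `|h|) *+ m = \sum_(i < m) (K + 1) * `|h|.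
    by rewrite sumr_const card_ord.
  apply: ler_sum => i _; rewrite normrM mulrC; apply: ler_pM => //.
    exact: (hA (i, a, b)).
  exact: rV_coord_le.
by apply: ler_wpM2r => //; rewrite mulrA; apply: ler_wpM2r => //; rewrite lerDl.
Qed.

(** Strict differentiability, made uniform along the segment by [itv_near]. It serves to vary the
    coefficients of the equation along a ray with the end of the ray. *)
Lemma segment_strict f y h (e : R) : Ck_on 1 D f ->
  (forall t : R, 0 <= t <= 1 -> D (y + t *: h)) -> 0 < e ->
  \forall k \near (0 : 'rV[R]_m), forall t : R, 0 <= t <= 1 ->
    `|f (y + t *: (h + k)) - f (y + t *: h) - t * grad f (y + t *: h) k| <= e * `|k|
    /\ `|f (y + t *: (h + k)) - f (y + t *: h)| <= e.
Proof.
move=> hf hD e0; pose Q (t : R) (k : 'rV[R]_m) :=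
    `|f (y + t *: (h + k)) - f (y + t *: h) - t * grad f (y + t *: h) k| <= e * `|k|
    /\ `|f (y + t *: (h + k)) - f (y + t *: h)| <= e.
apply: (@itv_near R _ (nbhs (0 : 'rV[R]_m)) _ Q) => t0 t0b; pose z0 := y + t0 *: h.
have Dz0 : D z0 by exact: hD.
have e2 : 0 < e / 2 by rewrite divr_gt0.
have [r1 r10 [_ hr1]] := C1_strict oD hf Dz0 e2.
pose e' := e / 2 / m.+1%:R; have e'0 : 0 < e' by rewrite divr_gt0.
have : \forall z \near z0, `|f z0 - f z| <= e / 2 /\
    forall i, `|partial i f z0 - partial i f z| <= e'.
  have /cvgrPdist_le/(_ _ e2) h1 := Ck_continuous hf Dz0.
  apply: filterS2 h1 _ => [z|]; first by move=> h2 h3; split; [exact: h2|exact: h3].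
  apply: (near_forall (P := fun i z => `|partial i f z0 - partial i f z| <= e')) => i.
  by have /cvgrPdist_le/(_ _ e'0) := Ck_continuous (Ck_partial i hf) Dz0.
move=> /nbhs_ballP[r2 /= r20 hr2].
pose r := Num.min r1 r2; have r0 : 0 < r by rewrite lt_min r10.
have nh : 0 < `|h| + 1 by rewrite ltr_wpDl.
(* Half of [r] is left for the move along the segment and half for the perturbation [k]; adding 1
   covers [h = 0]. *)
exists (r / 2 / (`|h| + 1)); first by rewrite !divr_gt0.
apply/nbhs_ballP; exists (r / 2); first by rewrite /= divr_gt0.
move=> k; rewrite ballE add0r normrN => kr t tb tt.
case/andP: (tb) => t00 t1.
have bt k' : `|k'| < r / 2 -> ball z0 r (y + t *: (h + k')).
  move=> kr'; rewrite ballE.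
  have -> : z0 - (y + t *: (h + k')) = (t0 - t) *: h - t *: k'.
    by apply/rowP => i; rewrite !mxE; ring.
  apply: le_lt_trans (ler_normB _ _) _.
  have h1 : `|(t0 - t) *: h| <= r / 2.
    rewrite normrZ distrC; apply: le_trans (_ : r / 2 / (`|h| + 1) * (`|h| + 1) <= _).
      by apply: ler_pM => //; [exact: ltW|rewrite lerDl].
    by rewrite divfK // lt0r_neq0.
  have h2 : `|t *: k'| < r / 2.
    by rewrite normrZ ger0_norm //; apply: le_lt_trans kr'; rewrite ler_piMl.
  by lra.
have bz : ball z0 r (y + t *: h).
  by have := bt 0; rewrite addr0; apply; rewrite normr0 divr_gt0.
have bz' := bt k kr.
have sub z : ball z0 r z -> ball z0 r1 z /\ ball z0 r2 z.
  rewrite !ballE => b; split; apply: lt_le_trans b _; first by rewrite ge_min lexx.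
  by rewrite ge_min lexx orbT.
have [b1 b2] := sub _ bz; have [b1' b2'] := sub _ bz'.
have [c1 c2] := hr2 _ b2; have [c1' c2'] := hr2 _ b2'; split; last first.
  by rewrite distrC; exact: dist_half' c1 c1'.
have := hr1 _ _ b1 b1'.
have E : y + t *: (h + k) - (y + t *: h) = t *: k.
  by apply/rowP => i; rewrite !mxE; ring.
rewrite E.
have -> : \sum_i ((y + t *: (h + k)) 0 i - (y + t *: h) 0 i) * partial i f z0 = t * grad f z0 k.
  rewrite /grad mulr_sumr; apply: eq_bigr => i _; rewrite mulrA; congr (_ * _).
  by have /rowP/(_ i) := E; rewrite !mxE.
have g : `|t * grad f z0 k - t * grad f (y + t *: h) k| <= e / 2 * `|k|.
  rewrite -mulrBr normrM ger0_norm //; apply: le_trans (_ : `|grad f z0 k - grad f (y + t *: h) k| <= _).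
    by rewrite ler_piMl.
  rewrite /grad -sumrB; apply: le_trans (ler_norm_sum _ _ _) _.
  apply: le_trans (_ : \sum_(i < m) e' * `|k| <= _).
    apply: ler_sum => i _; rewrite -mulrBr normrM mulrC; apply: ler_pM => //.
    exact: rV_coord_le.
  rewrite sumr_const card_ord -[_ *+ m]mulr_natl mulrA; apply: ler_wpM2r => //.
  rewrite /e' mulrCA ler_piMr ?ltW //.
  by rewrite ltr_pdivrMr // mul1r ltr_nat.
have tk : `|t *: k| <= `|k| by rewrite normrZ ger0_norm // ler_piMl.
move: g; set a := t * grad f z0 k; set b := t * grad f _ k.
set c := f _ - f _ => g h1.
have -> : c - b = (c - a) + (a - b) by rewrite addrA subrK.
apply: le_trans (ler_normD _ _) _; apply: le_trans (lerD h1 g) _.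
have -> : e * `|k| = e / 2 * `|k| + e / 2 * `|k| by rewrite -mulrDl -splitr.
by rewrite lerD2r ler_wpM2l // ltW.
Qed.

(** The derivative of the form [contract h] in the direction [k]. *)
Definition dcontract (h k y : 'rV[R]_m) : 'M[R]_q :=
  \matrix_(a, b) \sum_i h 0 i * grad (fun z => A i z a b) y k.

(** Zero curvature of [du = u A]. Rows are multiplied from the right, which fixes the order in the
    commutator: it is what equating [d_i d_j u] and [d_j d_i u] gives. *)
Definition flat := forall y i j a b, D y ->
  partial i (fun z => A j z a b) y - partial j (fun z => A i z a b) y
  + (A i y *m A j y - A j y *m A i y) a b = 0.

Lemma flat_contract h k y : flat -> D y ->
  dcontract k h y = dcontract h k y + (contract k y *m contract h y - contract h y *m contract k y).
Proof.
move=> fl Dy; apply/matrixP => a b.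
have E (h' k' : 'rV[R]_m) : (contract h' y *m contract k' y) a b =
    \sum_i \sum_j h' 0 i * k' 0 j * (A i y *m A j y) a b.
  rewrite /contract mulmx_suml summxE; apply: eq_bigr => i _.
  rewrite mulmx_sumr summxE; apply: eq_bigr => j _.
  by rewrite -scalemxAl -scalemxAr scalerA mxE.
rewrite [RHS]mxE [X in _ = _ + X]mxE [X in _ = _ + (_ + X)]mxE (E k h) (E h k).
rewrite !mxE [in X in _ = _ + (X - _)]exchange_big /=.
rewrite /grad; apply/eqP; rewrite -subr_eq; apply/eqP.
have -> : \sum_i k 0 i * (\sum_j h 0 j * partial j (fun z => A i z a b) y) =
  \sum_j \sum_i h 0 j * k 0 i * partial j (fun z => A i z a b) y.
  rewrite exchange_big; apply: eq_bigr => i _; rewrite mulr_sumr.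
  by apply: eq_bigr => j _; rewrite mulrA (mulrC (k 0 i)).
have -> : \sum_i h 0 i * (\sum_j k 0 j * partial j (fun z => A i z a b) y) =
  \sum_i \sum_j h 0 i * k 0 j * partial j (fun z => A i z a b) y.
  by apply: eq_bigr => i _; rewrite mulr_sumr; apply: eq_bigr => j _; rewrite mulrA.
rewrite -!sumrB; apply: eq_bigr => i _; rewrite -!sumrB; apply: eq_bigr => j _.
have := fl y i j a b Dy; rewrite !mxE.
move: (partial _ _ _) (partial _ _ _) (\sum_j0 _) (\sum_j0 _) => p1 p2 s1 s2 fe.
have -> : p1 = p2 - (s1 - s2) by lra.
by ring.
Qed.

Lemma is_derive_contract (y h k : 'rV[R]_m) (t : R) : D (y + t *: h) ->
  is_derive t 1 (fun s : R => contract k (y + s *: h)) (dcontract k h (y + t *: h)).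
Proof.
move=> Dt; apply/is_derive_mxP => a b.
rewrite (_ : (fun _ => _) = fun s : R => \sum_i k 0 i * A i (y + s *: h) a b); last first.
  by apply/funext => s; rewrite contractE.
rewrite mxE; apply: is_derive_bigsum => i.
by apply: is_deriveMl; exact: (C1_derive_line oD).
Qed.

Lemma is_derive_line_parallel (E : set 'rV[R]_m) u (y h : 'rV[R]_m) (t : R) :
  open E -> E `<=` D -> parallel E u -> E (y + t *: h) ->
  is_derive t 1 (fun s : R => u (y + s *: h)) (u (y + t *: h) *m contract h (y + t *: h)).
Proof.
move=> oE ED pu Et.
have u1 j : Ck_on 1 E (fun z => u z 0 j).
  split=> [z Ez|i]; first by apply: coord_for_continuous; case: (pu z Ez).
  have dz z : E z -> is_derive z (delta_mx 0 i) (fun z => u z 0 j) ((u z *m A i z) 0 j).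
    by move=> Ez; have [_ /(_ i)/is_derive_mxP] := pu z Ez; exact.
  split=> [z /dz[]//|].
  apply: (@Ck_ext _ _ _ 0 E (fun z => (u z *m A i z) 0 j)) => //.
    by move=> z /dz[_ <-].
  apply: Ck_mulmx => // [a b|a b].
    by split=> // z Ez; rewrite (ord1 a); apply: coord_for_continuous; case: (pu z Ez).
  by apply: Ck_sub ED _; exact: Ck_pred.
apply/is_derive_mxP => a j; rewrite (ord1 a).
apply: is_derive_eq; first exact: (C1_derive_line oE (u1 j) Et).
rewrite /contract mulmx_sumr summxE; apply: eq_bigr => i _.
rewrite -scalemxAr mxE; congr (_ * _).
by have [_ /(_ i)/is_derive_mxP/(_ 0 j)[_]] := pu _ Et.
Qed.

Lemma parallel_frechet (E : set 'rV[R]_m) u :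
  (forall y, E y -> forall e : R, 0 < e -> \forall k \near (0 : 'rV[R]_m),
    `|u (y + k) - u y - u y *m contract k y| <= e * `|k|) ->
  parallel E u.
Proof.
move=> H y Ey; pose L k := u y *m contract k y.
have Lc : continuous (lin_mulmx_contract y (u y)) by exact: rV_linear_continuous.
have H' (e : R) : 0 < e -> \forall k \near (0 : 'rV[R]_m),
    `|u (k + y) - (u y + u y *m contract k y)| <= e * `|k|.
  by move=> e0; apply: filterS (H y Ey e e0) => k; rewrite opprD addrA (addrC k).
have df : ('d u y = lin_mulmx_contract y (u y) :> (_ -> _)).
  by apply: (@diff_unique R _ _ u (lin_mulmx_contract y (u y)) y Lc); apply/eqaddoP => e /H'.
have dd : differentiable u y.
  by apply/diff_locallyP; rewrite df; split=> //; apply/eqaddoP => e /H'.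
split; first exact: differentiable_continuous.
move=> i; apply: DeriveDef; first exact: diff_derivable.
rewrite deriveE // df /lin_mulmx_contract /contract (bigD1 i) //= mxE !eqxx scale1r.
rewrite big1 ?addr0 // => j ji; rewrite mxE (negbTE ji) andbF scale0r //.
Qed.

Lemma half_twice (a : R) : 2^-1 * a + 2^-1 * a = a. Proof. by field. Qed.

(** The candidate is [U y 1], where [U y] solves the equation along the segment from [y0] to [y].
    Its first variation is guessed; flatness makes the guess satisfy the varied equation up to
    [o(|k|)], and [gronwall] bounds the remainder. Uniqueness is [gronwall] along the segment
    between the two points. *)
Theorem frobenius y0 : flat -> D y0 -> exists2 r : R, 0 < r &
  [/\ ball y0 r `<=` D,
    (forall u0 : 'rV[R]_q, exists2 u, u y0 = u0 & parallel (ball y0 r) u) &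
    forall u v, parallel (ball y0 r) u -> parallel (ball y0 r) v ->
      forall y y', ball y0 r y -> ball y0 r y' -> u y = v y -> u y' = v y'].
Proof.
move=> fl Dy0; have [C C0 /nbhs_ballP[r0 /= r00 hr0]] := contract_bound Dy0.
(* Two points of the ball are less than [2 r] apart, so along the segment between them the
   coefficient has norm at most [2 r C <= 1/2], as the differential equation requires. *)
pose r := Num.min r0 (4^-1 / C); have r_gt0 : 0 < r by rewrite lt_min r00 divr_gt0.
have rC (h : 'rV[R]_m) : `|h| < r + r -> C * `|h| <= 2^-1.
  move=> hr; have h1 : r <= 4^-1 / C by rewrite ge_min lexx orbT.
  have h2 : r * C <= 4^-1 by rewrite -ler_pdivlMr.
  have : C * `|h| <= C * (r + r) by rewrite ler_wpM2l // ltW.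
  have -> : (2^-1 : R) = 4^-1 + 4^-1 by field.
  by move=> h3; apply: le_trans h3 _; rewrite mulrDr !(mulrC C); exact: lerD.
have bD y : ball y0 r y -> D y /\ forall h (u : 'rV[R]_q), `|u *m contract h y| <= C * `|h| * `|u|.
  move=> by0; apply: hr0; move: by0; rewrite !ballE => /lt_le_trans; apply.
  by rewrite ge_min lexx.
have bseg y h : ball y0 r y -> ball y0 r (y + h) -> forall t : R, 0 <= t <= 1 ->
    ball y0 r (y + t *: h).
  move=> b1 b2 t /andP[t0 t1]; rewrite ballE.
  have -> : y0 - (y + t *: h) = (1 - t) *: (y0 - y) + t *: (y0 - (y + h)).
    by apply/rowP => i; rewrite !mxE; ring.
  apply: le_lt_trans (ler_normD _ _) _.
  rewrite !normrZ !ger0_norm ?subr_ge0 //; apply: convex_lt; rewrite ?t0 //.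
    by move: b1; rewrite ballE.
  by move: b2; rewrite ballE.
exists r => //; split=> [y /bD[]//||u v pu pv y y' by1 by2 uv]; last first.
  pose h := y' - y; have yE : y' = y + h by rewrite /h addrC subrK.
  have seg := bseg y h by1 _; rewrite -yE in seg; have {}seg := seg by2.
  have hh : `|h| < r + r.
    have -> : h = (y0 - y) - (y0 - y') by rewrite opprB addrC addrA subrK.
    apply: le_lt_trans (ler_normB _ _) _; apply: ltrD.
      by move: by1; rewrite ballE.
    by move: by2; rewrite ballE.
  pose B t := contract h (y + clamp t *: h).
  have B2 (t : R) (w : 'rV[R]_q) : 0 <= t <= 1 -> `|w *m B t| <= 2^-1 * `|w|.
    move=> t01; rewrite /B clamp_id //; have [_ hb] := bD _ (seg t t01).
    by apply: le_trans (hb _ _) _; apply: ler_wpM2r => //; exact: rC.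
  pose e (t : R) := u (y + t *: h) - v (y + t *: h).
  have de (t : R) : 0 <= t <= 1 -> is_derive t 1 e (e t *m B t + 0).
    move=> t01; have oB : open (ball y0 r) by exact: ball_open.
    have sD : ball y0 r `<=` D by move=> z /bD[].
    have h1 := is_derive_line_parallel oB sD pu (seg t t01).
    have h2 := is_derive_line_parallel oB sD pv (seg t t01).
    by rewrite /B clamp_id // addr0 mulmxBl; exact: is_deriveB.
  have i1 : 0 <= (1 : R) <= 1 by rewrite ler01 lexx.
  have h0 (t : R) : 0 <= t <= 1 -> `|0 : 'rV[R]_q| <= 0 by move=> _; rewrite normr0.
  have e0 : e 0 = 0 by rewrite /e scale0r addr0 uv subrr.
  have := @gronwall R q B B2 e (fun=> 0) 0 de h0 e0 1 i1.
  by rewrite addr0 normr_le0 /e scale1r -yE subr_eq0 => /eqP.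
move=> u0; have by0 : ball y0 r y0 by exact: ballxx.
have dist y : ball y0 r y -> `|y - y0| < r by rewrite ballE distrC.
pose B y (t : R) := contract (y - y0) (y0 + clamp t *: (y - y0)).
have Dz y (t : R) : ball y0 r y -> 0 <= t <= 1 -> ball y0 r (y0 + t *: (y - y0)).
  by move=> by1; apply: bseg => //; rewrite addrC subrK.
have BC y (t : R) (w : 'rV[R]_q) : ball y0 r y -> `|w *m B y t| <= C * `|y - y0| * `|w|.
  by move=> by1; have [_ hb] := bD _ (Dz y _ by1 (clampP t)); exact: hb.
have B2 y (t : R) (w : 'rV[R]_q) : ball y0 r y -> `|w *m B y t| <= 2^-1 * `|w|.
  move=> by1; apply: le_trans (BC y t w by1) _; apply: ler_wpM2r => //; apply: rC.
  by apply: lt_trans (dist _ by1) _; rewrite ltrDl.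
have Bc y : ball y0 r y -> forall a b, continuous (fun t => B y t a b).
  move=> by1 a b t; rewrite (_ : (fun _ => _) =
     fun t : R => \sum_i (y - y0) 0 i * A i (y0 + clamp t *: (y - y0)) a b); last first.
    by apply/funext => s; rewrite contractE.
  apply: (@cvg_big R 'I_m +%R 0 xpredT _ _ _ _ _
    (fun i => (y - y0) 0 i * A i (y0 + clamp t *: (y - y0)) a b) (nbhs_filter t)) => [|i _].
    exact: add_continuous.
  apply: continuousM; first exact: cst_continuous.
  apply: (@continuous_comp _ _ _ (fun t : R => y0 + clamp t *: (y - y0)) (fun z => A i z a b)).
    apply: continuousD; first exact: cst_continuous.
    apply: (@continuous_comp _ _ _ clamp (fun t : R => t *: (y - y0))); first exact: clamp_continuous.
    exact: scalel_continuous.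
  by have [d _] := bD _ (Dz y _ by1 (clampP t)); exact: Ck_continuous (A1 i a b) d.
(* Outside the ball the solution is the arbitrary value 0. *)
have exU (y : 'rV[R]_m) : exists Uy : R -> 'rV[R]_q, ball y0 r y -> Uy 0 = u0 /\
    forall t : R, 0 <= t <= 1 -> is_derive t 1 Uy (Uy t *m B y t).
  have [by1|nb] := pselect (ball y0 r y); last by exists (fun=> 0) => /nb.
  have [Uy hUy] := linear_ode (Bc y by1) (fun t w _ => B2 y t w by1) u0.
  by exists Uy.
have [U hU] := choice exU.
have Ub y (t : R) : ball y0 r y -> 0 <= t <= 1 ->
    `|U y t - u0| <= C * `|y - y0| * `|u0| + C * `|y - y0| * `|u0|.
  move=> by1; have [U0 dU] := hU y by1.
  pose e (t : R) := U y t - u0.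
  apply: (@gronwall R q (B y) (fun t w _ => B2 y t w by1) e (fun t => u0 *m B y t)).
  - move=> s s01; have h := dU s s01.
    rewrite /e -mulmxDl subrK; have : is_derive s 1 (U y - cst u0) (U y s *m B y s - 0).
      by apply: is_deriveB.
    by rewrite subr0.
  - by move=> s s01; exact: BC.
  - by rewrite /e U0 subrr.
have Ub2 y (t : R) : ball y0 r y -> 0 <= t <= 1 -> `|U y t| <= `|u0| + `|u0|.
  move=> by1 t01; have := Ub y t by1 t01.
  have h1 : C * `|y - y0| <= 2^-1.
    by apply: rC; apply: lt_trans (dist _ by1) _; rewrite ltrDl.
  have h2 : C * `|y - y0| * `|u0| <= 2^-1 * `|u0| by rewrite ler_wpM2r.
  have h3 : `|U y t| <= `|U y t - u0| + `|u0| by have := ler_normD (U y t - u0) u0; rewrite subrK.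
  by move: h2 h3; lra.
exists (fun y => U y 1).
  have := Ub y0 1 by0; rewrite subrr normr0 mulr0 mul0r addr0 ler01 lexx => /(_ isT).
  by rewrite normr_le0 subr_eq0 => /eqP.
apply: parallel_frechet => y by1 e e0.
pose h := y - y0; have hE k : y + k - y0 = h + k by rewrite addrAC.
(* [K] gathers the constants of the estimate [rrb] below. The factor 2 makes that estimate
   [e |k| / 2], which [gronwall] doubles; the final 1 keeps [K] positive. *)
pose K := 2 * ((q%:R * (m%:R * (`|h| + 1)) + C * (q%:R * (m%:R * `|h|) + 1)) * (`|u0| + `|u0|)) + 1.
have K1 : 1 <= K.
  by rewrite lerDr !mulr_ge0 ?addr_ge0 ?mulr_ge0 ?addr_ge0 ?mulr_ge0 // ltW.
have K0 : 0 < K by apply: lt_le_trans K1.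
pose e' := e / K; have e'0 : 0 < e' by rewrite divr_gt0.
have eK : e = e' * K by rewrite /e' divfK // lt0r_neq0.
clearbody e'.
have st : \forall k \near (0 : 'rV[R]_m), forall j : 'I_m * 'I_q * 'I_q,
   forall t : R, 0 <= t <= 1 ->
    `|A j.1.1 (y0 + t *: (h + k)) j.1.2 j.2 - A j.1.1 (y0 + t *: h) j.1.2 j.2
       - t * grad (fun z => A j.1.1 z j.1.2 j.2) (y0 + t *: h) k| <= e' * `|k|
    /\ `|A j.1.1 (y0 + t *: (h + k)) j.1.2 j.2 - A j.1.1 (y0 + t *: h) j.1.2 j.2| <= e'.
  apply: (near_forall (P := fun (j : 'I_m * 'I_q * 'I_q) k => forall t : R, 0 <= t <= 1 ->
    `|A j.1.1 (y0 + t *: (h + k)) j.1.2 j.2 - A j.1.1 (y0 + t *: h) j.1.2 j.2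
       - t * grad (fun z => A j.1.1 z j.1.2 j.2) (y0 + t *: h) k| <= e' * `|k|
    /\ `|A j.1.1 (y0 + t *: (h + k)) j.1.2 j.2 - A j.1.1 (y0 + t *: h) j.1.2 j.2| <= e')).
  move=> j; apply: segment_strict => // t t01.
  by have [] := bD _ (Dz y t by1 t01).
have kb : \forall k \near (0 : 'rV[R]_m), ball y0 r (y + k) /\ C * `|k| <= e'.
  have s0 : 0 < r - `|y - y0| by rewrite subr_gt0; exact: dist.
  have s1 : 0 < e' / C by rewrite divr_gt0.
  have ss0 : 0 < Num.min (r - `|y - y0|) (e' / C) by rewrite lt_min s0.
  apply/nbhs_ballP; exists (Num.min (r - `|y - y0|) (e' / C)) => // k.
  rewrite ballE add0r normrN lt_min => /andP[k1 k2]; split; last first.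
    by rewrite mulrC -ler_pdivlMr // ltW.
  rewrite ballE distrC hE; apply: le_lt_trans (ler_normD _ _) _.
  by rewrite -/h in k1 *; lra.
apply: filterS2 st kb => k st' [bk Ck].
have {}st i a b (t : R) : 0 <= t <= 1 -> _ := st' (i, a, b) t; rewrite /= in st.
pose z (t : R) := y0 + t *: h.
(* The expected variation: a parallel section changes by [u A(k)], and the point at time [t] moves
   by [t k]. *)
pose w (t : R) := (t *: U y t) *m contract k (z t).
(* The linear part in [k] of the change of the coefficient [contract h (y0 + t h)] when [h] becomes
   [h + k]. *)
pose dB (t : R) := contract k (z t) + t *: dcontract h k (z t).
pose M1 (t : R) := B (y + k) t - B y t - dB t.
pose M2 (t : R) := B (y + k) t - B y t.
pose ee (t : R) := U (y + k) t - U y t - w t.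
pose rr (t : R) := U y t *m M1 t + w t *m M2 t.
have [U0 dU] := hU y by1; have [U0' dU'] := hU _ bk.
have dee (t : R) : 0 <= t <= 1 -> is_derive t 1 ee (ee t *m B (y + k) t + rr t).
  move=> t01; have h1 := dU t t01; have h2 := dU' t t01.
  have [Dt _] := bD _ (Dz y t by1 t01).
  have h3 : is_derive t 1 (fun t => t *: U y t) (U y t + t *: (U y t *m B y t)).
    apply/is_derive_mxP => a b; rewrite (_ : (fun _ => _) = fun t : R => t * U y t a b); last first.
      by apply/funext => s; rewrite mxE.
    have /is_derive_mxP/(_ a b) h4 := h1.
    have := @is_deriveM R R id (fun t => U y t a b) t 1 _ _ (is_derive_id t 1) h4.
    by congr is_derive; rewrite [RHS]mxE [X in _ = _ + X]mxE addrC /GRing.scale /= mulr1.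
  have h4 := is_derive_mulmx h3 (is_derive_contract k Dt).
  have h5 : is_derive t 1 (U (y + k) - U y) (U (y + k) t *m B (y + k) t - U y t *m B y t).
    exact: is_deriveB.
  have : is_derive t 1 (U (y + k) - U y - w) (U (y + k) t *m B (y + k) t - U y t *m B y t
      - ((U y t + t *: (U y t *m B y t)) *m contract k (z t) + (t *: U y t) *m dcontract k h (z t))).
    exact: is_deriveB.
  (* Flatness exchanges the derivative of [A(k)] along the ray for the derivative of [A(h)] in the
     direction of the variation. *)
  congr is_derive; rewrite (flat_contract h k fl Dt).
  have -> : contract h (y0 + t *: h) = B y t by rewrite /B clamp_id.
  rewrite /ee /rr /w /M1 /M2 /dB -/(z t); move: (B (y + k) t) (B y t) (contract k (z t)) (dcontract h k (z t)).
  move=> P1 P2 P3 P4; move: (U (y + k) t) (U y t) => V1 V2.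
  rewrite !(mulmxDl, mulmxDr, mulmxN, mulNmx, opprD) -!scalemxAl -!scalemxAr !mulmxA.
  move: (V1 *m P1) (V2 *m P1) (V2 *m P2) (V2 *m P3) (V2 *m P4) => a1 a2 a3 a4 a5.
  move: (a4 *m P1) (a4 *m P2) (a3 *m P3) => a6 a7 a8.
  by apply/rowP => j; rewrite !mxE; ring.
have rrb (t : R) : 0 <= t <= 1 -> `|rr t| <= 2^-1 * e * `|k|.
  move=> t01; case/andP: (t01) => t0 t1; have [Dt hb] := bD _ (Dz y t by1 t01).
  have wb : `|w t| <= C * `|k| * (`|u0| + `|u0|).
    apply: le_trans (hb _ _) _; apply: ler_wpM2l; first by rewrite mulr_ge0 // ltW.
    rewrite normrZ ger0_norm //; apply: le_trans (Ub2 y t by1 t01).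
    by rewrite ler_piMl.
  have BE a b : (B (y + k) t) a b = \sum_i (h + k) 0 i * A i (y0 + t *: (h + k)) a b.
    by rewrite /B contractE clamp_id // hE.
  have BE' a b : (B y t) a b = \sum_i h 0 i * A i (y0 + t *: h) a b.
    by rewrite /B contractE clamp_id.
  have const (c : R) : m%:R * c = \sum_(i < m) c by rewrite sumr_const card_ord mulr_natl.
  have m1 a b : `|M1 t a b| <= m%:R * ((`|h| + 1) * (e' * `|k|)).
    have -> : M1 t a b = \sum_i (h 0 i * (A i (y0 + t *: (h + k)) a b - A i (y0 + t *: h) a b
         - t * grad (fun z => A i z a b) (y0 + t *: h) k) +
        k 0 i * (A i (y0 + t *: (h + k)) a b - A i (y0 + t *: h) a b)).
      have sub (N1 N2 N3 : 'M[R]_q) : (N1 - N2 - N3) a b = N1 a b - N2 a b - N3 a b by rewrite !mxE.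
      have dBE : dB t a b = \sum_i k 0 i * A i (y0 + t *: h) a b
           + t * \sum_i h 0 i * grad (fun z => A i z a b) (y0 + t *: h) k.
        by rewrite /dB mxE contractE [X in _ + X]mxE [X in t * X]mxE.
      rewrite /M1 sub BE BE' dBE mulr_sumr -big_split -!sumrB.
      by apply: eq_bigr => i _ /=; rewrite mxE; ring.
    rewrite const; apply: le_trans (ler_norm_sum _ _ _) _; apply: ler_sum => i _.
    have [s1 s2] := st i a b t t01.
    apply: le_trans (ler_normD _ _) _; rewrite mulrDl mul1r; apply: lerD.
      by rewrite normrM; apply: ler_pM => //; exact: rV_coord_le.
    by rewrite normrM mulrC; apply: ler_pM => //; exact: rV_coord_le.
  have m2 : `|w t *m M2 t| <= (q%:R * (m%:R * (`|h| * e')) + e') * `|w t|.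
    pose M3 : 'M[R]_q := \matrix_(a, b) \sum_i h 0 i * (A i (y0 + t *: (h + k)) a b - A i (y0 + t *: h) a b).
    have -> : M2 t = M3 + contract k (y0 + t *: (h + k)).
      apply/matrixP => a b; rewrite [RHS]mxE [M3 a b]mxE contractE mxE [X in _ + X = _]mxE BE BE'.
      by rewrite -sumrB -big_split; apply: eq_bigr => i _ /=; rewrite mxE; ring.
    rewrite mulmxDr mulrDl; apply: le_trans (ler_normD _ _) _; apply: lerD.
      apply: norm_mulmx_le => [|a b]; first by rewrite !mulr_ge0 // ltW.
      rewrite mxE const; apply: le_trans (ler_norm_sum _ _ _) _; apply: ler_sum => i _.
      have [_ s2] := st i a b t t01.
      by rewrite normrM; apply: ler_pM => //; exact: rV_coord_le.
    have [_ hb'] := bD _ (Dz _ t bk t01); rewrite hE in hb'.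
    by apply: le_trans (hb' _ _) _; rewrite ler_wpM2r.
  have b1 : `|U y t *m M1 t| <= q%:R * (m%:R * ((`|h| + 1) * (e' * `|k|))) * (`|u0| + `|u0|).
    have p0 : 0 <= m%:R * ((`|h| + 1) * (e' * `|k|)) by rewrite !mulr_ge0 ?addr_ge0 // ltW.
    apply: le_trans (norm_mulmx_le (U y t) p0 m1) _; apply: ler_wpM2l; first by rewrite mulr_ge0.
    exact: Ub2.
  apply: le_trans (ler_normD _ _) _.
  have b2 : `|w t *m M2 t| <= (q%:R * (m%:R * (`|h| * e')) + e') * (C * `|k| * (`|u0| + `|u0|)).
    apply: le_trans m2 _; apply: ler_wpM2l wb.
    by rewrite addr_ge0 ?mulr_ge0 // ltW.
  apply: le_trans (lerD b1 b2) _.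
  have ek0 : 0 <= e' * `|k| by rewrite mulr_ge0 // ltW.
  rewrite eK /K; set nh := `|h|; set nk := `|k|; set nu := `|u0| + `|u0|.
  move: ek0; rewrite -/nk.
  move: (q%:R : R) (m%:R : R) => q' m'.
  suff -> : 2^-1 * (e' * (2 * ((q' * (m' * (nh + 1)) + C * (q' * (m' * nh) + 1)) * nu) + 1)) * nk =
   q' * (m' * ((nh + 1) * (e' * nk))) * nu + (q' * (m' * (nh * e')) + e') * (C * nk * nu) + 2^-1 * (e' * nk).
    by move=> h1; rewrite lerDl mulr_ge0.
  by field.
have i1 : 0 <= (1 : R) <= 1 by rewrite ler01 lexx.
have ee0 : ee 0 = 0 by rewrite /ee U0 U0' subrr /w scale0r mul0mx subrr.
have := @gronwall R q (B (y + k)) (fun t w _ => B2 _ t w bk) ee rr _ dee rrb ee0 1 i1.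
rewrite /ee /w scale1r /z scale1r /h (addrC y0) subrK.
by rewrite -!mulrA half_twice.
Qed.

End Frobenius.

(** * Continuation along paths *)

Section Paths.
Context {R : realType}.

Lemma within_comp_continuous (X T U : topologicalType) (A : set T) (f : T -> U)
    (phi : X -> T) : {within A, continuous f} -> continuous phi ->
  (forall x, A (phi x)) -> continuous (f \o phi).
Proof.
move=> /subspace_continuousP cf cphi hA x V hV.
have h := cphi x _ (cf (phi x) (hA x) V hV).
suff : \forall y \near x, (f \o phi) y \in V.
  by apply: (@filterS _ (nbhs x)) => y; rewrite inE.
by apply: (@filterS _ (nbhs x)) h => y hy; rewrite inE; exact: hy (hA y).
Qed.

Lemma pair_continuous (X T U : topologicalType) (f : X -> T) (g : X -> U) (x : X) :
  {for x, continuous f} -> {for x, continuous g} ->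
  {for x, continuous (fun z => (f z, g z))}.
Proof.
move=> cf cg V [[A B] /= [nA nB] AB].
suff : \forall y \near x, (f y, g y) \in V.
  by apply: (@filterS _ (nbhs x)) => y; rewrite inE.
by apply: (@filterS2 _ (nbhs x)) (cf _ nA) (cg _ nB) => y h1 h2; rewrite inE; apply: AB.
Qed.

Lemma path_near (T : topologicalType) (g : R -> T) (t : R) (U : set T) :
  {for t, continuous g} -> nbhs (g t) U ->
  exists2 e : R, 0 < e & forall t' : R, `|t' - t| < e -> U (g t').
Proof.
move=> cg /cg /nbhs_ballP[e e0 he]; exists e => // t' h; apply: he.
by rewrite ballE distrC.
Qed.

Lemma near_lt (t a : R) : t < a -> \forall s \near t, s < a.
Proof.
move=> ta; apply/nbhs_ballP; exists (a - t); rewrite /= ?subr_gt0 // => s.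
by rewrite ballE => /ltr_normlP[]; lra.
Qed.

Lemma near_gt (t a : R) : a < t -> \forall s \near t, a < s.
Proof.
move=> ta; apply/nbhs_ballP; exists (t - a); rewrite /= ?subr_gt0 // => s.
by rewrite ballE => /ltr_normlP[]; lra.
Qed.

Lemma continuous_glue (T : topologicalType) (f g : R -> T) (a : R) :
  continuous f -> continuous g -> f a = g a ->
  continuous (fun t => if t <= a then f t else g t).
Proof.
move=> cf cg E t U hU.
suff : \forall s \near t, (if s <= a then f s else g s) \in U.
  by apply: (@filterS _ (nbhs t)) => s; rewrite inE.
move: hU => /=; have [ta|ta|ta] := ltgtP t a => hU.
- apply: (@filterS2 _ (nbhs t)) (near_lt ta) (cf _ _ hU) => s sa h.
  by rewrite ltW //; exact: mem_set h.
- apply: (@filterS2 _ (nbhs t)) (near_gt ta) (cg _ _ hU) => s sa h.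
  by rewrite leNgt sa; exact: mem_set h.
- move: hU; rewrite ta => hU.
  have h2 := cg a U; rewrite -E in h2; have {}h2 := h2 hU.
  by apply: (@filterS2 _ (nbhs a)) (cf a U hU) h2 => s h1 h2; rewrite inE; case: ifP.
Qed.

Lemma path_exists (T : topologicalType) (p q : T) : @simply_connected R T ->
  exists g : R -> T, [/\ continuous g, g 0 = p, g 1 = q & forall t, g (clamp t) = g t].
Proof.
move=> [+ _] => /(_ p q)[g [cg g0 g1]]; exists (g \o clamp); split.
- apply: within_comp_continuous cg (@clamp_continuous R) _ => t.
  by rewrite /= in_itv /= clampP.
- by rewrite /= clamp_id ?lexx ?ler01.
- by rewrite /= clamp_id ?lexx ?ler01.
- by move=> t /=; rewrite clampK.
Qed.

Lemma loop_homotopy (T : topologicalType) (g : R -> T) : @simply_connected R T ->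
  continuous g -> g 0 = g 1 -> (forall t, g (clamp t) = g t) ->
  exists H : R * R -> T, [/\ continuous H, forall t, H (0, t) = g t,
     forall t, H (1, t) = g 0 & forall s, H (s, 0) = g 0 /\ H (s, 1) = g 0].
Proof.
move=> [_ +] cg g01 gc => /(_ g (continuous_subspaceT cg) g01)[H [cH H0 H1 H01]].
have i0 : 0 \in `[0, 1 : R] by rewrite in_itv /= lexx ler01.
have i1 : 1 \in `[0, 1 : R] by rewrite in_itv /= lexx ler01.
have ic (t : R) : clamp t \in `[0, 1 : R] by rewrite in_itv /= clampP.
have c0 : clamp 0 = 0 :> R by rewrite clamp_id ?lexx ?ler01.
have c1 : clamp 1 = 1 :> R by rewrite clamp_id ?lexx ?ler01.
exists (H \o (fun z => (clamp z.1, clamp z.2))); split=> [|t|t|s] /=.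
- apply: within_comp_continuous cH _ _ => [z|z]; last by split; exact: ic.
  apply: (@pair_continuous _ _ _ (fun z : R * R => clamp z.1) (fun z : R * R => clamp z.2)).
    by apply: (@continuous_comp _ _ _ fst clamp); [exact: cvg_fst|exact: clamp_continuous].
  by apply: (@continuous_comp _ _ _ snd clamp); [exact: cvg_snd|exact: clamp_continuous].
- by rewrite c0 H0.
- by rewrite c1 H1.
- by rewrite c0 c1; have [-> ->] := H01 _ (ic s).
Qed.

End Paths.

(** * Continuation of germs of solutions, for an abstract local notion [Sol], over a simply
    connected space *)

Section Continuation.
Context {R : realType} (T : topologicalType) (J : Type).
Variable Sol : (T -> J) -> T -> Prop.

Definition eq_at (s s' : T -> J) (p : T) : Prop := \forall q \near p, s q = s' q.

Lemma eq_at_refl s p : eq_at s s p.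
Proof. by near=> q. Unshelve. all: by end_near. Qed.

Lemma eq_at_sym s s' p : eq_at s s' p -> eq_at s' s p.
Proof. by apply: filterS => q ->. Qed.

Lemma eq_at_trans s s' s'' p : eq_at s s' p -> eq_at s' s'' p -> eq_at s s'' p.
Proof. by apply: filterS2 => q -> ->. Qed.

Lemma eq_at_near s s' p : eq_at s s' p -> \forall q \near p, eq_at s s' q.
Proof. by move=> h; exact: (near_join h). Qed.

Hypothesis Sol_open : forall s p, Sol s p -> \forall q \near p, Sol s q.
Hypothesis Sol_id : forall s s' p, Sol s p -> Sol s' p ->
  exists2 U, nbhs p U & forall q q', U q -> U q' -> eq_at s s' q -> eq_at s s' q'.

(** A solution for each time, with a locally constant germ along the path. The set [I] of times is
    free so that continuations can be restricted. *)
Definition continuation (I : set R) (s : R -> T -> J) (g : R -> T) : Prop :=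
  forall t, I t -> Sol (s t) (g t) /\ exists2 e : R, 0 < e &
    forall t', I t' -> `|t' - t| < e -> eq_at (s t') (s t) (g t').

(** An affine change of parameter reduces to the unit interval. The segment from [b1] to [b2] may
    run backwards or be a point. *)
Lemma continuation_unique (I : set R) s s' g (b1 b2 : R) :
  continuous g -> (forall t : R, 0 <= t <= 1 -> I (b1 + t * (b2 - b1))) ->
  continuation I s g -> continuation I s' g ->
  eq_at (s b1) (s' b1) (g b1) -> eq_at (s b2) (s' b2) (g b2).
Proof.
move=> cg hI hs hs' e1; pose f (t : R) := b1 + t * (b2 - b1).
pose P (t : R) := eq_at (s (f t)) (s' (f t)) (g (f t)).
have f1 : f 1 = b2 by rewrite /f mul1r addrC subrK.
suff : P 1 by rewrite /P f1.
apply: (@itv_induction R P); [by rewrite /P /f mul0r addr0| |by rewrite ler01 lexx].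
move=> t /hI It; have [S1 [d1 d10 h1]] := hs _ It.
have [S2 [d2 d20 h2]] := hs' _ It.
have [U nU hU] := Sol_id S1 S2.
have [d3 d30 h3] := path_near (cg (f t)) nU.
pose d := Num.min d1 (Num.min d2 d3).
have d0 : 0 < d by rewrite !lt_min d10 d20.
have c0 : 0 < `|b2 - b1| + 1 by rewrite ltr_wpDl.
exists (d / (`|b2 - b1| + 1)); first by rewrite divr_gt0.
have close (t' : R) : `|t' - t| < d / (`|b2 - b1| + 1) -> `|f t' - f t| < d.
  move=> ht; have -> : f t' - f t = (t' - t) * (b2 - b1) by rewrite /f; ring.
  rewrite normrM; apply: le_lt_trans (_ : `|t' - t| * (`|b2 - b1| + 1) < d).
    by rewrite ler_wpM2l // lerDl.
  by rewrite -ltr_pdivlMr.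
have dd (x : R) : x < d -> [/\ x < d1, x < d2 & x < d3].
  by rewrite !lt_min => /andP[-> /andP[-> ->]].
move=> t1 t2 /hI I1 /hI I2 /close/dd[a1 a2 a3] /close/dd[b1' b2' b3] P1.
have E : eq_at (s (f t)) (s' (f t)) (g (f t1)).
  apply: eq_at_trans (eq_at_sym (h1 _ I1 a1)) _.
  exact: eq_at_trans P1 (h2 _ I1 a2).
apply: eq_at_trans (h1 _ I2 b1') (eq_at_trans _ (eq_at_sym (h2 _ I2 b2'))).
by apply: hU E; exact: h3.
Qed.

Let I01 := [set t : R | 0 <= t <= 1].

Lemma segment01 (b1 b2 t : R) : I01 b1 -> I01 b2 -> 0 <= t <= 1 -> I01 (b1 + t * (b2 - b1)).
Proof.
rewrite /I01 /= => /andP[h1 h2] /andP[h3 h4] /andP[h5 h6]; apply/andP; split; nra.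
Qed.

(* Analytic continuation along a family of paths depends continuously on the
   parameter. *)
Lemma continuation_parameter (A : topologicalType) (a0 : A) (h : A -> R -> T)
    (s : A -> R -> T -> J) :
  (forall (b : R) U, I01 b -> nbhs (h a0 b) U -> exists2 e : R, 0 < e &
     \forall a \near a0, forall b' : R, I01 b' -> `|b' - b| < e -> U (h a b')) ->
  (forall a, continuous (h a)) ->
  (forall a, continuation I01 (s a) (h a)) ->
  (\forall a \near a0, eq_at (s a 0) (s a0 0) (h a 0)) ->
  forall b : R, I01 b -> \forall a \near a0, eq_at (s a b) (s a0 b) (h a b).
Proof.
move=> ch cha cs init b Ib.
pose P (b : R) := \forall a \near a0, eq_at (s a b) (s a0 b) (h a b).
suff H : forall b : R, 0 <= b <= 1 -> P b by exact: H.
apply: itv_induction => // t It.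
have [S1 [d1 d10 h1]] := cs a0 _ It.
have [d2 d20 h2] := ch _ _ It (Sol_open S1).
pose d := Num.min d1 d2; have d0 : 0 < d by rewrite lt_min d10.
exists d => // t1 t2 I1 I2; rewrite !lt_min => /andP[a1 a2] /andP[b1 b2] P1.
have near_eq (t' : R) : I01 t' -> eq_at (s a0 t') (s a0 t) (h a0 t') ->
    \forall a \near a0, eq_at (s a0 t') (s a0 t) (h a t').
  move=> It' /eq_at_near E; have [e e0] := ch _ _ It' E.
  by apply: filterS => a; apply => //; rewrite subrr normr0.
have N1 := near_eq _ I1 (h1 _ I1 a1); have N2 := near_eq _ I2 (h1 _ I2 b1).
near=> a.
have E1 : eq_at (s a t1) (s a0 t1) (h a t1) by near: a.
have E2 : eq_at (s a0 t1) (s a0 t) (h a t1) by near: a.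
have E3 : eq_at (s a0 t2) (s a0 t) (h a t2) by near: a.
have SU : forall b' : R, I01 b' -> `|b' - t| < d2 -> Sol (s a0 t) (h a b') by near: a.
apply: eq_at_trans (eq_at_sym E3).
pose I := [set b' : R | I01 b' /\ `|b' - t| < d2].
(* Near [t] both [s a] and the single solution [s a0 t] are continuations along [h a]; uniqueness
   transports their agreement from [t1] to [t2]. *)
apply: (@continuation_unique I (s a) (fun=> s a0 t) (h a) t1 t2) => //.
- move=> u u01; split; first exact: segment01.
  case/andP: u01 => u0 u1; move: a2 b2 => /ltr_normlP[x1 x2] /ltr_normlP[x3 x4].
  have -> : t1 + u * (t2 - t1) - t = (1 - u) * (t1 - t) + u * (t2 - t) by ring.
  have u01 : 0 <= u <= 1 by rewrite u0.
  apply/ltr_normlP; split; last exact: convex_lt.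
  by have := convex_lt x1 x3 u01; apply: le_lt_trans; lra.
- move=> u [Iu _]; have [Su [e e0 he]] := cs a _ Iu.
  by split=> //; exists e => // u' [Iu' _]; exact: he.
- move=> u [Iu du]; split; first exact: SU.
  by exists 1 => // u' _ _; exact: eq_at_refl.
- exact: eq_at_trans E1 E2.
Unshelve. all: by end_near. Qed.

Hypothesis Sol_eq : forall s s' p, eq_at s s' p -> Sol s p -> Sol s' p.
Hypothesis Sol_ext : forall p, exists U : set T, [/\ nbhs p U,
  forall q, U q -> exists d : R -> T, [/\ continuous d, d 0 = p, d 1 = q,
     forall t, d (clamp t) = d t & forall t, U (d t)] &
  forall q s, U q -> Sol s q -> exists2 s', (forall q', U q' -> Sol s' q') & eq_at s' s q].

(** Induction on the interval: beyond [t1] the last germ is replaced by its extension over the whole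
    neighbourhood given by [Sol_ext]. *)
Lemma continuation_exists (g : R -> T) s0 : continuous g -> Sol s0 (g 0) ->
  exists2 s, s 0 = s0 & continuation I01 s g.
Proof.
move=> cg S0; pose P (t : R) := exists2 s, s 0 = s0 &
   continuation [set u : R | 0 <= u <= t] s g.
suff : P 1 by [].
apply: (@itv_induction R P); last by rewrite ler01 lexx.
  exists (fun=> s0) => // t /= /andP[t0 t1].
  have -> : t = 0 by apply/eqP; rewrite eq_le t1.
  by split=> //; exists 1 => // t' _ _; exact: eq_at_refl.
move=> t It; have [U [nU _ hU]] := Sol_ext (g t).
have [d d0 hd] := path_near (cg t) nU; exists d => // t1 t2 I1 I2 d1 d2 [s s_0 cs].
have [t21|t12] := leP t2 t1.
  exists s => // u /= /andP[u0 u1]; have [|Su [e e0 he]] := cs u.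
    by rewrite /= u0 (le_trans u1).
  split=> //; exists e => // u' /= /andP[u0' u1']; apply: he.
  by rewrite /= u0' (le_trans u1').
case/andP: I1 => t10 t11.
have [St1 [e1 e10 he1]] : Sol (s t1) (g t1) /\ exists2 e : R, 0 < e &
    forall t', 0 <= t' <= t1 -> `|t' - t1| < e -> eq_at (s t') (s t1) (g t').
  by apply: cs; rewrite /= t10 lexx.
have [sg Ssg Esg] := hU _ _ (hd _ d1) St1.
have inU (u : R) : t1 <= u <= t2 -> U (g u).
  move=> /andP[u1 u2]; apply: hd; move: d1 d2 => /ltr_normlP[x1 x2] /ltr_normlP[x3 x4].
  by apply/ltr_normlP; split; lra.
exists (fun u => if u <= t1 then s u else sg); first by rewrite t10.
move=> u /= /andP[u0 u2]; have [ut|tu|->] := ltgtP u t1.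
- have [|Su [e e0 he]] := cs u; first by rewrite /= u0 ltW.
  split=> //; exists (Num.min e (t1 - u)); first by rewrite lt_min e0 subr_gt0.
  move=> u' /andP[u0' u2']; rewrite lt_min => /andP[h1 h2].
  have u1' : u' <= t1 by move: h2 => /ltr_normlP[]; lra.
  by rewrite u1'; apply: he => //=; rewrite u0'.
- split; first by apply: Ssg; apply: inU; rewrite (ltW tu).
  exists (u - t1); first by rewrite subr_gt0.
  move=> u' /andP[u0' u2'] /ltr_normlP[h1 h2].
  have -> : (u' <= t1) = false by apply/negbTE; rewrite -ltNge; lra.
  exact: eq_at_refl.
- split=> //; have [e2 e20 he2] := path_near (cg t1) (eq_at_near Esg).
  exists (Num.min e1 e2); first by rewrite lt_min e10.
  move=> u' /andP[u0' u2']; rewrite lt_min => /andP[h1 h2].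
  by case: leP => ut; [apply: he1 => //; rewrite u0'|exact: he2].
Qed.

Hypothesis sc : @simply_connected R T.

(** Homotopy invariance: the germ at the end of the loop [h a] is locally constant in the parameter
    [a], and for [a = 1] the loop is a point. *)
Lemma loop_continuation (g : R -> T) s : continuous g -> g 0 = g 1 ->
  (forall t, g (clamp t) = g t) -> continuation I01 s g ->
  eq_at (s 1) (s 0) (g 0).
Proof.
move=> cg g01 gc cs; have [H [cH H0 H1 H01]] := loop_homotopy sc cg g01 gc.
have I0 : I01 0 by rewrite /I01 /= lexx ler01.
have I1 : I01 1 by rewrite /I01 /= lexx ler01.
have [S0 _] := cs 0 I0.
pose h (a b : R) := H (a, b).
have ch a : continuous (h a).
  move=> b; apply: (@continuous_comp _ _ _ (fun b => (a, b)) H); last exact: cH.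
  by apply: (@pair_continuous _ _ _ (fun=> a) id); [exact: cst_continuous|exact: cvg_id].
have exs a : exists2 sa, sa 0 = s 0 & continuation I01 sa (h a).
  by apply: continuation_exists => //; rewrite /h (H01 a).1.
have exs' a : exists sa, sa 0 = s 0 /\ continuation I01 sa (h a).
  by have [sa ? ?] := exs a; exists sa.
have [S hS] := choice exs'.
have hI (b1 b2 : R) : I01 b1 -> I01 b2 -> forall t : R, 0 <= t <= 1 -> I01 (b1 + t * (b2 - b1)).
  by move=> ? ? t; exact: segment01.
have E0 : eq_at (s 1) (S 0 1) (g 0).
  have hg : h 0 = g by apply/funext => t; rewrite /h H0.
  have [s00 c0] := hS 0; rewrite g01; rewrite hg in c0.
  apply: (continuation_unique cg (hI 0 1 I0 I1) cs c0).
  by rewrite s00; exact: eq_at_refl.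
have E1 : eq_at (S 1 1) (s 0) (g 0).
  have hg : h 1 = (fun=> g 0) by apply/funext => t; rewrite /h H1.
  have [s10 c1] := hS 1; rewrite hg in c1.
  apply: (@continuation_unique I01 (S 1) (fun=> s 0) (fun=> g 0) 0 1) => //.
  - by move=> t; exact: cst_continuous.
  - exact: hI.
  - move=> t It; split=> //; exists 1 => // t' _ _; exact: eq_at_refl.
  - by rewrite s10; exact: eq_at_refl.
have Em : forall a : R, 0 <= a <= 1 -> eq_at (S a 1) (S 0 1) (g 0).
  apply: itv_induction; first exact: eq_at_refl.
  move=> a0 _.
  have : \forall a \near a0, eq_at (S a 1) (S a0 1) (h a 1).
    apply: continuation_parameter => //.
    - move=> b U Ib nU; have [[X Y] /= [nX nY] XY] := cH (a0, b) U nU.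
      move: nY => /nbhs_ballP[e e0 he]; exists e => //.
      apply: filterS nX => a Xa b' Ib' bb; apply: (XY (a, b')); split=> //=.
      by apply: he; rewrite ballE distrC.
    - by move=> a; case: (hS a).
    - near=> a; rewrite (hS a).1 (hS a0).1; exact: eq_at_refl.
  move=> /nbhs_ballP[e e0 he]; exists e => // a1 a2 _ _ d1 d2 E.
  have F a : `|a - a0| < e -> eq_at (S a 1) (S a0 1) (g 0).
    move=> da; have := he a; rewrite ballE distrC /h (H01 a).2; exact.
  exact: eq_at_trans (F _ d2) (eq_at_trans (eq_at_sym (F _ d1)) E).
apply: eq_at_trans E0 (eq_at_trans (eq_at_sym (Em 1 _)) E1).
by rewrite ler01 lexx.
Unshelve. all: by end_near. Qed.

(** The value at [p] is read off at the end of a continuation along a chosen path to [p]. That it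
    agrees near [p] with one solution [sg] is the triviality of continuation around a triangle. *)
Theorem global_section p0 s0 : Sol s0 p0 ->
  exists2 S, (forall p, Sol S p) & eq_at S s0 p0.
Proof.
move=> S0.
have I0 : I01 0 by rewrite /I01 /= lexx ler01.
have I1 : I01 1 by rewrite /I01 /= lexx ler01.
have ex p : exists gs : (R -> T) * (R -> T -> J),
   [/\ continuous gs.1, gs.1 0 = p0, gs.1 1 = p, forall t, gs.1 (clamp t) = gs.1 t &
       gs.2 0 = s0 /\ continuation I01 gs.2 gs.1].
  have [g [cg g0 g1 gc]] := path_exists p0 p sc.
  have [|s s_0 cs] := @continuation_exists g s0 cg; first by rewrite g0.
  by exists (g, s).
have [GS hGS] := choice ex.
pose S p := (GS p).2 1 p.
have sat (t : R) : t <= 0 -> clamp t = 0 by move=> t0; rewrite /clamp (min_idPl _) ?(max_idPl _) // (le_trans t0).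
have main p : exists sg, [/\ Sol sg p, eq_at S sg p & eq_at sg ((GS p).2 1) p].
  have [U [nU Upath Uext]] := Sol_ext p.
  have [cg g0 g1 gc [s_0 cs]] := hGS p.
  have [Sp _] : Sol ((GS p).2 1) ((GS p).1 1) /\ _ := cs 1 I1.
  rewrite g1 in Sp; have [sg Ssg Esg] := Uext p _ (nbhs_singleton nU) Sp.
  exists sg; split=> //; first exact: Ssg (nbhs_singleton nU).
  have Up := nbhs_singleton nU.
  apply: filterS nU => q Uq; have [d [cd d0 d1 dc dU]] := Upath q Uq.
  have [cg' g0' g1' gc' [s_0' cs']] := hGS q.
  (* The triangle: the chosen path to [p], a path inside [U] from [p] to [q], and the chosen path to
     [q] backwards, each on a third of the interval. On each third the continuation along [L] is
     compared with the one already known there. *)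
  pose L (t : R) := if t <= 2 / 3 then (if t <= 1 / 3 then (GS p).1 (3 * t) else d (3 * t - 1))
      else (GS q).1 (3 - 3 * t).
  have cM (a : R) : continuous (fun t : R => 3 * t + a).
    move=> t; apply: continuousD; last exact: cst_continuous.
    by apply: continuousM; [exact: cst_continuous|exact: cvg_id].
  have cM' : continuous (fun t : R => 3 - 3 * t).
    move=> t; apply: (@continuousB _ R _ (fun=> 3) (fun t : R => 3 * t)); first exact: cst_continuous.
    by apply: continuousM; [exact: cst_continuous|exact: cvg_id].
  have one3 : (3 * (1 / 3) = 1 :> R) by field.
  have two31 : (3 * (2 / 3) - 1 = 1 :> R) by field.
  have two32 : (3 - 3 * (2 / 3) = 1 :> R) by field.
  have cL : continuous L.
    apply: continuous_glue.
    - apply: continuous_glue.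
      + move=> t; apply: (@continuous_comp _ _ _ (fun t : R => 3 * t) (GS p).1); last exact: cg.
        by have := cM 0 t; rewrite (_ : (fun _ => _) = (fun t => 3 * t)) //; apply/funext => x; rewrite addr0.
      + move=> t; apply: (@continuous_comp _ _ _ (fun t : R => 3 * t - 1) d); [exact: cM|exact: cd].
      + by rewrite one3 subrr g1 d0.
    - move=> t; apply: (@continuous_comp _ _ _ (fun t : R => 3 - 3 * t) (GS q).1); [exact: cM'|exact: cg'].
    - have -> : (2 / 3 <= 1 / 3 :> R) = false by apply/negbTE; rewrite -ltNge; lra.
      by rewrite two31 two32 d1 g1'.
  have L0 : L 0 = p0.
    rewrite /L; have -> : (0 <= 2 / 3 :> R) by lra.
    have -> : (0 <= 1 / 3 :> R) by lra.
    by rewrite mulr0 g0.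
  have L1 : L 1 = p0.
    rewrite /L; have -> : (1 <= 2 / 3 :> R) = false by apply/negbTE; rewrite -ltNge; lra.
    by rewrite mulr1 subrr g0'.
  have Lc t : L (clamp t) = L t.
    have [t0|t0] := leP t 0.
      rewrite sat // L0 /L; have -> : t <= 2 / 3 by lra.
      have -> : t <= 1 / 3 by lra.
      by rewrite -gc sat ?g0 //; lra.
    have [t1|t1] := leP t 1; first by rewrite clamp_id // t1 ltW.
    have -> : clamp t = 1 by rewrite /clamp (min_idPr (ltW t1)) (max_idPr ler01).
    rewrite L1 /L; have -> : (t <= 2 / 3) = false by apply/negbTE; rewrite -ltNge; lra.
    by rewrite -gc' sat ?g0' //; lra.
  have [|s s__0 csL] := @continuation_exists L s0 cL; first by rewrite L0.
  have L01 : L 0 = L 1 by rewrite L0 L1.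
  have loop := loop_continuation cL L01 Lc csL.
  have L13 : L (1 / 3) = p.
    rewrite /L; have -> : (1 / 3 <= 2 / 3 :> R) by lra.
    by rewrite lexx one3 g1.
  have L23 : L (2 / 3) = q.
    rewrite /L lexx; have -> : (2 / 3 <= 1 / 3 :> R) = false by apply/negbTE; rewrite -ltNge; lra.
    by rewrite two31 d1.
  have E1 : eq_at (s (1 / 3)) ((GS p).2 1) p.
    have := @continuation_unique [set t : R | 0 <= t <= 1 / 3] s (fun t => (GS p).2 (3 * t)) L 0 (1 / 3) cL.
    rewrite one3 mulr0 L13 L0; apply.
    - by move=> t /= /andP[t0 t1]; apply/andP; split; lra.
    - move=> t /andP[t0 t1]; have [|St [e e0 he]] := csL t; first by rewrite /I01 /= t0; lra.
      split=> //; exists e => // t' /andP[t0' t1'] ht; apply: he => //; rewrite /I01 /= t0'; lra.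
    - move=> t /andP[t0 t1]; have LE (u : R) : u <= 1 / 3 -> L u = (GS p).1 (3 * u).
        by move=> u1; rewrite /L u1; have -> : u <= 2 / 3 by lra.
      have [|St [e e0 he]] := cs (3 * t); first by rewrite /I01 /=; apply/andP; split; lra.
      split; first by rewrite LE.
      exists (e / 3); first by rewrite divr_gt0.
      move=> t' /andP[t0' t1'] ht; rewrite LE //; apply: he; first by rewrite /I01 /=; apply/andP; split; lra.
      by rewrite -mulrBr normrM ger0_norm // mulrC -ltr_pdivlMr.
    - by rewrite s__0 s_0; exact: eq_at_refl.
  have E2 : eq_at (s (2 / 3)) sg q.
    have := @continuation_unique [set t : R | 1 / 3 <= t <= 2 / 3] s (fun=> sg) L (1 / 3) (2 / 3) cL.
    rewrite L13 L23; apply.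
    - by move=> t /= /andP[t0 t1]; apply/andP; split; lra.
    - move=> t /andP[t0 t1]; have [|St [e e0 he]] := csL t; first by rewrite /I01 /=; apply/andP; split; lra.
      split=> //; exists e => // t' /andP[t0' t1'] ht; apply: he => //; rewrite /I01 /=; apply/andP; split; lra.
    - move=> t /andP[t0 t1]; split; last by exists 1 => // t' _ _; exact: eq_at_refl.
      apply: Ssg; rewrite /L t1; case: leP => t13; last exact: dU.
      have -> : t = 1 / 3 by apply/eqP; rewrite eq_le t13 t0.
      by rewrite one3 g1.
    - exact: eq_at_trans E1 (eq_at_sym Esg).
  have E3 : eq_at (s (2 / 3)) ((GS q).2 1) q.
    have := @continuation_unique [set t : R | 2 / 3 <= t <= 1] s (fun t => (GS q).2 (3 - 3 * t)) L 1 (2 / 3) cL.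
    rewrite two32 mulr1 subrr L23 L1; apply.
    - by move=> t /= /andP[t0 t1]; apply/andP; split; lra.
    - move=> t /andP[t0 t1]; have [|St [e e0 he]] := csL t; first by rewrite /I01 /= t1 andbT; lra.
      split=> //; exists e => // t' /andP[t0' t1'] ht; apply: he => //; rewrite /I01 /= t1' andbT; lra.
    - move=> t /andP[t0 t1]; have LE (u : R) : 2 / 3 <= u -> L u = (GS q).1 (3 - 3 * u).
        rewrite le_eqVlt => /orP[/eqP <-|u1]; first by rewrite L23 two32 g1'.
        by rewrite /L; have -> : (u <= 2 / 3) = false by apply/negbTE; rewrite -ltNge; lra.
      have [|St [e e0 he]] := cs' (3 - 3 * t); first by rewrite /I01 /=; apply/andP; split; lra.
      split; first by rewrite LE.
      exists (e / 3); first by rewrite divr_gt0.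
      move=> t' /andP[t0' t1'] ht; rewrite LE //; apply: he; first by rewrite /I01 /=; apply/andP; split; lra.
      have -> : 3 - 3 * t' - (3 - 3 * t) = 3 * (t - t') by ring.
      by rewrite normrM ger0_norm // mulrC -ltr_pdivlMr // distrC.
    - by rewrite -L0 s_0'; move: loop; rewrite s__0.
  have E4 : eq_at ((GS q).2 1) sg q by exact: eq_at_trans (eq_at_sym E3) E2.
  exact: nbhs_singleton E4.
exists S => [p|].
  by have [sg [Sg E _]] := main p; exact: Sol_eq (eq_at_sym E) Sg.
have [cg g0 g1 gc [s_0 cs]] := hGS p0.
have g01 : (GS p0).1 0 = (GS p0).1 1 by rewrite g0 g1.
have := loop_continuation cg g01 gc cs; rewrite g0 s_0 => h.
have [sg [_ E1 E2]] := main p0.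
exact: eq_at_trans E1 (eq_at_trans E2 h).
Qed.

End Continuation.

(** * Flatness of the Hessian connection *)

Opaque partial.

(** * Algebraic curvature tensors *)

Section CurvatureAlgebra.
Context {R : realType} {m : nat}.

Definition mult4 (W : 'I_m -> 'I_m -> 'I_m -> 'I_m -> R) (u v w z : 'rV[R]_m) : R :=
  \sum_i \sum_j \sum_k \sum_l u 0 i * v 0 j * w 0 k * z 0 l * W i j k l.

Lemma mult4E W a b c d :
  mult4 W (delta_mx 0 a) (delta_mx 0 b) (delta_mx 0 c) (delta_mx 0 d) = W a b c d.
Proof.
have pick (F : 'I_m -> R) (x : 'I_m) : (forall i, i != x -> F i = 0) -> \sum_i F i = F x.
  by move=> h; rewrite (bigD1 x) //= big1 ?addr0.
have e0 x i : i != x -> (delta_mx 0 x : 'rV[R]_m) 0 i = 0.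
  by move=> ix; rewrite mxE (negbTE ix) andbF.
rewrite /mult4 (pick _ a) => [|i ia]; last first.
  by apply: big1 => j _; apply: big1 => k _; apply: big1 => l _; rewrite (e0 a) // !mul0r.
rewrite (pick _ b) => [|i ia]; last first.
  by apply: big1 => k _; apply: big1 => l _; rewrite (e0 b) // mulr0 !mul0r.
rewrite (pick _ c) => [|i ia]; last first.
  by apply: big1 => l _; rewrite (e0 c) // mulr0 !mul0r.
rewrite (pick _ d) => [|i ia]; last by rewrite (e0 d) // mulr0 !mul0r.
by rewrite !mxE !eqxx !mul1r.
Qed.

Lemma mult4D1 W u u' v w z : mult4 W (u + u') v w z = mult4 W u v w z + mult4 W u' v w z.
Proof.
rewrite /mult4 -big_split; apply: eq_bigr => i _; rewrite -big_split; apply: eq_bigr => j _.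
rewrite -big_split; apply: eq_bigr => k _; rewrite -big_split; apply: eq_bigr => l _ /=.
by rewrite mxE; ring.
Qed.
Lemma mult4D2 W u v' v w z : mult4 W u (v + v') w z = mult4 W u v w z + mult4 W u v' w z.
Proof.
rewrite /mult4 -big_split; apply: eq_bigr => i _; rewrite -big_split; apply: eq_bigr => j _.
rewrite -big_split; apply: eq_bigr => k _; rewrite -big_split; apply: eq_bigr => l _ /=.
by rewrite mxE; ring.
Qed.
Lemma mult4D3 W u v w' w z : mult4 W u v (w + w') z = mult4 W u v w z + mult4 W u v w' z.
Proof.
rewrite /mult4 -big_split; apply: eq_bigr => i _; rewrite -big_split; apply: eq_bigr => j _.
rewrite -big_split; apply: eq_bigr => k _; rewrite -big_split; apply: eq_bigr => l _ /=.
by rewrite mxE; ring.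
Qed.
Lemma mult4D4 W u v w z' z : mult4 W u v w (z + z') = mult4 W u v w z + mult4 W u v w z'.
Proof.
rewrite /mult4 -big_split; apply: eq_bigr => i _; rewrite -big_split; apply: eq_bigr => j _.
rewrite -big_split; apply: eq_bigr => k _; rewrite -big_split; apply: eq_bigr => l _ /=.
by rewrite mxE; ring.
Qed.

Lemma mult4Z1 W (c : R) u v w z : mult4 W (c *: u) v w z = c * mult4 W u v w z.
Proof.
rewrite /mult4 mulr_sumr; apply: eq_bigr => i _; rewrite mulr_sumr; apply: eq_bigr => j _.
rewrite mulr_sumr; apply: eq_bigr => k _; rewrite mulr_sumr; apply: eq_bigr => l _.
by rewrite mxE; ring.
Qed.

Lemma mult4_swap12 W u v w z : (forall i j k l, W i j k l = - W j i k l) ->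
  mult4 W u v w z = - mult4 W v u w z.
Proof.
move=> h; rewrite /mult4 exchange_big /= -sumrN; apply: eq_bigr => j _; rewrite -sumrN.
apply: eq_bigr => i _; rewrite -sumrN; apply: eq_bigr => k _; rewrite -sumrN; apply: eq_bigr => l _.
by rewrite h; ring.
Qed.

Variable W : 'I_m -> 'I_m -> 'I_m -> 'I_m -> R.
Hypothesis W12 : forall i j k l, W i j k l = - W j i k l.
Hypothesis W34 : forall i j k l, W i j k l = - W i j l k.
Hypothesis Wb : forall i j k l, W i j k l + W j k i l + W k i j l = 0.

(** A combination of the four cyclic identities, one for each index kept in the last place. *)
Lemma pair_symmetry i j k l : W i j k l = W k l i j.
Proof.
have b1 := Wb i j k l; have b2 := Wb j k l i; have b3 := Wb k l i j; have b4 := Wb l i j k.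
have a1 := W34 i j k l; have a2 := W34 j k i l; have a3 := W34 k i j l.
have a4 := W34 k l i j; have a5 := W34 l j k i; have a6 := W34 l i k j.
have c1 := W12 k i j l; have c2 := W12 l j k i; have c3 := W12 i k l j.
have c4 := W12 j l i k; have c5 := W34 j l i k; have c6 := W12 l i j k.
have c7 := W34 k i l j; have c8 := W34 l j i k; have c9 := W12 i k j l.
have d1 := W34 i k j l.
lra.
Qed.

Hypothesis Wq : forall u v, mult4 W u v v u = 0.

(** Polarizing the quadratic condition and using the pair symmetry makes [W] antisymmetric in its
    two middle indices. It is then antisymmetric in all, and the cyclic identity reads [3 W = 0]. *)
Lemma curvature_like_zero i j k l : W i j k l = 0.
Proof.
have h a b c d : W a b c d + W a c b d + W d b c a + W d c b a = 0.
  pose e x : 'rV[R]_m := delta_mx 0 x.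
  have q x y := Wq x y.
  (* The polarization: both arguments are replaced by sums and all unmixed terms are subtracted. *)
  have E : mult4 W (e a + e d) (e b + e c) (e b + e c) (e a + e d)
     - mult4 W (e a + e d) (e b) (e b) (e a + e d) - mult4 W (e a + e d) (e c) (e c) (e a + e d)
     - (mult4 W (e a) (e b + e c) (e b + e c) (e a) - mult4 W (e a) (e b) (e b) (e a) - mult4 W (e a) (e c) (e c) (e a))
     - (mult4 W (e d) (e b + e c) (e b + e c) (e d) - mult4 W (e d) (e b) (e b) (e d) - mult4 W (e d) (e c) (e c) (e d)) = 0.
    by rewrite !q !subr0.
  rewrite -[RHS]E !(mult4D1, mult4D2, mult4D3, mult4D4) !mult4E; ring.
have s a b c d : W a b c d = - W a c b d.
  have := h a b c d; have := pair_symmetry d b c a; have := pair_symmetry d c b a.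
  have := W12 c a d b; have := W34 a c d b; have := W12 b a d c; have := W34 a b d c.
  by lra.
have := Wb i j k l; have := s i j k l; have := s j k i l; have := W12 j i k l; have := W12 k i j l.
have := s i k j l; lra.
Qed.

End CurvatureAlgebra.

(** * Levi-Civita connection and curvature of a metric given on an open set of R^m *)

Section CoordinateMetric.
Context {R : realType} {m : nat}.
Variables (D : set 'rV[R]_m) (g : 'rV[R]_m -> 'M[R]_m).
Hypothesis oD : open D.
Hypothesis g_smooth : smooth_on D g.
Hypothesis g_sym : forall y, D y -> (g y)^T = g y.
Hypothesis g_pos : forall y, D y -> forall v : 'rV[R]_m, v != 0 -> 0 < (v *m g y *m v^T) 0 0.

Definition dmet k a b (y : 'rV[R]_m) : R := partial k (fun z => g z a b) y.

Definition chr (i j k : 'I_m) (y : 'rV[R]_m) : R :=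
  2^-1 * \sum_l invmx (g y) k l * (dmet i j l y + dmet j i l y - dmet l i j y).

Definition curv (i j k l : 'I_m) (y : 'rV[R]_m) : R :=
  partial i (chr j k l) y - partial j (chr i k l) y
  + \sum_m (chr j k m y * chr i m l y - chr i k m y * chr j m l y).

(** Row [j] is the covariant derivative of the [j]-th coordinate field along the [i]-th. *)
Definition Gam i y : 'M[R]_m := \matrix_(j, k) chr i j k y.

Lemma g_unit y : D y -> g y \in unitmx.
Proof.
move=> Dy; rewrite -row_free_unit -kermx_eq0; apply/eqP/row_matrixP => i.
rewrite row0; apply/eqP/negPn/negP => v0; have := g_pos Dy v0.
suff -> : row i (kermx (g y)) *m g y = 0 by rewrite mul0mx mxE ltxx.
by rewrite -row_mul mulmx_ker row0.
Qed.

Lemma g_smooth_entry a b k : Ck_on k D (fun y => g y a b).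
Proof. exact: Ck_entry. Qed.

Lemma dmet_sym k a b y : D y -> dmet k a b y = dmet k b a y.
Proof.
move=> Dy; apply: partial_near; apply: (eq_near oD) Dy => z Dz.
by rewrite -[in LHS](g_sym Dz) mxE.
Qed.

Lemma dmet_Ck k a b l : Ck_on l D (dmet k a b).
Proof. exact: Ck_partial (g_smooth_entry a b l.+1). Qed.

Lemma chr_Ck i j k l : Ck_on l D (chr i j k).
Proof.
apply: CkM => //; first exact: Ck_cst.
apply: Ck_sum => // a _; apply: CkM => //.
  by apply: Ck_invmx => // [y|b c]; [exact: g_unit|exact: g_smooth_entry].
apply: CkB => //; last exact: dmet_Ck.
by apply: CkD => //; exact: dmet_Ck.
Qed.

Lemma chr_sym i j k y : D y -> chr i j k y = chr j i k y.
Proof.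
move=> Dy; congr (_ * _); apply: eq_bigr => l _; congr (_ * _).
by rewrite (dmet_sym l i j Dy) (addrC (dmet i j l y)).
Qed.

(** The Koszul formula for the symbols of the first kind: lowering the index removes the inverse
    metric. *)
Lemma Gam_low i j l y : D y ->
  (Gam i y *m g y) j l = 2^-1 * (dmet i j l y + dmet j i l y - dmet l i j y).
Proof.
move=> Dy; pose X : 'M[R]_m := \matrix_(a, b) (dmet i a b y + dmet a i b y - dmet b i a y).
have -> : Gam i y = 2^-1 *: (X *m invmx (g y)).
  apply/matrixP => a b; rewrite !mxE; congr (_ * _); apply: eq_bigr => c _.
  rewrite mulrC mxE; congr (_ * _).
  by rewrite -[in LHS](g_sym Dy) -trmx_inv mxE.
by rewrite -scalemxAl mulmxKV ?g_unit // !mxE.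
Qed.

Lemma metric_compat k i j y : D y ->
  dmet k i j y = (Gam k y *m g y) i j + (Gam k y *m g y) j i.
Proof.
move=> Dy; rewrite !Gam_low // (dmet_sym k j i Dy) (dmet_sym i k j Dy) (dmet_sym j k i Dy).
by rewrite (dmet_sym i j k Dy) (dmet_sym j i k Dy); field.
Qed.

Lemma dmetC i j a b y : D y -> partial i (dmet j a b) y = partial j (dmet i a b) y.
Proof. exact: partialC oD (g_smooth_entry a b 2). Qed.

Opaque dmet chr.

Let dGam i j y : 'M[R]_m := \matrix_(k, l) partial i (chr j k l) y.

Definition Riem i j y : 'M[R]_m := \matrix_(k, l) curv i j k l y.

Lemma RiemE i j y : Riem i j y =
  dGam i j y - dGam j i y + Gam j y *m Gam i y - Gam i y *m Gam j y.
Proof.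
apply/matrixP => k l; rewrite !mxE /curv sumrB addrA; congr (_ + _ - _).
  by apply: eq_bigr => a _; rewrite !mxE.
by apply: eq_bigr => a _; rewrite !mxE.
Qed.

Lemma is_derive_Gam i j y : D y -> is_derive y (delta_mx 0 j) (Gam i) (dGam j i y).
Proof.
move=> Dy; apply/is_derive_mxP => a b; rewrite mxE.
rewrite (_ : (fun _ => _) = chr i a b); last by apply/funext => z; rewrite mxE.
by apply: DeriveDef => //; exact: Ck_derivable (chr_Ck i a b 1) Dy.
Qed.

Lemma is_derive_g j y : D y -> is_derive y (delta_mx 0 j) g (\matrix_(a, b) dmet j a b y).
Proof.
move=> Dy; apply/is_derive_mxP => a b; rewrite mxE.
by apply: DeriveDef => //; exact: Ck_derivable (g_smooth_entry a b 1) Dy.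
Qed.

Let skew (A B G : 'M[R]_m) : G^T = G ->
  (A *m (B *m G)^T - B *m (A *m G)^T)^T = - (A *m (B *m G)^T - B *m (A *m G)^T).
Proof. by move=> GT; rewrite raddfB /= !trmx_mul !trmxK GT opprB !mulmxA. Qed.

Let commutator_expand (A1 A2 B1 B2 G : 'M[R]_m) : (A1 - A2 + B1 *m B2 - B2 *m B1) *m G =
  A1 *m G + B1 *m (B2 *m G + (B2 *m G)^T) - (A2 *m G + B2 *m (B1 *m G + (B1 *m G)^T))
  - (B1 *m (B2 *m G)^T - B2 *m (B1 *m G)^T).
Proof.
rewrite !mulmxDr !mulmxDl !mulNmx -!mulmxA.
move: (A1 *m G) (A2 *m G) (B1 *m (B2 *m G)) => a1 a2 a3.
move: (B2 *m (B1 *m G)) (B1 *m (B2 *m G)^T) (B2 *m (B1 *m G)^T) => a4 a5 a6.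
by apply/matrixP => a b; rewrite !mxE; ring.
Qed.

Let skew_solve (P Q Z : 'M[R]_m) : Z^T = - Z -> P + P^T = Q + Q^T ->
  (P - Q - Z)^T = - (P - Q - Z).
Proof.
move=> hZ hP; rewrite !raddfB /= hZ.
have -> : P^T = Q + Q^T - P by rewrite -hP addrAC subrr add0r.
by apply/matrixP => a b; rewrite !mxE; ring.
Qed.

(** Differentiating [metric_compat] writes the second derivatives of the metric as [P + P^T], which
    is symmetric in [i] and [j] by Schwarz. The lowered curvature is [P i j - P j i] minus the
    commutator [Z], which is visibly skew. *)
Lemma Riem_antisym i j y : D y -> (Riem i j y *m g y)^T = - (Riem i j y *m g y).
Proof.
move=> Dy.
pose P a b := dGam a b y *m g y + Gam b y *m (Gam a y *m g y + (Gam a y *m g y)^T).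
have PE a b k l : partial a (dmet b k l) y = P a b k l + P a b l k.
  have dme : \matrix_(k, l) dmet a k l y = Gam a y *m g y + (Gam a y *m g y)^T.
    by apply/matrixP => p q; rewrite mxE metric_compat // [RHS]mxE [X in _ = _ + X]mxE.
  have D1 : is_derive y (delta_mx 0 a) (fun z => Gam b z *m g z) (P a b).
    by rewrite /P -dme; exact: is_derive_mulmx (is_derive_Gam b a Dy) (is_derive_g a Dy).
  have -> : partial a (dmet b k l) y =
     partial a (fun z => (Gam b z *m g z) k l + (Gam b z *m g z) l k) y.
    by apply: partial_near; apply: (eq_near oD) Dy => z Dz; exact: metric_compat.
  have [d1 e1] := (is_derive_mxP _ _ _ _).1 D1 k l.
  have [d2 e2] := (is_derive_mxP _ _ _ _).1 D1 l k.
  by rewrite partialD //; congr (_ + _); [exact: e1|exact: e2].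
have PP : P i j + (P i j)^T = P j i + (P j i)^T.
  apply/matrixP => k l; rewrite [LHS]mxE [RHS]mxE [X in _ + X = _]mxE [X in _ = _ + X]mxE.
  exact: (etrans (esym (PE i j k l)) (etrans (dmetC i j k l Dy) (PE j i k l))).
clear PE; pose Z := Gam j y *m (Gam i y *m g y)^T - Gam i y *m (Gam j y *m g y)^T.
have ZT : Z^T = - Z.
  by rewrite /Z; exact: skew (g_sym Dy).
have RE : Riem i j y *m g y = P i j - P j i - Z.
  by rewrite RiemE; exact: commutator_expand.
by rewrite RE; exact: skew_solve ZT PP.
Qed.

Lemma dchr_sym a i j k y : D y -> partial a (chr i j k) y = partial a (chr j i k) y.
Proof. by move=> Dy; apply: partial_near; apply: (eq_near oD) Dy => z Dz; exact: chr_sym. Qed.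

Lemma Bianchi i j k l y : D y -> curv i j k l y + curv j k i l y + curv k i j l y = 0.
Proof.
move=> Dy; rewrite /curv (dchr_sym i k j _ Dy) (dchr_sym j i k _ Dy) (dchr_sym k j i _ Dy).
have -> : \sum_m0 (chr j k m0 y * chr i m0 l y - chr i k m0 y * chr j m0 l y) =
  \sum_m0 chr j k m0 y * chr i m0 l y - \sum_m0 chr i k m0 y * chr j m0 l y by rewrite sumrB.
have -> : \sum_m0 (chr k i m0 y * chr j m0 l y - chr j i m0 y * chr k m0 l y) =
  \sum_m0 chr i k m0 y * chr j m0 l y - \sum_m0 chr j i m0 y * chr k m0 l y.
  by rewrite -sumrB; apply: eq_bigr => a _; rewrite (chr_sym k i a Dy).
have -> : \sum_m0 (chr i j m0 y * chr k m0 l y - chr k j m0 y * chr i m0 l y) =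
  \sum_m0 chr j i m0 y * chr k m0 l y - \sum_m0 chr j k m0 y * chr i m0 l y.
  by rewrite -sumrB; apply: eq_bigr => a _; rewrite (chr_sym i j a Dy) (chr_sym k j a Dy).
have aux (p q r s1 s2 s3 : R) : p - q + (s1 - s2) + (q - r + (s2 - s3)) + (r - p + (s3 - s1)) = 0.
  by ring.
exact: aux.
Qed.

(** Strict Cauchy-Schwarz: [w] is [c] times the part of [u] orthogonal to [v], and its squared
    length is [c (a c - b^2)]. *)
Lemma gram_pos y (u v : 'rV[R]_m) : D y -> row_free (col_mx u v) ->
  (u *m g y *m u^T) 0 0 * (v *m g y *m v^T) 0 0 - (u *m g y *m v^T) 0 0 ^+ 2 != 0.
Proof.
move=> Dy fr; have v0 : v != 0.
  apply/eqP => v0; have : (row_mx (0 : 'M[R]_1) 1%:M *m col_mx u v == 0).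
    by rewrite mul_row_col v0 mul0mx mulmx0 addr0.
  rewrite mulmx_free_eq0 // => /eqP/matrixP/(_ 0 (rshift 1 0)).
  by rewrite row_mxEr !mxE eqxx => /eqP; rewrite oner_eq0.
set b := (u *m g y *m v^T) 0 0; set c := (v *m g y *m v^T) 0 0; set a := (u *m g y *m u^T) 0 0.
have c0 : 0 < c by exact: g_pos.
pose w := c *: u - b *: v.
have w0 : w != 0.
  apply/eqP => w0; have : (row_mx (c%:M : 'M[R]_1) (- b)%:M *m col_mx u v == 0).
    by rewrite mul_row_col !mul_scalar_mx scaleNr -/w w0.
  rewrite mulmx_free_eq0 // => /eqP/matrixP/(_ 0 (lshift 1 0)).
  by rewrite row_mxEl !mxE eqxx mulr1n => /eqP; rewrite (gt_eqF c0).
have b' : (v *m g y *m u^T) 0 0 = b.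
  rewrite /b -[in RHS](trmxK (u *m g y *m v^T)) [in RHS]mxE.
  by rewrite !trmx_mul trmxK g_sym // mulmxA.
have wT : w^T = c *: u^T - b *: v^T by apply/matrixP => i j; rewrite !mxE.
have := g_pos Dy w0; rewrite wT /w !(mulmxBl, mulmxBr) -!scalemxAl -!scalemxAr.
have ent (p q r t : 'M[R]_1) : (c *: (c *: p) - b *: (c *: q) - (c *: (b *: r) - b *: (b *: t))) 0 0
  = c * (c * p 0 0) - b * (c * q 0 0) - (c * (b * r 0 0) - b * (b * t 0 0)) by rewrite !mxE.
rewrite ent b' -/a -/b -/c => h.
have {}h : 0 < c * (a * c - b ^+ 2) by move: h; congr (0 < _); ring.
by apply/eqP => E; move: h; rewrite E mulr0 ltxx.
Qed.

Variable kappa : R.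
Hypothesis sect : forall (y u v : 'rV[R]_m), D y -> row_free (col_mx u v) ->
  ((\row_l \sum_i \sum_j \sum_k u 0 i * v 0 j * v 0 k * curv i j k l y) *m g y *m u^T) 0 0
   / ((u *m g y *m u^T) 0 0 * (v *m g y *m v^T) 0 0 - (u *m g y *m v^T) 0 0 ^+ 2) = kappa.

Let T y i j k l := (Riem i j y *m g y) k l.
(** The lowered curvature tensor of a space of curvature 1, in the sign convention of [curv]. *)
Let G2 y i j k l := g y j k * g y i l - g y i k * g y j l.

Lemma mult4_T y u v : mult4 (T y) u v v u =
  ((\row_l \sum_i \sum_j \sum_k u 0 i * v 0 j * v 0 k * curv i j k l y) *m g y *m u^T) 0 0.
Proof.
rewrite -mulmxA mxE; under eq_bigr => a _ do rewrite mxE mxE.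
have E1 : mult4 (T y) u v v u = \sum_i \sum_j \sum_k \sum_a
   u 0 i * v 0 j * v 0 k * curv i j k a y * (\sum_l g y a l * u 0 l).
  apply: eq_bigr => i _; apply: eq_bigr => j _; apply: eq_bigr => k _.
  transitivity (\sum_l \sum_a u 0 i * v 0 j * v 0 k * curv i j k a y * (g y a l * u 0 l)).
    apply: eq_bigr => l _; rewrite /T mxE mulr_sumr; apply: eq_bigr => a _.
    by rewrite mxE; ring.
  by rewrite exchange_big; apply: eq_bigr => a _; rewrite mulr_sumr.
rewrite E1.
transitivity (\sum_a \sum_i \sum_j \sum_k u 0 i * v 0 j * v 0 k * curv i j k a y * (\sum_l g y a l * u 0 l)).
  rewrite [RHS]exchange_big; apply: eq_bigr => i _; rewrite [RHS]exchange_big; apply: eq_bigr => j _.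
  by rewrite exchange_big.
apply: eq_bigr => a _; rewrite -[X in _ * X]/(\sum_l g y a l * (u^T) l 0).
have -> : \sum_l g y a l * u^T l 0 = \sum_l g y a l * u 0 l by apply: eq_bigr => l _; rewrite mxE.
rewrite mulr_suml; apply: eq_bigr => i _; rewrite mulr_suml; apply: eq_bigr => j _.
by rewrite mulr_suml.
Qed.

Lemma quad_form (M : 'M[R]_m) (u v : 'rV[R]_m) :
  (u *m M *m v^T) 0 0 = \sum_i \sum_j u 0 i * v 0 j * M i j.
Proof.
rewrite -mulmxA mxE; apply: eq_bigr => i _; rewrite mxE mulr_sumr; apply: eq_bigr => j _.
by rewrite mxE; ring.
Qed.

Lemma mult4_G2 y u v : mult4 (G2 y) u v v u =
  (u *m g y *m u^T) 0 0 * (v *m g y *m v^T) 0 0 - (u *m g y *m v^T) 0 0 * (v *m g y *m u^T) 0 0.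
Proof.
have E (M N : 'M[R]_m) (a b c d : 'rV[R]_m) : (a *m M *m b^T) 0 0 * (c *m N *m d^T) 0 0 =
   \sum_i \sum_j \sum_k \sum_l a 0 i * b 0 j * M i j * (c 0 k * d 0 l * N k l).
  rewrite !quad_form mulr_suml; apply: eq_bigr => i _; rewrite mulr_suml; apply: eq_bigr => j _.
  by rewrite mulr_sumr; apply: eq_bigr => k _; rewrite mulr_sumr.
rewrite !E /mult4 -sumrB.
apply: eq_bigr => i _.
transitivity (\sum_j \sum_k \sum_l (u 0 i * v 0 j * v 0 k * u 0 l * (g y j k * g y i l)) -
   \sum_j \sum_k \sum_l (u 0 i * v 0 j * v 0 k * u 0 l * (g y i k * g y j l))).
  rewrite -sumrB; apply: eq_bigr => j _; rewrite -sumrB; apply: eq_bigr => k _; rewrite -sumrB.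
  by apply: eq_bigr => l _; rewrite /G2 mulrBr.
congr (_ - _).
  rewrite [RHS](_ : _ = \sum_l \sum_j \sum_k (u 0 i * v 0 j * v 0 k * u 0 l * (g y j k * g y i l))); last first.
    by apply: eq_bigr => l _; apply: eq_bigr => j _; apply: eq_bigr => k _; ring.
  rewrite [RHS]exchange_big; apply: eq_bigr => j _; rewrite [RHS]exchange_big; apply: eq_bigr => k _.
  by [].
rewrite [LHS]exchange_big; apply: eq_bigr => k _; apply: eq_bigr => j _; apply: eq_bigr => l _; ring.
Qed.

Lemma row_free_dep (u v : 'rV[R]_m) : ~~ row_free (col_mx u v) ->
  exists2 ab : R * R, (ab.1 != 0) || (ab.2 != 0) & ab.1 *: u + ab.2 *: v = 0.
Proof.
rewrite -kermx_eq0 => /rowV0Pn[w /sub_kermxP wk w0].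
exists (w 0 (lshift 1 0), w 0 (rshift 1 0)) => /=.
  apply: contraNT w0; rewrite negb_or !negbK => /andP[/eqP h1 /eqP h2].
  by apply/eqP/rowP => i; rewrite mxE; case: (split_ordP i) => j ->; rewrite (ord1 j).
rewrite -wk -[in RHS](hsubmxK w) mul_row_col; congr (_ + _).
  rewrite [lsubmx w]mx11_scalar mul_scalar_mx; congr (_ *: _); rewrite mxE; congr (w _ _); exact: val_inj.
rewrite [rsubmx w]mx11_scalar mul_scalar_mx; congr (_ *: _); rewrite mxE; congr (w _ _); exact: val_inj.
Qed.

(** The difference from the model tensor has all the symmetries of a curvature tensor, and its
    sectional form vanishes. *)
Theorem constant_curvature i j k l y : D y -> T y i j k l = kappa * G2 y i j k l.
Proof.
move=> Dy; pose W i j k l := T y i j k l - kappa * G2 y i j k l.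
suff : W i j k l = 0 by move/eqP; rewrite subr_eq0 => /eqP.
have gs a b : g y a b = g y b a by rewrite -[in LHS](g_sym Dy) mxE.
have W12 i' j' k' l' : W i' j' k' l' = - W j' i' k' l'.
  rewrite /W /T /G2 (_ : Riem i' j' y = - Riem j' i' y); last first.
    rewrite !RiemE; move: (dGam i' j' y) (dGam j' i' y) (_ *m _) (_ *m _) => a1 a2 a3 a4.
    by apply/matrixP => a b; rewrite !mxE; ring.
  by rewrite mulNmx [X in X - _]mxE; ring.
have W34 i' j' k' l' : W i' j' k' l' = - W i' j' l' k'.
  rewrite /W /T; have /matrixP/(_ l' k') := Riem_antisym i' j' Dy.
  rewrite [LHS]mxE [RHS]mxE => ->; rewrite /G2; ring.
have Wb i' j' k' l' : W i' j' k' l' + W j' k' i' l' + W k' i' j' l' = 0.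
  have : T y i' j' k' l' + T y j' k' i' l' + T y k' i' j' l' = 0.
    have TE a b c d : T y a b c d = \sum_e curv a b c e y * g y e d.
      by rewrite /T mxE; apply: eq_bigr => e _; rewrite mxE.
    rewrite !TE -!big_split /= big1 // => a _; rewrite -!mulrDl.
    by rewrite Bianchi // mul0r.
  rewrite /W => h; rewrite (_ : _ + _ = (T y i' j' k' l' + T y j' k' i' l' + T y k' i' j' l')
     - kappa * (G2 y i' j' k' l' + G2 y j' k' i' l' + G2 y k' i' j' l')); last by ring.
  rewrite h /G2 (gs k' j') (gs k' i') (gs j' i'); ring.
apply: (curvature_like_zero W12 W34 Wb) => u v.
have sub : mult4 W u v v u = mult4 (T y) u v v u - kappa * mult4 (G2 y) u v v u.
  rewrite /mult4 mulr_sumr -sumrB; apply: eq_bigr => a _; rewrite mulr_sumr -sumrB; apply: eq_bigr => b _.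
  rewrite mulr_sumr -sumrB; apply: eq_bigr => c _; rewrite mulr_sumr -sumrB; apply: eq_bigr => d _.
  by rewrite /W; ring.
(* The curvature hypothesis speaks of independent pairs; for dependent ones the antisymmetry of [W]
   gives zero. *)
have [fr|/row_free_dep[[a b] /= ab E]] := boolP (row_free (col_mx u v)).
  rewrite sub mult4_T mult4_G2.
  have vu : (v *m g y *m u^T) 0 0 = (u *m g y *m v^T) 0 0.
    rewrite -[in RHS](trmxK (u *m g y *m v^T)) [in RHS]mxE.
    by rewrite !trmx_mul trmxK g_sym // mulmxA.
  rewrite vu -expr2; have n0 := gram_pos Dy fr.
  by rewrite -(sect Dy fr) divfK // subrr.
have [a0|a0] := eqVneq a 0.
  have b0 : b != 0 by move: ab; rewrite a0 eqxx.
  have v0 : v = 0.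
    by move: E; rewrite a0 scale0r add0r => /eqP; rewrite scaler_eq0 (negbTE b0) => /eqP.
  rewrite (mult4_swap12 _ _ _ _ W12) v0 -[X in mult4 W X _ _ _](scale0r (0 : 'rV[R]_m)).
  by rewrite mult4Z1 mul0r oppr0.
have uE : u = (- b / a) *: v.
  have -> : - b / a = a^-1 * - b by rewrite mulrC.
  by rewrite -scalerA scaleNr -[- (b *: v)]add0r -E addrK scalerA mulVf // scale1r.
rewrite uE mult4Z1; apply/eqP; rewrite mulf_eq0; apply/orP; right.
by have := mult4_swap12 v v v ((- b / a) *: v) W12; move: (mult4 _ _ _ _ _) => t h; apply/eqP; lra.
Qed.

End CoordinateMetric.

Lemma partial_eq (R : realType) m (V : normedModType R) (f : 'rV[R]_m -> V) y i d :
  is_derive y (delta_mx 0 i) f d -> partial i f y = d.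
Proof. by case. Qed.

Lemma dmetE (R : realType) m (g : 'rV[R]_m -> 'M[R]_m) k a b y :
  partial k (fun z => g z a b) y = dmet g k a b y.
Proof. by []. Qed.

Lemma add_entry (V : zmodType) p q (A B : 'M[V]_(p, q)) i j : (A + B) i j = A i j + B i j.
Proof. by rewrite mxE. Qed.

Lemma flat_block (R : comPzRingType) q (k : R) (b d : 'cV[R]_q) (r t : 'rV[R]_q)
    (a1 a2 a3 a4 : 'M[R]_q) :
  a3 - a4 + a1 *m a2 - a2 *m a1 = k *: (b *m r) - k *: (d *m t) ->
  b *m (- k *: r) + a1 *m a2 - (d *m (- k *: t) + a2 *m a1) = a4 - a3.
Proof.
rewrite -!scalemxAr !scaleNr.
move: (a1 *m a2) (a2 *m a1) (k *: _) (k *: _) => b1 b2 b3 b4 h.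
have -> : a4 - a3 = b1 - b2 - (b4 - b3).
  by rewrite -h; apply/matrixP => i j; rewrite !mxE; ring.
by apply/matrixP => i j; rewrite !mxE; ring.
Qed.

Lemma gam_entry (R : realType) m (g : 'rV[R]_m -> 'M[R]_m) a e b c y :
  (a *: Gam g e y) b c = a * chr g e b c y.
Proof. by rewrite !mxE. Qed.

Opaque partial dmet chr.

(** * The Hessian equation as a flat connection on first-order jets *)

Section Jets.
Context {R : realType} {m : nat}.

(** Bootstrap: the equation writes every partial derivative of [u] through [u] itself, so each order
    of smoothness gives the next. *)
Lemma parallel_smooth q (D : set 'rV[R]_m) (A : 'I_m -> 'rV[R]_m -> 'M[R]_q) u :
  open D -> (forall i a b k, Ck_on k D (fun y => A i y a b)) -> parallel A D u ->
  forall b k, Ck_on k D (fun y => u y 0 b).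
Proof.
move=> oD hA hu b k; elim: k b => [|k IH] b.
  by split=> // y Dy; apply: coord_for_continuous; case: (hu y Dy).
split=> [y Dy|i]; first by apply: coord_for_continuous; case: (hu y Dy).
have dz z : D z -> is_derive z (delta_mx 0 i) (fun z => u z 0 b) ((u z *m A i z) 0 b).
  by move=> Dz; have [_ /(_ i)/is_derive_mxP] := hu z Dz; exact.
split=> [y /dz[]//|].
apply: (@Ck_ext _ _ _ k D (fun z => (u z *m A i z) 0 b)) => //.
  by move=> z /dz[_ <-].
by apply: Ck_mulmx => // a c; rewrite (ord1 a).
Qed.

Variables (D : set 'rV[R]_m) (g : 'rV[R]_m -> 'M[R]_m) (kappa : R).
Hypothesis oD : open D.
Hypothesis g_smooth : smooth_on D g.
Hypothesis g_sym : forall y, D y -> (g y)^T = g y.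
Hypothesis g_pos : forall y, D y -> forall v : 'rV[R]_m, v != 0 -> 0 < (v *m g y *m v^T) 0 0.

(** Acting from the right on a jet [(f, df)], the first column returns [d_i f] and the others the
    right-hand side of the Hessian equation for [d_i d_j f], as [jet_conn] computes. *)
Definition conn i y : 'M[R]_(1 + m) :=
  block_mx 0 (- kappa *: row i (g y)) (delta_mx i 0) (Gam g i y)^T.

Lemma conn_Ck i a b k : Ck_on k D (fun y => conn i y a b).
Proof.
have h (f f' : 'rV[R]_m -> R) : (forall y, f y = f' y) -> Ck_on k D f' -> Ck_on k D f.
  by move=> e; apply: Ck_ext => // y _; rewrite e.
case: (split_ordP a) => a' ->; case: (split_ordP b) => b' ->.
- apply: (h _ (fun=> 0)); last exact: Ck_cst.
  by move=> y; rewrite block_mxEul mxE.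
- apply: (h _ (fun y => - kappa * g y i b')).
    by move=> y; rewrite block_mxEur !mxE.
  by apply: CkM => //; [exact: Ck_cst|exact: g_smooth_entry].
- apply: (h _ (fun=> (delta_mx i 0 : 'cV[R]_m) a' b')); last exact: Ck_cst.
  by move=> y; rewrite block_mxEdl.
- apply: (h _ (chr g i b' a')); last exact: chr_Ck.
  by move=> y; rewrite block_mxEdr !mxE.
Qed.

Definition hess_on (E : set 'rV[R]_m) (f : 'rV[R]_m -> R) :=
  Ck_on 2 E f /\ forall y i j, E y -> partial i (partial j f) y =
    \sum_k chr g i j k y * partial k f y - kappa * f y * g y i j.

Definition jet (f : 'rV[R]_m -> R) y : 'rV[R]_(1 + m) :=
  row_mx (f y)%:M (\row_j partial j f y).

Lemma jet_conn f y i : jet f y *m conn i y =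
  row_mx (partial i f y)%:M
   (\row_j (\sum_k chr g i j k y * partial k f y - kappa * f y * g y i j)).
Proof.
rewrite /jet /conn mul_row_block; congr row_mx; apply/rowP => j.
  rewrite mulmx0 add0r (ord1 j) !mxE (bigD1 i) //= !mxE !eqxx mulr1 mulr1n big1 ?addr0 //.
  by move=> k ki; rewrite [X in _ * X]mxE (negbTE ki) mulr0.
rewrite mul_scalar_mx [LHS]mxE [RHS]mxE addrC [X in X + _]mxE; congr (_ + _).
  by apply: eq_bigr => k _; rewrite !mxE mulrC.
by rewrite !mxE; ring.
Qed.

Lemma row_mx_is_derive (X : normedModType R) p q (a : X -> 'rV[R]_p) (b : X -> 'rV[R]_q) da db (x v : X) :
  is_derive x v a da -> is_derive x v b db ->
  is_derive x v (fun z => row_mx (a z) (b z)) (row_mx da db).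
Proof.
move=> /is_derive_mxP ha /is_derive_mxP hb; apply/is_derive_mxP => i j.
case: (split_ordP j) => j' ->.
  rewrite row_mxEl (_ : (fun _ => _) = fun z => a z i j') //.
  by apply/funext => z; rewrite row_mxEl.
rewrite row_mxEr (_ : (fun _ => _) = fun z => b z i j') //.
by apply/funext => z; rewrite row_mxEr.
Qed.

Lemma parallel_jet E f : open E -> hess_on E f -> parallel conn E (jet f).
Proof.
move=> oE [f2 hf] y Ey; split.
  apply: rV_continuous => a; case: (split_ordP a) => a' ->.
    rewrite (_ : (fun _ => _) = f); first exact: Ck_continuous f2 Ey.
    by apply/funext => z; rewrite row_mxEl (ord1 a') mxE eqxx mulr1n.
  rewrite (_ : (fun _ => _) = partial a' f); first exact: Ck_continuous (Ck_partial a' f2) Ey.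
  by apply/funext => z; rewrite row_mxEr mxE.
move=> i; rewrite jet_conn; apply: row_mx_is_derive; apply/is_derive_mxP => a b.
  rewrite !(ord1 a) !(ord1 b) mxE eqxx mulr1n (_ : (fun _ => _) = f); last first.
    by apply/funext => z; rewrite mxE eqxx mulr1n.
  by apply: DeriveDef => //; exact: Ck_derivable f2 Ey.
rewrite mxE (_ : (fun _ => _) = partial b f); last by apply/funext => z; rewrite mxE.
rewrite -hf //.
by apply: DeriveDef => //; exact: Ck_derivable (Ck_partial b f2) Ey.
Qed.

(** The first component of the parallel equation identifies the other components as the partial
    derivatives of [f]; the remaining components are then the Hessian equation. *)
Lemma jet_parallel E u : open E -> E `<=` D -> parallel conn E u ->
  let f y := u y 0 (lshift m 0) in
  [/\ hess_on E f, forall k, Ck_on k E f & forall y, E y -> u y = jet f y].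
Proof.
move=> oE ED hu f.
have sm b k : Ck_on k E (fun y => u y 0 b).
  by apply: parallel_smooth hu b k => // i a b k; exact: Ck_sub ED (conn_Ck i a b k).
have uE y : u y = row_mx (f y)%:M (rsubmx (u y)).
  rewrite -[LHS](hsubmxK (u y)); congr row_mx; rewrite [LHS]mx11_scalar; congr (_ %:M).
  by rewrite mxE; congr (u y _ _); exact: val_inj.
have du y i b : E y -> partial i (fun z => u z 0 b) y = (u y *m conn i y) 0 b.
  by move=> Ey; have [_ /(_ i)/is_derive_mxP/(_ 0 b)[_ e]] := hu y Ey.
have pf y i : E y -> partial i f y = u y 0 (rshift 1 i).
  move=> Ey; rewrite (du y i (lshift m 0) Ey) [in LHS]uE /conn mul_row_block row_mxEl.
  rewrite mulmx0 add0r mxE (bigD1 i) //= !mxE !eqxx mulr1 big1 ?addr0 //.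
  by move=> k ki; rewrite !mxE (negbTE ki) mulr0.
have uj y : E y -> u y = jet f y.
  move=> Ey; rewrite [LHS]uE; congr row_mx; apply/rowP => i.
  by rewrite !mxE pf.
split=> //; last by move=> k; exact: sm.
split; first exact: sm.
move=> y i j Ey.
have -> : partial i (partial j f) y = partial i (fun z => u z 0 (rshift 1 j)) y.
  by apply: partial_near; apply: (eq_near oE) Ey => z Ez; exact: pf.
by rewrite du // uj // jet_conn row_mxEr mxE.
Qed.

Hypothesis sect : forall y (u v : 'rV[R]_m), D y -> row_free (col_mx u v) ->
  ((\row_l \sum_i \sum_j \sum_k u 0 i * v 0 j * v 0 k * curv g i j k l y) *m g y *m u^T) 0 0
   / ((u *m g y *m u^T) 0 0 * (v *m g y *m v^T) 0 0 - (u *m g y *m v^T) 0 0 ^+ 2) = kappa.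

Lemma Riem_constant i j y : D y -> Riem g i j y =
  kappa *: (col j (g y) *m delta_mx 0 i - col i (g y) *m delta_mx 0 j).
Proof.
move=> Dy; apply: (can_inj (mulmxK (g_unit g_pos Dy))); apply/matrixP => k l.
rewrite (constant_curvature oD g_smooth g_sym g_pos sect i j k l Dy) -scalemxAl mulmxBl -!mulmxA -!rowE.
by rewrite [RHS]mxE [X in _ = _ * X]mxE [X in _ = _ * (_ + X)]mxE !mxE !big_ord1 !mxE;
   rewrite -[g y j k]/((g y) j k) -[in g y j k](g_sym Dy) -[in g y i k](g_sym Dy) !mxE.
Qed.

(** Each block of the curvature has its own reason: the corner vanishes by the symmetry of [g], the
    row block by metric compatibility, the column block because the connection is torsion free, and
    the last block is constant curvature. *)
Lemma conn_flat : flat D conn.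
Proof.
pose dG i j y : 'M[R]_m := \matrix_(k, l) partial i (chr g j k l) y.
have RE i j y : Riem g i j y = dG i j y - dG j i y + Gam g j y *m Gam g i y - Gam g i y *m Gam g j y.
  exact: RiemE.
pose dC i j y : 'M[R]_(1 + m) := block_mx 0 (- kappa *: \row_l dmet g i j l y) 0 (dG i j y)^T.
have dCE y i j a b : D y -> partial i (fun z => conn j z a b) y = dC i j y a b.
  move=> Dy; case: (split_ordP a) => a' ->; case: (split_ordP b) => b' ->.
  - rewrite block_mxEul mxE (_ : (fun _ => _) = fun=> 0) ?partial_cst //.
    by apply/funext => z; rewrite block_mxEul mxE.
  - rewrite block_mxEur !mxE (_ : (fun _ => _) = fun z => - kappa * g z j b'); last first.
      by apply/funext => z; rewrite block_mxEur !mxE.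
    have h := @is_deriveMl R _ (- kappa) (fun z => g z j b') (dmet g i j b' y) y (delta_mx 0 i).
    have [|_ E] := h; last exact: E.
    by apply: DeriveDef => //; exact: Ck_derivable (g_smooth_entry oD g_smooth j b' 1) Dy.
  - rewrite block_mxEdl mxE (_ : (fun _ => _) = fun=> (delta_mx j 0 : 'cV[R]_m) a' b') ?partial_cst //.
    by apply/funext => z; rewrite block_mxEdl.
  - rewrite block_mxEdr !mxE (_ : (fun _ => _) = chr g j b' a') //.
    by apply/funext => z; rewrite block_mxEdr !mxE.
move=> y i j a b Dy; rewrite !dCE //.
suff -> : conn i y *m conn j y - conn j y *m conn i y = dC j i y - dC i j y.
  have aux (M N : 'M[R]_(1 + m)) : M a b - N a b + (N - M) a b = 0 by rewrite !mxE; ring.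
  exact: aux.
rewrite /conn !mulmx_block opp_block_mx add_block_mx /dC opp_block_mx add_block_mx.
rewrite ?mul0mx ?mulmx0 ?add0r ?addr0 ?subr0.
have gs p q : g y p q = g y q p by rewrite -[in LHS](g_sym Dy) mxE.
congr block_mx.
- apply/matrixP => p q; rewrite -!colE !mxE (gs j i).
  by rewrite subrr ?subr0 ?oppr0.
- rewrite -!scalemxAl -!scalerBr; congr (_ *: _); apply/rowP => l.
  have E (p q : 'I_m) : (row p (g y) *m (Gam g q y)^T) 0 l = (Gam g q y *m g y) l p.
    by rewrite !mxE; apply: eq_bigr => k _; rewrite !mxE gs mulrC.
  have sub (v w : 'rV[R]_m) : (v - w) 0 l = v 0 l - w 0 l by rewrite !mxE.
  rewrite !sub !E ![(\row_l0 _) 0 l]mxE !(metric_compat oD g_sym g_pos) //.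
  have S : (Gam g j y *m g y) i l = (Gam g i y *m g y) j l.
    by rewrite !mxE; apply: eq_bigr => k _; rewrite !mxE (chr_sym oD g_sym j i k Dy).
  by rewrite S; ring.
- apply/matrixP => p q; rewrite -!colE !mxE (chr_sym oD g_sym i j p Dy).
  by rewrite subrr ?subr0 ?oppr0.
- have := congr1 trmx (Riem_constant i j Dy); rewrite RE linearZ /= !raddfB /= raddfD /= raddfB /=.
  rewrite !trmx_mul !tr_col !trmx_delta g_sym //.
  exact: flat_block.
Qed.

End Jets.

(** It is ['J T y] where [T] is differentiable, but assembled from partial derivatives entry by
    entry, so that the calculus of [Ck_on] applies to it. *)
Definition jac {R : realType} {m n} (T : 'rV[R]_m -> 'rV[R]_n) y : 'M[R]_(m, n) :=
  \matrix_(i, a) partial i (fun z => T z 0 a) y.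

(** * Invariance of the Hessian equation under changes of chart *)

Section ChartChange.

Context {R : realType} {m : nat}.

Lemma is_derive_trmx (X : normedModType R) p q (A : X -> 'M[R]_(p, q)) dA (x v : X) :
  is_derive x v A dA -> is_derive x v (fun z => (A z)^T) dA^T.
Proof.
move=> /is_derive_mxP h; apply/is_derive_mxP => i j; rewrite mxE.
by rewrite (_ : (fun _ => _) = fun z => A z j i) //; apply/funext => z; rewrite mxE.
Qed.

Let mulrBCA_aux (a b c d : R) : a * (b - c * d) = a * b - c * (a * d).
Proof. ring. Qed.

Let product_rule (dA A G' B : 'M[R]_m) : B^T = B ->
  (dA *m B + A *m (G' *m B + (G' *m B)^T)) *m A^T + A *m B *m dA^T =
  (dA + A *m G') *m (B *m A^T) + ((dA + A *m G') *m (B *m A^T))^T.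
Proof.
move=> BT; have E1 : (dA + A *m G')^T = dA^T + G'^T *m A^T by rewrite raddfD /= trmx_mul.
rewrite !trmx_mul trmxK E1 BT.
rewrite !(mulmxDl, mulmxDr) !mulmxA.
move: (dA *m B *m A^T) (A *m G' *m B *m A^T) (A *m B *m G'^T *m A^T) (A *m B *m dA^T) => a1 a2 a3 a4.
by apply/matrixP => a b; rewrite !mxE; ring.
Qed.

Variables (D D' : set 'rV[R]_m) (g g' : 'rV[R]_m -> 'M[R]_m) (T : 'rV[R]_m -> 'rV[R]_m).
Hypotheses (oD : open D) (oD' : open D') (TD : forall y, D y -> D' (T y)).
Hypotheses (g_smooth : smooth_on D g) (g_sym : forall y, D y -> (g y)^T = g y)
  (g_pos : forall y, D y -> forall v : 'rV[R]_m, v != 0 -> 0 < (v *m g y *m v^T) 0 0).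
Hypotheses (g'_smooth : smooth_on D' g') (g'_sym : forall y, D' y -> (g' y)^T = g' y)
  (g'_pos : forall y, D' y -> forall v : 'rV[R]_m, v != 0 -> 0 < (v *m g' y *m v^T) 0 0).
Hypothesis T_smooth : forall a k, Ck_on k D (fun y => T y 0 a).

Local Notation jacT := (jac T).

Hypothesis change : forall y, D y -> g y = jacT y *m g' (T y) *m (jacT y)^T.

Let dJ i y : 'M[R]_m := \matrix_(j, a) partial i (fun z => partial j (fun z' => T z' 0 a) z) y.

Let is_derive_jac i y : D y -> is_derive y (delta_mx 0 i) jacT (dJ i y).
Proof.
move=> Dy; apply/is_derive_mxP => j a; rewrite mxE.
have -> : (fun z => jacT z j a) = partial j (fun z' => T z' 0 a).
  by apply/funext => z; rewrite mxE.
by apply: DeriveDef => //; exact: Ck_derivable (Ck_partial j (T_smooth a 2)) Dy.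
Qed.

Let dJ_sym i j a y : D y -> dJ i y j a = dJ j y i a.
Proof. by move=> Dy; rewrite [LHS]mxE [RHS]mxE; exact: (partialC i j oD (T_smooth a 2) Dy). Qed.

Let Gam' i y : 'M[R]_m := \sum_e jacT y i e *: Gam g' e (T y).

Let is_derive_g' i y : D y -> is_derive y (delta_mx 0 i) (fun z => g' (T z))
  (Gam' i y *m g' (T y) + (Gam' i y *m g' (T y))^T).
Proof.
move=> Dy; apply/is_derive_mxP => a b.
have h := chain_partial oD' (g_smooth_entry oD' g'_smooth a b 1) (TD Dy)
  (fun c => Ck_derivable (T_smooth c 1) Dy).
have E e : partial e (fun z => g' z a b) (T y) =
   (Gam g' e (T y) *m g' (T y)) a b + (Gam g' e (T y) *m g' (T y)) b a.
  by rewrite dmetE; exact: (metric_compat oD' g'_sym g'_pos e a b (TD Dy)).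
have E2 c d : (Gam' i y *m g' (T y)) c d = \sum_e jacT y i e * (Gam g' e (T y) *m g' (T y)) c d.
  rewrite /Gam' mulmx_suml summxE; apply: eq_bigr => e _.
  by rewrite -scalemxAl mxE.
have := h i; congr is_derive.
rewrite [RHS]mxE [X in _ = _ + X]mxE !E2 -big_split; apply: eq_bigr => e _.
by rewrite E /= [jacT y i e]mxE mulrDr.
Qed.

(** Lowered by the metric, the right-hand side becomes [N i], which is compatible with the metric
    and symmetric in its first two indices. The Koszul formula shows that these properties determine
    the symbols. *)
Lemma christoffel_change i y : D y ->
  Gam g i y *m jacT y = dJ i y + jacT y *m Gam' i y.
Proof.
move=> Dy; pose N i := (dJ i y + jacT y *m Gam' i y) *m (g' (T y) *m (jacT y)^T).
have compat k a b : dmet g k a b y = N k a b + N k b a.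
  have h1 := is_derive_mulmx (is_derive_mulmx (is_derive_jac k Dy) (is_derive_g' k Dy))
     (is_derive_trmx (is_derive_jac k Dy)).
  rewrite (_ : dmet g k a b y = partial k (fun z => (jacT z *m g' (T z) *m (jacT z)^T) a b) y).
    rewrite (partial_eq ((is_derive_mxP _ _ _ _).1 h1 a b)).
    have -> : N k b a = (N k)^T a b by rewrite [RHS]mxE.
    apply: etrans (congr1 (fun M : 'M[R]_m => M a b)
      (product_rule (dJ k y) (jacT y) (Gam' k y) (g'_sym (TD Dy)))) _.
    by rewrite [LHS]mxE.
  apply: partial_near; apply: (eq_near oD) Dy => z Dz.
  by rewrite change.
have symN a j l : N a j l = N j a l.
  rewrite /N ![((dJ _ _ + _) *m _) _ _]mxE; apply: eq_bigr => c _; congr (_ * _).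
  have EN p q : (dJ p y + jacT y *m Gam' p y) q c = dJ p y q c + (jacT y *m Gam' p y) q c.
    exact: add_entry.
  apply: etrans (EN a j) (etrans _ (esym (EN j a))).
  apply: f_equal2 (dJ_sym a j c Dy) _.
  have E p q : (jacT y *m Gam' p y) q c = \sum_b \sum_e jacT y q b * jacT y p e * chr g' e b c (T y).
    rewrite mxE; apply: eq_bigr => b _; rewrite /Gam' summxE mulr_sumr.
    apply: eq_bigr => e _; rewrite -mulrA; congr (_ * _).
    exact: gam_entry.
  rewrite !E exchange_big; apply: eq_bigr => b _; apply: eq_bigr => e _.
  by rewrite (chr_sym oD' g'_sym b e c (TD Dy)); congr (_ * _); rewrite mulrC.
have GN : Gam g i y *m g y = N i.
  apply/matrixP => j l; rewrite (Gam_low g_sym g_pos i j l Dy) !compat.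
  by rewrite (symN i l j) (symN j l i) (symN j i l); field.
have gE : g y = jacT y *m (g' (T y) *m (jacT y)^T) by rewrite mulmxA -change.
have uM : g' (T y) *m (jacT y)^T \in unitmx.
  by have := g_unit g_pos Dy; rewrite gE unitmx_mul => /andP[].
apply: (can_inj (mulmxK uM)); rewrite -/(N i) -GN [in RHS]gE.
by rewrite -!mulmxA.
Qed.

(** The second derivatives of the change of chart are exactly the inhomogeneous term of
    [christoffel_change]. *)
Lemma hess_change (kappa : R) (E E' : set 'rV[R]_m) f : open E -> open E' ->
  E `<=` D -> E' `<=` D' -> (forall y, E y -> E' (T y)) ->
  hess_on g' kappa E' f -> hess_on g kappa E (fun y => f (T y)).
Proof.
move=> oE oE' ED ED' TE [f2 hf].
have T2 a k : Ck_on k E (fun y => T y 0 a) by exact: Ck_sub ED (T_smooth a k).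
have := @Ck_comp _ _ _ oE _ 2 T E' f oE' TE f2 (fun a => T2 a 2).
move=> h; split; first exact: h.
have d1 y j : E y -> partial j (fun z => f (T z)) y = \sum_a jacT y j a * partial a f (T y).
  move=> Ey; rewrite (partial_eq (chain_partial oE' (Ck1 f2) (TE _ Ey) (fun c => Ck_derivable (T2 c 1) Ey))).
  by apply: eq_bigr => a _; rewrite mxE.
move=> y i j Ey; have Dy := ED _ Ey; have Ey' := TE _ Ey.
pose x : 'rV[R]_m := \row_a partial a f (T y).
have LHS1 : partial i (partial j (fun z => f (T z))) y =
   \sum_a (dJ i y j a * partial a f (T y) + jacT y j a * \sum_b jacT y i b * partial b (partial a f) (T y)).
  rewrite (_ : partial i (partial j (fun z => f (T z))) y =
     partial i (fun z => \sum_a jacT z j a * partial a f (T z)) y); last first.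
    by apply: partial_near; apply: (eq_near oE) Ey => z Ez; exact: d1.
  have ha a : is_derive y (delta_mx 0 i) (fun z => jacT z j a * partial a f (T z))
     (dJ i y j a * partial a f (T y) + jacT y j a * \sum_b jacT y i b * partial b (partial a f) (T y)).
    have h1 := (is_derive_mxP _ _ _ _).1 (is_derive_jac i Dy) j a.
    have h2 := chain_partial oE' (Ck_partial a f2) Ey' (fun c => Ck_derivable (T2 c 1) Ey).
    have := @is_deriveM R _ _ _ y (delta_mx 0 i) _ _ h1 (h2 i); congr is_derive.
    rewrite addrC [X in X + _]mulrC; congr (_ + _ * _).
    by apply: eq_bigr => b _; rewrite mxE.
  exact: (partial_eq (is_derive_bigsum (index_enum _) ha)).
rewrite LHS1.
transitivity (((dJ i y + jacT y *m Gam' i y) *m x^T) j 0 - kappa * f (T y) * (jacT y *m g' (T y) *m (jacT y)^T) i j).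
  have -> : (jacT y *m g' (T y) *m (jacT y)^T) i j = \sum_a jacT y j a * \sum_b jacT y i b * g' (T y) b a.
    rewrite mxE; apply: eq_bigr => a _; rewrite [X in _ * X]mxE mulrC; congr (_ * _).
    by rewrite mxE.
  rewrite mulmxDl -mulmxA [X in _ = X - _]mxE [X in _ = X + _ - _]mxE [X in _ = _ + X - _]mxE.
  rewrite big_split /= -addrA; congr (_ + _).
    by apply: eq_bigr => a _; rewrite [x^T a 0]mxE [x 0 a]mxE.
  rewrite mulr_sumr -sumrB; apply: eq_bigr => a _.
  rewrite -mulrBCA_aux; congr (_ * _).
  have -> : (Gam' i y *m x^T) a 0 = \sum_b jacT y i b * \sum_c chr g' b a c (T y) * partial c f (T y).
    rewrite /Gam' mulmx_suml summxE; apply: eq_bigr => b _; rewrite -scalemxAl mxE; congr (_ * _).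
    by rewrite mxE; apply: eq_bigr => c _; rewrite !mxE.
  rewrite mulr_sumr -sumrB; by apply: eq_bigr => b _; rewrite hf //.
rewrite -christoffel_change // -change //; congr (_ - _).
rewrite -mulmxA mxE; apply: eq_bigr => k _; rewrite [Gam _ _ _ _ _]mxE; congr (_ * _).
rewrite d1 // mxE; apply: eq_bigr => a _; by rewrite [x^T a 0]mxE [x 0 a]mxE.
Qed.

End ChartChange.
Transparent partial dmet chr.

(** * Coordinate changes *)

Section ChartTools.
Context {R : realType}.

Lemma C1_differentiable n m (D : set 'rV[R]_n) (T : 'rV[R]_n -> 'rV[R]_m) y :
  open D -> (forall a, Ck_on 1 D (fun z => T z 0 a)) -> D y -> differentiable T y.
Proof.
move=> oD hT Dy.
have -> : T = \sum_(a < m) (fun z => T z 0 a *: (delta_mx 0 a : 'rV[R]_m)).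
  by apply/funext => z; rewrite fct_sumE [LHS]row_sum_delta.
by apply: differentiable_sum => a; apply: differentiableZl; have [] := C1_diff oD (hT a) Dy.
Qed.

Lemma jacobianE n m (T : 'rV[R]_n -> 'rV[R]_m) y : differentiable T y -> 'J T y = jac T y.
Proof.
move=> dT; apply/matrixP => i a; rewrite [LHS]mxE [RHS]mxE -deriveE //.
have dv : derivable T y (delta_mx 0 i) by exact: diff_derivable.
by rewrite (derive_mx dv) mxE.
Qed.

Lemma grad_eq0_ball n (f : 'rV[R]_n -> R) y0 r : 0 < r ->
  (forall y, ball y0 r y -> {for y, continuous f}) ->
  (forall y i, ball y0 r y -> is_derive y (delta_mx 0 i) f 0) ->
  forall y, ball y0 r y -> f y = f y0.
Proof.
move=> r0 cf df y By; have oB : open (ball y0 r) by exact: ball_open.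
have C1f : Ck_on 1 (ball y0 r) f.
  split=> // i; split=> [z Bz|]; first by have [] := df z i Bz.
  have E : forall z, ball y0 r z -> 0 = partial i f z by move=> z Bz; rewrite (partial_eq (df z i Bz)).
  apply: (@Ck_ext _ _ _ 0 _ (fun=> 0) _ oB E); exact: Ck_cst.
have B t : 0 <= t <= 1 -> ball y0 r (y0 + t *: (y - y0)).
  move=> /andP[t0 t1]; rewrite ballE opprD addrA subrr add0r normrN normrZ (ger0_norm t0).
  apply: le_lt_trans (_ : `|y - y0| < r); first by rewrite ler_piMl.
  by move: By; rewrite ballE distrC.
have h t : 0 <= t <= 1 -> is_derive (y0 + t *: (y - y0)) (y - y0) f 0.
  move=> /B Bt; have := C1_is_derive oB (y - y0) C1f Bt; congr is_derive.
  by rewrite /grad big1 // => i _; rewrite (partial_eq (df _ i Bt)) mulr0.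
have [|t ht] := @line_MVT R _ f y0 (y - y0) 1.
  move=> t ht; rewrite mulr1; exact: (@ex_derive _ _ _ _ _ _ _ (h t ht)).
rewrite scale1r mulr1 mul1r (@derive_val _ _ _ _ _ _ _ (h t ht)) subrKC => /eqP.
by rewrite subr_eq0 => /eqP.
Qed.

Variables (n : nat) (T : topologicalType).
Implicit Types (c d : chart R n T).

Lemma chart_imgK c y : (c @` chart_dom c) y -> c (chart_inv c y) = y /\ chart_dom c (chart_inv c y).
Proof. by case=> p dp <-; rewrite chart_mapK. Qed.

Lemma chart_img_near c p (U : set T) : chart_dom c p -> nbhs p U ->
  \forall y \near c p, (c @` (chart_dom c `&` U)) y.
Proof.
move=> dp nU; have Dy : (c @` chart_dom c) (c p) by exists p.
have h1 : \forall z \near c p, (c @` chart_dom c) z.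
  by apply: open_nbhs_nbhs; split=> //; exact: chart_img_open.
have h2 : \forall z \near c p, U (chart_inv c z).
  by apply: (chart_inv_continuous Dy); rewrite chart_mapK.
apply: filterS2 h1 h2 => z [q dq <-]; rewrite chart_mapK // => Uq.
by exists q.
Qed.

Lemma chart_img_openI c (U : set T) : open U -> open (c @` (chart_dom c `&` U)).
Proof.
move=> oU; rewrite openE => y [p [dp Up] <-].
by apply: chart_img_near => //; apply: open_nbhs_nbhs.
Qed.

Lemma chart_pre_open c (B : set 'rV[R]_n) : open B -> open (chart_dom c `&` c @^-1` B).
Proof.
move=> oB; rewrite openE => p [dp Bp].
have h1 : \forall q \near p, chart_dom c q.
  by apply: open_nbhs_nbhs; split=> //; exact: chart_dom_open.
have h2 : \forall q \near p, B (c q).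
  by apply: (chart_map_continuous dp); apply: open_nbhs_nbhs.
by apply: filterS2 h1 h2.
Qed.

End ChartTools.

Section ManifoldCharts.
Context {R : realType} {n : nat} (M : riemannianManifold R n).
Implicit Types (c d : chart R n M).

Lemma overlap_open c d : open (c @` (chart_dom c `&` chart_dom d)).
Proof. by apply: chart_img_openI; exact: chart_dom_open. Qed.
Arguments overlap_open c d : clear implicits.

Lemma transition_Ck c d a k : atlas c -> atlas d ->
  Ck_on k (c @` (chart_dom c `&` chart_dom d)) (fun y => transition c d y 0 a).
Proof. move=> hc hd; refine (@Ck_entry _ _ _ (overlap_open c d) 1 n k (transition c d) 0 a _).
exact: (atlas_smooth hc hd k). Qed.

Lemma transition_img c d y : (c @` (chart_dom c `&` chart_dom d)) y ->
  (d @` (chart_dom d `&` chart_dom c)) (transition c d y).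
Proof. by case=> p [dc dd] <-; exists p => //; rewrite /transition chart_mapK. Qed.

Lemma transition_jacobian c d y : atlas c -> atlas d ->
  (c @` (chart_dom c `&` chart_dom d)) y -> 'J (transition c d) y = jac (transition c d) y.
Proof.
move=> hc hd Dy; apply: jacobianE; exact: (C1_differentiable (overlap_open c d) (fun a => transition_Ck a 1 hc hd) Dy).
Qed.

Lemma metric_coord_change c d y : atlas c -> atlas d ->
  (c @` (chart_dom c `&` chart_dom d)) y ->
  metric_coord c y = jac (transition c d) y *m metric_coord d (transition c d y)
    *m (jac (transition c d) y)^T.
Proof.
move=> hc hd Dy; rewrite -transition_jacobian //; case: Dy => p [dc dd] <-.
by rewrite /metric_coord /transition !chart_mapK //; exact: metric_change.
Qed.

Lemma metric_coord_sym c y : atlas c -> (c @` chart_dom c) y ->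
  (metric_coord c y)^T = metric_coord c y.
Proof. by move=> hc [p dp <-]; rewrite /metric_coord chart_mapK //; exact: (Defs.metric_sym hc dp). Qed.

Lemma metric_coord_pos c y : atlas c -> (c @` chart_dom c) y ->
  forall v : 'rV[R]_n, v != 0 -> 0 < (v *m metric_coord c y *m v^T) 0 0.
Proof. by move=> hc [p dp <-]; rewrite /metric_coord chart_mapK //; exact: metric_pos. Qed.

Lemma coord_sect c kappa : atlas c -> constant_sectional_curvature M kappa ->
  forall y (u v : 'rV[R]_n), (c @` chart_dom c) y -> row_free (col_mx u v) ->
  ((\row_l \sum_i \sum_j \sum_k u 0 i * v 0 j * v 0 k * curv (metric_coord c) i j k l y)
     *m metric_coord c y *m u^T) 0 0
   / ((u *m metric_coord c y *m u^T) 0 0 * (v *m metric_coord c y *m v^T) 0 0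
      - (u *m metric_coord c y *m v^T) 0 0 ^+ 2) = kappa.
Proof. by move=> hc h y u v [p dp <-] uv; exact: h c p hc dp u v uv. Qed.

End ManifoldCharts.

(** * Global solutions of the Hessian equation *)

(** Initial values may be prescribed at any point of the ball, not only at its centre. *)
Lemma frobenius_basis {R : realType} {m q} (D : set 'rV[R]_m) (A : 'I_m -> 'rV[R]_m -> 'M[R]_q) y0 :
  open D -> (forall i a b, Ck_on 1 D (fun y => A i y a b)) -> flat D A -> D y0 ->
  exists2 r : R, 0 < r &
  [/\ ball y0 r `<=` D,
    (forall y u0, ball y0 r y -> exists2 u, u y = u0 & parallel A (ball y0 r) u) &
    forall u v, parallel A (ball y0 r) u -> parallel A (ball y0 r) v ->
      forall y y', ball y0 r y -> ball y0 r y' -> u y = v y -> u y' = v y'].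
Proof.
move=> oD A1 fl Dy0; have [r r0 [BD ex un]] := frobenius oD A1 fl Dy0.
exists r => //; split=> // y u0 By.
have [U hU] := choice (fun j : 'I_q => let: ex_intro2 u h1 h2 := ex (delta_mx 0 j) in
   ex_intro (fun u => u y0 = delta_mx 0 j /\ parallel A (ball y0 r) u) u (conj h1 h2)).
pose W z : 'M[R]_q := \matrix_(j, b) U j z 0 b.
have rW j z : row j (W z) = U j z by apply/rowP => b; rewrite !mxE.
have par v : parallel A (ball y0 r) (fun z => v *m W z).
  move=> z Bz; have dW i : is_derive z (delta_mx 0 i) W (W z *m A i z).
    apply/is_derive_mxP => j b; have [_ /(_ z Bz)[_ /(_ i)/is_derive_mxP/(_ 0 b)]] := hU j.
    rewrite -rW -row_mul [row _ _ 0 b]mxE; congr is_derive.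
    by apply/funext => w; rewrite mxE.
  split.
    apply: rV_continuous => b.
    have -> : (fun z => (v *m W z) 0 b) = \sum_j (fun z => v 0 j * U j z 0 b).
      apply/funext => w; rewrite fct_sumE mxE; apply: eq_bigr => j _.
      by rewrite mxE.
    elim/big_ind: _ => [|f g cf cg|j _]; first exact: cst_continuous.
      exact: (continuousD cf cg).
    apply: (@continuousM _ _ (fun=> v 0 j) (fun z => U j z 0 b)); first exact: cst_continuous.
    by apply: coord_for_continuous; have [_ /(_ z Bz)[]] := hU j.
  move=> i; have := is_derive_mulmx (is_derive_cst v z (delta_mx 0 i)) (dW i).
  by rewrite mul0mx add0r mulmxA.
have By0 : ball y0 r y0 by exact: ballxx.
(* A combination of the basis sections that vanishes at [y] vanishes at the centre by uniqueness,
   where the basis is the identity matrix. *)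
have uW : W y \in unitmx.
  rewrite -row_free_unit; apply: inj_row_free => v vW.
  have /(_ _) := un _ _ (par v) (par 0) y y0 By By0.
  rewrite vW !mul0mx => /(_ erefl).
  rewrite (_ : W y0 = 1%:M) ?mulmx1 // .
  by apply/row_matrixP => j; rewrite rW row1; have [] := hU j.
exists (fun z => (u0 *m invmx (W y)) *m W z); last exact: par.
by rewrite mulmxKV.
Qed.

(** * Local solutions on the space form and their continuation *)

Section HessianSolutions.
Context {R : realType} {m : nat} (Q : riemannianManifold R m) (kappa : R).
Hypothesis cs : constant_sectional_curvature Q kappa.
Implicit Types (c d : chart R m Q) (phi : Q -> R).

Definition hess_near phi (p : Q) := exists U : set Q, [/\ open U, U p &
  forall c, atlas c -> hess_on (metric_coord c) kappa (c @` (chart_dom c `&` U))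
    (fun y => phi (chart_inv c y))].

Definition coord_jet c phi (p : Q) := jet (fun y => phi (chart_inv c y)) (c p).

Lemma hess_on_ext (g : 'rV[R]_m -> 'M[R]_m) (E E' : set 'rV[R]_m) (f f' : 'rV[R]_m -> R) :
  open E -> E `<=` E' -> (forall y, E y -> f y = f' y) -> hess_on g kappa E' f -> hess_on g kappa E f'.
Proof.
move=> oE EE ff [f2 hf]; split; first exact: Ck_ext oE ff (Ck_sub EE f2).
have p1 y i : E y -> partial i f' y = partial i f y.
  by move=> Ey; apply/esym/partial_near/(eq_near oE).
move=> y i j Ey.
have -> : partial i (partial j f') y = partial i (partial j f) y.
  by apply: partial_near; apply: (eq_near oE) Ey => z Ez; exact: p1.
rewrite (hf y i j (EE y Ey)) ff //; congr (_ - _).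
by apply: eq_bigr => k _; rewrite p1.
Qed.

Lemma hess_near_open phi p : hess_near phi p -> \forall q \near p, hess_near phi q.
Proof.
move=> [U [oU Up hU]]; have : \forall q \near p, U q by apply: open_nbhs_nbhs.
by apply: filterS => q Uq; exists U.
Qed.

Lemma hess_near_eq phi phi' p : eq_at phi phi' p -> hess_near phi p -> hess_near phi' p.
Proof.
move=> e [U [oU Up hU]].
pose V := [set q | phi q = phi' q]^°.
have oUV : open (U `&` V) by apply: openI => //; exact: open_interior.
exists (U `&` V); split=> //.
move=> c hc; apply: hess_on_ext (hU c hc).
- exact: chart_img_openI.
- by move=> y [q [dq [Uq _]] <-]; exists q.
- by move=> y [q [dq [_ /interior_subset Vq]] <-]; rewrite chart_mapK.
Qed.

(** The equation need only be checked in one chart around the point: [hess_change] carries it to all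
    charts of the atlas. *)
Lemma hess_near_chart c phi (B : set 'rV[R]_m) p : atlas c -> open B -> B `<=` c @` chart_dom c ->
  hess_on (metric_coord c) kappa B (fun y => phi (chart_inv c y)) ->
  chart_dom c p -> B (c p) -> hess_near phi p.
Proof.
move=> hc oB BD hB dp Bp; exists (chart_dom c `&` c @^-1` B); split=> //.
  exact: chart_pre_open.
move=> d hd; set E := d @` _.
have oE : open E by apply: chart_img_openI; exact: chart_pre_open.
have ED : E `<=` d @` (chart_dom d `&` chart_dom c) by move=> y [q [dq [cq _]] <-]; exists q.
have oE' : open (c @` chart_dom c) by exact: chart_img_open.
apply: (@hess_on_ext _ _ E (fun y => phi (chart_inv c (transition d c y)))) => //.
  by move=> y [q [dq [cq _]] <-]; rewrite /transition !chart_mapK.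
have TD y : (d @` (chart_dom d `&` chart_dom c)) y -> (c @` chart_dom c) (transition d c y).
  by move=> /transition_img[q [cq _] <-]; exists q.
have oDC : open (d @` (chart_dom d `&` chart_dom c)) by exact: overlap_open.
refine (@hess_change _ _ _ _ (metric_coord d) (metric_coord c) _ oDC oE' TD _ _ (metric_smooth hc) _ _ _ _ _ _ _ _ oE oB ED BD _ hB).
- by move=> y [q [dq cq] <-]; apply: (metric_coord_sym hd); exists q.
- by move=> y [q [dq cq] <-]; apply: (metric_coord_pos hd); exists q.
- by move=> y; exact: (metric_coord_sym hc).
- by move=> y; exact: (metric_coord_pos hc).
- by move=> a k; exact: transition_Ck.
- by move=> y; exact: metric_coord_change.
- by move=> y [q [dq [cq Bq]] <-]; rewrite /transition chart_mapK.
Qed.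

Let img_flat c (hc : atlas c) : flat (c @` chart_dom c) (conn (metric_coord c) kappa).
Proof.
apply: conn_flat; first exact: chart_img_open.
- exact: metric_smooth.
- by move=> y; exact: (metric_coord_sym hc).
- by move=> y; exact: (metric_coord_pos hc).
- by move=> y u v; exact: coord_sect.
Qed.

Let img_conn_Ck c (hc : atlas c) i a b k :
  Ck_on k (c @` chart_dom c) (fun y => conn (metric_coord c) kappa i y a b).
Proof.
apply: conn_Ck; first exact: chart_img_open.
- exact: metric_smooth.
- by move=> y; exact: (metric_coord_pos hc).
Qed.

Lemma eq_at_jet c phi phi' p : chart_dom c p -> eq_at phi phi' p ->
  coord_jet c phi p = coord_jet c phi' p.
Proof.
move=> dp e; have h : \forall y \near c p, phi (chart_inv c y) = phi' (chart_inv c y).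
  by apply: filterS (chart_img_near dp e) => y [q [dq eq] <-]; rewrite chart_mapK.
rewrite /coord_jet /jet (nbhs_singleton h); congr row_mx.
by apply/rowP => j; rewrite !mxE; exact: partial_near.
Qed.

(** The identity theorem: on a ball in a chart both jets are parallel, hence determined by their
    common value at one point. *)
Lemma hess_near_id c phi phi' p : atlas c -> chart_dom c p ->
  hess_near phi p -> hess_near phi' p ->
  exists2 U, nbhs p U & forall q q', U q -> U q' ->
    coord_jet c phi q = coord_jet c phi' q -> eq_at phi phi' q'.
Proof.
move=> hc dp [U [oU Up hU]] [V [oV Vp hV]].
pose E := c @` (chart_dom c `&` (U `&` V)).
have oE : open E by apply: chart_img_openI; exact: openI.
have Ep : E (c p) by exists p.
have ED : E `<=` c @` chart_dom c by move=> y [q [dq _] <-]; exists q.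
have [r r0 [BE _ un]] := frobenius_basis oE
   (fun i a b => Ck_sub ED (img_conn_Ck hc i a b 1)) (fun y i j a b Ey => img_flat hc i j a b (ED y Ey)) Ep.
pose W := chart_dom c `&` c @^-1` (ball (c p) r).
have oW : open W by apply: chart_pre_open; exact: ball_open.
have B0 : ball (c p) r (c p) by exact: ballxx.
exists W; first by apply: open_nbhs_nbhs; split.
move=> q q' [dq Bq] [dq' Bq'] e.
have oB : open (ball (c p) r) by exact: ball_open.
have P1 : parallel (conn (metric_coord c) kappa) (ball (c p) r) (jet (fun y => phi (chart_inv c y))).
  apply: parallel_jet => //; apply: hess_on_ext (hU c hc) => // y /BE[q1 [dq1 [Uq1 _]] <-].
  by exists q1.
have P2 : parallel (conn (metric_coord c) kappa) (ball (c p) r) (jet (fun y => phi' (chart_inv c y))).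
  apply: parallel_jet => //; apply: hess_on_ext (hV c hc) => // y /BE[q1 [dq1 [_ Uq1]] <-].
  by exists q1.
have : \forall w \near q', W w by apply: open_nbhs_nbhs.
apply: filterS => w [dw Bw].
have := un _ _ P1 P2 _ _ Bq Bw e.
move=> /(congr1 (fun v : 'rV[R]_(1 + m) => v 0 (lshift m 0))).
by rewrite !row_mxEl !mxE !mulr1n !chart_mapK.
Qed.

(** The neighbourhood asked for by [global_section] is a ball in a chart: segments join its points
    to the centre, and every jet extends to a solution over all of it. The last clause provides the
    initial germ. *)
Lemma hess_near_ext p : exists U : set Q, [/\ nbhs p U,
  (forall q, U q -> exists d : R -> Q, [/\ continuous d, d 0 = p, d 1 = q,
     forall t, d (clamp t) = d t & forall t, U (d t)]) ,
  (forall q s, U q -> hess_near s q -> exists2 s', (forall q', U q' -> hess_near s' q') & eq_at s' s q) &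
  forall u, exists2 s, hess_near s p & coord_jet (chart_at p) s p = u].
Proof.
pose c := chart_at p; have hc : atlas c by exact: chart_at_atlas.
have dp : chart_dom c p by exact: chart_at_dom.
have oD : open (c @` chart_dom c) by exact: chart_img_open.
have Dp : (c @` chart_dom c) (c p) by exists p.
have [r r0 [BD ex _]] := frobenius_basis oD (fun i a b => img_conn_Ck hc i a b 1) (img_flat hc) Dp.
have oB : open (ball (c p) r) by exact: ball_open.
have B0 : ball (c p) r (c p) by exact: ballxx.
pose W := chart_dom c `&` c @^-1` (ball (c p) r).
have sol q u0 : W q -> exists2 s, (forall q', W q' -> hess_near s q') & coord_jet c s q = u0.
  move=> [dq Bq]; have [u uq up] := ex (c q) u0 Bq.
  have [h1 _ h3] := jet_parallel oD (metric_smooth hc) (fun y => @metric_coord_pos _ _ _ _ y hc) oB BD up.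
  pose s q' := u (c q') 0 (lshift m 0).
  have sE y : ball (c p) r y -> s (chart_inv c y) = u y 0 (lshift m 0).
    by move=> /BD/chart_imgK[e _]; rewrite /s e.
  have hs : hess_on (metric_coord c) kappa (ball (c p) r) (fun y => s (chart_inv c y)).
    by apply: hess_on_ext h1 => // y /sE.
  exists s; first by move=> q' [dq' Bq']; exact: hess_near_chart hs dq' Bq'.
  rewrite -uq h3 // /coord_jet /jet sE //; congr row_mx.
  apply/rowP => j; rewrite !mxE; apply: partial_near.
  by apply: (eq_near oB) Bq.
have oW : open W by exact: chart_pre_open.
exists W; split.
- by apply: open_nbhs_nbhs; split.
- move=> q [dq Bq].
  have Bt t : ball (c p) r (c p + clamp t *: (c q - c p)).
    have /andP[t0 t1] := clampP t.
    rewrite ballE opprD addrA subrr add0r normrN normrZ (ger0_norm t0).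
    apply: le_lt_trans (_ : `|c q - c p| < r); first by rewrite ler_piMl.
    by move: Bq; rewrite /= ballE distrC.
  exists (fun t => chart_inv c (c p + clamp t *: (c q - c p))); split.
  + move=> t; apply: (@continuous_comp _ _ _ (fun t => c p + clamp t *: (c q - c p)) (chart_inv c)).
      apply: (@continuousD _ _ _ (fun=> c p)); first exact: cst_continuous.
      apply: (@continuousZr_tmp _ _ _ clamp); exact: clamp_continuous.
    by apply: chart_inv_continuous; exact: BD.
  + by rewrite clamp_id ?lexx ?ler01 // scale0r addr0 chart_mapK.
  + by rewrite clamp_id ?lexx ?ler01 // scale1r subrKC chart_mapK.
  + by move=> t; rewrite clampK.
  + by move=> t; have [E1 E2] := chart_imgK (BD _ (Bt t)); split=> //=; rewrite E1.
- move=> q s Wq hs; have [s' h1 h2] := sol q (coord_jet c s q) Wq.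
  exists s' => //; have [U nU hU] := hess_near_id hc Wq.1 (h1 q Wq) hs.
  exact: hU (nbhs_singleton nU) (nbhs_singleton nU) h2.
- move=> u; have [s h1 h2] := sol p u (conj dp B0).
  by exists s => //; exact: h1.
Qed.

Hypothesis sc : @simply_connected R Q.

Theorem hess_global p0 (u0 : 'rV[R]_(1 + m)) :
  exists2 S : Q -> R, (forall p, hess_near S p) & coord_jet (chart_at p0) S p0 = u0.
Proof.
have [_ [_ _ _ /(_ u0)[s0 h1 h2]]] := hess_near_ext p0.
have [||||S hS e] := @global_section R Q R hess_near _ _ _ _ sc p0 s0 h1.
- exact: hess_near_open.
- move=> s s' p hs hs'.
  have dp : chart_dom (chart_at p) p by exact: chart_at_dom.
  have [U nU hU] := hess_near_id (chart_at_atlas p) dp hs hs'.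
  have : \forall q \near p, chart_dom (chart_at p) q.
    by apply: open_nbhs_nbhs; split=> //; exact: chart_dom_open.
  move=> /(filterI nU) nV; exists (U `&` chart_dom (chart_at p)) => //.
  move=> q q' [Uq dq] [Uq' dq'] e; apply: hU Uq Uq' _.
  exact: eq_at_jet.
- by move=> s s' p; exact: hess_near_eq.
- by move=> p; have [U [? ? ? _]] := hess_near_ext p; exists U.
- exists S => //; rewrite -h2; apply: eq_at_jet e; exact: chart_at_dom.
Qed.

Lemma hess_near_coord phi c : atlas c -> (forall p, hess_near phi p) ->
  hess_on (metric_coord c) kappa (c @` chart_dom c) (fun y => phi (chart_inv c y)).
Proof.
move=> hc h; have oD : open (c @` chart_dom c) by exact: chart_img_open.
have loc y : (c @` chart_dom c) y -> exists2 E, open E /\ E y &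
    E `<=` c @` chart_dom c /\ hess_on (metric_coord c) kappa E (fun y => phi (chart_inv c y)).
  move=> [p dp <-]; have [U [oU Up hU]] := h p.
  exists (c @` (chart_dom c `&` U)); last by split; [move=> z [q [dq _] <-]; exists q|exact: hU].
  by split; [exact: chart_img_openI|exists p].
split; last by move=> y i j /loc[E [oE Ey] [_ [_ hE]]]; exact: hE.
split=> [y /loc[E [oE Ey] [_ [f2 _]]]|i]; first exact: Ck_continuous f2 Ey.
split=> [y /loc[E [oE Ey] [_ [f2 _]]]|]; first exact: Ck_derivable f2 Ey.
split=> [y /loc[E [oE Ey] [_ [f2 _]]]|j]; first exact: Ck_continuous (Ck_partial i f2) Ey.
split=> [y /loc[E [oE Ey] [_ [f2 _]]]|]; first exact: Ck_derivable (Ck_partial i f2) Ey.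
by split=> // y /loc[E [oE Ey] [_ [f2 _]]]; exact: Ck_continuous (Ck_partial j (Ck_partial i f2)) Ey.
Qed.

Lemma hess_smooth phi c k : atlas c -> (forall p, hess_near phi p) ->
  Ck_on k (c @` chart_dom c) (fun y => phi (chart_inv c y)).
Proof.
move=> hc h; have oD : open (c @` chart_dom c) by exact: chart_img_open.
have P := parallel_jet oD (hess_near_coord hc h).
have := parallel_smooth oD (img_conn_Ck hc) P (lshift m 0) k.
apply: Ck_ext => // y _.
by rewrite row_mxEl mxE mulr1n.
Qed.

End HessianSolutions.

(** * The model map *)

Section Cholesky.
Context {R : rcfType}.

Lemma quad_block p q (A : 'M[R]_p) (B : 'M[R]_(p, q)) C (D : 'M[R]_q) (s : 'rV[R]_p) (t : 'rV[R]_q) :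
  row_mx s t *m block_mx A B C D *m (row_mx s t)^T =
  s *m A *m s^T + t *m C *m s^T + (s *m B *m t^T + t *m D *m t^T).
Proof. by rewrite mul_row_block tr_row_mx mul_row_col !mulmxDl. Qed.

(** Induction on the Schur complement of the first pivot [a]. *)
Lemma cholesky m (G : 'M[R]_m) : G^T = G ->
  (forall v : 'rV[R]_m, v != 0 -> 0 < (v *m G *m v^T) 0 0) -> exists L : 'M[R]_m, L *m L^T = G.
Proof.
elim: m G => [|m IH] G GT Gpos; first by exists 0; apply/matrixP => -[].
move: G GT Gpos; rewrite -[m.+1]/(1 + m)%N => G.
rewrite -[G]submxK; move: (ulsubmx G) (ursubmx G) (dlsubmx G) (drsubmx G) => A B C D.
rewrite tr_block_mx => /eq_block_mx[_ _ BC DT] Gpos; rewrite -{}BC in Gpos *.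
rewrite [A]mx11_scalar in Gpos *; set a := A 0 0 in Gpos *.
have a0 : 0 < a.
  have := Gpos (row_mx 1%:M 0); rewrite quad_block !mul0mx !trmx0 !mulmx0 !addr0 trmx1 mulmx1 mul1mx mxE eqxx mulr1n.
  by apply; apply/eqP => /(congr1 (fun M : 'rV[R]_(1 + m) => M 0 (lshift m 0))); rewrite row_mxEl !mxE => /eqP; rewrite oner_eq0.
have sa : Num.sqrt a * Num.sqrt a = a by rewrite -expr2 sqr_sqrtr // ltW.
have sa0 : Num.sqrt a != 0 by rewrite gt_eqF // sqrtr_gt0.
have [||L LE] := IH (D - a^-1 *: (B^T *m B)).
- by rewrite raddfB /= DT linearZ /= trmx_mul trmxK.
- move=> v v0.
  have [t E1] : exists t, v *m B^T = t%:M by exists ((v *m B^T) 0 0); rewrite -mx11_scalar.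
  have E2 : B *m v^T = t%:M by rewrite -[LHS]trmxK trmx_mul trmxK E1 tr_scalar_mx.
  (* This first coordinate minimizes the form for given [v], and the minimum is the Schur
     complement. *)
  have := Gpos (row_mx (- (a^-1 * t))%:M v); rewrite quad_block.
  rewrite tr_scalar_mx E1 -!scalar_mxM -(mulmxA (_ %:M) B) E2 -scalar_mxM.
  have E3 : v *m (B^T *m B) *m v^T = (t * t)%:M by rewrite mulmxA E1 -mulmxA E2 -scalar_mxM.
  rewrite mulmxBr mulmxBl -scalemxAr -scalemxAl E3.
  have add (M N : 'M[R]_1) : (M + N) 0 0 = M 0 0 + N 0 0 by rewrite mxE.
  have opp (M : 'M[R]_1) : (- M) 0 0 = - M 0 0 by rewrite mxE.
  have sc k (M : 'M[R]_1) : (k *: M) 0 0 = k * M 0 0 by rewrite mxE.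
  have cs k : (k%:M : 'M[R]_1) 0 0 = k by rewrite mxE eqxx mulr1n.
  rewrite !(add, opp, sc, cs).
  have -> : - (a^-1 * t) * a * - (a^-1 * t) + t * - (a^-1 * t) + (- (a^-1 * t) * t + (v *m D *m v^T) 0 0)
    = (v *m D *m v^T) 0 0 - a^-1 * (t * t).
    by rewrite mulrAC -!mulrA !mulNr; field; rewrite gt_eqF.
  apply; apply/eqP => /(congr1 rsubmx); rewrite row_mxKr => E.
  by move: v0; rewrite E linear0 eqxx.
exists (block_mx (Num.sqrt a)%:M 0 ((Num.sqrt a)^-1 *: B^T) L).
rewrite tr_block_mx mulmx_block tr_scalar_mx !trmx0 !mul0mx !mulmx0 !addr0 linearZ /= trmxK.
rewrite -scalar_mxM sa mul_scalar_mx scalerA divff // scale1r mul_mx_scalar scalerA divff // scale1r.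
congr block_mx; rewrite -scalemxAl -scalemxAr scalerA -invfM sa LE addrC subrK //.
Qed.

End Cholesky.

(** * The conserved matrix of a system of solutions *)

Section Invariant.
Context {R : realType} {m : nat}.

(** With [Psi] standing for [G^-1 Phi], its derivative is obtained from the relation [G Psi = Phi],
    which avoids differentiating an inverse. *)
Lemma invariant_derivative (G gam Gm dPhi Phi Psi dPsi : 'M[R]_m) (F dF : 'rV[R]_m) (e : 'cV[R]_m) (kappa : R) :
  G^T = G -> G *m Psi = Phi -> gam = Gm *m G -> (gam + gam^T) *m Psi + G *m dPsi = dPhi ->
  dPhi = Gm *m Phi - kappa *: (G *m e *m F) -> dF = e^T *m Phi ->
  dPhi^T *m Psi + Phi^T *m dPsi + kappa *: (dF^T *m F + F^T *m dF) = 0.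
Proof.
move=> GT GP gE h1 h2 ->.
have E1 : Phi^T *m dPsi = Psi^T *m dPhi - Psi^T *m gam *m Psi - Psi^T *m gam^T *m Psi.
  rewrite -h1 -GP trmx_mul GT mulmxDr mulmxDl mulmxDr !mulmxA.
  move: (Psi^T *m G *m dPsi) (Psi^T *m gam *m Psi) (Psi^T *m gam^T *m Psi) => a b c.
  by apply/matrixP => i j; rewrite !mxE; ring.
have E2 : dPhi = gam *m Psi - kappa *: (G *m e *m F) by rewrite h2 -GP gE mulmxA.
have E3 : Psi^T *m G = Phi^T by rewrite -GP trmx_mul GT.
rewrite E1 E2 raddfB /= linearZ /= !trmx_mul GT mulmxBl mulmxBr trmxK -!scalemxAl -!scalemxAr !mulmxA E3.
rewrite -[F^T *m e^T *m G *m Psi]mulmxA GP scalerDr.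
move: (Psi^T *m gam^T *m Psi) (Psi^T *m gam *m Psi) (kappa *: _) (kappa *: _) => a b c d.
by apply/matrixP => i j; rewrite !mxE; ring.
Qed.

Variables (D : set 'rV[R]_m) (g : 'rV[R]_m -> 'M[R]_m) (kappa : R) (F : 'rV[R]_m -> 'rV[R]_m).
Hypothesis oD : open D.
Hypothesis g_smooth : smooth_on D g.
Hypothesis g_sym : forall y, D y -> (g y)^T = g y.
Hypothesis g_pos : forall y, D y -> forall v : 'rV[R]_m, v != 0 -> 0 < (v *m g y *m v^T) 0 0.
Hypothesis F_hess : forall a, hess_on g kappa D (fun y => F y 0 a).

(** The entries are [<dF_a, dF_b> + kappa F_a F_b]. *)
Definition first_integral y := (jac F y)^T *m invmx (g y) *m jac F y + kappa *: ((F y)^T *m F y).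

Lemma jac_Ck k : (forall a, Ck_on k.+1 D (fun y => F y 0 a)) -> forall i a, Ck_on k D (fun y => jac F y i a).
Proof.
move=> h i a; apply: Ck_ext (Ck_partial i (h a)) => // y _.
by rewrite mxE.
Qed.

Lemma jac_hess y i : D y -> is_derive y (delta_mx 0 i) (jac F)
  (Gam g i y *m jac F y - kappa *: (g y *m delta_mx i 0 *m F y)).
Proof.
move=> Dy; apply/is_derive_mxP => j a; have [f2 hf] := F_hess a.
have E : (fun z => jac F z j a) = partial j (fun y => F y 0 a) by apply/funext => z; rewrite mxE.
rewrite E; apply: DeriveDef; first exact: Ck_derivable (Ck_partial j f2) Dy.
rewrite -[LHS]/(partial i (partial j (fun y => F y 0 a)) y) hf // !mxE big_ord1 -colE [col i (g y) j 0]mxE; congr (_ - _).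
  by apply: eq_bigr => k _; rewrite !mxE.
by rewrite -[in LHS](g_sym Dy) [_^T i j]mxE -mulrA [_ * g y j i]mulrC.
Qed.

Lemma first_integral_derive y i : D y -> is_derive y (delta_mx 0 i) first_integral 0.
Proof.
move=> Dy; pose Psi z := invmx (g z) *m jac F z.
have J1 : forall i a, Ck_on 1 D (fun y => jac F y i a) by apply: jac_Ck => a; have [] := F_hess a.
have Psi1 : forall i a, Ck_on 1 D (fun y => Psi y i a).
  have Inv1 : forall a b, Ck_on 1 D (fun y => invmx (g y) a b).
    move=> a b; apply: (Ck_invmx oD); first by move=> z Dz; exact: (g_unit g_pos Dz).
    by move=> p q; exact: (g_smooth_entry oD g_smooth).
  exact: (Ck_mulmx oD Inv1 J1).
pose dPsi : 'M[R]_m := \matrix_(j, a) partial i (fun z => Psi z j a) y.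
have hPsi : is_derive y (delta_mx 0 i) Psi dPsi.
  apply/is_derive_mxP => j a; rewrite mxE; apply: DeriveDef => //.
  exact: Ck_derivable (Psi1 j a) Dy.
pose dg : 'M[R]_m := Gam g i y *m g y + (Gam g i y *m g y)^T.
have hg : is_derive y (delta_mx 0 i) g dg.
  apply/is_derive_mxP => j a; have := metric_compat oD g_sym g_pos i j a Dy.
  have -> : dg j a = (Gam g i y *m g y) j a + (Gam g i y *m g y) a j.
    by rewrite /dg mxE [_^T j a]mxE.
  move=> <-.
  by apply: DeriveDef => //; exact: Ck_derivable (g_smooth_entry oD g_smooth j a 1) Dy.
have GP z : D z -> g z *m Psi z = jac F z by move=> Dz; rewrite mulKVmx // (g_unit g_pos Dz).
have hF : is_derive y (delta_mx 0 i) F ((delta_mx i 0 : 'cV[R]_m)^T *m jac F y).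
  apply/is_derive_mxP => j a; rewrite (ord1 j) trmx_delta -rowE mxE [jac F y i a]mxE.
  by apply: DeriveDef => //; have [f2 _] := F_hess a; exact: Ck_derivable f2 Dy.
have hJ := jac_hess i Dy.
have E : dg *m Psi y + g y *m dPsi = Gam g i y *m jac F y - kappa *: (g y *m delta_mx i 0 *m F y).
  apply/matrixP => j a.
  have [_ <-] := (is_derive_mxP _ _ _ _).1 hJ j a.
  have [_ <-] := (is_derive_mxP _ _ _ _).1 (is_derive_mulmx hg hPsi) j a.
  by apply: (@partial_near _ _ _ _ _ y i); apply: (eq_near oD) Dy => z Dz; rewrite GP.
have := is_derive_mulmx (is_derive_trmx hJ) hPsi.
move=> /is_derive_mxP h1; have /is_derive_mxP h2 := is_derive_mulmx (is_derive_trmx hF) hF.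
apply/is_derive_mxP => j a.
have := @is_deriveD _ _ _ _ _ _ _ _ _ (h1 j a) (is_deriveMl kappa (h2 j a)).
congr is_derive.
  by apply/funext => z; rewrite /first_integral -mulmxA -/(Psi z) [RHS]mxE [X in _ = _ + X]mxE.
have := invariant_derivative (g_sym Dy) (GP y Dy) (erefl _) E (erefl _) (erefl _).
by move=> /matrixP/(_ j a); rewrite [LHS]mxE [X in _ + X]mxE.
Qed.

Lemma first_integral_C0 i j : Ck_on 0 D (fun y => first_integral y i j).
Proof.
have J0 : forall i a, Ck_on 0 D (fun y => jac F y i a).
  by move=> p q; apply: Ck_pred; apply: jac_Ck => a; have [] := F_hess a.
have I0 a b : Ck_on 0 D (fun y => invmx (g y) a b).
  apply: (Ck_invmx oD); first by move=> z Dz; exact: (g_unit g_pos Dz).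
  by move=> p q; exact: (g_smooth_entry oD g_smooth).
have F0 a : Ck_on 0 D (fun y => F y 0 a) by have [f2 _] := F_hess a; exact: Ck_pred (Ck_pred f2).
have JT0 a b : Ck_on 0 D (fun y => (jac F y)^T a b).
  by apply: Ck_ext (J0 b a) => // y _; rewrite [RHS]mxE.
have h1 := Ck_mulmx oD (Ck_mulmx oD JT0 I0) J0 i j.
have h2 := CkM oD (Ck_cst 0 D kappa) (CkM oD (F0 i) (F0 j)).
apply: Ck_ext (CkD oD h1 h2) => // y _.
by rewrite [RHS]mxE [X in _ = _ + X]mxE; congr (_ + _ * _); rewrite mxE big_ord1 mxE.
Qed.

End Invariant.

Section ModelMap.
Context {R : realType} {m : nat} (Q : riemannianManifold R m) (kappa : R).
Implicit Types c d : chart R m Q.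

Definition in_chart q (f : Q -> 'rV[R]_q) c : 'rV[R]_m -> 'rV[R]_q := fun y => f (chart_inv c y).

Lemma jac_change q (f : Q -> 'rV[R]_q) c d y : atlas c -> atlas d ->
  (forall a, Ck_on 1 (d @` chart_dom d) (fun z => in_chart f d z 0 a)) ->
  (c @` (chart_dom c `&` chart_dom d)) y ->
  jac (in_chart f c) y = jac (transition c d) y *m jac (in_chart f d) (transition c d y).
Proof.
move=> hc hd hf Dy; have oD : open (c @` (chart_dom c `&` chart_dom d)) by exact: overlap_open.
apply/matrixP => i a; rewrite [LHS]mxE [RHS]mxE.
have Ty : (d @` chart_dom d) (transition c d y) by have [p [dp _] <-] := transition_img Dy; exists p.
have oE : open (d @` chart_dom d) by exact: chart_img_open.
have h := chain_partial oE (hf a) Ty (fun b => Ck_derivable (transition_Ck b 1 hc hd) Dy).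
transitivity (partial i (fun z => in_chart f d (transition c d z) 0 a) y).
  apply: partial_near; apply: (eq_near oD) Dy => z [p [dp dp'] <-].
  by rewrite /in_chart /transition !chart_mapK.
by rewrite (partial_eq (h i)); apply: eq_bigr => b _; rewrite !mxE.
Qed.

Lemma first_integral_change (f : Q -> 'rV[R]_m) c d p : atlas c -> atlas d ->
  (forall a, Ck_on 1 (d @` chart_dom d) (fun z => in_chart f d z 0 a)) ->
  chart_dom c p -> chart_dom d p ->
  first_integral (metric_coord c) kappa (in_chart f c) (c p) =
  first_integral (metric_coord d) kappa (in_chart f d) (d p).
Proof.
move=> hc hd hf dp dp'; have Dy : (c @` (chart_dom c `&` chart_dom d)) (c p) by exists p.
have Tp : transition c d (c p) = d p by rewrite /transition chart_mapK.
rewrite /first_integral /in_chart !chart_mapK //; congr (_ + _).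
rewrite (jac_change hc hd hf Dy) (metric_coord_change hc hd Dy) Tp.
have U : metric_coord c (c p) \in unitmx.
  by apply: (g_unit (D := c @` chart_dom c)); [move=> y; exact: (metric_coord_pos hc)|exists p].
have U' : metric_coord d (d p) \in unitmx.
  by apply: (g_unit (D := d @` chart_dom d)); [move=> y; exact: (metric_coord_pos hd)|exists p].
move: U; rewrite (metric_coord_change hc hd Dy) Tp !unitmx_mul unitmx_tr => /andP[/andP[UJ _] _].
move: (jac _ _) (jac _ _) (metric_coord _ _) UJ U' => Phi J G UJ UG.
have -> : invmx (J *m G *m J^T) = invmx J^T *m invmx G *m invmx J.
  have UJT : J^T \in unitmx by rewrite unitmx_tr.
  apply: (can_inj (mulKmx (_ : J *m G *m J^T \in unitmx))); rewrite ?unitmx_mul ?UJ ?UG //.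
  rewrite mulmxV ?unitmx_mul ?UJ ?UG // !mulmxA mulmxK // mulmxK //.
  by rewrite mulmxV.
by rewrite trmx_mul !mulmxA mulmxK ?unitmx_tr // mulmxKV.
Qed.

Theorem model_map : @simply_connected R Q -> constant_sectional_curvature Q kappa ->
  exists f : Q -> 'rV[R]_m, exists2 p0, f p0 = 0 & forall c, atlas c ->
   [/\ forall a k, Ck_on k (c @` chart_dom c) (fun y => in_chart f c y 0 a),
       forall a, hess_on (metric_coord c) kappa (c @` chart_dom c) (fun y => in_chart f c y 0 a) &
       forall y, (c @` chart_dom c) y -> first_integral (metric_coord c) kappa (in_chart f c) y = 1%:M].
Proof.
move=> sc cs; pose p0 : Q := point.
pose c0 := chart_at p0; have hc0 : atlas c0 by exact: chart_at_atlas.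
have dp0 : chart_dom c0 p0 by exact: chart_at_dom.
have Dp0 : (c0 @` chart_dom c0) (c0 p0) by exists p0.
have [L LE] := cholesky (metric_coord_sym hc0 Dp0) (metric_coord_pos hc0 Dp0).
(* The differentials at [p0] are the columns of the factor [L] of the metric; they are orthonormal
   because [L^T (L L^T)^-1 L = 1]. *)
have ex a := hess_global cs sc p0 (row_mx 0 (row a L^T)).
have [S hS] := choice (fun a => let: ex_intro2 s h1 h2 := ex a in
  ex_intro (fun s => (forall p, hess_near kappa s p) /\
     coord_jet c0 s p0 = row_mx 0 (row a L^T)) s (conj h1 h2)).
pose f p : 'rV[R]_m := \row_a S a p.
have fE c a : (fun y => in_chart f c y 0 a) = (fun y => S a (chart_inv c y)).
  by apply/funext => y; rewrite mxE.
have f0 : f p0 = 0.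
  apply/rowP => a; have [_ /(congr1 lsubmx)] := hS a; rewrite !row_mxKl chart_mapK // => /matrixP/(_ 0 0).
  by rewrite !mxE mulr1n.
have fk c : atlas c -> forall a k, Ck_on k (c @` chart_dom c) (fun y => in_chart f c y 0 a).
  by move=> hc a k; rewrite fE; exact: (hess_smooth k hc (proj1 (hS a))).
have fh c : atlas c -> forall a, hess_on (metric_coord c) kappa (c @` chart_dom c) (fun y => in_chart f c y 0 a).
  by move=> hc a; rewrite fE; exact: (hess_near_coord hc (proj1 (hS a))).
exists f; exists p0 => // c hc; split; [exact: fk|exact: fh|].
pose Om (p : Q) := first_integral (metric_coord (chart_at p)) kappa (in_chart f (chart_at p)) (chart_at p p).
have OmE d p : atlas d -> chart_dom d p ->
    first_integral (metric_coord d) kappa (in_chart f d) (d p) = Om p.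
  move=> hd dp; apply: first_integral_change => //; [exact: chart_at_atlas| |exact: chart_at_dom].
  by move=> a; apply: fk; exact: chart_at_atlas.
suff main p : Om p = 1%:M by move=> y [p dp <-]; rewrite OmE.
have [g [cg g0 g1 gc]] := path_exists p0 p sc.
rewrite -g1; have I1 : 0 <= (1 : R) <= 1 by rewrite ler01 lexx.
apply: (@itv_induction R (fun t => Om (g t) = 1%:M) _ _ 1 I1); rewrite ?g0.
  rewrite -(OmE c0) // /first_integral /in_chart chart_mapK // f0 mulmx0 scaler0 addr0.
  have -> : jac (fun y => f (chart_inv c0 y)) (c0 p0) = L.
    apply/matrixP => i a; rewrite mxE; have [_ /(congr1 rsubmx)] := hS a.
    rewrite !row_mxKr => /rowP/(_ i); rewrite !mxE => <-.
    by congr (partial i _ _); apply/funext => y; rewrite mxE.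
  have UL : L \in unitmx.
    have := g_unit (D := c0 @` chart_dom c0) (fun y => @metric_coord_pos _ _ _ _ y hc0) Dp0.
    by rewrite -LE unitmx_mul => /andP[].
  rewrite -LE.
  have -> : invmx (L *m L^T) = invmx L^T *m invmx L.
    apply: (can_inj (mulKmx (_ : L *m L^T \in unitmx))); rewrite ?unitmx_mul ?unitmx_tr ?UL //.
    by rewrite mulmxV ?unitmx_mul ?unitmx_tr ?UL // mulmxA mulmxK ?unitmx_tr // mulmxV.
  by rewrite mulmxA mulmxV ?unitmx_tr // mul1mx mulVmx.
move=> t _; pose d := chart_at (g t); have hd : atlas d by exact: chart_at_atlas.
have dg : chart_dom d (g t) by exact: chart_at_dom.
have oD : open (d @` chart_dom d) by exact: chart_img_open.
have Dg : (d @` chart_dom d) (d (g t)) by exists (g t).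
have /nbhs_ballP[r /= r0 Br] : nbhs (d (g t)) (d @` chart_dom d) by apply: open_nbhs_nbhs.
have oW : open (chart_dom d `&` d @^-1` ball (d (g t)) r).
  by apply: chart_pre_open; exact: ball_open.
have nW : nbhs (g t) (chart_dom d `&` d @^-1` ball (d (g t)) r).
  by apply: open_nbhs_nbhs; split=> //; split=> //; exact: ballxx.
have [e e0 he] := path_near (cg t) nW.
exists e => // t1 t2 _ _ h1 h2.
suff cst q : (chart_dom d `&` d @^-1` ball (d (g t)) r) q -> Om q = Om (g t).
  by rewrite (cst _ (he _ h1)) (cst _ (he _ h2)).
move=> [dq Bq]; rewrite -(OmE d) // -(OmE d (g t)) //.
have der y i : ball (d (g t)) r y ->
    is_derive y (delta_mx 0 i) (first_integral (metric_coord d) kappa (in_chart f d)) 0.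
  move=> /Br Dy; apply: (first_integral_derive oD) => //.
  - exact: metric_smooth.
  - by move=> z; exact: (metric_coord_sym hd).
  - by move=> z; exact: (metric_coord_pos hd).
  - exact: fh.
apply/matrixP => i j.
apply: (@grad_eq0_ball R m (fun y => first_integral (metric_coord d) kappa (in_chart f d) y i j)
   (d (g t)) r r0 _ _ (d q) Bq).
  move=> y /Br Dy; apply: (@Ck_continuous R m _ 0 (d @` chart_dom d)) => //.
  apply: first_integral_C0 => //; last exact: fh.
  - exact: metric_smooth.
  - by move=> z; exact: (metric_coord_pos hd).
by move=> y k Bqy; have /is_derive_mxP/(_ i j) := der y k Bqy; rewrite mxE.
Qed.

End ModelMap.

(** * Inverse function theorem with constants *)

Section LocalInverse.
Context {R : realType} {m : nat}.

Lemma mulmx_bound p q (M : 'M[R]_(p, q)) :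
  exists2 K : R, 0 < K & forall u : 'rV[R]_p, `|u *m M| <= K * `|u|.
Proof.
have [K K0 hK] := fin_bound (fun ab : 'I_p * 'I_q => M ab.1 ab.2).
exists (p%:R * K + 1); first by rewrite ltr_wpDl // mulr_ge0.
move=> u; apply: le_trans (norm_mulmx_le u K0 (fun a b => hK (a, b))) _.
by rewrite ler_wpM2r // lerDl.
Qed.

Lemma C1_strict_mx (D : set 'rV[R]_m) q (F : 'rV[R]_m -> 'rV[R]_q) y0 (e : R) : open D ->
  (forall a, Ck_on 1 D (fun y => F y 0 a)) -> D y0 -> 0 < e ->
  exists2 r : R, 0 < r & ball y0 r `<=` D /\ forall z z', ball y0 r z -> ball y0 r z' ->
  `|F z' - F z - (z' - z) *m jac F y0| <= e * `|z' - z|.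
Proof.
move=> oD hF Dy e0.
have [r0 r00 [B0 _]] : exists2 r : R, 0 < r & ball y0 r `<=` D /\ True.
  by have /nbhs_ballP[r r0 Br] : nbhs y0 D; [apply: open_nbhs_nbhs|exists r].
pose P a (d : R) := forall z z', ball y0 d z -> ball y0 d z' ->
  `|F z' 0 a - F z 0 a - \sum_i (z' 0 i - z 0 i) * partial i (fun y => F y 0 a) y0| <= e * `|z' - z|.
have h : \forall d \near (0 : R), forall a, P a d.
  apply: near_forall => a; have [r r_gt0 [_ hr]] := C1_strict oD (hF a) Dy e0.
  apply/nbhs_ballP; exists r => // d; rewrite ballE sub0r normrN => dr z z' Bz Bz'.
  have dr' : d <= r by apply: ltW; apply: le_lt_trans dr; exact: ler_norm.
  by apply: hr; [exact: le_ball Bz|exact: le_ball Bz'].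
have [e' /= e'0 he'] := (nbhs_ballP _ _).1 h.
exists (Num.min r0 (e' / 2)); first by rewrite lt_min r00 divr_gt0.
split=> [z Bz|z z' Bz Bz']; first by apply: B0; apply: le_ball Bz; rewrite ge_min lexx.
apply/rV_normP; first by rewrite mulr_ge0 // ltW.
move=> a; have := he' (e' / 2) _ a z z'.
have -> : (F z' - F z - (z' - z) *m jac F y0) 0 a =
    F z' 0 a - F z 0 a - \sum_i (z' 0 i - z 0 i) * partial i (fun y => F y 0 a) y0.
  by rewrite !mxE; congr (_ - _); apply: eq_bigr => i _; rewrite !mxE.
apply.
- by rewrite ballE sub0r normrN gtr0_norm ?divr_gt0 //; lra.
- by apply: le_ball Bz; rewrite ge_min lexx orbT.
- by apply: le_ball Bz'; rewrite ge_min lexx orbT.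
Qed.

Let half_absorb (a b c d K : R) : a <= b + c -> c <= K * d -> b <= 2^-1 * a -> a <= 2 * K * d.
Proof. lra. Qed.

Let halving (a b c q q' e : R) :
  a <= b / 2 -> b <= q -> c <= q' -> q' = q / 2 -> q < e / 2 -> 0 < e -> a + c <= e.
Proof. lra. Qed.

Let tri (u v : 'rV[R]_m) : `|u| <= `|v - u| + `|v|.
Proof. by rewrite addrC -{1}(subKr v u); exact: ler_normB. Qed.

(** Newton's iteration with the derivative frozen at [y0]. It needs only strict differentiability at
    that point and yields a Lipschitz constant for the inverse. *)
Lemma local_inverse (D : set 'rV[R]_m) (F : 'rV[R]_m -> 'rV[R]_m) y0 : open D ->
  (forall a, Ck_on 1 D (fun y => F y 0 a)) -> D y0 -> jac F y0 \in unitmx ->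
  exists r K rho : R, [/\ 0 < r, 0 < K, 0 < rho, ball y0 r `<=` D &
    (forall y y', ball y0 r y -> ball y0 r y' -> `|y - y'| <= K * `|F y - F y'|) /\
    forall w, ball (F y0) rho w -> exists2 y, ball y0 r y & F y = w].
Proof.
move=> oD hF Dy U; set P := jac F y0.
have [K K0 hK] := mulmx_bound (invmx P).
(* After multiplication by the inverse Jacobian, of norm at most [K], this error becomes one
   half. *)
have e0 : 0 < (2 * K)^-1 by rewrite invr_gt0 mulr_gt0.
have [r r0 [BD hr]] := C1_strict_mx oD hF Dy e0.
have st z z' : ball y0 r z -> ball y0 r z' ->
    `|(F z' - F z) *m invmx P - (z' - z)| <= 2^-1 * `|z' - z|.
  move=> Bz Bz'; have := hr z z' Bz Bz'.
  have -> : (F z' - F z) *m invmx P - (z' - z) = (F z' - F z - (z' - z) *m P) *m invmx P.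
    by rewrite [RHS]mulmxBl mulmxK.
  move=> h; apply: le_trans (hK _) _; apply: le_trans (ler_wpM2l (ltW K0) h) _.
  by rewrite mulrA invfM mulrCA mulfV ?gt_eqF // mulr1.
have lip y y' : ball y0 r y -> ball y0 r y' -> `|y - y'| <= (2 * K) * `|F y - F y'|.
  move=> By By'; exact: half_absorb (tri _ _) (hK _) (st _ _ By' By).
have cF y : ball y0 r y -> {for y, continuous F}.
  by move=> /BD Dy'; apply: rV_continuous => a; exact: Ck_continuous (hF a) Dy'.
(* The first step of the iteration has length [C < r / 4], and the following ones halve, so the
   iteration stays within [2 C < r] of [y0]. *)
exists r, (2 * K), (r / (4 * K)); split=> //; [exact: mulr_gt0|by rewrite divr_gt0 // mulr_gt0|split=> //].
move=> w; rewrite ballE => Bw.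
pose step y := y + (w - F y) *m invmx P.
pose C := `|(w - F y0) *m invmx P|.
have Cr : C + C < r.
  have h1 := hK (w - F y0).
  have h2 : K * `|w - F y0| < r / 4.
    by move: Bw; rewrite distrC ltr_pdivlMr ?mulr_gt0 // ltr_pdivlMr //; lra.
  by rewrite /C; lra.
have C0 : 0 <= C by exact: normr_ge0.
have pow k : 0 < (2 : R) ^+ k by rewrite exprn_gt0.
have stepE z z' : ball y0 r z -> ball y0 r z' -> `|step z' - step z| <= `|z' - z| / 2.
  move=> Bz Bz'; rewrite mulrC; apply: le_trans (st _ _ Bz Bz'); rewrite -normrN le_eqVlt; apply/orP; left.
  apply/eqP; congr (`| _ |); rewrite /step !mulmxBl.
  by apply/matrixP => i j; rewrite !mxE; ring.
have iter_ok k : `|iter k step y0 - y0| <= C + C - (C + C) / 2 ^+ k /\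
   `|iter k.+1 step y0 - iter k step y0| <= C / 2 ^+ k.
  elim: k => [|k [IH1 IH2]].
    rewrite expr0 divr1 !subrr normr0 divr1; split=> //=.
    by rewrite {1}/step addrC addKr.
  have B1 : ball y0 r (iter k step y0).
    rewrite ballE distrC; apply: le_lt_trans IH1 _.
    by have := divr_ge0 (addr_ge0 C0 C0) (ltW (pow k)); lra.
  have h1 : `|iter k.+1 step y0 - y0| <= C + C - (C + C) / 2 ^+ k.+1.
    rewrite -(subrK (iter k step y0) (iter k.+1 step y0)) -addrA.
    apply: le_trans (ler_normD _ _) _; apply: le_trans (lerD IH2 IH1) _.
    by rewrite exprS; have := pow k; move: (2 ^+ k) => x x0; rewrite le_eqVlt; apply/orP; left; apply/eqP; field; rewrite gt_eqF.
  split=> //.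
  have B2 : ball y0 r (iter k.+1 step y0).
    rewrite ballE distrC; apply: le_lt_trans h1 _.
    by have := divr_ge0 (addr_ge0 C0 C0) (ltW (pow k.+1)); lra.
  have := stepE _ _ B1 B2; rewrite -!iterS => h2; apply: le_trans h2 _.
  by rewrite exprSr invfM mulrA ler_wpM2r.
have [l hl] := geometric_cvg_rV (a := fun k => iter k step y0) (fun k => (iter_ok k).2).
have Bl : ball y0 r l.
  by rewrite ballE distrC; have := hl 0%N; rewrite expr0 divr1 /= => h; exact: le_lt_trans h Cr.
have small (e : R) : 0 < e -> exists k, (C + C) / 2 ^+ k < e.
  move=> e_gt0; pose c := (C + C) / e.
  exists (Num.truncn c).+1; rewrite ltr_pdivrMr ?exprn_gt0 //.
  rewrite -ltr_pdivrMl // mulrC; apply: lt_le_trans (truncnS_gt c) _.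
  by rewrite -natrX ler_nat ltnW // ltn_expl.
exists l => //.
have fix_l : step l = l.
  apply/eqP; rewrite -subr_eq0 -normr_le0; apply/ler_addgt0Pr => e e_gt0; rewrite add0r.
  have [|k ke] := small (e / 2); first by rewrite divr_gt0.
  have Bk : ball y0 r (iter k step y0).
    rewrite ballE distrC; apply: le_lt_trans (iter_ok k).1 _.
    by have := divr_ge0 (addr_ge0 C0 C0) (ltW (pow k)); lra.
  have h1 := stepE _ _ Bk Bl; have h2 := hl k; have h3 := hl k.+1.
  have -> : step l - l = (step l - step (iter k step y0)) + (iter k.+1 step y0 - l) by rewrite addrA subrK.
  apply: le_trans (ler_normD _ _) _; rewrite (distrC _ l).
  have h4 : (C + C) / 2 ^+ k.+1 = (C + C) / 2 ^+ k / 2 by rewrite exprSr invfM mulrA.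
  exact: halving h1 h2 h3 h4 ke e_gt0.
have : (w - F l) *m invmx P = 0 by apply: (addrI l); rewrite addr0; exact: fix_l.
move=> /(congr1 (fun M : 'rV[R]_m => M *m P)); rewrite mulmxKV // mul0mx => /eqP.
by rewrite subr_eq0 => /eqP.
Qed.

(** Serves to differentiate a continuous lift [y] of a curve [z]: the increment of [y] is first
    bounded by that of [z], then compared with it to first order. *)
Lemma is_derive_inverse (D : set 'rV[R]_m) (F : 'rV[R]_m -> 'rV[R]_m) (y z : R -> 'rV[R]_m) z' (t0 : R) :
  open D -> (forall a, Ck_on 1 D (fun y => F y 0 a)) -> D (y t0) -> jac F (y t0) \in unitmx ->
  {for t0, continuous y} -> (\forall t \near t0, F (y t) = z t) -> is_derive t0 1 z z' ->
  is_derive t0 1 y (z' *m invmx (jac F (y t0))).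
Proof.
move=> oD hF Dy U cy Fy [dz dzE]; set P := jac F (y t0).
have [K K0 hK] := mulmx_bound (invmx P).
have Hz : (h^-1 *: ((z \o shift t0) (h *: 1) - z t0)) @[h --> 0^'] --> z'.
  by rewrite -dzE; exact: dz.
have Fy0 : F (y t0) = z t0 by exact: nbhs_singleton Fy.
have H : (h^-1 *: ((y \o shift t0) (h *: 1) - y t0)) @[h --> 0^'] --> z' *m invmx P.
  apply/cvgrPdist_le => e e0.
  pose B := `|z'| + 1; have B0 : 0 < B by rewrite ltr_wpDl.
  (* The first bound gives [|dy| <= 2 K |dz|]; the second makes the final error at most [e / 2],
     with [B] bounding the difference quotients of [z]. *)
  pose e1 := Num.min (2 * K)^-1 (e / (4 * K * K * B)).
  have e10 : 0 < e1 by rewrite lt_min invr_gt0 !(divr_gt0, mulr_gt0).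
  have [r r0 [_ hr]] := C1_strict_mx oD hF Dy e10.
  have n1 : \forall h \near (0 : R)^', ball (y t0) r (y (h + t0)) /\ F (y (h + t0)) = z (h + t0).
    have n0 : \forall t \near t0, ball (y t0) r (y t) /\ F (y t) = z t.
      have nb : nbhs (y t0) (ball (y t0) r) by apply/nbhs_ballP; exists r.
      have h1 : \forall t \near t0, ball (y t0) r (y t) by exact: cy.
      by apply: filterS2 h1 Fy.
    apply: cvg_within; move: n0; rewrite -{1}[t0]add0r.
    exact: (@cvgD _ R^o _ (nbhs (0 : R)) _ id (fun=> t0) 0 t0 (@cvg_id _ _) (@cvg_cst _ _ _ _ _)).
  have n2 : \forall h \near (0 : R)^', `|z' - h^-1 *: ((z \o shift t0) (h *: 1) - z t0)| <= Num.min 1 (e / (2 * K)).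
    by move/cvgrPdist_le: Hz; apply; rewrite lt_min ltr01 divr_gt0 // mulr_gt0.
  have n3 : \forall h \near (0 : R)^', h != 0 by exact: nbhs_dnbhs_neq.
  apply: filterS3 n1 n2 n3 => h [Bh Fh] /=; rewrite [h *: 1]mulr1 => zh h0.
  have h1 := hr _ _ (ballxx _ r0) Bh; rewrite Fh Fy0 in h1.
  set dy := y (h + t0) - y t0 in h1 *; set dz0 := z (h + t0) - z t0 in h1 zh *.
  have h2 : `|dz0 *m invmx P - dy| <= K * (e1 * `|dy|).
    have -> : dz0 *m invmx P - dy = (dz0 - dy *m P) *m invmx P by rewrite [RHS]mulmxBl mulmxK.
    by apply: le_trans (hK _) _; rewrite ler_wpM2l // ltW.
  have Ke1 : K * e1 <= 2^-1.
    have : e1 <= (2 * K)^-1 by rewrite ge_min lexx.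
    by move=> /(ler_wpM2l (ltW K0)) /le_trans; apply; rewrite invfM mulrCA mulfV ?gt_eqF // mulr1.
  have h3 : `|dy| <= 2 * K * `|dz0|.
    have t3 : K * (e1 * `|dy|) <= 2^-1 * `|dy| by rewrite mulrA ler_wpM2r.
    exact: half_absorb (tri _ _) (hK _) (le_trans h2 t3).
  have h4 : `|h^-1 *: dz0| <= B.
    have : `|z' - h^-1 *: dz0| <= 1 by apply: le_trans zh _; rewrite ge_min lexx.
    have := ler_normB z' (z' - h^-1 *: dz0); rewrite opprB addrC subrK /B; lra.
  have -> : z' *m invmx P - h^-1 *: dy = (z' - h^-1 *: dz0) *m invmx P + h^-1 *: (dz0 *m invmx P - dy).
    by rewrite mulmxBl [h^-1 *: (_ *m _ - _)]scalerBr -scalemxAl addrA subrK.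
  apply: le_trans (ler_normD _ _) _.
  have b1 : `|(z' - h^-1 *: dz0) *m invmx P| <= e / 2.
    apply: le_trans (hK _) _; apply: le_trans (ler_wpM2l (ltW K0) zh) _.
    have : Num.min 1 (e / (2 * K)) <= e / (2 * K) by rewrite ge_min lexx orbT.
    move=> /(ler_wpM2l (ltW K0)) /le_trans; apply.
    by rewrite le_eqVlt; apply/orP; left; apply/eqP; field; rewrite gt_eqF.
  have b2 : `|h^-1 *: (dz0 *m invmx P - dy)| <= e / 2.
    rewrite normrZ in h4; rewrite normrZ; have hp : 0 <= `|h^-1| by [].
    have q1 : `|h^-1| * `|dz0 *m invmx P - dy| <= (K * e1) * (2 * K) * (`|h^-1| * `|dz0|).
      apply: le_trans (ler_wpM2l hp h2) _.
      have := ler_wpM2l (mulr_ge0 hp (mulr_ge0 (ltW K0) (ltW e10))) h3.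
      by move: `|h^-1| `|dy| `|dz0| => a b c; rewrite !mulrA; nra.
    apply: le_trans q1 _.
    have q2 : e1 <= e / (4 * K * K * B) by rewrite ge_min lexx orbT.
    apply: le_trans (ler_wpM2l _ h4) _; first by rewrite !mulr_ge0 // ltW.
    have := ler_wpM2l (_ : 0 <= 2 * K * K * B) q2.
    rewrite !mulr_ge0 ?(ltW K0) ?(ltW B0) // => /(_ isT) q3.
    apply: le_trans (_ : 2 * K * K * B * e1 <= _); first by nra.
    apply: le_trans q3 _.
    by rewrite le_eqVlt; apply/orP; left; apply/eqP; field; rewrite !gt_eqF.
  lra.
by apply: DeriveDef; [apply/cvg_ex; exists (z' *m invmx P); exact: H|exact: cvg_lim H].
Qed.

End LocalInverse.

(** * Properness of the model map *)

Import measurable_realfun.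

Section ModelMetric.
Context {R : realType} {m : nat}.

Definition sqn (v : 'rV[R]_m) : R := (v *m v^T) 0 0.

Lemma sqn_sum v : sqn v = \sum_a v 0 a ^+ 2.
Proof. by rewrite /sqn mxE; apply: eq_bigr => a _; rewrite mxE expr2. Qed.

Lemma sqn_ge0 v : 0 <= sqn v.
Proof. by rewrite sqn_sum; apply: sumr_ge0 => a _; exact: sqr_ge0. Qed.

Lemma sqnZ a v : sqn (a *: v) = a ^+ 2 * sqn v.
Proof. by rewrite !sqn_sum mulr_sumr; apply: eq_bigr => i _; rewrite mxE exprMn. Qed.

(** [P^T G^-1 P] is a rank-one perturbation of the identity, inverted by the Sherman-Morrison
    formula. The sign of [kappa] keeps the denominator positive. *)
Lemma model_metric (G P : 'M[R]_m) (F : 'rV[R]_m) (kappa : R) : kappa <= 0 -> G \in unitmx ->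
  P^T *m invmx G *m P + kappa *: (F^T *m F) = 1%:M ->
  P \in unitmx /\ G = P *m (1%:M + (kappa / (1 - kappa * sqn F)) *: (F^T *m F)) *m P^T.
Proof.
move=> k0 UG H; have q0 : 0 < 1 - kappa * sqn F by have := sqn_ge0 F; nra.
set b := kappa / _; set A' := 1%:M + _.
have FF : F^T *m F *m (F^T *m F) = sqn F *: (F^T *m F).
  by rewrite mulmxA -(mulmxA F^T) [F *m F^T]mx11_scalar mul_mx_scalar -scalemxAl.
have A1 : (P^T *m invmx G *m P) *m A' = 1%:M.
  have -> : P^T *m invmx G *m P = 1%:M - kappa *: (F^T *m F) by rewrite -H addrK.
  rewrite mulmxBl mul1mx -scalemxAl mulmxDr mulmx1 -scalemxAr FF !scalerDr !scalerA.
  have -> : kappa * b * sqn F = b - kappa by rewrite /b; field; rewrite gt_eqF.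
  by rewrite /A' scalerBl subrKC addrK.
have [UA UA'] := mulmx1_unit A1.
have UP : P \in unitmx by move: UA; rewrite unitmx_mul => /andP[].
split=> //; have UPT : P^T \in unitmx by rewrite unitmx_tr.
apply: (can_inj (mulKmx (_ : P^T *m invmx G \in unitmx))); first by rewrite unitmx_mul UPT unitmx_inv.
by rewrite mulmxKV // !mulmxA A1 mul1mx.
Qed.

Lemma lipschitz_continuous (X : normedModType R) q (Y : X -> 'rV[R]_q) (w0 w : X) (rho K : R) : 0 < K ->
  ball w0 rho w -> (forall w', ball w0 rho w' -> `|Y w - Y w'| <= K * `|w - w'|) -> {for w, continuous Y}.
Proof.
move=> K0 Bw lip; apply/cvgrPdist_le => e e0.
have n1 : \forall w' \near w, ball w0 rho w'.
  have := Bw; rewrite ballE -subr_gt0 => d0; apply/nbhs_ballP; exists (rho - `|w0 - w|) => // w'.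
  rewrite !ballE => h; have := ler_normD (w0 - w) (w - w'); rewrite addrA subrK; lra.
have n2 : \forall w' \near w, `|w - w'| <= e / K.
  apply/nbhs_ballP; exists (e / K) => /=; first by rewrite divr_gt0.
  by move=> w'; rewrite ballE => /ltW.
apply: filterS2 n1 n2 => w' Bw' hw; apply: le_trans (lip _ Bw') _.
by rewrite mulrC -ler_pdivlMr.
Qed.

End ModelMetric.

(** * Lifting rays through the model map *)

Section ModelCompact.
Context {R : realType} {m : nat} (Q : riemannianManifold R m) (kappa : R) (f : Q -> 'rV[R]_m) (p0 : Q).
Hypothesis kappa_le0 : kappa <= 0.
Hypothesis f0 : f p0 = 0.
Hypothesis f_smooth : forall c, atlas c -> forall a k, Ck_on k (c @` chart_dom c) (fun y => in_chart f c y 0 a).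
Hypothesis f_integral : forall c, atlas c -> forall y, (c @` chart_dom c) y ->
  first_integral (metric_coord c) kappa (in_chart f c) y = 1%:M.
Implicit Types (c d : chart R m Q) (v : 'rV[R]_m).

Lemma conformal_gt0 x : 0 <= x -> 0 < 1 - kappa * x.
Proof. by move=> x0; have := mulr_le0_ge0 kappa_le0 x0; lra. Qed.

Lemma model_jac c y : atlas c -> (c @` chart_dom c) y -> jac (in_chart f c) y \in unitmx /\
  metric_coord c y = jac (in_chart f c) y *m (1%:M + (kappa / (1 - kappa * sqn (in_chart f c y))) *:
    ((in_chart f c y)^T *m in_chart f c y)) *m (jac (in_chart f c) y)^T.
Proof.
move=> hc Dy; apply: model_metric => //; last exact: f_integral.
by apply: (g_unit (D := c @` chart_dom c)) => // z; exact: (metric_coord_pos hc).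
Qed.

Lemma in_chart_continuous c y : atlas c -> (c @` chart_dom c) y -> {for y, continuous (in_chart f c)}.
Proof. by move=> hc Dy; apply: rV_continuous => a; exact: Ck_continuous (f_smooth hc a 0) Dy. Qed.

Lemma model_continuous : continuous f.
Proof.
move=> p; pose c := chart_at p; have dp : chart_dom c p by exact: chart_at_dom.
have oD : open (chart_dom c) by exact: chart_dom_open.
apply: (continuous_near (f := in_chart f c \o c) oD _ dp).
  by move=> q dq; rewrite /in_chart /= chart_mapK.
apply: continuous_comp; first exact: chart_map_continuous.
by apply: in_chart_continuous; [exact: chart_at_atlas|exists p].
Qed.

Lemma local_section p : exists (W : set Q) (rho : R) (s : 'rV[R]_m -> Q), [/\ open W, W p, 0 < rho,
    forall q q', W q -> W q' -> f q = f q' -> q = q' &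
    forall w : 'rV[R]_m, ball (f p) rho w -> [/\ W (s w), f (s w) = w & {for w, continuous s}]].
Proof.
pose c := chart_at p; have hc : atlas c by exact: chart_at_atlas.
have dp : chart_dom c p by exact: chart_at_dom.
have Dp : (c @` chart_dom c) (c p) by exists p.
have oD : open (c @` chart_dom c) by exact: chart_img_open.
have [r [K [rho [r0 K0 rho0 BD [lip sur]]]]] :=
  local_inverse oD (fun a => f_smooth hc a 1) Dp (proj1 (model_jac hc Dp)).
rewrite /in_chart chart_mapK // in sur.
have sur' (w : 'rV[R]_m) : exists y : 'rV[R]_m, ball (f p) rho w -> ball (c p) r y /\ in_chart f c y = w.
  have [Bw|nB] := pselect (ball (f p) rho w); last by exists 0.
  by have [y By Fy] := sur w Bw; exists y.
have [Y hY] := choice sur'.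
exists (chart_dom c `&` c @^-1` ball (c p) r), rho, (fun w => chart_inv c (Y w)); split=> //.
- by apply: chart_pre_open; exact: ball_open.
- by split=> //; exact: ballxx.
- move=> q q' [dq Bq] [dq' Bq'] e.
  rewrite -(chart_mapK dq) -(chart_mapK dq'); congr chart_inv.
  have := lip _ _ Bq Bq'; rewrite /in_chart !chart_mapK // e subrr normr0 mulr0 => h.
  by apply/eqP; rewrite -subr_eq0 -normr_le0.
move=> w Bw; have [BY FY] := hY w Bw; have [E1 E2] := chart_imgK (BD _ BY).
split=> //; first by split=> //=; rewrite E1.
apply: (@continuous_comp _ _ _ Y (chart_inv c)); last by apply: chart_inv_continuous; exact: BD.
apply: (lipschitz_continuous K0 Bw) => w' Bw'; have [BY' FY'] := hY w' Bw'.
by apply: le_trans (lip _ _ BY BY') _; rewrite FY FY'.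
Qed.

(** Equality spreads because [f] is locally injective, inequality because [Q] is Hausdorff. *)
Lemma lift_unique (g g' : R -> Q) : continuous g -> continuous g' -> g 0 = g' 0 ->
  (forall t, 0 <= t <= 1 -> f (g t) = f (g' t)) -> forall t, 0 <= t <= 1 -> g t = g' t.
Proof.
move=> cg cg' E0 E; apply: itv_induction => // t t01.
have [e|ne] := pselect (g t = g' t).
  have [W [rho [s [oW Wp _ inj _]]]] := local_section (g t).
  have nW : nbhs (g t) W by apply: open_nbhs_nbhs.
  have [e1 e10 h1] := path_near (cg t) nW.
  rewrite e in nW; have [e2 e20 h2] := path_near (cg' t) nW.
  exists (Num.min e1 e2); first by rewrite lt_min e10.
  move=> t1 t2 _ t201 _; rewrite lt_min => /andP[d1 d2] _.
  by apply: inj; [exact: h1|exact: h2|exact: E].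
(* Distinct values stay distinct nearby, so the implication to be proved is vacuous. *)
have neq : g t != g' t by apply/eqP.
have := @manifold_hausdorff R m Q; rewrite open_hausdorff => /(_ _ _ neq)[[A B] /= [Ag Bg] [oA oB AB]].
rewrite !inE in Ag Bg.
have [e1 e10 h1] := path_near (cg t) (open_nbhs_nbhs (conj oA Ag)).
have [e2 e20 h2] := path_near (cg' t) (open_nbhs_nbhs (conj oB Bg)).
exists (Num.min e1 e2); first by rewrite lt_min e10.
move=> t1 t2 _ _; rewrite lt_min => /andP[d1 d2] _ e.
have : (A `&` B) (g t1) by split; [exact: h1|rewrite e; exact: h2].
by rewrite (eqP AB).
Qed.

Definition ray_lift v (T : R) (g : R -> Q) :=
  [/\ continuous g, g 0 = p0 & forall t, 0 <= t <= T -> f (g t) = t *: v].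

Lemma ray_lift_unique v (T T' : R) g g' (t : R) : ray_lift v T g -> ray_lift v T' g' ->
  0 <= t -> t <= T -> t <= T' -> g t = g' t.
Proof.
move=> [cg g0 gE] [cg' g0' gE'] t0 tT tT'.
have cM : continuous (fun s : R => s * t).
  by move=> s; apply: continuousM; [exact: cvg_id|exact: cst_continuous].
have I1 : 0 <= (1 : R) <= 1 by rewrite ler01 lexx.
have := @lift_unique (fun s => g (s * t)) (fun s => g' (s * t)) _ _ _ _ 1 I1; rewrite !mul1r; apply.
- by move=> s; apply: (@continuous_comp _ _ _ (fun s : R => s * t) g); [exact: cM|exact: cg].
- by move=> s; apply: (@continuous_comp _ _ _ (fun s : R => s * t) g'); [exact: cM|exact: cg'].
- by rewrite mul0r g0 g0'.
- move=> s /andP[s0 s1]; have st : 0 <= s * t by rewrite mulr_ge0.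
  have st' : s * t <= t by rewrite ler_piMl.
  by rewrite gE ?gE' // st /= (le_trans st').
Qed.

Lemma ray_lift_extend v (T T' rho : R) g (W : set Q) (s : 'rV[R]_m -> Q) p : ray_lift v T g -> 0 <= T -> T <= T' ->
  (forall q q', W q -> W q' -> f q = f q' -> q = q') ->
  (forall w : 'rV[R]_m, ball (f p) rho w -> [/\ W (s w), f (s w) = w & {for w, continuous s}]) ->
  W (g T) -> (forall t, T <= t <= T' -> ball (f p) rho (t *: v)) -> exists g', ray_lift v T' g'.
Proof.
move=> [cg g0 gE] T0 TT inj sec WT Bt.
(* The new piece is the local section along the ray, frozen outside the interval from [T] to [T'] to
   make it a map of the whole line. *)
pose cl (t : R) := Num.max T (Num.min t T').
have clP t : T <= cl t <= T' by rewrite /cl le_max lexx /= ge_max TT /= ge_min lexx orbT.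
have cl_id t : T <= t <= T' -> cl t = t.
  by move=> /andP[h1 h2]; rewrite /cl (min_idPl h2) (max_idPr h1).
have ccl : continuous cl.
  move=> t; apply: (@continuous_comp _ _ _ (fun s : R => Num.min s T') (fun s : R => Num.max T s)).
    by apply: continuous_min; [exact: cvg_id|exact: cst_continuous].
  by apply: continuous_max; [exact: cst_continuous|exact: cvg_id].
pose g2 t := s (cl t *: v).
have cg2 : continuous g2.
  move=> t; have [_ _ cs] := sec _ (Bt _ (clP t)).
  apply: (@continuous_comp _ _ _ (fun t => cl t *: v) s); last exact: cs.
  by apply: (@continuousZr_tmp _ _ _ cl); exact: ccl.
have gT : g T = g2 T.
  have TT' : T <= T <= T' by rewrite lexx.
  have [h1 h2 _] := sec _ (Bt T TT'); apply: inj => //; rewrite /g2 cl_id // ?h2.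
  by apply: gE; rewrite T0 lexx.
exists (fun t => if t <= T then g t else g2 t); split.
- exact: continuous_glue.
- by rewrite T0.
- move=> t /andP[t0 tT']; case: leP => tT; first by apply: gE; rewrite t0.
  have tT2 : T <= t <= T' by rewrite ltW.
  by have [_ h _] := sec _ (Bt t tT2); rewrite /g2 cl_id.
Qed.

Lemma ball_segment v (T : R) (rho : R) : 0 < rho ->
  exists2 e : R, 0 < e & forall t : R, `|t - T| < e -> ball (T *: v) rho (t *: v).
Proof.
move=> r0; exists (rho / (`|v| + 1)); first by rewrite divr_gt0 // ltr_wpDl.
move=> t ht; rewrite ballE -scalerBl normrZ distrC.
have := ht; rewrite ltr_pdivlMr ?ltr_wpDl // => h; apply: le_lt_trans h.
by rewrite ler_wpM2l // lerDl.
Qed.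

Lemma ray_lift_open v (T : R) g : 0 <= T -> ray_lift v T g ->
  exists2 e : R, 0 < e & exists g', ray_lift v (T + e) g'.
Proof.
move=> T0 lg; have [W [rho [s [oW Wp rho0 inj sec]]]] := local_section (g T).
have fT : f (g T) = T *: v by case: lg => _ _; apply; rewrite T0 lexx.
have [e e0 he] := ball_segment v T rho0.
exists (e / 2); first by rewrite divr_gt0.
have Te : T <= T + e / 2 by rewrite lerDl ltW // divr_gt0.
apply: (ray_lift_extend lg T0 Te inj sec) => // t /andP[t0 t1].
by rewrite fT; apply: he; rewrite ger0_norm ?subr_ge0 //; lra.
Qed.

(** Speed, in the metric of [model_metric], of a curve lying over the curve [u t *: v]. *)
Definition ray_speed v (u u' : R -> R) (t : R) : R :=
  Num.sqrt (u' t ^+ 2 * (sqn v + kappa / (1 - kappa * (u t ^+ 2 * sqn v)) * (u t ^+ 2 * sqn v ^+ 2))).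

Lemma ray_quad (P G : 'M[R]_m) v (F : 'rV[R]_m) (u u' b : R) : P \in unitmx ->
  G = P *m (1%:M + b *: (F^T *m F)) *m P^T -> F = u *: v ->
  ((u' *: v *m invmx P) *m G *m (u' *: v *m invmx P)^T) 0 0 =
  u' ^+ 2 * (sqn v + b * (u ^+ 2 * sqn v ^+ 2)).
Proof.
move=> UP -> ->.
have -> : (u' *: v *m invmx P) *m (P *m (1%:M + b *: ((u *: v)^T *m (u *: v))) *m P^T) *m (u' *: v *m invmx P)^T
   = (u' *: v) *m (1%:M + b *: ((u *: v)^T *m (u *: v))) *m (u' *: v)^T.
  by rewrite trmx_mul !mulmxA mulmxKV // -!mulmxA (mulmxA P^T) -trmx_mul mulVmx // trmx1 mul1mx.
rewrite mulmxDr mulmx1 mulmxDl -!scalemxAr -!scalemxAl !linearZ /= -!scalemxAl -!scalemxAr -!scalemxAl mulmxA.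
rewrite -mulmxA [v *m v^T]mx11_scalar -/(sqn v) -scalar_mxM !mxE !mulr1n.
ring.
Qed.

Lemma ray_curve v (h : R -> Q) (u u' : R -> R) : continuous h -> continuous u' ->
  (forall t : R, is_derive t 1 u (u' t)) -> (forall t, f (h t) = u t *: v) ->
  C1_curve h /\ forall t, speed h t = ray_speed v u u' t.
Proof.
move=> ch cu' du fh.
have der (c : chart R m Q) (t : R) : atlas c -> chart_dom c (h t) ->
    is_derive t 1 (c \o h : R -> 'rV[R]_m) (u' t *: v *m invmx (jac (in_chart f c) (c (h t)))).
  move=> hc dh; have oD : open (c @` chart_dom c) by exact: chart_img_open.
  have Dh : (c @` chart_dom c) (c (h t)) by exists (h t).
  apply: (is_derive_inverse (z := fun t => u t *: v) oD (fun a => f_smooth hc a 1) Dh (proj1 (model_jac hc Dh))).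
  - by apply: continuous_comp; [exact: ch|exact: chart_map_continuous].
  - have : \forall s \near t, chart_dom c (h s).
      by apply: ch; apply: open_nbhs_nbhs; split=> //; exact: chart_dom_open.
    by apply: filterS => s ds; rewrite /in_chart /= chart_mapK.
  - apply/is_derive_mxP => i j; have := is_deriveMl (v i j) (du t).
    by rewrite [(u' t *: v) i j]mxE mulrC; congr is_derive; apply/funext => s; rewrite [RHS]mxE mulrC.
split; last first.
  move=> t; rewrite /speed; set c := chart_at (h t).
  have hc : atlas c by exact: chart_at_atlas.
  have dh : chart_dom c (h t) by exact: chart_at_dom.
  have Dh : (c @` chart_dom c) (c (h t)) by exists (h t).
  rewrite derive1E; have [_ ->] := der c t hc dh.
  have [UP GE] := model_jac hc Dh; rewrite /metric_coord /in_chart !chart_mapK // in GE.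
  have Fh := fh t.
  by rewrite (ray_quad _ UP GE Fh) Fh sqnZ.
split; first exact: ch.
move=> c t hc dh; have [d1 d2] := der c t hc dh; split; first exact: d1.
have oU : open (h @^-1` chart_dom c) by apply: open_comp => [s _|]; [exact: ch|exact: chart_dom_open].
apply: (continuous_near (f := fun s => u' s *: v *m invmx (jac (in_chart f c) (c (h s)))) oU _ dh).
  by move=> s ds; rewrite derive1E; have [_ ->] := der c s hc ds.
have Dh : (c @` chart_dom c) (c (h t)) by exists (h t).
have oD : open (c @` chart_dom c) by exact: chart_img_open.
have UP z : (c @` chart_dom c) z -> jac (in_chart f c) z \in unitmx by move=> Dz; have [] := model_jac hc Dz.
have cI a b : {for t, continuous (fun s => invmx (jac (in_chart f c) (c (h s))) a b)}.
  apply: (@continuous_comp _ _ _ (c \o h) (fun z => invmx (jac (in_chart f c) z) a b)).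
    by apply: continuous_comp; [exact: ch|exact: chart_map_continuous].
  apply: (Ck_continuous (k := 0) (D := c @` chart_dom c)) Dh.
  apply: (Ck_invmx oD UP) => i j; apply: (jac_Ck oD) => a'; exact: f_smooth.
apply: rV_continuous => b.
have -> : (fun s => (u' s *: v *m invmx (jac (in_chart f c) (c (h s)))) 0 b) =
   \sum_a (fun s => u' s * v 0 a * invmx (jac (in_chart f c) (c (h s))) a b).
  by apply/funext => s; rewrite fct_sumE mxE; apply: eq_bigr => a _; rewrite mxE.
elim/big_ind: _ => [|p q cp cq|a _]; first exact: cst_continuous.
  exact: (continuousD cp cq).
apply: (@continuousM _ _ (fun s => u' s * v 0 a)); last exact: cI.
by apply: (@continuousM _ _ u' (fun=> v 0 a)); [exact: cu'|exact: cst_continuous].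
Qed.

(** As [kappa <= 0], the rank-one term of the metric only shortens vectors: a lift is never longer
    than its Euclidean image. This is what brings the completeness of [Q] into play. *)
Lemma ray_speed_le v u u' t (K : R) : 0 <= K -> `|u' t| <= K -> ray_speed v u u' t <= K * Num.sqrt (sqn v).
Proof.
move=> K0 hu; have s0 := sqn_ge0 v.
rewrite -(ger0_norm K0) -sqrtr_sqr -sqrtrM ?sqr_ge0 // ler_wsqrtr //.
have q0 : 0 < 1 - kappa * (u t ^+ 2 * sqn v).
  by apply: conformal_gt0; apply: mulr_ge0 => //; exact: sqr_ge0.
have h1 : kappa / (1 - kappa * (u t ^+ 2 * sqn v)) * (u t ^+ 2 * sqn v ^+ 2) <= 0.
  apply: mulr_le0_ge0; last by apply: mulr_ge0; exact: sqr_ge0.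
  by rewrite pmulr_lle0 // invr_gt0.
have h2 : u' t ^+ 2 <= K ^+ 2 by rewrite -[u' t ^+ 2]real_normK ?num_real // ler_sqr ?nnegrE.
apply: le_trans (_ : u' t ^+ 2 * sqn v <= _); last by rewrite ler_wpM2r.
by rewrite ler_wpM2l ?sqr_ge0 // gerDl.
Qed.

Lemma ray_speed_continuous v u u' : continuous u -> continuous u' -> continuous (ray_speed v u u').
Proof.
move=> cu cu' t; have s0 := sqn_ge0 v.
have q0 : 1 - kappa * (u t ^+ 2 * sqn v) != 0.
  by rewrite gt_eqF //; apply: conformal_gt0; apply: mulr_ge0 => //; exact: sqr_ge0.
apply: (@continuous_comp _ _ _ (fun t => u' t ^+ 2 * (sqn v + kappa / (1 - kappa * (u t ^+ 2 * sqn v)) * (u t ^+ 2 * sqn v ^+ 2))) Num.sqrt); last exact: sqrt_continuous.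
have cc (a : R) : {for t, continuous (fun _ : R => a)} by exact: cst_continuous.
have cM (a b : R -> R) : {for t, continuous a} -> {for t, continuous b} -> {for t, continuous (fun s => a s * b s)}.
  by move=> ca cb; exact: continuousM.
have cD (a b : R -> R) : {for t, continuous a} -> {for t, continuous b} -> {for t, continuous (fun s => a s + b s)}.
  by move=> ca cb; exact: continuousD.
have cN (a : R -> R) : {for t, continuous a} -> {for t, continuous (fun s => - a s)}.
  by move=> ca; exact: continuousN.
have c2 (a : R -> R) : {for t, continuous a} -> {for t, continuous (fun s => a s ^+ 2)} by move=> ca; exact: cM.
have h1 : {for t, continuous (fun s => kappa * (u s ^+ 2 * sqn v))}.
  exact: (cM (fun=> kappa) (fun s => u s ^+ 2 * sqn v) (cc _) (cM (fun s => u s ^+ 2) (fun=> sqn v) (c2 _ (cu t)) (cc _))).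
have h2 : {for t, continuous (fun s => (1 - kappa * (u s ^+ 2 * sqn v))^-1)}.
  exact: (@continuousV _ _ (fun s => 1 - kappa * (u s ^+ 2 * sqn v)) _ q0 (cD (fun=> 1) _ (cc 1) (cN _ h1))).
have h3 : {for t, continuous (fun s => kappa / (1 - kappa * (u s ^+ 2 * sqn v)) * (u s ^+ 2 * sqn v ^+ 2))}.
  exact: (cM (fun s => kappa / (1 - kappa * (u s ^+ 2 * sqn v))) (fun s => u s ^+ 2 * sqn v ^+ 2)
    (cM (fun=> kappa) _ (cc _) h2) (cM (fun s => u s ^+ 2) (fun=> sqn v ^+ 2) (c2 _ (cu t)) (cc _))).
exact: (cM (fun s => u' s ^+ 2) _ (c2 _ (cu' t)) (cD (fun=> sqn v) _ (cc _) h3)).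
Qed.

Lemma ray_dist v (T : R) g (t1 t2 : R) : ray_lift v T g -> 0 <= t1 <= T -> 0 <= t2 <= T ->
  (riemannian_dist (g t1) (g t2) <= (`|t2 - t1| * pi * Num.sqrt (sqn v))%:E)%E.
Proof.
move=> [cg g0 gE] /andP[t10 t1T] /andP[t20 t2T].
(* The cosine keeps the parameter between [t1] and [t2] at all real times, where the lift is known
   to lie over the ray, and makes the curve C^1 on the whole line. The bound on its slope
   contributes the factor [pi]. *)
pose u (s : R) := t1 + (t2 - t1) * ((1 - cos (pi * s)) / 2).
pose u' (s : R) := (t2 - t1) * (pi / 2) * sin (pi * s).
have du (s : R) : is_derive s 1 u (u' s).
  have h1 : is_derive s 1 (fun s : R => pi * s) pi.
    by have := is_deriveMl pi (is_derive_id s 1); rewrite mulr1.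
  have h2 := is_derive1_comp (is_derive_cos (pi * s)) h1.
  have h3 := is_deriveMl (- ((t2 - t1) / 2)) h2.
  have := @is_deriveD _ _ _ _ _ _ _ _ _ (is_derive_cst (t1 + (t2 - t1) / 2) s 1) h3.
  congr is_derive; last by rewrite /u' add0r; field.
  apply/funext => w.
  by change (t1 + (t2 - t1) / 2 + - ((t2 - t1) / 2) * cos (pi * w) = t1 + (t2 - t1) * ((1 - cos (pi * w)) / 2)); field.
have cpi : continuous (fun s : R => pi * s).
  by move=> s; apply: (@continuousM _ _ (fun=> pi) id); [exact: cst_continuous|exact: cvg_id].
have cu : continuous u.
  by move=> s; have [d _] := du s; apply: differentiable_continuous; exact/derivable1_diffP.
have cu' : continuous u'.
  move=> s; apply: (@continuousM _ _ (fun=> (t2 - t1) * (pi / 2)) (fun s => sin (pi * s))); first exact: cst_continuous.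
  by apply: (@continuous_comp _ _ _ (fun s : R => pi * s) sin); [exact: cpi|exact: continuous_sin].
have u01 s : 0 <= u s <= T.
  have := cos_geN1 (pi * s); have := cos_le1 (pi * s); rewrite /u.
  set x := (1 - cos _) / 2 => h1 h2; have x0 : 0 <= x by rewrite /x; lra.
  have x1 : x <= 1 by rewrite /x; lra.
  by apply/andP; split; nra.
have cgu : continuous (g \o u) by move=> s; apply: continuous_comp; [exact: cu|exact: cg].
have [C1 sp] := ray_curve (v := v) cgu cu' du (fun s => gE _ (u01 s)).
apply: (@le_trans _ _ (curve_length (g \o u))).
  apply: ereal_inf_lbound; exists (g \o u) => //; split=> //=.
    by rewrite /u mulr0 cos0 subrr mul0r mulr0 addr0.
  by rewrite /u mulr1 cospi opprK -[1 + 1]/(2%:R) divff ?pnatr_eq0 // mulr1 subrKC.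
rewrite /curve_length.
have mI : measurable (`[0%R, 1%R] : set R) by exact: measurable_itv.
apply: (@le_trans _ _ (\int[lebesgue_measure]_(t in `[0%R, 1%R]) (cst (`|t2 - t1| * pi * Num.sqrt (sqn v))%:E t))%E).
  apply: ge0_le_integral => //.
  - by move=> s _; rewrite lee_fin sqrtr_ge0.
  - apply/measurable_EFinP; rewrite (_ : speed _ = ray_speed v u u'); last by apply/funext.
    apply: measurable_funTS; apply: continuous_measurable_fun; exact: ray_speed_continuous.
  - move=> s _; rewrite /cst lee_fin sp; apply: ray_speed_le; first by rewrite mulr_ge0 // pi_ge0.
    rewrite /u' !normrM -mulrA ler_wpM2l // ger0_norm ?divr_ge0 ?pi_ge0 //.
    have : `|sin (pi * s)| <= 1 by rewrite ler_norml sin_geN1 sin_le1.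
    rewrite (_ : `|2^-1| = 2^-1); last by rewrite ger0_norm // invr_ge0.
    have := pi_ge0 R; move: `|sin (pi * s)| (normr_ge0 (sin (pi * s))) pi => x x0 y; nra.
rewrite integral_cst //= lebesgue_measure_itv /= lte_fin ltr01 -EFinD subr0 mule1 //.
Qed.

Hypothesis cplt : riemannian_complete Q.

(** By [ray_dist] the lifts at times increasing to [T] form a Cauchy sequence in [Q]; the local
    section at their limit continues one of them up to [T]. *)
Lemma ray_lift_closed v (T : R) : 0 < T ->
  (forall t, 0 <= t -> t < T -> exists g, ray_lift v t g) -> exists g, ray_lift v T g.
Proof.
move=> T0 ex.
have ex' t : exists g, 0 <= t -> t < T -> ray_lift v t g.
  have [t0|t0] := leP 0 t; last by exists (fun=> p0).
  have [tT|tT] := ltP t T; first by have [g hg] := ex t t0 tT; exists g.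
  by exists (fun=> p0).
have [G hG] := choice ex'.
pose u (n : nat) : R := T - T * n.+1%:R^-1.
have un n : 0 <= u n /\ u n < T.
  have n1 : (n.+1%:R : R)^-1 <= 1 by rewrite invf_le1 ?ler1n // ltr0n.
  have n0 : 0 < (n.+1%:R : R)^-1 by rewrite invr_gt0 ltr0n.
  by rewrite /u; move: (n.+1%:R^-1) n1 n0 => x n1 n0; split; nra.
pose q n := G (u n) (u n).
have lq n : ray_lift v (u n) (G (u n)) by have [h1 h2] := un n; exact: hG.
have cu : u @ \oo --> T.
  rewrite -[X in _ --> X]subr0 -[X in _ - X](mulr0 T).
  apply: cvgB; first exact: cvg_cst.
  by apply: cvgM; [exact: cvg_cst|exact: cvg_harmonic].
have qd i j : (riemannian_dist (q i) (q j) <= (`|u j - u i| * pi * Num.sqrt (sqn v))%:E)%E.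
  have [i0 iT] := un i; have [j0 jT] := un j.
  have [ij|/ltW ij] := leP (u i) (u j).
    have -> : q i = G (u j) (u i) by apply: (ray_lift_unique (lq i) (lq j)).
    by apply: (ray_dist (lq j)); rewrite ?lexx ?andbT // i0.
  have -> : q j = G (u i) (u j) by apply: (ray_lift_unique (lq j) (lq i)).
  by apply: (ray_dist (lq i)); rewrite ?lexx ?andbT // j0.
have [e e0|p qp] := cplt (u := q).
  pose C : R := pi * Num.sqrt (sqn v) + 1.
  have C0 : 0 < C by rewrite ltr_wpDl // mulr_ge0 ?pi_ge0 ?sqrtr_ge0.
  have /cvgrPdist_lt/(_ (e / C / 2)) := cu; rewrite !divr_gt0 // => /(_ isT)[N _ hN].
  exists N => i j Ni Nj; apply: le_lt_trans (qd i j) _; rewrite lte_fin -mulrA.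
  have h1 := hN i Ni; have h2 := hN j Nj.
  have h3 : `|u j - u i| < e / C.
    have -> : u j - u i = (T - u i) - (T - u j) by ring.
    by apply: le_lt_trans (ler_normB _ _) _; move: h1 h2 => /=; lra.
  have h4 : 0 <= pi * Num.sqrt (sqn v) by rewrite mulr_ge0 ?pi_ge0 ?sqrtr_ge0.
  move: h3; rewrite ltr_pdivlMr // => h3; apply: le_lt_trans h3.
  by rewrite ler_wpM2l // /C lerDl.
have fp : f p = T *: v.
  have c1 : (fun n => f (q n)) @ \oo --> f p by apply: continuous_cvg qp; exact: model_continuous.
  have c2 : (fun n => f (q n)) @ \oo --> T *: v.
    have -> : (fun n => f (q n)) = (fun n => u n *: v).
      by apply/funext => n; have [_ _ ->] := lq n; rewrite // (un n).1 lexx.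
    by apply: cvgZr_tmp.
  exact: (cvg_unique (@norm_hausdorff _ _) c1 c2).
have [W [rho [s [oW Wp rho0 inj sec]]]] := local_section p.
have [d d0 hd] := ball_segment v T rho0.
have n1 : \forall n \near \oo, W (q n) by apply: qp; apply: open_nbhs_nbhs.
have n2 : \forall n \near \oo, `|T - u n| < d by move/cvgrPdist_lt: cu; exact.
have [n [Wn dn]] := filter_ex (filterI n1 n2).
have [u0 uT] := un n.
apply: (ray_lift_extend (lq n) u0 (ltW uT) inj sec Wn) => t /andP[t0 t1].
rewrite fp; apply: hd; apply: le_lt_trans dn; rewrite distrC !ger0_norm ?subr_ge0 ?(ltW uT) //.
by rewrite lerD2l lerN2.
Qed.

Lemma ray_lift_exists v : exists g, ray_lift v 1 g.
Proof.
have I1 : 0 <= (1 : R) <= 1 by rewrite ler01 lexx.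
have mono (t t' : R) : t <= t' -> (exists g, ray_lift v t' g) -> exists g, ray_lift v t g.
  move=> tt [g [cg g0 gE]]; exists g; split=> // s /andP[s0 st]; apply: gE.
  by rewrite s0 (le_trans st).
apply: (itv_induction (P := fun T => exists g, ray_lift v T g)) I1.
  exists (fun=> p0); split=> [t|//|t /andP[t0 t1]]; first exact: cst_continuous.
  by rewrite f0 (_ : t = 0) ?scale0r //; apply/eqP; rewrite eq_le t0 t1.
move=> t /andP[t0 t1].
have [[g lg]|nl] := pselect (exists g, ray_lift v t g).
  have [e e0 ex] := ray_lift_open t0 lg.
  exists e => // t1' t2 _ _ _ d2 _; apply: mono ex; move: d2 => /ltr_normlP[]; lra.
(* If [t] is not reached, then by [ray_lift_closed] some earlier [t'] is not reached either, and no
   time beyond [t'] is, which makes the implication vacuous near [t]. *)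
have [h|[t' [t'0 t't nl']]] : (forall t', 0 <= t' -> t' < t -> exists g, ray_lift v t' g) \/
    exists t', [/\ 0 <= t', t' < t & ~ exists g, ray_lift v t' g].
  have [h|/existsNP[t' h]] := pselect (forall t', 0 <= t' -> t' < t -> exists g, ray_lift v t' g); first by left.
  by right; exists t'; move: h => /not_implyP[h1 /not_implyP[h2 h3]].
  have [t_gt0|t_le0] := ltP 0 t; first by case: nl; exact: ray_lift_closed.
  case: nl; exists (fun=> p0); split=> [s|//|s /andP[s0 s1]]; first exact: cst_continuous.
  rewrite f0 (_ : s = 0) ?scale0r //; apply/eqP; rewrite eq_le s0 (le_trans s1) //.
exists (t - t'); first by rewrite subr_gt0.
move=> t1' t2 _ _ d1 _ ex; case: nl'; apply: mono ex.
by move: d1 => /ltr_normlP[]; lra.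
Qed.

(** [E v] is the end of the lift of the ray to [v]. Continuity at [v0] is carried along the ray: for
    [v] near [v0] the lift at time [t] is a continuous local section applied to [t *: v]. *)
Lemma model_inverse : exists2 E : 'rV[R]_m -> Q, continuous E & forall v, f (E v) = v /\ E 0 = p0.
Proof.
have [G lG] := choice ray_lift_exists.
have I1 : 0 <= (1 : R) <= 1 by rewrite ler01 lexx.
exists (fun v => G v 1); last first.
  move=> v; have [_ _ h] := lG v; split; first by rewrite h ?scale1r.
  have l0 : ray_lift 0 1 (fun=> p0).
    by split=> // [t|t _]; [exact: cst_continuous|rewrite f0 scaler0].
  by apply: (ray_lift_unique (lG 0) l0) => //; rewrite ler01.
move=> v0; have [cg0 _ g0E] := lG v0.
pose P (t : R) := exists (U : set 'rV[R]_m) (s : 'rV[R]_m -> Q), [/\ open U, U (t *: v0),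
   {in U, continuous s} & \forall v \near v0, G v t = s (t *: v)].
suff /(_ 1 I1)[U [s [oU Uv cs e]]] : forall t : R, 0 <= t <= 1 -> P t.
  rewrite scale1r in Uv.
  have cs' : {for v0, continuous s} by apply: cs; rewrite inE.
  have : \forall v \near v0, s v = G v 1 by apply: filterS e => v ->; rewrite scale1r.
  move=> e' V; rewrite -(nbhs_singleton e') => /cs' nV.
  suff : \forall v \near v0, G v 1 \in V by apply: (@filterS _ (nbhs v0)) => v; rewrite inE.
  by apply: (@filterS2 _ (nbhs v0)) nV e' => v h1 <-; rewrite inE.
apply: itv_induction.
  exists setT, (fun=> p0); split=> //; [exact: openT|by move=> v _; exact: cst_continuous|].
  have nT : nbhs v0 setT by exact: (@filterT _ (nbhs v0)).
  by apply: (@filterS _ (nbhs v0)) nT => v _; have [] := lG v.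
move=> t t01; have [W [rho [s [oW Wp rho0 inj sec]]]] := local_section (G v0 t).
have ft : f (G v0 t) = t *: v0 by exact: g0E.
have [e1 e10 h1] := path_near (cg0 t) (open_nbhs_nbhs (conj oW Wp)).
have [e2 e20 h2] := ball_segment v0 t rho0.
exists (Num.min e1 e2); first by rewrite lt_min e10.
move=> t1 t2 t101 t201; rewrite !lt_min => /andP[d11 d12] /andP[d21 d22] [U [s1 [oU Uv cs e]]].
have oB : open (ball (f (G v0 t)) rho) by exact: ball_open.
exists (ball (f (G v0 t)) rho), s; split=> //; first by rewrite ft; exact: h2.
  by move=> w; rewrite inE => /sec[].
pose seg v (x : R) := (t1 + x * (t2 - t1)) *: v.
have sB x : 0 <= x <= 1 -> ball (f (G v0 t)) rho (seg v0 x).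
  move=> /andP[x0 x1]; rewrite ft; apply: h2.
  rewrite (_ : _ - t = (1 - x) * (t1 - t) + x * (t2 - t)); last by ring.
  apply: le_lt_trans (ler_normD _ _) _; rewrite !normrM (ger0_norm x0) ger0_norm ?subr_ge0 //.
  by apply: convex_lt => //; rewrite x0.
have I0 : 0 <= (0 : R) <= 1 by rewrite ler01 lexx.
have scalec (x : R) : {for v0, continuous (fun v : 'rV[R]_m => x *: v)}.
  by apply: (@continuousZl_tmp _ _ _ id); exact: cvg_id.
have seg0 v : seg v 0 = t1 *: v by rewrite /seg mul0r addr0.
have seg1 v : seg v 1 = t2 *: v by rewrite /seg mul1r subrKC.
have n1 : \forall v \near v0, ball (f (G v0 t)) rho (t1 *: v).
  by apply: (scalec t1); apply: open_nbhs_nbhs; split=> //; rewrite -seg0; exact: sB.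
have n2 : \forall v \near v0, ball (f (G v0 t)) rho (t2 *: v).
  by apply: (scalec t2); apply: open_nbhs_nbhs; split=> //; rewrite -seg1; exact: sB.
have n3 : \forall v \near v0, W (s1 (t1 *: v)).
  have c1 : {for v0, continuous (fun v => s1 (t1 *: v))}.
    by apply: (@continuous_comp _ _ _ (fun v : 'rV[R]_m => t1 *: v) s1); [exact: scalec|apply: cs; rewrite inE].
  apply: c1; apply: open_nbhs_nbhs; split=> //=; rewrite -(nbhs_singleton e); exact: h1.
apply: (@filterS3 _ (nbhs v0)) (filterI n1 n2) n3 e => v [B1 B2] Ws1 Ev.
have [cg _ gE] := lG v.
have sBv x : 0 <= x <= 1 -> ball (f (G v0 t)) rho (seg v x).
  move=> /andP[x0 x1]; move: B1 B2; rewrite !ballE => B1 B2.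
  rewrite (_ : f (G v0 t) - seg v x = (1 - x) *: (f (G v0 t) - t1 *: v) + x *: (f (G v0 t) - t2 *: v)); last first.
    by rewrite /seg; move: (f _) => w; apply/rowP => a; rewrite !mxE; ring.
  apply: le_lt_trans (ler_normD _ _) _; rewrite !normrZ (ger0_norm x0) ger0_norm ?subr_ge0 //.
  by apply: convex_lt => //; rewrite x0.
have caff : continuous (fun x : R => t1 + x * (t2 - t1)).
  move=> x; apply: (@continuousD _ _ _ (fun=> t1) (fun x : R => x * (t2 - t1))); first exact: cst_continuous.
  by apply: (@continuousM _ _ id (fun=> t2 - t1)); [exact: cvg_id|exact: cst_continuous].
have t12 x : 0 <= x <= 1 -> 0 <= t1 + x * (t2 - t1) <= 1.
  move: t101 t201 => /andP[a1 a2] /andP[b1 b2] /andP[x0 x1].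
  by apply/andP; split; nra.
have c2 : continuous (fun x => s (seg v (clamp x))).
  move=> x; apply: (@continuous_comp _ _ _ (fun x => seg v (clamp x)) s); last by have [_ _] := sec _ (sBv _ (clampP x)).
  apply: (@continuousZr_tmp _ _ _ (fun x => t1 + clamp x * (t2 - t1))).
  by apply: (@continuous_comp _ _ _ clamp (fun x : R => t1 + x * (t2 - t1))); [exact: clamp_continuous|exact: caff].
have := @lift_unique (fun x => G v (t1 + x * (t2 - t1))) (fun x => s (seg v (clamp x))) _ c2 _ _ 1 I1.
rewrite (clamp_id I1) seg1 mul1r subrKC; apply.
- by move=> x; apply: (@continuous_comp _ _ _ (fun x : R => t1 + x * (t2 - t1)) (G v)); [exact: caff|exact: cg].
- rewrite (clamp_id I0) seg0 mul0r addr0; have [w1 w2 _] := sec _ B1.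
  by apply: inj => //; rewrite ?w2 ?gE // Ev.
- move=> x x01; rewrite (clamp_id x01); have [_ w2 _] := sec _ (sBv _ x01).
  by rewrite w2 gE // t12.
Qed.

(** [E] is a continuous two-sided inverse of [f], so the preimage of [B] is the image of [B] under
    [E]. *)
Theorem model_proper : @simply_connected R Q -> forall B : set 'rV[R]_m, compact B -> compact (f @^-1` B).
Proof.
move=> sc B cB; have [E cE hE] := model_inverse.
have Ef p : E (f p) = p.
  (* Along a path from [p0] to [p], both the path and its image under [E \o f] lift the same curve
     from the same point. *)
  have [g [cg g0 g1 _]] := path_exists p0 p sc.
  have I1 : 0 <= (1 : R) <= 1 by rewrite ler01 lexx.
  have := @lift_unique (fun t => E (f (g t))) g _ cg _ _ 1 I1; rewrite g1; apply.
  - move=> t; apply: (@continuous_comp _ _ _ (f \o g) E); last exact: cE.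
    by apply: continuous_comp; [exact: cg|exact: model_continuous].
  - by rewrite g0 f0 (hE 0).2.
  - by move=> t _; rewrite (hE _).1.
have -> : f @^-1` B = E @` B.
  apply/seteqP; split=> [p Bp|_ [v Bv <-]]; first by exists (f p).
  by rewrite /= (hE v).1.
by apply: continuous_compact => //; exact: continuous_subspaceT.
Qed.

End ModelCompact.

(** * Newton tensors *)

From mathcomp Require Import zify.
From mathcomp Require complex.

(** * Coefficients of polynomials by interpolation *)

Section CoefficientWeights.
Context {R : realFieldType}.

Definition node (j : nat) : R := j.+1%:R.

(** The weights are a column of the inverse Vandermonde matrix. They allow taking a coefficient in
    [t] of quantities that are only handled for individual values of [t]. *)
Lemma coef_weights N r : (r < N)%N -> exists om : 'I_N -> R,
  forall p : {poly R}, (size p <= N)%N -> p`_r = \sum_j om j * p.[node j].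
Proof.
move=> rN; pose a : 'rV[R]_N := \row_j node j.
have U : Vandermonde N a \in unitmx.
  rewrite unitmxE det_Vandermonde unitfE; apply/prodf_neq0 => i _; apply/prodf_neq0 => j ij.
  by rewrite !mxE subr_eq0 eqr_nat eqSS gtn_eqF.
pose w := invmx (Vandermonde N a) *m delta_mx (Ordinal rN) 0 : 'cV[R]_N.
have hw (i : 'I_N) : \sum_(j < N) node j ^+ i * w j 0 = (i == r :> nat)%:R :> R.
  have := congr1 (fun M : 'cV[R]_N => M i 0) (mulKVmx U (delta_mx (Ordinal rN) 0)).
  rewrite mxE [RHS]mxE eqxx andbT => <-; apply: eq_bigr => j _.
  by rewrite !mxE.
exists (fun j => w j 0) => p sp.
under eq_bigr => j _ do rewrite (horner_coef_wide _ sp) mulr_sumr.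
rewrite exchange_big /= (bigD1 (Ordinal rN)) //= [X in _ + X]big1 ?addr0.
  under eq_bigr => j _ do rewrite mulrCA [w j 0 * _]mulrC.
  by have /= hr := hw (Ordinal rN); rewrite -mulr_sumr hr eqxx mulr1.
move=> i ir; under eq_bigr => j _ do rewrite mulrCA [w j 0 * _]mulrC.
by rewrite -mulr_sumr hw (_ : (i == r :> nat) = false) ?mulr0 //; apply: negbTE.
Qed.

End CoefficientWeights.

(** * Real-rooted polynomials and Newton's inequality *)

Section RealRooted.
Context {R : rcfType}.

Definition linear_factor (ab : R * R) : {poly R} := ab.1 *: 'X + ab.2%:P.

(** Factors of slope 0 are allowed, the zero factor included, so that constants belong to the class
    and it is closed under derivation. *)
Definition real_rooted (p : {poly R}) := exists s : seq (R * R), p = \prod_(ab <- s) linear_factor ab.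

Import complex.
Local Notation C := (complex R).
Local Notation toC := (map_poly (real_complex R)).

Lemma horner_linear_factor ab (z : C) : (toC (linear_factor ab)).[z] = real_complex R ab.1 * z + real_complex R ab.2.
Proof. by rewrite rmorphD /= map_polyZ map_polyX map_polyC /= !hornerE. Qed.

Lemma linear_factor_nonzero ab (z : C) : complex.Im z != 0 -> linear_factor ab != 0 ->
  (toC (linear_factor ab)).[z] != 0.
Proof.
rewrite horner_linear_factor; case: ab z => a b [x y] /= y0 l0; apply: contraNneq l0.
move=> [] e1 e2; have a0 : a = 0.
  by move: e2; rewrite mul0r !addr0 => /eqP; rewrite mulf_eq0 (negbTE y0) orbF => /eqP.
by move: e1; rewrite {}a0 !mul0r subr0 add0r => b0; apply/eqP; rewrite b0 /linear_factor /= scale0r add0r.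
Qed.

Lemma log_derivative (s : seq (R * R)) (z : C) : complex.Im z != 0 ->
  (forall ab, ab \in s -> linear_factor ab != 0) ->
  (toC (\prod_(ab <- s) linear_factor ab)^`()).[z] =
  (toC (\prod_(ab <- s) linear_factor ab)).[z] *
    \sum_(ab <- s) real_complex R ab.1 / (toC (linear_factor ab)).[z].
Proof.
move=> z0; elim: s => [|ab s IH] h.
  by rewrite !big_nil derivC map_poly0 horner0 mulr0.
rewrite !big_cons derivM rmorphD /= hornerD !rmorphM /= !hornerM IH; last first.
  by move=> ab' h'; apply: h; rewrite inE h' orbT.
have l0 := linear_factor_nonzero z0 (h ab (mem_head _ _)).
have -> : (toC (linear_factor ab)^`()).[z] = real_complex R ab.1.
  by rewrite /linear_factor derivD derivZ derivX derivC addr0 alg_polyC map_polyC hornerC.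
rewrite mulrDr; congr (_ + _); last by rewrite mulrA.
by rewrite [X in _ = X * _]mulrC -[RHS]mulrA [X in _ = _ * X]mulrC divfK // mulrC.
Qed.

Lemma Im_log_derivative (s : seq (R * R)) (z : C) : 
  complex.Im (\sum_(ab <- s) real_complex R ab.1 / (toC (linear_factor ab)).[z]) =
  - complex.Im z * \sum_(ab <- s) ab.1 ^+ 2 / ((ab.1 * complex.Re z + ab.2) ^+ 2 + (ab.1 * complex.Im z) ^+ 2).
Proof.
elim: s => [|ab s IH]; first by rewrite !big_nil mulr0.
rewrite !big_cons mulrDr -IH raddfD /=; congr (_ + _).
rewrite horner_linear_factor; case: ab z {IH} => a b [x y] /=.
by rewrite !mul0r !subr0 !addr0; ring.
Qed.

(** The Gauss-Lucas argument: at a non-real root of [p'] the polynomial [p] is nonzero, so the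
    logarithmic derivative vanishes there. All its terms have imaginary part of one sign, so every
    slope is 0 and [p'] vanishes identically. *)
Lemma real_rooted_deriv p : real_rooted p -> real_rooted p^`().
Proof.
move=> [s ->] {p}; set p := \prod_(ab <- s) _.
have [p'0|p'0] := eqVneq p^`() 0.
  by exists [:: (0, 0)]; rewrite p'0 big_seq1 /linear_factor scale0r addr0.
have lf ab : ab \in s -> linear_factor ab != 0.
  move=> h; apply: contra_neq p'0 => l0; rewrite /p (big_rem ab) //= l0 mul0r derivC //.
have [r Er] := closed_field_poly_normal (toC p^`()).
have real z : z \in r -> complex.Im z = 0.
  move=> zr; apply/eqP; apply: contraT => z0.
  have : (toC p^`()).[z] = 0.
    rewrite Er hornerZ; apply/eqP; rewrite mulf_eq0; apply/orP; right.
    by rewrite -/(root _ z) root_prod_XsubC.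
  rewrite log_derivative //; move=> /eqP; rewrite mulf_eq0; case/orP.
    rewrite -/p /p; move: lf; elim: (s) => [|ab s' IH] lf.
      by rewrite big_nil map_polyC hornerC /= oner_eq0.
    rewrite big_cons rmorphM hornerM mulf_eq0 (negbTE (linear_factor_nonzero z0 (lf ab (mem_head _ _)))) /=.
    by apply: IH => ab' h; apply: lf; rewrite inE h orbT.
  move=> /eqP/(congr1 (fun w : C => complex.Im w)); rewrite Im_log_derivative /= => /eqP.
  rewrite mulf_eq0 oppr_eq0 (negbTE z0) /= psumr_eq0 => [/allP h|ab _]; last first.
    by rewrite divr_ge0 ?addr_ge0 ?sqr_ge0.
  case/eqP: p'0; rewrite /p; elim: (s) h lf => [|ab s' IH] h lf; first by rewrite big_nil derivC.
  have a0 : ab.1 = 0.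
    have := h ab (mem_head _ _); rewrite mulf_eq0 invr_eq0 paddr_eq0 ?sqr_ge0 // !sqrf_eq0.
    by rewrite mulf_eq0 (negbTE z0) orbF => /orP[/eqP//|/andP[_ /eqP]].
  rewrite big_cons derivM IH ?mulr0 ?addr0; last 2 first.
  - by move=> ab' h'; apply: h; rewrite inE h' orbT.
  - by move=> ab' h'; apply: lf; rewrite inE h' orbT.
  by rewrite /linear_factor a0 scale0r add0r derivC mul0r.
exists ((0, lead_coef p^`()) :: [seq (1, - complex.Re z) | z <- r]).
apply: (map_inj_poly (@complexI R)) => //=; rewrite {1}Er big_cons big_map rmorphM rmorph_prod /=.
rewrite /linear_factor /= scale0r add0r map_polyC /= mul_polyC lead_coef_map; congr (_ *: _).
rewrite !big_seq; apply: eq_bigr => z /real z0; rewrite scale1r rmorphD /= map_polyX map_polyC /=.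
by rewrite -polyCN; congr (_ + _%:P); case: z z0 => x y /= ->; apply/eqP; rewrite eq_complex /= oppr0 !eqxx.
Qed.

(** Multiplying [q] by a linear factor [l] of slope [a] changes [q'^2 - q q''] into
    [l^2 (q'^2 - q q'') + (a q)^2]. *)
Lemma laguerre p : real_rooted p -> forall x : R, p.[x] * p^`()^`().[x] <= p^`().[x] ^+ 2.
Proof.
move=> [s ->] x; elim: s => [|ab s IH]; first by rewrite big_nil !derivC !horner0 mulr0 expr0n.
rewrite big_cons; move: (\prod_(j <- s) _) IH => q.
have : (linear_factor ab)^`() = ab.1%:P.
  by rewrite /linear_factor derivD derivZ derivX derivC addr0 alg_polyC.
move: (linear_factor ab) => f df.
rewrite derivM df derivD !derivM df derivC mul0r add0r.
rewrite !(hornerD, hornerM, hornerC); move: q.[x] q^`().[x] q^`()^`().[x] f.[x] => a b c l h.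
have h2 : 0 <= l ^+ 2 * (b ^+ 2 - a * c) by rewrite mulr_ge0 ?sqr_ge0 // subr_ge0.
have := sqr_ge0 (ab.1 * a); rewrite -subr_ge0 => h3.
rewrite -subr_ge0 (_ : _ - _ = (ab.1 * a) ^+ 2 + l ^+ 2 * (b ^+ 2 - a * c)); last by ring.
by rewrite addr_ge0 ?sqr_ge0.
Qed.

(** Laguerre's inequality at 0 for the [r]-th derivative, whose first Taylor coefficients are three
    consecutive coefficients of [p] up to factorials. *)
Lemma newton p r : real_rooted p -> r.+2%:R * p`_r * p`_r.+2 <= r.+1%:R * p`_r.+1 ^+ 2.
Proof.
move=> rp; have : real_rooted p^`(r) by elim: r => //= r IH; exact: real_rooted_deriv.
move=> /laguerre/(_ 0); rewrite -!derivnS !horner_coef0 !coef_derivn !addn0 !ffactnn.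
rewrite -(mulr_natr p`_r) -(mulr_natr p`_r.+2) -(mulr_natr p`_r.+1) (factS r.+1) (factS r) !natrM.
have F0 : 0 < (r`!%:R : R) by rewrite ltr0n fact_gt0.
have r0 : 0 < (r.+1%:R : R) by rewrite ltr0n.
move: (r`!%:R) (r.+1%:R) (r.+2%:R) p`_r p`_r.+1 p`_r.+2 F0 r0 => F n1 n2 a b c F0 r0 h.
have k0 : 0 < n1 * F ^+ 2 by rewrite mulr_gt0 // exprn_gt0.
rewrite -subr_ge0 in h; rewrite -(ler_pM2l k0) -subr_ge0.
by rewrite (_ : _ - _ = (b * (n1 * F)) ^+ 2 - a * F * (c * (n2 * (n1 * F)))) //; ring.
Qed.

End RealRooted.

(** * Diagonalization of self-adjoint matrices *)

Section Diagonalization.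
Context {R : rcfType}.

(** The product of the [A - z]. Its vanishing is what the induction below carries: it passes to the
    restriction of [A] to an invariant subspace, without computing the characteristic polynomial of
    the restriction. *)
Definition split_prod n (A : 'M[R]_n) (s : seq R) : 'M[R]_n := foldr (fun z M => (A - z%:M) *m M) 1%:M s.

Lemma split_prod_char_poly n (A : 'M[R]_n) (s : seq R) : char_poly A = \prod_(z <- s) ('X - z%:P) ->
  split_prod A s = 0.
Proof.
case: n A => [|n] A h; first by apply/matrixP => -[].
have := Cayley_Hamilton A; rewrite h rmorph_prod /= => <-.
elim: s {h} => [|z s IH]; first by rewrite big_nil.
by rewrite big_cons /= IH rmorphB /= horner_mx_X horner_mx_C.
Qed.

Lemma split_prod_intertwine m n (A : 'M[R]_n) (B : 'M[R]_m) (K : 'M[R]_(m, n)) s : K *m A = B *m K ->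
  K *m split_prod A s = split_prod B s *m K.
Proof.
move=> h; elim: s => [|z s IH] /=; first by rewrite mulmx1 mul1mx.
by rewrite mulmxA mulmxBr h mul_mx_scalar -mul_scalar_mx -mulmxBl -[LHS]mulmxA IH mulmxA.
Qed.

Lemma split_prod_eigen n (A : 'M[R]_n.+1) s : split_prod A s = 0 ->
  exists2 z, z \in s & exists2 v : 'rV[R]_n.+1, v != 0 & v *m A = z *: v.
Proof.
elim: s => [/eqP|z s IH] /=; first by rewrite oner_eq0.
have [U h|nU _] := boolP ((A - z%:M) \in unitmx).
  have [|z' zs hv] := IH; first by rewrite -[split_prod A s](mulKmx U) h mulmx0.
  by exists z' => //; rewrite inE zs orbT.
exists z; first exact: mem_head.
have : ~~ row_free (A - z%:M) by rewrite row_free_unit.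
rewrite -kermx_eq0 => /rowV0Pn[v /sub_kermxP e v0]; exists v => //.
by apply/eqP; rewrite -subr_eq0 -mul_mx_scalar -mulmxBr e.
Qed.

(** Induction on the dimension: the rows of [K] span the [G]-orthogonal complement of a unit
    eigenvector [w], which is invariant because [A] is self-adjoint, and [B] is the restriction of
    [A] to it. *)
Lemma self_adjoint_diag n (A G : 'M[R]_n) (s : seq R) : G^T = G ->
  (forall v : 'rV[R]_n, v != 0 -> 0 < (v *m G *m v^T) 0 0) -> A *m G = G *m A^T ->
  split_prod A s = 0 ->
  exists (T : 'M[R]_n) (mu : 'rV[R]_n), T *m G *m T^T = 1%:M /\ T *m A = diag_mx mu *m T.
Proof.
elim: n A G => [|n IH] A G GT Gpos AG sp; first by exists 0, 0; split; apply/matrixP => -[].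
have [z _ [v v0 vA]] := split_prod_eigen sp.
pose N := (v *m G *m v^T) 0 0; have N0 : 0 < N by exact: Gpos.
pose w := (Num.sqrt N)^-1 *: v.
have sN : Num.sqrt N != 0 by rewrite gt_eqF // sqrtr_gt0.
have wG : w *m G *m w^T = 1%:M.
  rewrite [LHS]mx11_scalar /w linearZ /= -!scalemxAl -scalemxAr 2![in LHS]mxE -/N mulrA -invfM -expr2.
  by rewrite sqr_sqrtr ?(ltW N0) // mulVf // gt_eqF.
have wA : w *m A = z *: w by rewrite /w -scalemxAl vA !scalerA mulrC.
have [K [fK K0]] : exists K : 'M[R]_(n, n.+1), row_free K /\ K *m (G *m w^T) = 0.
  pose c : 'cV[R]_n.+1 := G *m w^T.
  have rc : \rank (kermx c) = n.
    rewrite mxrank_ker; suff -> : \rank c = 1%N by rewrite subn1.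
    apply/eqP; rewrite eqn_leq rank_leq_col lt0n mxrank_eq0; apply: contraTneq N0 => c0.
    move: wG; rewrite -mulmxA -/c c0 mulmx0 => /matrixP/(_ 0 0)/eqP.
    by rewrite !mxE eq_sym oner_eq0.
  have e0 : row_base (kermx c) *m c = 0 by apply/sub_kermxP; rewrite eq_row_base.
  have := row_base_free (kermx c); move: (row_base _) e0; rewrite rc => K h1 h2.
  by exists K.
pose P : 'M[R]_(1 + n) := col_mx w K.
have KG : K *m G *m w^T = 0 by rewrite -mulmxA.
have wGK : w *m G *m K^T = 0.
  by apply: trmx_inj; rewrite trmx0 !trmx_mul trmxK GT mulmxA.
have UP : P \in unitmx.
  rewrite -row_free_unit; apply: inj_row_free => u; rewrite -[u]hsubmxK mul_row_col => h.
  have h1 : lsubmx u = 0.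
    have := congr1 (fun M => M *m (G *m w^T)) h; rewrite mulmxDl mul0mx -!mulmxA K0 mulmx0 addr0.
    by rewrite [w *m _]mulmxA wG mulmx1.
  move: h; rewrite h1 mul0mx add0r => /(congr1 (fun M => M *m pinvmx K)).
  by rewrite mul0mx mulmxKp // => ->; rewrite row_mx0.
pose B := K *m A *m pinvmx K.
have KA : K *m A = B *m K.
  have sub : (K *m A <= K)%MS.
    have e1 : K *m A *m (G *m w^T) = 0.
      by rewrite mulmxA -(mulmxA K) AG mulmxA -mulmxA -trmx_mul wA linearZ /= -scalemxAr KG scaler0.
    have e2 : K *m A = (K *m A *m invmx P) *m P by rewrite mulmxKV.
    move: e2; rewrite -[K *m A *m invmx P]hsubmxK mul_row_col => e2.
    have e3 : lsubmx (K *m A *m invmx P) = 0.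
      have := congr1 (fun M => M *m (G *m w^T)) e2; rewrite e1 mulmxDl -!mulmxA K0 mulmx0 addr0.
      by rewrite [w *m _]mulmxA wG mulmx1 => <-.
    by rewrite e2 e3 mul0mx add0r submxMl.
  by rewrite /B mulmxKpV.
have [|u u0|||T [mu [TG TB]]] := IH B (K *m G *m K^T).
- by rewrite !trmx_mul trmxK GT mulmxA.
- have := Gpos (u *m K); rewrite trmx_mul !mulmxA; apply.
  by rewrite mulmx_free_eq0.
- rewrite !mulmxA -KA -(mulmxA K) AG -!mulmxA; congr (_ *m (_ *m _)).
  by rewrite -!trmx_mul KA.
(* The vanishing product passes to [B] because the rows of [K] are independent. *)
- have := split_prod_intertwine s KA; rewrite sp mulmx0 => /esym/eqP.
  by rewrite mulmx_free_eq0 // => /eqP.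
pose W : 'M[R]_(1 + n, n.+1) := col_mx w (T *m K); pose d : 'rV[R]_(1 + n) := row_mx (z%:M : 'rV[R]_1) mu.
have C1 : W *m G *m W^T = 1%:M.
  rewrite /W tr_col_mx mul_col_mx mul_col_row trmx_mul wG !mulmxA wGK mul0mx -(mulmxA T) -(mulmxA T) KG mulmx0.
  by rewrite -(mulmxA T (K *m G)) TG -scalar_mx_block.
have C2 : W *m A = diag_mx d *m W.
  rewrite /W mul_col_mx wA -mulmxA KA mulmxA TB.
  have -> : diag_mx d = block_mx z%:M 0 0 (diag_mx mu).
    by rewrite /d diag_mx_row; congr block_mx; apply/matrixP => i j; rewrite !ord1 !mxE.
  by rewrite mul_block_col !mul0mx addr0 add0r mul_scalar_mx mulmxA.
by exists W, d; split.
Qed.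

End Diagonalization.

(** * Elementary symmetric functions and the bounds on Newton tensors *)

Section NewtonTensor.
Context {R : realType}.

Definition sym_poly n (mu : 'I_n -> R) : {poly R} := \prod_i (1 + mu i *: 'X).
(** Its coefficients are the eigenvalues of the Newton tensors in the [i]-th principal direction. *)
Definition sym_poly' n (mu : 'I_n -> R) (i : 'I_n) : {poly R} := \prod_(j | j != i) (1 + mu j *: 'X).

Lemma S_coef n (T : Type) (lam : 'I_n -> T -> R) r p : S_ lam r p = (sym_poly (fun i => lam i p))`_r.
Proof.
rewrite /sym_poly; under [in RHS]eq_bigr => i _ do rewrite addrC.
rewrite bigA_distr coef_sum /S_ big_mkcond /=; apply: eq_bigr => J _.
rewrite -big_mkcond /= scaler_prod prodr_const coefZ coefXn eq_sym.
by case: eqP; rewrite ?mulr1 ?mulr0.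
Qed.

Lemma sym_poly_D1 n (mu : 'I_n -> R) i : sym_poly mu = (1 + mu i *: 'X) * sym_poly' mu i.
Proof. by rewrite /sym_poly (bigD1 i). Qed.

Lemma size_sym_poly' n (mu : 'I_n -> R) i : (size (sym_poly' mu i) <= n)%N.
Proof.
apply: leq_trans (size_poly_prod_leq _ _) _.
have h : (\sum_(j < n | j != i) size (1 + mu j *: 'X)%R <= \sum_(j < n | j != i) 2)%N.
  apply: leq_sum => j _; apply: leq_trans (size_polyD _ _) _; rewrite size_poly1 geq_max /=.
  by apply: leq_trans (size_scale_leq _ _) _; rewrite size_polyX.
rewrite sum_nat_const in h; have := cardC1 i; rewrite card_ord.
rewrite (eq_card (_ : _ =i [pred j | j != i])) //; move=> e; rewrite e in h *.
have n0 : (0 < n)%N by apply: leq_ltn_trans (ltn_ord i).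
by move: (\sum_(j < n | _) _)%N h => S h; lia.
Qed.

Lemma deriv_prod_seq (I : eqType) (s : seq I) (F : I -> {poly R}) : uniq s ->
  (\prod_(i <- s) F i)^`() = \sum_(i <- s) (F i)^`() * \prod_(j <- s | j != i) F j.
Proof.
elim: s => [|a s IH] /=; first by rewrite !big_nil derivC.
move=> /andP[as_ us]; rewrite !big_cons derivM IH // eqxx /=; congr (_ * _ + _).
  rewrite [LHS]big_seq [RHS]big_seq_cond; apply: eq_bigl => j.
  by case: (boolP (j \in s)) => //= js; apply/esym; apply: contraNneq as_ => <-.
rewrite mulr_sumr !big_seq; apply: eq_bigr => i is_; rewrite big_cons.
have -> : a != i by apply: contraNneq as_ => ->.
by rewrite mulrCA.
Qed.

Lemma sym_poly'_coef n (mu : 'I_n -> R) i r :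
  (sym_poly mu)`_r.+1 = (sym_poly' mu i)`_r.+1 + mu i * (sym_poly' mu i)`_r.
Proof. by rewrite (sym_poly_D1 mu i) mulrDl mul1r coefD -scalerAl coefZ coefXM. Qed.

Lemma sum_mu_sym_poly' n (mu : 'I_n -> R) r :
  \sum_i mu i * (sym_poly' mu i)`_r = r.+1%:R * (sym_poly mu)`_r.+1.
Proof.
have : (sym_poly mu)^`() = \sum_i mu i *: sym_poly' mu i.
  rewrite /sym_poly deriv_prod_seq ?index_enum_uniq //; apply: eq_bigr => i _.
  by rewrite derivD derivC derivZ derivX add0r alg_polyC mul_polyC.
move=> /(congr1 (fun q : {poly R} => q`_r)); rewrite coef_deriv coef_sum mulr_natl => ->.
by apply: eq_bigr => i _; rewrite coefZ.
Qed.

Lemma sum_sym_poly' n (mu : 'I_n -> R) r : (r <= n)%N ->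
  \sum_i (sym_poly' mu i)`_r = (n - r)%:R * (sym_poly mu)`_r.
Proof.
move=> rn; have : \sum_(i < n) (sym_poly mu)`_r = n%:R * (sym_poly mu)`_r.
  by rewrite sumr_const card_ord mulr_natl.
case: r rn => [|r] rn.
  rewrite subn0 => <-; apply: eq_bigr => i _; rewrite (sym_poly_D1 mu i) mulrDl mul1r coefD -scalerAl coefZ coefXM.
  by rewrite mulr0 addr0.
under eq_bigr => i _ do rewrite (sym_poly'_coef mu i).
rewrite big_split /= sum_mu_sym_poly' => h; apply: (addIr (r.+1%:R * (sym_poly mu)`_r.+1)).
by rewrite h natrB // mulrBl subrK.
Qed.

(** For [r > 0], let [sig] be the coefficient in question and [tau] the next one. The vanishing of
    [S_(r+1)] gives [tau = - m sig], and Newton's inequality for [q] becomes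
    [sig^2 <= (k + 1) sig S_r], which excludes [sig < 0]. *)
Lemma sym_poly'_ge0 n (mu : 'I_n -> R) i r : 0 <= (sym_poly mu)`_r -> (sym_poly mu)`_r.+1 = 0 ->
  0 <= (sym_poly' mu i)`_r.
Proof.
move=> s0 s1; set q := sym_poly' mu i.
have rq : real_rooted q.
  exists [seq (mu j, 1) | j <- index_enum _ & j != i]; rewrite big_map big_filter.
  by apply: eq_bigr => j _; rewrite /linear_factor /= addrC.
case: r s0 s1 => [|r] s0 s1.
  have <- : (sym_poly mu)`_0 = q`_0; last by [].
  by rewrite (sym_poly_D1 mu i) mulrDl mul1r coefD -scalerAl coefZ coefXM mulr0 addr0.
rewrite !(sym_poly'_coef mu i) -/q in s0 s1.
have := newton r rq; move: q`_r q`_r.+1 q`_r.+2 (mu i) s0 s1 => rho sig tau m s0 s1.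
have r0 : 0 < (r.+1%:R : R) by rewrite ltr0n.
have -> : (r.+2%:R : R) = r.+1%:R + 1 by rewrite -natr1.
move: (r.+1%:R : R) r0 => k k0 h.
have t : tau = - (m * sig) by apply/eqP; rewrite -addr_eq0 s1.
have h1 : rho * tau = - (sig * (sig + m * rho)) + sig ^+ 2 by rewrite t; ring.
have h2 : sig ^+ 2 <= (k + 1) * (sig * (sig + m * rho)).
  by move: h; rewrite -mulrA h1; nra.
rewrite leNgt; apply/negP => sn.
have h3 : 0 < sig ^+ 2 by rewrite exprn_even_gt0 //= lt_eqF.
have h4 : sig * (sig + m * rho) <= 0 by rewrite mulr_le0_ge0 // ltW.
by have := lt_le_trans h3 h2; rewrite ltNge mulr_ge0_le0 // addr_ge0 // ltW.
Qed.

Lemma horner_adj n (A : 'M[R]_n) t : \adj (1%:M + t *: A) =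
  map_mx (fun q : {poly R} => q.[t]) (\adj (1%:M + 'X *: map_mx polyC A)).
Proof.
rewrite -[RHS]/(map_mx (horner_eval t) _) map_mx_adj; congr (\adj _).
by apply/matrixP => i j; rewrite !mxE rmorphD rmorphMn /= rmorphM /= /horner_eval !hornerE.
Qed.

(** The identity is proved over polynomials in [t], where the determinant is nonzero and can be
    cancelled, and then evaluated; thus it also holds for the [t] that make [1 + t A] singular. *)
Lemma adj_diag n (A T : 'M[R]_n) (mu : 'rV[R]_n) t : T \in unitmx -> T *m A = diag_mx mu *m T ->
  \adj (1%:M + t *: A) = invmx T *m diag_mx (\row_i (sym_poly' (mu 0) i).[t]) *m T.
Proof.
move=> UT TA; rewrite horner_adj.
pose P : 'M[{poly R}]_n := 1%:M + 'X *: map_mx polyC A.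
pose D : 'M[{poly R}]_n := diag_mx (\row_i sym_poly' (mu 0) i).
pose Y := map_mx polyC (invmx T) *m D *m map_mx polyC T.
have TT : map_mx polyC T *m map_mx polyC (invmx T) = 1%:M by rewrite -map_mxM mulmxV // map_mx1.
have TT' : map_mx polyC (invmx T) *m map_mx polyC T = 1%:M by rewrite -map_mxM mulVmx // map_mx1.
have PE : P = map_mx polyC (invmx T) *m diag_mx (\row_i (1 + mu 0 i *: 'X)) *m map_mx polyC T.
  have AE : A = invmx T *m diag_mx mu *m T by rewrite -mulmxA -TA mulKmx.
  have -> : diag_mx (\row_i (1 + mu 0 i *: 'X)) = 1%:M + 'X *: map_mx polyC (diag_mx mu).
    apply/matrixP => i j; rewrite !mxE; case: eqVneq => [->|]; last by rewrite !mulr0n polyC0 mulr0 addr0.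
    by rewrite !mulr1n mulrC mul_polyC.
  rewrite mulmxDr mulmxDl mulmx1 TT' /P {1}AE !map_mxM /= -scalemxAr -scalemxAl //.
have detP : \det P = sym_poly (mu 0).
  rewrite PE !det_mulmx mulrAC -det_mulmx TT' det1 mul1r det_diag.
  by apply: eq_bigr => i _; rewrite mxE.
have PY : P *m Y = (sym_poly (mu 0))%:M.
  rewrite PE /Y !mulmxA -(mulmxA (_ *m diag_mx _)) TT mulmx1 -(mulmxA (map_mx _ _)) mulmx_diag.
  rewrite (_ : diag_mx _ = (sym_poly (mu 0))%:M).
    by rewrite mul_mx_scalar -scalemxAl TT' scalemx1.
  rewrite -diag_const_mx; congr diag_mx; apply/rowP => i; rewrite !mxE.
  by rewrite (sym_poly_D1 _ i).
have d0 : \det P != 0.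
  rewrite detP; apply: contra_neq (oner_neq0 R) => /(congr1 (fun q : {poly R} => q.[0])).
  by rewrite horner0 /sym_poly horner_prod big1 // => i _; rewrite !hornerE.
have -> : \adj P = Y.
  apply/matrixP => i j; apply: (mulfI d0).
  have : \adj P *m (P *m (\adj P - Y)) = 0.
    by rewrite mulmxBr mul_mx_adj PY detP subrr mulmx0.
  rewrite mulmxA mul_adj_mx mul_scalar_mx.
  have aux d (V W : 'M[{poly R}]_n) : d *: (V - W) = 0 -> d * V i j = d * W i j.
    by move=> /matrixP/(_ i j); rewrite !mxE mulrBr => /eqP; rewrite subr_eq0 => /eqP.
  exact: aux.
rewrite -[LHS]/(map_mx (horner_eval t) _) !map_mxM /=.
congr (_ *m _ *m _); apply/matrixP => i j; rewrite !mxE /horner_eval ?hornerC //.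
by rewrite hornerMn.
Qed.

Lemma char_poly_conj n (A B T : 'M[R]_n) : T \in unitmx -> T *m A = B *m T -> char_poly A = char_poly B.
Proof.
move=> UT TA; have d0 : \det (map_mx polyC T) != 0.
  by rewrite det_map_mx polyC_eq0 -unitfE -unitmxE.
apply: (mulfI d0); rewrite /char_poly -det_mulmx [RHS]mulrC -det_mulmx; congr (\det _).
by rewrite /char_poly_mx mulmxBr mulmxBl -!map_mxM TA mul_mx_scalar mul_scalar_mx.
Qed.

(** By the choice of the weights, [B] is the coefficient of [t^r] in the adjugate of [1 + t A], the
    [r]-th Newton tensor. Its eigenvalues are nonnegative, so each is at most their sum
    [(n - r) S_r]. *)
Theorem newton_tensor n r (A G : 'M[R]_n) (lam : 'I_n -> R) (om : 'I_n.+1 -> R) : (r < n)%N ->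
  (forall p : {poly R}, (size p <= n.+1)%N -> p`_r = \sum_j om j * p.[node j]) ->
  G^T = G -> (forall v : 'rV[R]_n, v != 0 -> 0 < (v *m G *m v^T) 0 0) -> A *m G = G *m A^T ->
  char_poly A = \prod_i ('X - (lam i)%:P) -> 0 <= (sym_poly lam)`_r -> (sym_poly lam)`_r.+1 = 0 ->
  let B := \sum_j om j *: \adj (1%:M + node j *: A) in
  [/\ \tr B = (n - r)%:R * (sym_poly lam)`_r, \tr (A *m B) = 0 &
   forall b : 'rV[R]_n, 0 <= (b *m B *m G *m b^T) 0 0 <= (n - r)%:R * (sym_poly lam)`_r * (b *m G *m b^T) 0 0].
Proof.
move=> rn hom GT Gpos AG cp; set sr := (sym_poly lam)`_r => s0 s1.
have sp : split_prod A [seq lam i | i <- index_enum _] = 0.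
  by apply: split_prod_char_poly; rewrite cp big_map.
have [T [mu [TG TA]]] := self_adjoint_diag GT Gpos AG sp.
have UT : T \in unitmx.
  by have [] := mulmx1_unit (_ : T *m (G *m T^T) = 1%:M); rewrite // mulmxA.
(* The eigenvalues found by diagonalizing are the prescribed ones up to order, by unique
   factorization of the characteristic polynomial. *)
have sympoly_eq : sym_poly (mu 0) = sym_poly lam.
  have := char_poly_conj UT TA; rewrite cp char_poly_trig ?diag_mx_is_trig //.
  under [RHS]eq_bigr => i _ do rewrite mxE eqxx mulr1n.
  rewrite -(big_map lam xpredT (fun z => 'X - z%:P)) -(big_map (mu 0) xpredT (fun z => 'X - z%:P)).
  move=> /prod_XsubC_eq pe; rewrite /sym_poly.
  by rewrite -(big_map (mu 0) xpredT (fun z => 1 + z *: 'X)) -(perm_big _ pe) big_map.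
have sig i := hom (sym_poly' (mu 0) i) (leq_trans (size_sym_poly' _ _) (leqnSn n)).
pose sg i := (sym_poly' (mu 0) i)`_r.
move=> B; have BE : B = invmx T *m diag_mx (\row_i sg i) *m T.
  rewrite /B; under eq_bigr => j _ do rewrite (adj_diag (node j) UT TA) scalemxAl scalemxAr.
  rewrite -mulmx_suml -mulmx_sumr; congr (_ *m _ *m _); apply/matrixP => i k.
  rewrite summxE [RHS]mxE [X in X *+ _]mxE /sg sig -sumrMnl; apply: eq_bigr => j _.
  by rewrite !mxE mulrnAr.
have sg0 i : 0 <= sg i by apply: sym_poly'_ge0; rewrite sympoly_eq.
have sums : \sum_i sg i = (n - r)%:R * sr by rewrite sum_sym_poly' ?sympoly_eq // ltnW.
split.
- rewrite BE -mulmxA mxtrace_mulC -mulmxA mulmxV // mulmx1 mxtrace_diag -sums.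
  by apply: eq_bigr => i _; rewrite mxE.
- have -> : A = invmx T *m diag_mx mu *m T by rewrite -mulmxA -TA mulKmx.
  rewrite BE !mulmxA mulmxK // mxtrace_mulC !mulmxA mulmxV // mul1mx mulmx_diag mxtrace_diag.
  transitivity (\sum_i mu 0 i * sg i); first by apply: eq_bigr => i _; rewrite !mxE.
  by rewrite sum_mu_sym_poly' sympoly_eq s1 mulr0.
move=> b; pose w := b *m invmx T.
have UTT : T^T \in unitmx by rewrite unitmx_tr.
have GE : G = invmx T *m (invmx T)^T.
  have E : G *m T^T = invmx T by apply: (can_inj (mulKmx UT)); rewrite mulmxV // mulmxA.
  by rewrite trmx_inv -E mulmxK.
have -> : (b *m B *m G *m b^T) 0 0 = \sum_i sg i * w 0 i ^+ 2.
  rewrite BE GE !mulmxA mulmxK // -(mulmxA _ _ b^T) -trmx_mul -/w mxE; apply: eq_bigr => i _.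
  rewrite mul_mx_diag !mxE expr2 mulrA; congr (_ * _); rewrite mulrC; congr (_ * _).
have -> : (b *m G *m b^T) 0 0 = \sum_i w 0 i ^+ 2.
  rewrite GE mulmxA -(mulmxA _ _ b^T) -trmx_mul -/w mxE.
  by apply: eq_bigr => i _; rewrite [w^T i 0]mxE expr2.
rewrite sumr_ge0 => [|i _] /=; last by rewrite mulr_ge0 ?sqr_ge0.
rewrite -sums mulr_sumr; apply: ler_sum => i _; rewrite ler_wpM2r ?sqr_ge0 //.
by rewrite (bigD1 i) //= lerDl sumr_ge0.
Qed.

End NewtonTensor.

(** * The Newton flow of a hypersurface *)

Section DetTools.
Context {R : comNzRingType}.

Definition rowrep n m (i : 'I_n) (M : 'M[R]_(n, m)) (u : 'rV[R]_m) : 'M[R]_(n, m) :=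
  \matrix_(k, l) if k == i then u 0 l else M k l.

Lemma rowrep_mulmx n m p (i : 'I_n) (M : 'M[R]_(n, m)) u (E : 'M[R]_(m, p)) :
  rowrep i M u *m E = rowrep i (M *m E) (u *m E).
Proof.
apply/matrixP => k l; rewrite !mxE.
by case: eqP => [->|/eqP ki]; apply: eq_bigr => a _; rewrite mxE ?eqxx ?(negbTE ki).
Qed.

Lemma det_rowrep n (i : 'I_n) (M : 'M[R]_n) (u : 'rV[R]_n) : \det (rowrep i M u) = (u *m \adj M) 0 i.
Proof.
rewrite (expand_det_row _ i) mxE; apply: eq_bigr => k _; rewrite !mxE eqxx; congr (_ * (_ * \det _)).
by apply/matrixP => a b; rewrite !mxE eq_sym (negbTE (neq_lift _ _)).
Qed.

Lemma det_xrow n (M : 'M[R]_n) (a b : 'I_n) : a != b -> \det (xrow a b M) = - \det M.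
Proof.
by move=> ab; rewrite xrowE det_mulmx det_perm odd_tperm ab expr1 mulN1r.
Qed.

(** Once [col_mx a E] is factored out, the other factor is block triangular: the component of the
    new row along [a] drops out and Cramer's rule remains. *)
Lemma det_col_rowrep n (a : 'rV[R]_(1 + n)) (E : 'M[R]_(n, 1 + n)) (i : 'I_n) (B : 'M[R]_n) (v : 'rV[R]_n) (beta : R) :
  \det (col_mx a (rowrep i (B *m E) (v *m E + beta *: a)) : 'M[R]_(1 + n)) =
  (v *m \adj B) 0 i * \det (col_mx a E : 'M[R]_(1 + n)).
Proof.
have -> : col_mx a (rowrep i (B *m E) (v *m E + beta *: a)) =
   block_mx 1%:M 0 (beta *: delta_mx i 0) (rowrep i B v) *m col_mx a E.
  rewrite mul_block_col mul1mx mul0mx addr0; congr col_mx.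
  rewrite rowrep_mulmx -scalemxAl; apply/matrixP => k l.
  rewrite [LHS]mxE [RHS]mxE [X in _ = X + _]mxE [X in _ = _ * X + _]mxE big_ord1.
  rewrite [X in _ = _ * (X * _) + _]mxE eqxx andbT [X in _ = _ + X]mxE.
  have [_|_] := eqVneq k i; last by rewrite mul0r mulr0 add0r.
  by rewrite mul1r [LHS]mxE [Y in _ + Y = _]mxE addrC.
by rewrite det_mulmx det_lblock det1 mul1r det_rowrep.
Qed.

(** The first row has no component along [a], so only [beta] survives from the replaced row.
    Exchanging these two rows makes the factor block triangular and gives the sign. *)
Lemma det_col_rowrep_swap n (a : 'rV[R]_(1 + n)) (E : 'M[R]_(n, 1 + n)) (i : 'I_n) (B : 'M[R]_n) (v u : 'rV[R]_n) (beta : R) :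
  \det (col_mx (u *m E) (rowrep i (B *m E) (v *m E + beta *: a)) : 'M[R]_(1 + n)) =
  - (beta * (u *m \adj B) 0 i * \det (col_mx a E : 'M[R]_(1 + n))).
Proof.
have -> : col_mx (u *m E) (rowrep i (B *m E) (v *m E + beta *: a)) =
   xrow (lshift n ord0) (rshift 1 i) (block_mx beta%:M v 0 (rowrep i B u)) *m col_mx a E.
  rewrite xrowE -mulmxA -xrowE mul_block_col mul_scalar_mx mul0mx add0r rowrep_mulmx.
  apply/matrixP => k l; rewrite [RHS]mxE.
  case: (split_ordP k) => k' ->.
    by rewrite (ord1 k') tpermL col_mxEu col_mxEd [RHS]mxE eqxx.
  have [->|ki] := eqVneq k' i.
    by rewrite tpermR col_mxEu col_mxEd [LHS]mxE eqxx addrC.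
  rewrite tpermD; last 2 first.
  - by apply/eqP => /(congr1 val).
  - by rewrite eq_sym (inj_eq (@rshift_inj _ _)).
  by rewrite !col_mxEd [LHS]mxE [RHS]mxE (negbTE ki).
by rewrite det_mulmx det_xrow // det_ublock det_scalar1 mulNr det_rowrep.
Qed.

Lemma det_rank1 n (u : 'rV[R]_n) (b : R) : \det (1%:M + b *: (u^T *m u)) = 1 + b * (u *m u^T) 0 0.
Proof.
pose M := block_mx (1%:M : 'M[R]_1) (- b *: u) u^T (1%:M : 'M[R]_n).
have d1 : \det M = \det (1%:M + b *: (u^T *m u)).
  have : \det (block_mx (1%:M : 'M[R]_1) 0 (- u^T) (1%:M : 'M[R]_n) *m M) = \det M.
    by rewrite det_mulmx det_lblock !det1 !mul1r.
  move=> <-; rewrite mulmx_block !mul1mx !mul0mx !addr0 mulmx1 addNr mulNmx -scalemxAr !scaleNr opprK.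
  by rewrite det_ublock det1 mul1r addrC.
rewrite -d1.
have : \det (M *m block_mx (1%:M : 'M[R]_1) 0 (- u^T) (1%:M : 'M[R]_n)) = \det M.
  by rewrite det_mulmx det_lblock !det1 !mulr1.
move=> <-; rewrite mulmx_block !mulmx1 !mulmx0 !add0r mul1mx subrr det_ublock det1 mulr1.
rewrite [_ + _]mx11_scalar det_scalar1 mulmxN -scalemxAl scaleNr opprK.
by rewrite !mxE eqxx.
Qed.

End DetTools.

(** [r2] says that the normal has length 1, [r1] that it is normal, and [r3] is the derivative of
    [r2]. The conclusion is an explicit combination of them after clearing denominators. *)
Lemma nu_tangent_real (F : realFieldType) (kappa q a b d s p w : F) :
  0 < q -> q * (w - 1) + kappa * (p * p) = 0 -> q * d + kappa * (s * p) = 0 ->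
  q * (a + a + 0) + (w - 1) * (- kappa * (2 * s)) + kappa * (p * (d + b) + p * (b + d)) = 0 ->
  a + kappa / q * (b * p) = 0.
Proof.
move=> q0 r2 r1 r3.
suff : q * (q * (a + kappa / q * (b * p))) = 0.
  by move=> /eqP; rewrite !mulf_eq0 (gt_eqF q0) /= => /eqP.
have -> : q * (q * (a + kappa / q * (b * p))) = q * (q * a + kappa * (b * p)) by field; rewrite gt_eqF.
have -> : q * (q * a + kappa * (b * p)) = q / 2 * (q * (a + a + 0) + (w - 1) * (- kappa * (2 * s)) + kappa * (p * (d + b) + p * (b + d)))
    + kappa * s * (q * (w - 1) + kappa * (p * p)) - kappa * p * (q * d + kappa * (s * p)).
  by field.
by rewrite r1 r2 r3 !mulr0 addr0 subrr.
Qed.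

(** [r1] and [r2] express normality, [r3] and [r4] are its derivatives. The second derivatives of
    [X] enter the last two through the same [h1] and [h2], and cancel. *)
Lemma shape_real (F : realFieldType) (kappa q si sj di dj p Nij Nji Ni Nj h1 h2 g : F) :
  0 < q -> q * dj + kappa * (sj * p) = 0 -> q * di + kappa * (si * p) = 0 ->
  - kappa * (2 * si) * dj + q * (h1 + Nij) + kappa * ((h2 + g) * p + sj * (di + Ni)) = 0 ->
  - kappa * (2 * sj) * di + q * (h1 + Nji) + kappa * ((h2 + g) * p + si * (dj + Nj)) = 0 ->
  Nji + kappa / q * (Nj * si) = Nij + kappa / q * (Ni * sj).
Proof.
move=> q0 r1 r2 r3 r4; apply/eqP; rewrite -subr_eq0; apply/eqP.
set L := _ - _; suff : q * (q * L) = 0 by move=> /eqP; rewrite !mulf_eq0 (gt_eqF q0) /= => /eqP.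
have -> : q * (q * L) = q * (- kappa * (2 * sj) * di + q * (h1 + Nji) + kappa * ((h2 + g) * p + si * (dj + Nj)))
   - q * (- kappa * (2 * si) * dj + q * (h1 + Nij) + kappa * ((h2 + g) * p + sj * (di + Ni)))
   + 3 * kappa * sj * (q * di + kappa * (si * p)) - 3 * kappa * si * (q * dj + kappa * (sj * p)).
  by rewrite /L; field; rewrite gt_eqF.
by rewrite r1 r2 r3 r4 !mulr0 addr0 !subr0.
Qed.

(** * Hypersurfaces of R^(1+n) with the model metric [ambient] *)

Section FlatHypersurface.
Context {R : realType} {n : nat}.
Variables (D : set 'rV[R]_n) (X nu : 'rV[R]_n -> 'rV[R]_(1 + n)) (G : 'rV[R]_n -> 'M[R]_n) (kappa : R).
Hypothesis oD : open D.
Hypothesis kappa_le0 : kappa <= 0.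
Hypothesis X_smooth : forall a k, Ck_on k D (fun y => X y 0 a).
Hypothesis nu_smooth : forall a k, Ck_on k D (fun y => nu y 0 a).

Definition conf y : R := 1 - kappa * sqn (X y).
Definition ambient y : 'M[R]_(1 + n) := 1%:M + (kappa / conf y) *: ((X y)^T *m X y).

Hypothesis G_pos : forall y, D y -> forall v : 'rV[R]_n, v != 0 -> 0 < (v *m G y *m v^T) 0 0.
Hypothesis G_sym : forall y, D y -> (G y)^T = G y.
Hypothesis G_E : forall y, D y -> G y = jac X y *m ambient y *m (jac X y)^T.
Hypothesis nu_normal : forall y, D y -> jac X y *m ambient y *m (nu y)^T = 0.
Hypothesis nu_unit : forall y, D y -> nu y *m ambient y *m (nu y)^T = 1%:M.

(** The formula of the shape operator with ordinary derivatives of [nu]; [shape_position] identifies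
    it with the geometric one. *)
Definition shape y : 'M[R]_n := - jac nu y *m ambient y *m (jac X y)^T *m invmx (G y).
Definition frame y : 'M[R]_(1 + n) := col_mx (nu y) (jac X y).
Definition dot p (u v : 'rV[R]_p) : R := (u *m v^T) 0 0.

Lemma conf_gt0 y : 0 < conf y.
Proof. by rewrite /conf; have := mulr_le0_ge0 kappa_le0 (sqn_ge0 (X y)); lra. Qed.

Lemma dotC p (u v : 'rV[R]_p) : dot u v = dot v u.
Proof. by rewrite /dot !mxE; apply: eq_bigr => i _; rewrite !mxE mulrC. Qed.

Lemma is_derive_dot p (u v : 'rV[R]_n -> 'rV[R]_p) du dv y (h : 'rV[R]_n) :
  is_derive y h u du -> is_derive y h v dv ->
  is_derive y h (fun z => dot (u z) (v z)) (dot du (v y) + dot (u y) dv).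
Proof.
move=> hu hv; have /is_derive_mxP/(_ 0 0) := is_derive_mulmx hu (is_derive_trmx hv).
by rewrite mxE.
Qed.

Lemma ambient_sym y : (ambient y)^T = ambient y.
Proof. by rewrite raddfD /= trmx1 linearZ /= trmx_mul trmxK. Qed.

Lemma ambient_dot y (u v : 'rV[R]_(1 + n)) :
  (u *m ambient y *m v^T) 0 0 = dot u v + kappa / conf y * (dot u (X y) * dot (X y) v).
Proof.
rewrite mulmxDr mulmx1 mulmxDl -scalemxAr -scalemxAl mxE [X in _ + X]mxE; congr (_ + _ * _).
by rewrite mulmxA -(mulmxA (u *m (X y)^T)) mxE big_ord1.
Qed.

Lemma frame_metric y : D y -> frame y *m ambient y *m (frame y)^T = block_mx 1%:M 0 0 (G y).
Proof.
move=> Dy; rewrite /frame tr_col_mx mul_col_mx mul_col_row nu_unit // nu_normal // -G_E //; congr block_mx.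
by apply: trmx_inj; rewrite !trmx_mul trmxK ambient_sym mulmxA nu_normal // trmx0.
Qed.

Lemma G_unit y : D y -> G y \in unitmx.
Proof. by move=> Dy; exact: (g_unit G_pos). Qed.

Lemma frame_unit y : D y -> frame y \in unitmx.
Proof.
move=> Dy; have : block_mx (1%:M : 'M[R]_1) 0 0 (G y) \in unitmx.
  by rewrite unitmxE det_lblock det1 mul1r -unitmxE G_unit.
by rewrite -frame_metric // !unitmx_mul => /andP[/andP[]].
Qed.

(** The ambient metric has determinant [1 / conf]. Up to sign, the determinant of the frame is
    therefore [sqrt conf] times the Riemannian density. *)
Lemma frame_det y : D y -> \det (frame y) ^+ 2 = conf y * \det (G y).
Proof.
move=> Dy; have := congr1 (fun M : 'M[R]_(1 + n) => \det M) (frame_metric Dy).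
rewrite !det_mulmx det_lblock det1 mul1r det_tr det_rank1 -/(sqn (X y)).
have c0 := conf_gt0 y; have -> : 1 + kappa / conf y * sqn (X y) = (conf y)^-1.
  by move: c0; rewrite /conf => c0; field; rewrite gt_eqF.
by move=> <-; move: (\det _) => d; field; rewrite gt_eqF.
Qed.

Lemma frame_decomp p y (Z : 'M[R]_(p, 1 + n)) : D y ->
  Z = Z *m ambient y *m (nu y)^T *m nu y + Z *m ambient y *m (jac X y)^T *m invmx (G y) *m jac X y.
Proof.
move=> Dy; have U := frame_unit Dy; pose P := Z *m invmx (frame y).
have ZE : Z = lsubmx P *m nu y + rsubmx P *m jac X y.
  by rewrite -mul_row_col hsubmxK /P mulmxKV.
have u1 : nu y *m (ambient y *m (nu y)^T) = 1%:M by rewrite mulmxA nu_unit.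
have u2 : jac X y *m (ambient y *m (nu y)^T) = 0 by rewrite mulmxA nu_normal.
have u3 : nu y *m (ambient y *m (jac X y)^T) = 0.
  by apply: trmx_inj; rewrite !trmx_mul trmxK ambient_sym nu_normal // trmx0.
have u4 : jac X y *m (ambient y *m (jac X y)^T) = G y by rewrite mulmxA -G_E.
have e1 : Z *m ambient y *m (nu y)^T = lsubmx P.
  by rewrite {1}ZE !mulmxDl -!mulmxA u1 u2 mulmx1 mulmx0 addr0.
have e2 : Z *m ambient y *m (jac X y)^T = rsubmx P *m G y.
  by rewrite {1}ZE !mulmxDl -!mulmxA u3 u4 mulmx0 add0r.
by rewrite e1 e2 mulmxK ?G_unit.
Qed.

Let E i y : 'rV[R]_(1 + n) := row i (jac X y).
Let N i y : 'rV[R]_(1 + n) := row i (jac nu y).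

Let dX i y : D y -> is_derive y (delta_mx 0 i) X (E i y).
Proof.
move=> Dy; apply/is_derive_mxP => k a; rewrite (ord1 k) !mxE.
by apply: DeriveDef => //; exact: Ck_derivable (X_smooth a 1) Dy.
Qed.

Let dnu i y : D y -> is_derive y (delta_mx 0 i) nu (N i y).
Proof.
move=> Dy; apply/is_derive_mxP => k a; rewrite (ord1 k) !mxE.
by apply: DeriveDef => //; exact: Ck_derivable (nu_smooth a 1) Dy.
Qed.

Let dE i j y : D y -> is_derive y (delta_mx 0 j) (E i) (\row_a partial j (partial i (fun z => X z 0 a)) y).
Proof.
move=> Dy; apply/is_derive_mxP => k a; rewrite (ord1 k) mxE.
have -> : (fun z => E i z 0 a) = partial i (fun z => X z 0 a) by apply/funext => z; rewrite !mxE.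
by apply: DeriveDef => //; exact: Ck_derivable (Ck_partial i (X_smooth a 2)) Dy.
Qed.

Let dconf j y : D y -> is_derive y (delta_mx 0 j) conf (- kappa * (2 * dot (E j y) (X y))).
Proof.
move=> Dy; have h := is_deriveMl (- kappa) (is_derive_dot (dX j Dy) (dX j Dy)).
have := @is_deriveD _ _ _ _ _ _ _ _ _ (is_derive_cst (1 : R) y (delta_mx 0 j)) h.
congr is_derive; last by rewrite add0r (dotC (X y)); ring.
by apply/funext => z; rewrite /conf -mulNr.
Qed.

Let derive_zero (h : 'rV[R]_n -> R) j y dh : (forall z, D z -> h z = 0) -> D y ->
  is_derive y (delta_mx 0 j) h dh -> dh = 0.
Proof.
move=> h0 Dy /partial_eq <-; transitivity (partial j (fun=> 0 : R) y); last by rewrite partial_cst.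
by apply: partial_near; exact: (eq_near oD).
Qed.

Let normal_rel i y : D y -> conf y * dot (E i y) (nu y) + kappa * (dot (E i y) (X y) * dot (X y) (nu y)) = 0.
Proof.
move=> Dy; have := ambient_dot y (E i y) (nu y).
rewrite /E -row_mul -row_mul nu_normal // [LHS]mxE [X in X = _ -> _]mxE => /esym h.
have c0 := conf_gt0 y; have := congr1 (fun t => conf y * t) h; rewrite mulr0 => <-.
by field; rewrite gt_eqF.
Qed.

Let unit_rel y : D y -> conf y * (dot (nu y) (nu y) - 1) + kappa * (dot (nu y) (X y) * dot (X y) (nu y)) = 0.
Proof.
move=> Dy; have := ambient_dot y (nu y) (nu y); rewrite nu_unit // mxE eqxx mulr1n => h.
have c0 := conf_gt0 y; have := congr1 (fun t => conf y * (t - 1)) h; rewrite subrr mulr0 => ->.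
by field; rewrite gt_eqF.
Qed.

Lemma nu_tangent y : D y -> jac nu y *m ambient y *m (nu y)^T = 0.
Proof.
move=> Dy; apply/matrixP => j k; rewrite (ord1 k) [RHS]mxE.
have -> : (jac nu y *m ambient y *m (nu y)^T) j 0 = (N j y *m ambient y *m (nu y)^T) 0 0.
  by rewrite /N -!row_mul [RHS]mxE.
rewrite ambient_dot.
have h1 := is_deriveM (dconf j Dy) (@is_deriveD _ _ _ _ _ _ _ _ _ (is_derive_dot (dnu j Dy) (dnu j Dy)) (is_derive_cst (-1 : R) y (delta_mx 0 j))).
have h2 := is_deriveMl kappa (is_deriveM (is_derive_dot (dnu j Dy) (dX j Dy)) (is_derive_dot (dX j Dy) (dnu j Dy))).
have := derive_zero _ Dy (@is_deriveD _ _ _ _ _ _ _ _ _ h1 h2) => /(_ (fun z Dz => unit_rel Dz)).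
have := normal_rel j Dy; have := unit_rel Dy; have := conf_gt0 y.
rewrite /GRing.scale /= ![_ (nu y) (N j y)]dotC ![_ (X y) (N j y)]dotC ![_ (X y) (nu y)]dotC ![_ (nu y) (E j y)]dotC.
exact: nu_tangent_real.
Qed.

Lemma shapeG y : D y -> shape y *m G y = - (jac nu y *m ambient y *m (jac X y)^T).
Proof. by move=> Dy; rewrite /shape mulmxKV ?G_unit // !mulNmx. Qed.

Lemma shape_self_adjoint y : D y -> shape y *m G y = G y *m (shape y)^T.
Proof.
move=> Dy; rewrite -{2}(G_sym Dy) -trmx_mul shapeG // raddfN; congr (- _).
apply/matrixP => j i; rewrite [RHS]mxE.
have ent a b : (jac nu y *m ambient y *m (jac X y)^T) a b = (N a y *m ambient y *m (E b y)^T) 0 0.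
  rewrite [LHS]mxE [RHS]mxE; apply: eq_bigr => c _; rewrite /N -row_mul; congr (_ * _).
    by rewrite [RHS]mxE.
  by rewrite !mxE.
rewrite !ent !ambient_dot.
pose hE a b : 'rV[R]_(1 + n) := \row_l partial b (partial a (fun z => X z 0 l)) y.
have der a b : (- kappa * (2 * dot (E b y) (X y))) * dot (E a y) (nu y)
   + conf y * (dot (hE a b) (nu y) + dot (E a y) (N b y))
   + kappa * ((dot (hE a b) (X y) + dot (E a y) (E b y)) * dot (X y) (nu y)
      + dot (E a y) (X y) * (dot (E b y) (nu y) + dot (X y) (N b y))) = 0.
  have h1 := is_deriveM (dconf b Dy) (is_derive_dot (dE a b Dy) (dnu b Dy)).
  have h2 := is_deriveMl kappa (is_deriveM (is_derive_dot (dE a b Dy) (dX b Dy)) (is_derive_dot (dX b Dy) (dnu b Dy))).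
  have := derive_zero _ Dy (@is_deriveD _ _ _ _ _ _ _ _ _ h1 h2) => /(_ (fun z Dz => normal_rel a Dz)).
  by move=> e; rewrite -[RHS]e /GRing.scale /= -/(hE a b); ring.
have := der i j; have := der j i.
have hC : hE j i = hE i j.
  apply/rowP => l; rewrite /hE [LHS]mxE [RHS]mxE; have e := partialC i j oD (X_smooth l 2) Dy; exact e.
rewrite hC; move: (hE i j) => h.
have := normal_rel i Dy; have := normal_rel j Dy; have := conf_gt0 y.
rewrite ![_ (X y) (N _ y)]dotC ![_ (X y) (nu y)]dotC ![_ (E j y) (E i y)]dotC ![_ (E _ y) (N _ y)]dotC ![_ (X y) (E _ y)]dotC.
exact: shape_real.
Qed.

Lemma jac_nu y : D y -> jac nu y = - (shape y *m jac X y).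
Proof.
move=> Dy; rewrite [LHS](frame_decomp _ Dy) nu_tangent // mul0mx add0r /shape -!mulNmx.
by rewrite opprK.
Qed.

(** Coordinates of the tangential part of [X]; by [is_derive_sqn] the gradient of [|X|^2] is
    [2 conf] times this vector. *)
Definition tangent y : 'rV[R]_n := X y *m ambient y *m (jac X y)^T *m invmx (G y).
Definition support y : R := (X y *m ambient y *m (nu y)^T) 0 0.

Lemma X_decomp y : D y -> X y = tangent y *m jac X y + support y *: nu y.
Proof. by move=> Dy; rewrite {1}(frame_decomp (X y) Dy) addrC [Y in Y *m nu y]mx11_scalar mul_scalar_mx. Qed.

Lemma X_ambient y : X y *m ambient y = (conf y)^-1 *: X y.
Proof.
rewrite mulmxDr mulmx1 -scalemxAr mulmxA [Y in Y *m X y]mx11_scalar mul_scalar_mx scalerA -[Y in Y + _]scale1r -scalerDl.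
congr (_ *: _); have c0 := conf_gt0 y; move: c0; rewrite -/(sqn (X y)) /conf => c0.
by field; rewrite gt_eqF.
Qed.

Lemma tangentG y : D y -> tangent y *m G y = (conf y)^-1 *: (X y *m (jac X y)^T).
Proof. by move=> Dy; rewrite /tangent mulmxKV ?G_unit // X_ambient scalemxAl. Qed.

Lemma is_derive_sqn i y : D y ->
  is_derive y (delta_mx 0 i) (fun z => sqn (X z)) (2 * conf y * (tangent y *m G y) 0 i).
Proof.
move=> Dy; apply: (is_derive_eq (is_derive_dot (dX i Dy) (dX i Dy))).
rewrite (dotC (X y)) tangentG // mxE.
have -> : (X y *m (jac X y)^T) 0 i = dot (E i y) (X y).
  by rewrite dotC /dot !mxE; apply: eq_bigr => a _; rewrite !mxE.
by field; rewrite gt_eqF ?conf_gt0.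
Qed.

(** Pythagoras: the rest of the squared length of [X], which is [|X|^2 / conf] in the ambient
    metric, is the square of [support]. *)
Lemma tangent_norm y : D y -> (tangent y *m G y *m (tangent y)^T) 0 0 <= sqn (X y) / conf y.
Proof.
move=> Dy; have : (X y *m ambient y *m (X y)^T) 0 0 = sqn (X y) / conf y.
  by rewrite X_ambient -scalemxAl mxE mulrC.
have d : X y *m ambient y *m (jac X y)^T = tangent y *m G y by rewrite /tangent mulmxKV ?G_unit.
have xt : (X y)^T = (jac X y)^T *m (tangent y)^T + support y *: (nu y)^T.
  by rewrite -trmx_mul -linearZ -raddfD -X_decomp.
move=> <-; rewrite xt mulmxDr -scalemxAr mulmxA d [leRHS]mxE lerDl [leRHS]mxE -/(support y) -expr2.
exact: sqr_ge0.
Qed.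

Definition flow i t y : R := \det (col_mx (nu y) (rowrep i (jac X y - t *: jac nu y) (X y)) : 'M[R]_(1 + n)).

Lemma shifted_jac t y : D y -> jac X y - t *: jac nu y = (1%:M + t *: shape y) *m jac X y.
Proof. by move=> Dy; rewrite jac_nu // scalerN opprK mulmxDl mul1mx scalemxAl. Qed.

(** Modulo the normal, the replaced row is the tangential part of [X], and the other rows are those
    of [(1 + t A) dX]. *)
Lemma flowE i t y : D y -> flow i t y = \det (frame y) * (tangent y *m \adj (1%:M + t *: shape y)) 0 i.
Proof. by move=> Dy; rewrite /flow shifted_jac // {1}(X_decomp Dy) det_col_rowrep mulrC. Qed.

Lemma flow_smooth i t k : Ck_on k D (flow i t).
Proof.
have jX a b : Ck_on k D (fun y => jac X y a b).
  by apply: (Ck_ext oD) (Ck_partial a (X_smooth b k.+1)) => y _; rewrite mxE.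
have jnu a b : Ck_on k D (fun y => jac nu y a b).
  by apply: (Ck_ext oD) (Ck_partial a (nu_smooth b k.+1)) => y _; rewrite mxE.
apply: Ck_det => // a b; case: (split_ordP a) => a' ->.
  by apply: Ck_ext (nu_smooth b k) => // y _; rewrite col_mxEu (ord1 a').
case: (eqVneq a' i) => ai.
  by apply: Ck_ext (X_smooth b k) => // y _; rewrite col_mxEd mxE ai eqxx.
have := CkB oD (jX a' b) (CkM oD (Ck_cst k D t) (jnu a' b)).
by apply: (Ck_ext oD) => y _; rewrite col_mxEd [RHS]mxE (negbTE ai) [RHS]mxE [Y in _ = _ + Y]mxE [Y in _ = _ - Y]mxE.
Qed.

(** The derivative may fall on the normal, on the replaced row, or on another row. The first two
    cases give the two traces; the last cancels in pairs. *)
Lemma flow_divergence t y : D y ->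
  \sum_i partial i (flow i t) y = \det (frame y) *
    (\tr (\adj (1%:M + t *: shape y)) + support y * \tr (shape y *m \adj (1%:M + t *: shape y))).
Proof.
move=> Dy; set B := 1%:M + t *: shape y.
(* Second derivatives of [X - t nu]; their symmetry is all that remains of the Codazzi equation. *)
pose H i k : 'rV[R]_(1 + n) := \row_a (partial i (partial k (fun z => X z 0 a)) y - t * partial i (partial k (fun z => nu z 0 a)) y).
have HC i k : H i k = H k i.
  apply/rowP => a; rewrite [LHS]mxE [RHS]mxE.
  have e1 := partialC i k oD (X_smooth a 2) Dy; have e2 := partialC i k oD (nu_smooth a 2) Dy.
  by rewrite e1 e2.
have HE i k a : H i k 0 a = partial i (partial k (fun z => X z 0 a)) y - t * partial i (partial k (fun z => nu z 0 a)) y.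
  by rewrite mxE.
clearbody H.
pose dA i : 'M[R]_(1 + n) := col_mx (N i y) (\matrix_k (if k == i then E i y else H i k)).
pose M i : 'M[R]_(1 + n) := col_mx (nu y) (rowrep i (jac X y - t *: jac nu y) (X y)).
have part i : partial i (flow i t) y = \sum_j \det (\matrix_(k, l) (if k == j then dA i k l else M i k l)).
  apply: partial_eq; apply: is_derive_det => k l.
  rewrite /dA; case: (split_ordP k) => k' ->.
    rewrite col_mxEu (ord1 k'); have -> : (fun z => col_mx (nu z) (rowrep i (jac X z - t *: jac nu z) (X z)) (lshift n 0) l) = (fun z => nu z 0 l).
      by apply/funext => z; rewrite col_mxEu.
    by have /is_derive_mxP := dnu i Dy; exact.
  rewrite col_mxEd mxE; have [->|ki] := eqVneq k' i.
    have -> : (fun z => col_mx (nu z) (rowrep i (jac X z - t *: jac nu z) (X z)) (rshift 1 i) l) = (fun z => X z 0 l).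
      by apply/funext => z; rewrite col_mxEd mxE eqxx.
    by have /is_derive_mxP := dX i Dy; exact.
  have -> : (fun z => col_mx (nu z) (rowrep i (jac X z - t *: jac nu z) (X z)) (rshift 1 k') l) =
    (fun z => partial k' (fun z => X z 0 l) z + - t * partial k' (fun z => nu z 0 l) z).
    by apply/funext => z; rewrite col_mxEd mxE (negbTE ki) !mxE mulNr.
  rewrite HE -mulNr; apply: is_deriveD; last apply: is_deriveMl.
    by apply: DeriveDef => //; exact: Ck_derivable (Ck_partial k' (X_smooth l 2)) Dy.
  by apply: DeriveDef => //; exact: Ck_derivable (Ck_partial k' (nu_smooth l 2)) Dy.
(* The differentiated normal is tangential, so from the replaced row [X] only its normal component
   [support] contributes. *)
have first_row i : \det (\matrix_(k, l) (if k == lshift n 0 then dA i k l else M i k l)) =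
    \det (frame y) * (support y * (shape y *m \adj B) i i).
  transitivity (\det (col_mx (- row i (shape y) *m jac X y) (rowrep i (B *m jac X y) (tangent y *m jac X y + support y *: nu y)) : 'M[R]_(1 + n))).
    congr (\det _); apply/matrixP => k l; rewrite mxE; case: (split_ordP k) => k' ->.
      by rewrite (ord1 k') eqxx !col_mxEu /N jac_nu // mulNmx -row_mul raddfN.
    by rewrite eq_rlshift !col_mxEd -X_decomp // -shifted_jac.
  rewrite det_col_rowrep_swap mulNmx mxE -row_mul mxE -/(frame y); ring.
(* Here [X] becomes its own derivative, a row of [jac X], and Cramer's rule gives a diagonal entry
   of the adjugate. *)
have own_row i : \det (\matrix_(k, l) (if k == rshift 1 i then dA i k l else M i k l)) =
    \det (frame y) * (\adj B) i i.
  transitivity (\det (col_mx (nu y) (rowrep i (B *m jac X y) (row i 1%:M *m jac X y + 0 *: nu y)) : 'M[R]_(1 + n))).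
    congr (\det _); apply/matrixP => k l; rewrite mxE; case: (split_ordP k) => k' ->.
      by rewrite (ord1 k') eq_lrshift !col_mxEu.
    rewrite (inj_eq (@rshift_inj _ _)) !col_mxEd scale0r addr0 -row_mul mul1mx.
    rewrite -(shifted_jac t Dy) [RHS]mxE [Y in (if _ then Y else _) = _]mxE [Y in (if _ then _ else Y) = _]mxE.
    by case: (k' =P i).
  by rewrite det_col_rowrep -row_mul mul1mx mxE mulrC.
(* The derivative along [i] falling on row [k]. Exchanging rows [i] and [k] gives [cross k i],
   because [H] is symmetric, with the opposite sign. *)
pose cross i k := \det (\matrix_(k', l) (if k' == rshift 1 k then dA i k' l else M i k' l)).
have crossC i k : k != i -> cross i k = - cross k i.
  move=> ki; rewrite /cross -(det_xrow _ (a := rshift 1 i) (b := rshift 1 k)); last first.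
    by rewrite (inj_eq (@rshift_inj _ _)) eq_sym.
  congr (\det _); apply/matrixP => a l; rewrite [RHS]mxE [RHS]mxE [LHS]mxE; case: (split_ordP a) => a' ->.
    rewrite tpermD ?eq_lrshift // 1?eq_sym ?eq_lrshift //.
    by rewrite !col_mxEu.
  have [->|ai] := eqVneq a' i.
    rewrite tpermL (inj_eq (@rshift_inj _ _)) [i == k]eq_sym (negbTE ki) (inj_eq (@rshift_inj _ _)) (negbTE ki).
    by rewrite !col_mxEd !mxE !eqxx.
  have [->|ak] := eqVneq a' k.
    by rewrite tpermR !eqxx !col_mxEd [LHS]mxE [RHS]mxE [i == k]eq_sym (negbTE ki) HC.
  have -> : tperm (rshift 1 i) (rshift 1 k) (rshift 1 a') = rshift 1 a'.
    by apply: tpermD; rewrite (inj_eq (@rshift_inj _ _)) eq_sym.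
  rewrite !(inj_eq (@rshift_inj _ _)) (negbTE ai) (negbTE ak).
  by rewrite !col_mxEd !mxE (negbTE ai) (negbTE ak).
have cross0 : \sum_i \sum_(k | k != i) cross i k = 0.
  have e : \sum_i \sum_(k | k != i) cross i k = - \sum_i \sum_(k | k != i) cross i k.
    rewrite {1}(exchange_big_dep xpredT) //= -sumrN; apply: eq_bigr => k _; rewrite -sumrN.
    by apply: eq_big => [i|i]; [rewrite eq_sym|move=> ik; rewrite crossC].
  by apply/eqP; rewrite -eqNr -e eqxx.
transitivity (\sum_i (\det (frame y) * (support y * (shape y *m \adj B) i i) + (\det (frame y) * (\adj B) i i + \sum_(k | k != i) cross i k))).
  apply: eq_bigr => i _; rewrite part big_split_ord /= big_ord1 first_row; congr (_ + _).
  by rewrite (bigD1 i) //= own_row.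
by rewrite big_split /= big_split /= cross0 addr0 -!mulr_sumr -mulrDr addrC.
Qed.

End FlatHypersurface.

(** As in [adj_diag], the determinant is cancelled over polynomials before evaluating at [t]. *)
Lemma adj_intertwine {R : realType} n (A B T : 'M[R]_n) t : T \in unitmx -> T *m A = B *m T ->
  T *m \adj (1%:M + t *: A) = \adj (1%:M + t *: B) *m T.
Proof.
move=> UT TA; pose P (C : 'M[R]_n) : 'M[{poly R}]_n := 1%:M + 'X *: map_mx polyC C.
pose T' := map_mx polyC T.
have TP : P B *m T' = T' *m P A.
  by rewrite mulmxDl mulmxDr mul1mx mulmx1 -scalemxAl -scalemxAr -!map_mxM TA.
have T0 : \det T' != 0 by rewrite det_map_mx polyC_eq0 -unitfE -unitmxE.
have dd : \det (P B) = \det (P A).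
  by apply: (mulIf T0); rewrite -det_mulmx TP det_mulmx mulrC.
have d0 : \det (P A) != 0.
  apply: contra_neq (oner_neq0 R) => /(congr1 (horner_eval 0)).
  rewrite rmorph0 -det_map_mx => <-; rewrite (_ : map_mx _ _ = 1%:M) ?det1 //.
  by apply/matrixP => i j; rewrite !mxE rmorphD rmorphMn /= rmorphM /= /horner_eval !hornerE.
have e : T' *m \adj (P A) = \adj (P B) *m T'.
  have : (T' *m \adj (P A) - \adj (P B) *m T') *m P A *m \adj (P A) = 0.
    rewrite mulmxBl -!mulmxA mul_adj_mx -TP (mulmxA (\adj (P B))) mul_adj_mx dd.
    by rewrite mul_mx_scalar mul_scalar_mx subrr mul0mx.
  rewrite -mulmxA mul_mx_adj mul_mx_scalar => h; apply/matrixP => i j; apply: (mulfI d0).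
  by move/matrixP: h => /(_ i j); rewrite !mxE mulrBr => /eqP; rewrite subr_eq0 => /eqP.
have := congr1 (map_mx (horner_eval t)) e; rewrite !map_mxM /= !horner_adj.
have -> : map_mx (horner_eval t) T' = T.
  by apply/matrixP => i j; rewrite !mxE /horner_eval hornerC.
by [].
Qed.

Lemma Ck_points {R : realType} n (V : normedModType R) k (D : set 'rV[R]_n) (f : 'rV[R]_n -> V) :
  (forall y, D y -> exists2 U : set 'rV[R]_n, U y & Ck_on k U f) -> Ck_on k D f.
Proof.
elim: k f => [|k IH] f h.
  by split=> // y Dy; have [U Uy hU] := h _ Dy; exact: Ck_continuous hU Uy.
split=> [y Dy|i].
  by have [U Uy hU] := h _ Dy; exact: Ck_continuous hU Uy.
split=> [y Dy|].
  by have [U Uy hU] := h _ Dy; exact: Ck_derivable hU Uy.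
by apply: IH => y Dy; have [U Uy hU] := h _ Dy; exists U => //; exact: Ck_partial.
Qed.

(** * The immersed hypersurface seen through the model map *)

Section HypersurfaceModel.
Context {R : realType} {n : nat} (M : riemannianManifold R n) (Q : riemannianManifold R n.+1).
Variables (x : M -> Q) (N : chart R n.+1 Q -> M -> 'rV[R]_n.+1) (lam : 'I_n -> M -> R).
Variables (kappa : R) (f : Q -> 'rV[R]_n.+1).
Hypothesis kappa_le0 : kappa <= 0.
Hypothesis f_smooth : forall c, atlas c -> forall a k, Ck_on k (c @` chart_dom c) (fun y => in_chart f c y 0 a).
Hypothesis f_hess : forall c, atlas c -> forall a,
  hess_on (metric_coord c) kappa (c @` chart_dom c) (fun y => in_chart f c y 0 a).
Hypothesis f_integral : forall c, atlas c -> forall y, (c @` chart_dom c) y ->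
  first_integral (metric_coord c) kappa (in_chart f c) y = 1%:M.
Hypothesis himm : immersion x.
Hypothesis hisom : isometric x.
Hypothesis hN : unit_normal_field x N.

Definition position (p : M) : 'rV[R]_(1 + n) := f (x p).
Definition normal (p : M) : 'rV[R]_(1 + n) :=
  N (chart_at (x p)) p *m jac (in_chart f (chart_at (x p))) (chart_at (x p) (x p)).

Implicit Types (c : chart R n M) (d : chart R n.+1 Q).

Lemma map_overlap_open c d : open (overlap x c d).
Proof.
apply: chart_img_openI; have [[cx _] _] := himm.
by move/continuousP: cx; apply; exact: chart_dom_open.
Qed.
Arguments map_overlap_open : clear implicits.

Lemma map_coord_Ck c d a k : atlas c -> atlas d ->
  Ck_on k (overlap x c d) (fun y => map_coord x c d y 0 a).
Proof.
move=> hc hd; have [[_ h] _] := himm.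
refine (@Ck_entry _ _ _ (map_overlap_open c d) 1 n.+1 k (map_coord x c d) 0 a _); exact: (h c d hc hd k).
Qed.

Lemma map_coord_img c d y : overlap x c d y -> (d @` chart_dom d) (map_coord x c d y).
Proof. by case=> p [dp dq] <-; exists (x p) => //; rewrite /map_coord chart_mapK. Qed.

Lemma overlap_dom c d y : overlap x c d y ->
  [/\ c (chart_inv c y) = y, chart_dom c (chart_inv c y) & chart_dom d (x (chart_inv c y))].
Proof. by case=> p [dp dq] <-; rewrite chart_mapK. Qed.

Lemma differential_jac c d y : atlas c -> atlas d -> overlap x c d y ->
  differential_coord x c d (chart_inv c y) = jac (map_coord x c d) y.
Proof.
move=> hc hd Dy; rewrite /differential_coord; have [-> _ _] := overlap_dom Dy.
apply: jacobianE; exact: (C1_differentiable (map_overlap_open c d) (fun a => map_coord_Ck a 1 hc hd) Dy).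
Qed.

Lemma position_near c d y : overlap x c d y -> in_chart position c y = in_chart f d (map_coord x c d y).
Proof. by move=> /overlap_dom[_ _ dd]; rewrite /in_chart /position /map_coord chart_mapK. Qed.

Lemma img_overlap c y : (c @` chart_dom c) y -> overlap x c (chart_at (x (chart_inv c y))) y.
Proof.
move=> [p dp <-]; rewrite chart_mapK //; exists p => //; split=> //; exact: chart_at_dom.
Qed.

Lemma position_smooth c a k : atlas c -> Ck_on k (c @` chart_dom c) (fun y => in_chart position c y 0 a).
Proof.
move=> hc; apply: Ck_points => y Dy; pose d := chart_at (x (chart_inv c y)).
have hd : atlas d by exact: chart_at_atlas.
exists (overlap x c d); first exact: img_overlap.
have oE : open (d @` chart_dom d) by exact: chart_img_open.
have h := Ck_comp (map_overlap_open c d) oE (@map_coord_img c d) (f_smooth hd a k) (fun b => map_coord_Ck b k hc hd).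
by apply: (Ck_ext (map_overlap_open c d)) h => z Dz; rewrite -position_near.
Qed.

Lemma jac_position c d y : atlas c -> atlas d -> overlap x c d y ->
  jac (in_chart position c) y = jac (map_coord x c d) y *m jac (in_chart f d) (map_coord x c d y).
Proof.
move=> hc hd Dy; apply/matrixP => i a; rewrite [LHS]mxE [RHS]mxE.
have oE : open (d @` chart_dom d) by exact: chart_img_open.
have h := chain_partial oE (f_smooth hd a 1) (map_coord_img Dy)
  (fun b => Ck_derivable (map_coord_Ck b 1 hc hd) Dy).
transitivity (partial i (fun z => in_chart f d (map_coord x c d z) 0 a) y).
  apply: partial_near; apply: (eq_near (map_overlap_open c d)) Dy => z Dz.
  by rewrite (position_near Dz).
by rewrite (partial_eq (h i)); apply: eq_bigr => b _; rewrite !mxE.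
Qed.

Lemma normalE d p : atlas d -> chart_dom d (x p) ->
  normal p = N d p *m jac (in_chart f d) (d (x p)).
Proof.
move=> hd dd; rewrite /normal; set e := chart_at (x p).
have he : atlas e by exact: chart_at_atlas.
have de : chart_dom e (x p) by exact: chart_at_dom.
have [[hch _] _ _] := hN; have Dy : (e @` (chart_dom e `&` chart_dom d)) (e (x p)) by exists (x p).
rewrite (hch e d p he hd de dd) transition_jacobian //.
rewrite (jac_change he hd (fun a => f_smooth hd a 1) Dy) mulmxA.
have -> : transition e d (e (x p)) = d (x p) by rewrite /transition chart_mapK.
by [].
Qed.

Lemma normal_near c d y : atlas d -> overlap x c d y ->
  in_chart normal c y = N d (chart_inv c y) *m jac (in_chart f d) (map_coord x c d y).
Proof. by move=> hd /overlap_dom[_ _ dd]; rewrite /in_chart (normalE hd dd). Qed.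

Lemma field_smooth c d b k : atlas c -> atlas d ->
  Ck_on k (overlap x c d) (fun y => N d (chart_inv c y) 0 b).
Proof.
move=> hc hd; have [[_ h] _ _] := hN.
refine (@Ck_entry _ _ _ (map_overlap_open c d) 1 n.+1 k (fun y => N d (chart_inv c y)) 0 b _); exact: (h c d hc hd k).
Qed.

Lemma f_jac_Ck d b a k : atlas d -> Ck_on k (d @` chart_dom d) (fun y => jac (in_chart f d) y b a).
Proof.
move=> hd; have oE : open (d @` chart_dom d) by exact: chart_img_open.
by apply: (Ck_ext oE) (Ck_partial b (f_smooth hd a k.+1)) => y _; rewrite mxE.
Qed.

Lemma normal_smooth c a k : atlas c -> Ck_on k (c @` chart_dom c) (fun y => in_chart normal c y 0 a).
Proof.
move=> hc; apply: Ck_points => y Dy; pose d := chart_at (x (chart_inv c y)).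
have hd : atlas d by exact: chart_at_atlas.
have oO := map_overlap_open c d; have oE : open (d @` chart_dom d) by exact: chart_img_open.
exists (overlap x c d); first exact: img_overlap.
apply: (Ck_ext oO) (_ : Ck_on k _ (fun z => \sum_b N d (chart_inv c z) 0 b * jac (in_chart f d) (map_coord x c d z) b a)) => [z Dz|].
  by rewrite (normal_near hd Dz) mxE.
apply: (Ck_sum oO) => b _; apply: (CkM oO); first exact: field_smooth.
exact: (Ck_comp oO oE (@map_coord_img c d) (f_jac_Ck b a k hd) (fun e => map_coord_Ck e k hc hd)).
Qed.

Lemma ambient_metric c d y : atlas c -> atlas d -> overlap x c d y ->
  metric d (x (chart_inv c y)) = jac (in_chart f d) (map_coord x c d y) *m
    ambient (in_chart position c) kappa y *m (jac (in_chart f d) (map_coord x c d y))^T.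
Proof.
move=> hc hd Dy; have [_ _ dd] := overlap_dom Dy.
have [_ h] := model_jac kappa_le0 f_integral hd (map_coord_img Dy).
have e : metric_coord d (map_coord x c d y) = metric d (x (chart_inv c y)).
  by rewrite /metric_coord /map_coord chart_mapK.
by rewrite -e h /ambient /conf (position_near Dy).
Qed.

Lemma isometric_jac c d y : atlas c -> atlas d -> overlap x c d y ->
  metric_coord c y = jac (map_coord x c d) y *m metric d (x (chart_inv c y)) *m (jac (map_coord x c d) y)^T.
Proof.
move=> hc hd Dy; have [e dc dd] := overlap_dom Dy.
by rewrite /metric_coord (hisom hc hd dc dd) differential_jac.
Qed.

Lemma position_metric c y : atlas c -> (c @` chart_dom c) y ->
  metric_coord c y = jac (in_chart position c) y *m ambient (in_chart position c) kappa y
    *m (jac (in_chart position c) y)^T.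
Proof.
move=> hc /img_overlap; set d := chart_at _ => Dy; have hd : atlas d by exact: chart_at_atlas.
by rewrite (isometric_jac hc hd Dy) (ambient_metric hc hd Dy) (jac_position hc hd Dy) trmx_mul !mulmxA.
Qed.

Lemma normal_orthogonal c y : atlas c -> (c @` chart_dom c) y ->
  jac (in_chart position c) y *m ambient (in_chart position c) kappa y *m (in_chart normal c y)^T = 0.
Proof.
move=> hc /img_overlap; set d := chart_at _ => Dy; have hd : atlas d by exact: chart_at_atlas.
have [_ _ h] := hN; have [_ dc dd] := overlap_dom Dy; have := h c d _ hc hd dc dd.
rewrite (ambient_metric hc hd Dy) (differential_jac hc hd Dy) (jac_position hc hd Dy).
by rewrite (normal_near hd Dy) trmx_mul !mulmxA.
Qed.

Lemma normal_unit c y : atlas c -> (c @` chart_dom c) y ->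
  in_chart normal c y *m ambient (in_chart position c) kappa y *m (in_chart normal c y)^T = 1%:M.
Proof.
move=> hc /img_overlap; set d := chart_at _ => Dy; have hd : atlas d by exact: chart_at_atlas.
have [_ h _] := hN; have [_ dc dd] := overlap_dom Dy; have := h d _ hd dd.
rewrite (ambient_metric hc hd Dy) (normal_near hd Dy) trmx_mul !mulmxA => e.
by rewrite [LHS]mx11_scalar e.
Qed.

(** The Hessian equation for [f] trades the Christoffel symbols of [Q] for ordinary differentiation
    of [df (N)], up to a multiple of [f] in which the normal is paired with a tangent vector. *)
Lemma jac_normal c d y : atlas c -> atlas d -> overlap x c d y ->
  jac (in_chart normal c) y = covariant_derivative x N c d (chart_inv c y) *m jac (in_chart f d) (map_coord x c d y).
Proof.
move=> hc hd Dy; have oO := map_overlap_open c d.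
have oE : open (d @` chart_dom d) by exact: chart_img_open.
have [ey dc dd] := overlap_dom Dy.
set z0 := map_coord x c d y; set g := metric_coord d; set E := jac (in_chart f d).
have dz0 : d (x (chart_inv c y)) = z0 by [].
apply/row_matrixP => i.
pose Dm := jac (map_coord x c d) y.
pose dN : 'rV[R]_n.+1 := \row_b partial i (fun z => N d (chart_inv c z) 0 b) y.
pose dE : 'M[R]_n.+1 := \sum_a Dm i a *: (Gam g a z0 *m E z0 - kappa *: (g z0 *m delta_mx a 0 *m in_chart f d z0)).
have hdN : is_derive y (delta_mx 0 i) (fun z => N d (chart_inv c z)) dN.
  apply/is_derive_mxP => k b; rewrite (ord1 k) mxE.
  by apply: DeriveDef => //; exact: Ck_derivable (field_smooth b 1 hc hd) Dy.
have hdE : is_derive y (delta_mx 0 i) (fun z => E (map_coord x c d z)) dE.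
  apply/is_derive_mxP => b k.
  have h := chain_partial oE (f_jac_Ck b k 1 hd) (map_coord_img Dy)
    (fun e => Ck_derivable (map_coord_Ck e 1 hc hd) Dy).
  apply: (is_derive_eq (h i)); rewrite /dE summxE; apply: eq_bigr => a _.
  rewrite [RHS]mxE /Dm [jac _ _ _ _]mxE; congr (_ * _).
  have g_sym z : (d @` chart_dom d) z -> (g z)^T = g z by move=> hz; exact: (metric_coord_sym hd hz).
  have /is_derive_mxP/(_ b k) := jac_hess g_sym (f_hess hd) a (map_coord_img Dy).
  by move=> /partial_eq.
have rowE : row i (jac (in_chart normal c) y) = dN *m E z0 + N d (chart_inv c y) *m dE.
  apply/rowP => k; rewrite !mxE.
  have /is_derive_mxP/(_ 0 k) := is_derive_mulmx hdN hdE.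
  move=> /partial_eq; rewrite [X in _ = X -> _]mxE => h; rewrite [X in _ = X + _]mxE in h.
  rewrite [X in _ = _ + X]mxE in h; rewrite -h.
  apply: partial_near; apply: (eq_near oO) Dy => z Dz.
  by rewrite (normal_near hd Dz).
rewrite rowE row_mul; pose Gi : 'M[R]_n.+1 := \sum_a Dm i a *: Gam g a z0.
have -> : N d (chart_inv c y) *m dE = N d (chart_inv c y) *m Gi *m E z0.
  have -> : dE = Gi *m E z0 - kappa *: (g z0 *m (row i Dm)^T *m in_chart f d z0).
    rewrite /dE /Gi mulmx_suml; have -> : (row i Dm)^T = \sum_a Dm i a *: delta_mx a 0.
      apply/colP => a; rewrite summxE (bigD1 a) //= big1 ?addr0 => [|b ba].
        by rewrite !mxE !eqxx mulr1.
      by rewrite !mxE eq_sym (negbTE ba) mulr0.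
    rewrite mulmx_sumr mulmx_suml scaler_sumr -sumrB; apply: eq_bigr => a _.
    rewrite scalerBr; congr (_ - _); first exact: scalemxAl.
    by rewrite -scalemxAr -scalemxAl !scalerA mulrC.
  rewrite mulmxBr -scalemxAr !mulmxA.
  (* This is the pairing of the normal with the image of the [i]-th coordinate vector. *)
  have -> : N d (chart_inv c y) *m g z0 *m (row i Dm)^T = 0.
    have [_ _ hno] := hN; have := hno c d _ hc hd dc dd; rewrite (differential_jac hc hd Dy) => /(congr1 trmx).
    rewrite !trmx_mul trmxK trmx0 mulmxA.
    have -> : (metric d (x (chart_inv c y)))^T = g z0.
      by rewrite (Defs.metric_sym hd dd) /g /metric_coord /z0 /map_coord chart_mapK.
    move=> h; rewrite tr_row; apply/matrixP => u v; rewrite (ord1 v) (ord1 u).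
    rewrite [RHS]mxE; move/matrixP/(_ 0 i): h; rewrite [X in _ = X -> _]mxE => <-.
    by rewrite [LHS]mxE [RHS]mxE; apply: eq_bigr => b _; rewrite !mxE.
  by rewrite mul0mx scaler0 subr0.
rewrite -mulmxDl; congr (_ *m _); apply/rowP => k; rewrite [LHS]mxE [RHS]mxE [RHS]mxE ey; congr (_ + _).
  by rewrite mxE.
rewrite mxE exchange_big /=; apply: eq_bigr => b _.
rewrite /Gi summxE mulr_sumr; apply: eq_bigr => a _.
by rewrite (differential_jac hc hd Dy) mxE [Gam _ _ _ _ _]mxE mulrA (mulrC (N d _ _ _)).
Qed.

Lemma shape_position c d y : atlas c -> atlas d -> overlap x c d y ->
  shape (in_chart position c) (in_chart normal c) (metric_coord c) kappa y = shape_operator x N c d (chart_inv c y).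
Proof.
move=> hc hd Dy; rewrite /shape /shape_operator (jac_normal hc hd Dy) (jac_position hc hd Dy).
rewrite (ambient_metric hc hd Dy) (differential_jac hc hd Dy) trmx_mul !mulNmx !mulmxA.
by rewrite /metric_coord.
Qed.

Hypothesis hlam : principal_curvatures x N lam.
Variables (r : nat) (om : 'I_n.+1 -> R).
Hypothesis hr : (r < n)%N.
Hypothesis om_coef : forall p : {poly R}, (size p <= n.+1)%N -> p`_r = \sum_j om j * p.[node j].
Hypothesis S_ge0 : forall p : M, 0 <= S_ lam r p.
Hypothesis S_eq0 : forall p : M, S_ lam r.+1 p = 0.

Definition chart_shape c := shape (in_chart position c) (in_chart normal c) (metric_coord c) kappa.
Definition chart_tangent c := tangent (in_chart position c) (metric_coord c) kappa.
Definition chart_frame c := frame (in_chart position c) (in_chart normal c).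
Definition newton_mx c y := \sum_j om j *: \adj (1%:M + node j *: chart_shape c y).
Definition newton_field c y : 'rV[R]_n := chart_tangent c y *m newton_mx c y.
(** By [newton_flowE] these are the components of the frame determinant times [newton_field].
    Building them from [flow] gives their smoothness and divergence without differentiating the
    Newton tensor. *)
Definition newton_flow c i y : R := \sum_j om j * flow (in_chart position c) (in_chart normal c) i (node j) y.

Let oD c : open (c @` chart_dom c). Proof. exact: chart_img_open. Qed.
Let Gpos c (hc : atlas c) y (Dy : (c @` chart_dom c) y) := @metric_coord_pos _ _ _ c y hc Dy.
Let Gsym c (hc : atlas c) y (Dy : (c @` chart_dom c) y) := @metric_coord_sym _ _ _ c y hc Dy.
Let Xs c (hc : atlas c) a k := position_smooth a k hc.
Let nus c (hc : atlas c) a k := normal_smooth a k hc.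
Let GE c (hc : atlas c) y (Dy : (c @` chart_dom c) y) := position_metric hc Dy.
Let nuN c (hc : atlas c) y (Dy : (c @` chart_dom c) y) := normal_orthogonal hc Dy.
Let nuU c (hc : atlas c) y (Dy : (c @` chart_dom c) y) := normal_unit hc Dy.

Let img_sub c (c' : chart R n M) y : (c @` (chart_dom c `&` chart_dom c')) y -> (c @` chart_dom c) y.
Proof. by case=> p [dp _] <-; exists p. Qed.

Lemma in_chart_change q (h : M -> 'rV[R]_q) c c' y : (c @` (chart_dom c `&` chart_dom c')) y ->
  in_chart h c y = in_chart h c' (transition c c' y).
Proof. by case=> p [dp dp'] <-; rewrite /in_chart /transition !chart_mapK. Qed.

Lemma transition_unit c c' y : atlas c -> atlas c' -> (c @` (chart_dom c `&` chart_dom c')) y ->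
  jac (transition c c') y \in unitmx.
Proof.
move=> hc hc' Dy; have := g_unit (Gpos hc) (img_sub Dy).
by rewrite (metric_coord_change hc hc' Dy) !unitmx_mul => /andP[/andP[]].
Qed.

Let transition_dom c c' y : (c @` (chart_dom c `&` chart_dom c')) y -> (c' @` chart_dom c') (transition c c' y).
Proof. by move=> /transition_img[p [dp _] <-]; exists p. Qed.

Lemma ambient_change c c' y : (c @` (chart_dom c `&` chart_dom c')) y ->
  ambient (in_chart position c) kappa y = ambient (in_chart position c') kappa (transition c c' y).
Proof. by move=> Dy; rewrite /ambient /conf (in_chart_change position Dy). Qed.

Lemma shape_change c c' y : atlas c -> atlas c' -> (c @` (chart_dom c `&` chart_dom c')) y ->
  chart_shape c y *m jac (transition c c') y = jac (transition c c') y *m chart_shape c' (transition c c' y).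
Proof.
move=> hc hc' Dy; set J := jac _ _; set z := transition c c' y.
have Dz : (c' @` chart_dom c') z by exact: transition_dom.
have UJ : J \in unitmx by exact: transition_unit.
have UG := g_unit (Gpos hc) (img_sub Dy); have UG' := g_unit (Gpos hc') Dz.
have U : metric_coord c' z *m J^T \in unitmx by rewrite unitmx_mul UG' unitmx_tr.
have e : chart_shape c y *m metric_coord c y = J *m (chart_shape c' z *m metric_coord c' z) *m J^T.
  rewrite /chart_shape /shape !mulmxKV // (ambient_change Dy).
  rewrite (jac_change hc hc' (fun a => Xs hc' a 1) Dy) (jac_change hc hc' (fun a => nus hc' a 1) Dy).
  by rewrite trmx_mul !mulNmx mulmxN mulNmx !mulmxA.
rewrite -[LHS](mulmxK U) -[RHS](mulmxK U); congr (_ *m _).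
transitivity (chart_shape c y *m metric_coord c y); last by rewrite e !mulmxA.
by rewrite (metric_coord_change hc hc' Dy) !mulmxA.
Qed.

Lemma tangent_change c c' y : atlas c -> atlas c' -> (c @` (chart_dom c `&` chart_dom c')) y ->
  chart_tangent c y *m jac (transition c c') y = chart_tangent c' (transition c c' y).
Proof.
move=> hc hc' Dy; set J := jac _ _; set z := transition c c' y.
have Dz : (c' @` chart_dom c') z by exact: transition_dom.
have UJ : J \in unitmx by exact: transition_unit.
have UG := g_unit (Gpos hc) (img_sub Dy); have UG' := g_unit (Gpos hc') Dz.
have U : metric_coord c' z *m J^T \in unitmx by rewrite unitmx_mul UG' unitmx_tr.
have e : chart_tangent c y *m metric_coord c y = chart_tangent c' z *m metric_coord c' z *m J^T.
  rewrite /chart_tangent /tangent !mulmxKV // (ambient_change Dy) (in_chart_change position Dy).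
  by rewrite (jac_change hc hc' (fun a => Xs hc' a 1) Dy) trmx_mul !mulmxA.
rewrite -[LHS](mulmxK U) -[RHS](mulmxK U); congr (_ *m _).
transitivity (chart_tangent c y *m metric_coord c y); last by rewrite e !mulmxA.
by rewrite (metric_coord_change hc hc' Dy) !mulmxA.
Qed.

Lemma newton_field_change c c' y : atlas c -> atlas c' -> (c @` (chart_dom c `&` chart_dom c')) y ->
  newton_field c y *m jac (transition c c') y = newton_field c' (transition c c' y).
Proof.
move=> hc hc' Dy; rewrite /newton_field -(tangent_change hc hc' Dy).
move: (chart_tangent c y) => b; rewrite -[LHS]mulmxA -[RHS]mulmxA; congr (_ *m _).
rewrite mulmx_suml mulmx_sumr; apply: eq_bigr => j _; rewrite -scalemxAl -scalemxAr; congr (_ *: _).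
by apply/esym/adj_intertwine; [exact: transition_unit|rewrite shape_change].
Qed.

(** The principal curvatures are tied to the chosen charts at each point; in other charts the shape
    operator is conjugate by the Jacobian of the transition. *)
Lemma shape_char_poly c y : atlas c -> (c @` chart_dom c) y ->
  char_poly (chart_shape c y) = \prod_i ('X - (lam i (chart_inv c y))%:P).
Proof.
move=> hc [p dp <-]; rewrite chart_mapK // -hlam; set c' := chart_at p.
have hc' : atlas c' by exact: chart_at_atlas.
have dp' : chart_dom c' p by exact: chart_at_dom.
have Dy : (c @` (chart_dom c `&` chart_dom c')) (c p) by exists p.
have Dp' : overlap x c' (chart_at (x p)) (c' p) by exists p => //; split=> //; exact: chart_at_dom.
have hq : atlas (chart_at (x p)) by exact: chart_at_atlas.
have := shape_position hc' hq Dp'; rewrite chart_mapK // => <-.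
have tz : transition c c' (c p) = c' p by rewrite /transition chart_mapK.
apply: (char_poly_conj (T := invmx (jac (transition c c') (c p)))); first by rewrite unitmx_inv transition_unit.
have UJ := transition_unit hc hc' Dy; have := shape_change hc hc' Dy; rewrite tz => e.
rewrite -[LHS](mulmxK UJ) -(mulmxA (invmx _)) e; rewrite -/(chart_shape c') mulKmx //.
Qed.

Let newton_facts c y (hc : atlas c) (Dy : (c @` chart_dom c) y) :
  [/\ \tr (newton_mx c y) = (n - r)%:R * S_ lam r (chart_inv c y), \tr (chart_shape c y *m newton_mx c y) = 0
  & forall b : 'rV_n,
    0 <= (b *m newton_mx c y *m metric_coord c y *m b^T) 0 0 <=
    (n - r)%:R * S_ lam r (chart_inv c y) * (b *m metric_coord c y *m b^T) 0 0].
Proof.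
have := newton_tensor hr om_coef (Gsym hc Dy) (Gpos hc Dy)
  (shape_self_adjoint (@oD c) kappa_le0 (Xs hc) (nus hc) (Gpos hc) (Gsym hc) (nuN hc) Dy) (shape_char_poly hc Dy).
rewrite -!(S_coef (fun i p => lam i p)); apply; first exact: S_ge0; exact: S_eq0.
Qed.

Lemma newton_flowE c i y : atlas c -> (c @` chart_dom c) y ->
  newton_flow c i y = \det (chart_frame c y) * newton_field c y 0 i.
Proof.
move=> hc Dy; rewrite /newton_flow /newton_field /newton_mx mulmx_sumr summxE mulr_sumr; apply: eq_bigr => j _.
rewrite (flowE (@oD c) kappa_le0 (Xs hc) (nus hc) (Gpos hc) (GE hc) (nuN hc) (nuU hc) i _ Dy).
by rewrite -scalemxAr [X in _ = _ * X]mxE mulrCA.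
Qed.

Lemma newton_flow_smooth c i k : atlas c -> Ck_on k (c @` chart_dom c) (newton_flow c i).
Proof.
move=> hc; apply: (Ck_sum (@oD c)) => j _; apply: (CkM (@oD c)); first exact: Ck_cst.
exact: (flow_smooth (@oD c) (Xs hc) (nus hc)).
Qed.

(** The term with the support function carries the trace of [A P_r], that is [(r + 1) S_(r+1)],
    which vanishes. *)
Lemma newton_flow_divergence c y : atlas c -> (c @` chart_dom c) y ->
  \sum_i partial i (newton_flow c i) y = \det (chart_frame c y) * ((n - r)%:R * S_ lam r (chart_inv c y)).
Proof.
move=> hc Dy; have [t1 t2 _] := newton_facts hc Dy.
transitivity (\sum_i \sum_j om j * partial i (flow (in_chart position c) (in_chart normal c) i (node j)) y).
  apply: eq_bigr => i _; apply: partial_eq; apply: is_derive_bigsum => j; apply: is_deriveMl.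
  apply: DeriveDef => //; exact: Ck_derivable (flow_smooth (@oD c) (Xs hc) (nus hc) i (node j) 1) Dy.
set b := support (in_chart position c) (in_chart normal c) kappa y.
have -> : (n - r)%:R * S_ lam r (chart_inv c y) = \tr (newton_mx c y) + b * \tr (chart_shape c y *m newton_mx c y).
  by rewrite t1 t2 mulr0 addr0.
rewrite exchange_big /=.
rewrite /newton_mx mulmx_sumr !raddf_sum /= mulr_sumr -big_split /= mulr_sumr; apply: eq_bigr => j _.
rewrite -mulr_sumr (flow_divergence (@oD c) kappa_le0 (Xs hc) (nus hc) (Gpos hc) (GE hc) (nuN hc) (nuU hc) _ Dy).
rewrite -scalemxAr !linearZ /= -/(chart_shape c y) -/(chart_frame c y) -/b.
by rewrite /GRing.scale /=; ring.
Qed.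

Lemma frame_volume c y : atlas c -> (c @` chart_dom c) y ->
  \det (chart_frame c y) ^+ 2 = (1 - kappa * sqn (in_chart position c y)) * \det (metric_coord c y).
Proof. by move=> hc Dy; exact: (frame_det kappa_le0 (GE hc) (nuN hc) (nuU hc) Dy). Qed.

(** The factors [conf] cancel: the gradient of [|X|^2] is [2 conf] times the tangential part of [X],
    whose squared length is at most [|X|^2 / conf]. *)
Lemma newton_field_sqn c y : atlas c -> (c @` chart_dom c) y ->
  0 <= \sum_i partial i (fun z => sqn (in_chart position c z)) y * newton_field c y 0 i
    <= 2 * sqn (in_chart position c y) * ((n - r)%:R * S_ lam r (chart_inv c y)).
Proof.
move=> hc Dy; have [_ _ /(_ (chart_tangent c y))] := newton_facts hc Dy.
set G := metric_coord c y; set q := conf (in_chart position c) kappa y.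
have q0 : 0 < q by exact: conf_gt0.
have tn := tangent_norm kappa_le0 (Gpos hc) (GE hc) (nuN hc) (nuU hc) Dy.
set b := chart_tangent c y; rewrite -/b -/G -/q in tn.
have -> : \sum_i partial i (fun z => sqn (in_chart position c z)) y * newton_field c y 0 i =
  2 * q * (b *m newton_mx c y *m G *m b^T) 0 0.
  have -> : (b *m newton_mx c y *m G *m b^T) 0 0 = (b *m G *m (newton_field c y)^T) 0 0.
    have swap (u v : 'rV[R]_n) (K : 'M[R]_n) : K^T = K -> (u *m K *m v^T) 0 0 = (v *m K *m u^T) 0 0.
      move=> hK; transitivity ((v *m K *m u^T)^T 0 0); last by rewrite mxE.
      by rewrite trmx_mul trmxK trmx_mul hK mulmxA.
    exact: (swap (newton_field c y) b G (Gsym hc Dy)).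
  rewrite mxE mulr_sumr; apply: eq_bigr => i _.
  by rewrite (partial_eq (is_derive_sqn kappa_le0 (Xs hc) (Gpos hc) i Dy)) [(newton_field c y)^T i 0]mxE !mulrA.
move=> /andP[h1 h2]; have s0 : 0 <= (n - r)%:R * S_ lam r (chart_inv c y) by rewrite mulr_ge0.
move: (_ * S_ _ _ _) s0 h1 h2 => T s0; move: (fun_of_matrix (b *m newton_mx c y *m G *m b^T) 0 0) => u.
move: tn; move: (fun_of_matrix (b *m G *m b^T) 0 0) (sqn _) => v w tn h1 h2.
rewrite mulr_ge0 //=; last by rewrite mulr_ge0 // ltW.
have : u <= T * (w / q) by apply: (le_trans h2); rewrite ler_wpM2l.
move=> h3; rewrite (_ : 2 * w * T = 2 * q * (T * (w / q))); last by field; rewrite gt_eqF.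
by rewrite ler_wpM2l // mulr_ge0 // ltW.
Qed.

End HypersurfaceModel.

(** * Integration in charts *)

Lemma derive_affine {R : realType} (X Y V : normedModType R) (f : Y -> V) (l : X -> Y) (x v : X) (w : Y) :
  (forall h : R, l (h *: v + x) = h *: w + l x) ->
  'D_v (f \o l) x = 'D_w f (l x) /\ (derivable (f \o l) x v = derivable f (l x) w).
Proof.
move=> e; have ee : (fun h : R => h^-1 *: (((f \o l) \o shift x) (h *: v) - (f \o l) x)) =
   (fun h : R => h^-1 *: ((f \o shift (l x)) (h *: w) - f (l x))).
  by apply/funext => h /=; rewrite e.
by rewrite /derive /derivable ee.
Qed.

Lemma partial_eq0 {R : realType} n (g : 'rV[R]_n -> R) (B : R) i :
  (forall y : 'rV[R]_n, (exists j, B < `|y 0 j|) -> g y = 0) ->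
  forall y : 'rV[R]_n, (exists j, B < `|y 0 j|) -> partial i g y = 0.
Proof.
move=> g0 y [j yj]; rewrite -(_ : partial i (fun=> 0 : R) y = 0); last by rewrite partial_cst.
apply: partial_near; have : nbhs y (fun z : 'rV[R]_n => B < `|z 0 j|).
  have c : {for y, continuous (fun z : 'rV[R]_n => `|z 0 j|)}.
    by apply: (@continuous_comp _ _ _ (fun z : 'rV[R]_n => z 0 j) (fun t : R => `|t|)); [exact: coord_continuous|exact: norm_continuous].
  by apply: (c [set t | B < t]); exact: (open_nbhs_nbhs (conj (@open_gt _ B) yj)).
by apply: filterS => z zj; apply: g0; exists j.
Qed.

Lemma bounded_of_box {R : realType} n (g : 'rV[R]_n -> R) (B : R) : continuous g ->
  (forall y : 'rV[R]_n, (exists j, B < `|y 0 j|) -> g y = 0) -> exists2 K : R, 0 < K & forall y, `|g y| <= K.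
Proof.
move=> cg g0; have cpt : compact [set y : 'rV[R]_n | forall j, y 0 j \in `[- B, B]].
  by have := @rV_compact R n (fun=> `[- B, B]%classic) (fun=> @segment_compact _ _ _); apply.
have : compact (g @` [set y : 'rV[R]_n | forall j, y 0 j \in `[- B, B]]).
  by apply: continuous_compact cpt; exact: continuous_subspaceT.
move=> /compact_bounded[M [_ hM]]; exists (`|M| + 1); first by rewrite ltr_pwDr.
move=> y; have [yb|] := pselect (forall j, y 0 j \in `[- B, B]).
  by apply: (hM (`|M| + 1)); [rewrite ltr_pwDr // ler_norm|exists y].
move=> /existsNP[j yj]; rewrite g0 ?normr0; last first.
  exists j; rewrite ltNge; apply/negP => h; apply: yj; move: h; rewrite ler_norml => h.
  by rewrite in_itv.
by rewrite addr_ge0.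
Qed.

Section BorelPullback.
Context {R : realType} d (T : measurableType d) (X : topologicalType) (iota : T -> X).
Hypothesis iota_open : forall U, open U -> measurable (iota @^-1` U).

Lemma pullback_measurable (U : set X) (f : X -> R) : open U -> (forall y, U y -> {for y, continuous f}) ->
  measurable_fun (iota @^-1` U) (f \o iota).
Proof.
move=> oU cf mD; apply: (measurability _ (RGenOInfty.measurableE R)) => //= _ [_ [a ->] <-].
have -> : iota @^-1` U `&` (f \o iota) @^-1` `]a, +oo[%classic = iota @^-1` (U `&` f @^-1` [set t | a < t]).
  by apply/seteqP; split=> t /= [Ut]; rewrite in_itv /= andbT.
apply: iota_open; rewrite openE => y [Uy fy].
have h1 : \forall z \near y, U z by exact: (open_nbhs_nbhs (conj oU Uy)).
have h2 : \forall z \near y, a < f z.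
  by apply: (cf y Uy [set t | a < t]); exact: (open_nbhs_nbhs (conj (@open_gt _ a) fy)).
by apply: filterS2 h1 h2.
Qed.

End BorelPullback.

Section LebesgueTimes.
Local Open Scope ereal_scope.
Context {R : realType} {d} {T : measurableType d} (m : {sigma_finite_measure set T -> \bar R}).

(* The library's product measure is only found as a sigma-finite measure for
   probability measures. *)
Definition lebesgue_times : set (measurableTypeR R * T)%type -> \bar R := @lebesgue_measure R \x m.

HB.instance Definition _ := Measure.copy lebesgue_times (@lebesgue_measure R \x m).

Let lebesgue_times_sigma_finite : sigma_finite setT lebesgue_times.
Proof.
have /sigma_finiteP[F [TF ndF Foo]] := sigma_finiteT (@lebesgue_measure R).
have /sigma_finiteP[G [TG ndG Goo]] := sigma_finiteT m.
exists (fun k => F k `*` G k).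
  apply/seteqP; split=> // -[a b] _.
  have [i _ Fi] : (\bigcup_k F k) a by rewrite -TF.
  have [j _ Gj] : (\bigcup_k G k) b by rewrite -TG.
  exists (maxn i j) => //; split=> /=.
    by move: a Fi; exact/subsetPset/ndF/leq_maxl.
  by move: b Gj; exact/subsetPset/ndG/leq_maxr.
move=> k; have [mF lF] := Foo k; have [mG lG] := Goo k; split; first exact: measurableX.
by rewrite [lebesgue_times _]product_measure1E // lte_mul_pinfty // ge0_fin_numE.
Qed.

HB.instance Definition _ := Measure_isSigmaFinite.Build _ _ _ lebesgue_times lebesgue_times_sigma_finite.

End LebesgueTimes.

(** * Lebesgue measure on R^n as a measure on an iterated product *)

Section LebesgueModel.
Context {R : realType}.
Local Open Scope ereal_scope.

Definition box n (y : 'rV[R]_n) (e : R) : set 'rV[R]_n := [set z | forall i, (`|z 0%R i - y 0%R i| < e)%R].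

(** The iterated integral is realized as an integral over a product space [T], mapped to row vectors
    by [iota]. The four clauses are all that is used of Lebesgue measure; the last is the divergence
    theorem for one compactly supported component. *)
Definition lebesgue_model n d (T : measurableType d) (m : {sigma_finite_measure set T -> \bar R})
    (iota : T -> 'rV[R]_n) : Prop :=
  [/\ forall i, measurable_fun setT (fun t => iota t 0%R i : R),
      forall F : 'rV[R]_n -> \bar R, measurable_fun setT (F \o iota : T -> \bar R) -> (forall y, 0 <= F y) ->
        lebesgue_integral_rV F = \int[m]_t F (iota t),
      forall y (e : R), (0 < e)%R -> 0 < m (iota @^-1` box y e) < +oo
    & forall (phi : 'rV[R]_n -> R) (B : R) i, Ck_on 1 setT phi ->
        (forall y : 'rV[R]_n, (exists j, (B < `|y 0%R j|)%R) -> phi y = 0%R) ->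
        \int[m]_t (partial i phi (iota t))%:E = 0].

Section Facts.
Context n d (T : measurableType d) (iota : T -> 'rV[R]_n).
Hypothesis mi : forall i, measurable_fun setT (fun t => iota t 0%R i : R).

Lemma box_measurable y e : measurable (iota @^-1` box y e).
Proof.
have -> : iota @^-1` box y e = \bigcap_(i in [set: 'I_n]) ((fun t => iota t 0%R i : R) @^-1` [set s | (`|s - y 0%R i| < e)%R]).
  by apply/seteqP; split=> t /= h i => [_|]; exact: h.
apply: fin_bigcap_measurable => [|i _]; first exact: finite_finset.
rewrite -[X in measurable X]setTI; apply: mi => //.
have -> : [set s : R | (`|s - y 0%R i| < e)%R] = ball (y 0%R i) e.
  by apply/seteqP; split=> s /=; rewrite /ball /= distrC.
exact: measurable_ball.
Qed.

(** An open set is the countable union of the boxes with rational centre and radius [1 / (j + 1)]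
    that it contains. *)
Lemma open_preimage_measurable (U : set 'rV[R]_n) : open U -> measurable (iota @^-1` U).
Proof.
move=> oU; pose q (v : 'rV[rat]_n) : 'rV[R]_n := map_mx ratr v.
pose F k : set T := if unpickle k is Some (v, j) then
   (if `[< box (q v) (j.+1%:R^-1) `<=` U >] then iota @^-1` box (q v) (j.+1%:R^-1) else set0) else set0.
have -> : iota @^-1` U = \bigcup_k F k.
  apply/seteqP; split=> [t Ut|t [k _]]; last first.
    rewrite /F; case: (unpickle k) => [[v j]|//]; case: asboolP => // h; exact: h.
  have /nbhs_ballP[r /= r0 rU] : nbhs (iota t) U by apply: open_nbhs_nbhs.
  have [j hj] : exists j, (j.+1%:R^-1 < r / 2)%R.
    have [j _ hj] := @near_infty_natSinv_lt R (PosNum (divr_gt0 r0 (ltr0Sn R 1))).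
    by exists j; apply: (hj j) => /=.
  have j0 : (0 < j.+1%:R^-1 :> R)%R by rewrite invr_gt0.
  have ex i : exists a : rat, (`|iota t 0%R i - ratr a| < j.+1%:R^-1)%R.
    have : (iota t 0 i - j.+1%:R^-1 < iota t 0 i + j.+1%:R^-1)%R by rewrite ltrD2l; apply: lt_trans j0; rewrite oppr_lt0.
    by move=> /rat_in_itvoo[a]; rewrite in_itv /= => h; exists a; rewrite distrC ltr_distl.
  have [a ha] := choice ex.
  exists (pickle (\row_i a i, j)) => //; rewrite /F pickleK.
  have b1 : box (q (\row_i a i)) j.+1%:R^-1 (iota t).
    by move=> i; rewrite !mxE.
  case: asboolP => // [[]] z bz; apply: rU; apply/rV_ballP => // i.
  have := bz i; have := b1 i; move: (q _ 0%R i) => s h1 h2.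
  have := ler_distD s (iota t 0%R i) (z 0%R i); rewrite (distrC s) => /le_lt_trans; apply.
  by rewrite [ltRHS](splitr r); apply: ltrD; [exact: lt_trans h1 hj|exact: lt_trans h2 hj].
apply: bigcupT_measurable => k; rewrite /F; case: (unpickle k) => [[v j]|//].
by case: asboolP => // _; exact: box_measurable.
Qed.

Lemma box_integrable (m : {measure set T -> \bar R}) (g : 'rV[R]_n -> R) (B : R) :
  (forall e : R, (0 < e)%R -> m (iota @^-1` box 0%R e) < +oo) -> continuous g ->
  (forall y : 'rV[R]_n, (exists j, (B < `|y 0%R j|)%R) -> g y = 0%R) -> m.-integrable setT (EFin \o g \o iota).
Proof.
move=> bfin cg g0; have [K K0 hK] := bounded_of_box cg g0.
pose C := (`|B| + 1)%R; have C0 : (0 < C)%R by rewrite ltr_pwDr.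
have mg : measurable_fun setT (g \o iota).
  by have := pullback_measurable open_preimage_measurable openT (fun y _ => cg y).
have -> : EFin \o g \o iota = (EFin \o (g \o iota)) \_ (iota @^-1` box 0%R C).
  apply/funext => t; rewrite /patch; case: ifPn => //= tb; rewrite g0 //.
  move: tb; rewrite notin_setE /box /= => /existsNP[j hj]; exists j.
  move: hj; rewrite mxE subr0 => /negP; rewrite -leNgt; apply: lt_le_trans.
  by rewrite /C; apply: le_lt_trans (ler_norm _) _; rewrite ltr_pwDr.
apply: (integrable_mkcond _ (box_measurable 0%R C)).1.
apply: measurable_bounded_integrable; [exact: box_measurable|exact: bfin|exact: measurable_funTS|].
exists K; split; first exact: gtr0_real.
by move=> M KM t _ /=; apply: le_trans (hK _) (ltW KM).
Qed.

End Facts.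

Lemma integral_derivative_line (psi dpsi : R -> R) (B : R) : (forall t, is_derive t (1%R : R) psi (dpsi t)) ->
  continuous dpsi -> (forall t, (B < `|t|)%R -> psi t = 0%R /\ dpsi t = 0%R) ->
  \int[lebesgue_measure]_t (dpsi t)%:E = 0.
Proof.
move=> hd cd h0; pose C := (`|B| + 1)%R; have BC : (B < C)%R.
  by apply: le_lt_trans (ler_norm _) _; rewrite ltr_pwDr.
have C0 : (0 < C)%R by rewrite ltr_pwDr.
have cp : continuous psi.
  by move=> t; apply: differentiable_continuous; apply/derivable1_diffP; case: (hd t).
transitivity (\int[lebesgue_measure]_(t in `[(- C)%R, C]) (dpsi t)%:E).
  rewrite [RHS]integral_mkcond; apply: eq_integral => t _; rewrite /patch; case: ifPn => // tb.
  have [|_ -> //] := h0 t.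
  move: tb; rewrite notin_setE /= in_itv /= => /negP.
  by rewrite -ler_norml -ltNge; exact: lt_trans.
rewrite (@continuous_FTC2 _ _ psi).
- have hC : (B < `|C|)%R by rewrite gtr0_norm.
  have [p1 _] := h0 C hC; have [p2 _] : psi (- C)%R = 0%R /\ dpsi (- C)%R = 0%R by apply: h0; rewrite normrN.
  by rewrite p1 p2 subee.
- by rewrite -subr_gt0 opprK addr_gt0.
- by apply: continuous_subspaceT.
- split=> [t _||]; first by case: (hd t).
    by apply: cvg_at_right_filter; exact: cp.
  by apply: cvg_at_left_filter; exact: cp.
- by move=> t _; rewrite derive1E; case: (hd t).
Qed.

Lemma row_continuous n (v : 'rV[R]_n) : continuous (fun t : R => row_mx (const_mx t : 'rV[R]_1) v).
Proof.
move=> t; apply: rV_continuous => a; case: (split_ordP a) => a' ->.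
  have -> : (fun s : R => row_mx (const_mx s : 'rV[R]_1) v 0%R (lshift n a')) = id.
    by apply/funext => s; rewrite row_mxEl mxE.
  exact: cvg_id.
have -> : (fun s : R => row_mx (const_mx s : 'rV[R]_1) v 0%R (rshift 1 a')) = fun=> v 0%R a'.
  by apply/funext => s; rewrite row_mxEr.
exact: cst_continuous.
Qed.

Lemma row_continuous_r n (t : R) : continuous (fun v : 'rV[R]_n => row_mx (const_mx t : 'rV[R]_1) v).
Proof.
move=> v; apply: rV_continuous => a; case: (split_ordP a) => a' ->.
  have -> : (fun w : 'rV[R]_n => row_mx (const_mx t : 'rV[R]_1) w 0%R (lshift n a')) = fun=> t.
    by apply/funext => s; rewrite row_mxEl mxE.
  exact: cst_continuous.
have -> : (fun w : 'rV[R]_n => row_mx (const_mx t : 'rV[R]_1) w 0%R (rshift 1 a')) = fun w => w 0%R a'.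
  by apply/funext => s; rewrite row_mxEr.
exact: coord_continuous.
Qed.

(** For the last clause the order of integration is chosen so that the differentiated variable comes
    first: the new one by the fundamental theorem of calculus, an old one by the induction
    hypothesis. *)
Lemma lebesgue_model_step n d (T : measurableType d) (m : {sigma_finite_measure set T -> \bar R})
    (iota : T -> 'rV[R]_n) : lebesgue_model m iota ->
  lebesgue_model (n := n.+1) (lebesgue_times m)
    (fun w => row_mx (const_mx w.1 : 'rV[R]_1) (iota w.2)).
Proof.
case=> mi mI mb mp; set iota' := fun w => _; set m' : {sigma_finite_measure set _ -> \bar R} := lebesgue_times m.
have mi' i : measurable_fun setT (fun w => iota' w 0%R i : R).
  case: (split_ordP (i : 'I_(1 + n))) => i' ->.
    have -> : (fun w => iota' w 0%R (lshift n i') : R) = fst.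
      by apply/funext => w; rewrite /iota' row_mxEl mxE.
    exact: measurable_fst.
  have -> : (fun w => iota' w 0%R (rshift 1 i') : R) = (fun t => iota t 0%R i' : R) \o snd.
    by apply/funext => w; rewrite /iota' row_mxEr.
  by apply: measurableT_comp => //; exact: measurable_snd.
have mb' y (e : R) : (0 < e)%R -> 0 < m' (iota' @^-1` box y e) < +oo.
  move=> e0; have -> : iota' @^-1` box y e =
     ball (y 0%R (lshift n (0%R : 'I_1))) e `*` (iota @^-1` box (rsubmx (y : 'rV[R]_(1 + n))) e).
    apply/seteqP; split=> -[t z] /=.
      move=> h; split=> [|i].
        by have := h (lshift n (0%R : 'I_1)); rewrite /iota' row_mxEl mxE /ball /= distrC.
      by have := h (rshift 1 i); rewrite /iota' row_mxEr mxE.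
    move=> [h1 h2] i; case: (split_ordP (i : 'I_(1 + n))) => i' ->.
      by rewrite (ord1 i') /iota' row_mxEl mxE distrC.
    by have := h2 i'; rewrite /iota' row_mxEr mxE.
  rewrite [m' _]product_measure1E; [|exact: measurable_ball|exact: box_measurable].
  have /andP[b1 b2] := mb (rsubmx (y : 'rV[R]_(1 + n))) e e0.
  have lb := @lebesgue_measure_ball R (y 0%R (lshift n (0%R : 'I_1))) e (ltW e0).
  change (0 < lebesgue_measure (ball (y 0%R (lshift n (0%R : 'I_1))) e) * m (iota @^-1` box (rsubmx (y : 'rV[R]_(1 + n))) e) < +oo).
  by rewrite lb mule_gt0 ?lte_fin ?mulrn_wgt0 //= lte_mul_pinfty ?ltry // lee_fin mulrn_wge0 // ltW.
split=> // [F mF F0|phi B i hphi phi0].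
  rewrite /= fubini_tonelli1 //; apply: eq_integral => t _.
  by rewrite mI // ; exact: (measurable_fun_pair2 t mF).
have cg : continuous (partial i phi).
  by move=> y; have [_ /(_ i)[_ [h _]]] := hphi; exact: h.
have g0 := partial_eq0 i phi0.
have dphi y : derivable phi y (delta_mx 0%R i) by exact: (Ck_derivable hphi).
have int : m'.-integrable setT (EFin \o partial i phi \o iota').
  by apply: (box_integrable mi' _ cg g0) => e e0; have /andP[] := mb' 0%R e e0.
move: g0 cg dphi int; case: (split_ordP (i : 'I_(1 + n))) => i' ->{i} g0 cg dphi int.
  rewrite (ord1 i') in g0 cg dphi int *.
  rewrite -(fubini2 int); apply: integral0_eq => z _; rewrite /fubini_G /=.
  pose l (t : R) : 'rV[R]_(1 + n) := row_mx (const_mx t : 'rV[R]_1) (iota z).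
  have la (t h : R) : l (h *: (1%R : R) + t)%R = (h *: (delta_mx 0%R (lshift n (0%R : 'I_1)) : 'rV[R]_(1 + n)) + l t)%R.
    apply/rowP => a; case: (split_ordP (a : 'I_(1 + n))) => a' ->.
      by rewrite (ord1 a') [RHS]mxE [X in _ = (X + _)%R]mxE /l !row_mxEl !mxE !eqxx /= /GRing.scale /=.
    by rewrite [RHS]mxE [X in _ = (X + _)%R]mxE /l !row_mxEr !mxE eq_rlshift andbF mulr0 add0r.
  apply: (@integral_derivative_line (phi \o l) _ B) => [t||t tB].
  - have [e1 e2] := derive_affine phi (la t).
    by apply: DeriveDef; [rewrite e2; exact: dphi|rewrite e1].
  - by move=> t; apply: (@continuous_comp _ _ _ l (partial (lshift n (0%R : 'I_1)) phi)); [exact: row_continuous|exact: cg].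
  - have ex : exists j, (B < `|l t 0%R j|)%R by exists (lshift n (0%R : 'I_1)); rewrite /l row_mxEl mxE.
    by split; [exact: phi0|exact: g0].
rewrite -(fubini1 int); apply: integral0_eq => t _; rewrite /fubini_F /=.
pose l (v : 'rV[R]_n) : 'rV[R]_(1 + n) := row_mx (const_mx t : 'rV[R]_1) v.
have la a (v : 'rV[R]_n) (h : R) : l (h *: delta_mx 0%R a + v)%R = (h *: delta_mx 0%R (rshift 1 a) + l v)%R.
  apply/rowP => b; case: (split_ordP (b : 'I_(1 + n))) => b' ->.
    by rewrite [RHS]mxE [X in _ = (X + _)%R]mxE /l !row_mxEl !mxE eq_lrshift andbF mulr0 add0r.
  by rewrite [RHS]mxE [X in _ = (X + _)%R]mxE /l !row_mxEr !mxE (inj_eq (@rshift_inj _ _)).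
have dl a v := derive_affine phi (la a v).
transitivity (\int[m]_z (partial i' (phi \o l) (iota z))%:E).
  by apply: eq_integral => z _; have [e _] := dl i' (iota z); rewrite /partial e.
apply: (mp _ B) => [|y [j yj]]; last first.
  apply: phi0; exists (rshift 1 j); have lj : l y 0%R (rshift 1 j) = y 0%R j by rewrite /l row_mxEr.
  by move: yj; rewrite -lj.
split=> [y _|a].
  by apply: (@continuous_comp _ _ _ l phi); [exact: row_continuous_r|case: hphi => h _; exact: h].
split=> [y _|]; first by have [_ ->] := dl a y; exact: (Ck_derivable hphi).
split=> // y _; have -> : partial a (phi \o l) = partial (rshift 1 a) phi \o l.
  by apply/funext => z; have [e _] := dl a z.
apply: (@continuous_comp _ _ _ l (partial (rshift 1 a) phi)); first exact: row_continuous_r.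
by have [_ /(_ (rshift 1 a))[_ [h _]]] := hphi; exact: h.
Qed.

Lemma lebesgue_model_exists n : exists d (T : measurableType d) (m : {sigma_finite_measure set T -> \bar R})
  (iota : T -> 'rV[R]_n), lebesgue_model m iota.
Proof.
elim: n => [|n [d [T [m [iota h]]]]]; last by exists _, _, (lebesgue_times m), (fun w => row_mx (const_mx w.1 : 'rV[R]_1) (iota w.2)); exact: lebesgue_model_step h.
exists _, unit, (\d_tt : {sigma_finite_measure set unit -> \bar R}), (fun=> 0%R).
split=> [[]//|F mF F0|y e e0|phi B []//].
  by rewrite /= integral_dirac // diracT mul1e.
have e1 : @dirac _ unit tt R ((fun=> 0%R) @^-1` box y e) = 1 by rewrite diracE mem_set // => -[].
by change (0 < @dirac _ unit tt R ((fun=> 0%R) @^-1` box y e) < +oo); rewrite e1 lte_fin ltr01 ltry.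
Qed.

End LebesgueModel.


(** * The Riemannian volume in charts *)

Section VolumeIntegral.
Context {R : realType} {n : nat} (M : riemannianManifold R n).
Variable dM : {measure set (borel M) -> \bar R}.
Hypothesis hdM : is_volume dM.
Context d (T : measurableType d) (m : {sigma_finite_measure set T -> \bar R}) (iota : T -> 'rV[R]_n).
Hypothesis hm : lebesgue_model m iota.
Implicit Types c : chart R n M.
Local Open Scope ereal_scope.

Let iota_coord i : measurable_fun setT (fun t => iota t 0%R i : R).
Proof. by case: hm. Qed.
Let iota_open (U : set 'rV[R]_n) : open U -> measurable (iota @^-1` U).
Proof. exact: open_preimage_measurable. Qed.

Definition density c y : R := Num.sqrt (\det (metric_coord c y)).
Definition domain c : set T := iota @^-1` (c @` chart_dom c).
Definition param c (t : T) : borel M := chart_inv c (iota t).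

Lemma borel_open (U : set M) : open U -> measurable (U : set (borel M)).
Proof. by move=> oU; exact: sub_sigma_algebra. Qed.

Lemma borel_continuous (f : M -> R) : continuous f -> measurable_fun setT (f : borel M -> R).
Proof.
move=> cf; have := @pullback_measurable R _ (borel M) M id borel_open setT f openT (fun y _ => cf y).
by [].
Qed.

Lemma domain_measurable c : measurable (domain c).
Proof. by apply: iota_open; exact: chart_img_open. Qed.

Lemma param_measurable c : measurable_fun (domain c) (param c).
Proof.
apply: (measurability _ (erefl : @measurable _ (borel M) = <<s @open M>>)) => _ [U oU <-].
have -> : domain c `&` param c @^-1` U = iota @^-1` (c @` (chart_dom c `&` U)).
  apply/seteqP; split=> t /=.
    by move=> [[p dp e]]; rewrite /param -e chart_mapK // => Up; exists p.
  move=> [p [dp Up] e]; split; first by exists p.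
  by rewrite /param -e chart_mapK.
by apply: iota_open; exact: chart_img_openI.
Qed.

Lemma metric_entry_Ck c k i j : atlas c -> Ck_on k (c @` chart_dom c) (fun y => metric_coord c y i j).
Proof.
move=> hc; have oD : open (c @` chart_dom c) by exact: chart_img_open.
refine (@Ck_entry _ _ _ oD n n k (metric_coord c) i j _); exact: (metric_smooth hc k).
Qed.

Lemma density_continuous c y : atlas c -> (c @` chart_dom c) y -> {for y, continuous (density c)}.
Proof.
move=> hc Dy; have oD : open (c @` chart_dom c) by exact: chart_img_open.
apply: (@continuous_comp _ _ _ (fun y => \det (metric_coord c y)) (@Num.sqrt R)); last exact: sqrt_continuous.
exact: (Ck_continuous (Ck_det oD (fun i j => metric_entry_Ck 0 i j hc)) Dy).
Qed.

Lemma density_measurable c : atlas c -> measurable_fun (domain c) (fun t => (density c (iota t))%:E).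
Proof.
move=> hc; apply/measurable_EFinP; apply: (pullback_measurable iota_open); first exact: chart_img_open.
by move=> y; exact: density_continuous.
Qed.

Lemma density_ge0 c y : (0 <= density c y)%R. Proof. exact: sqrtr_ge0. Qed.

Lemma chart_integral_indic c (A : set (borel M)) : atlas c -> measurable A ->
  dM (A `&` chart_dom c) = \int[m]_(t in domain c) ((\1_A (param c t))%:E * (density c (iota t))%:E).
Proof.
move=> hc mA; have md : measurable (chart_dom c : set (borel M)) by apply: borel_open; exact: chart_dom_open.
rewrite (hdM hc (measurableI _ _ mA md)) => [|p []//].
set F := fun y : 'rV[R]_n => _.
have FE : F \o iota = (fun t => (\1_A (param c t))%:E * (density c (iota t))%:E) \_ (domain c).
  apply/funext => t; rewrite /F /patch /= EFinM; case: ifPn => [|ND].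
    rewrite inE => -[p dp e]; congr (_%:E * _); rewrite /param -e chart_mapK // !indicE; congr (_%:R).
    congr (nat_of_bool _); apply/idP/idP; rewrite !inE.
      by move=> [q [Aq dq] /(congr1 (chart_inv c))]; rewrite !chart_mapK // => <-.
    by move=> Ap; exists p.
  rewrite indicE memNset ?mul0e // => -[p [_ dp] e]; move: ND; rewrite notin_setE; apply.
  by exists p.
have [_ hI _ _] := hm; rewrite hI => [|//|y]; last by rewrite lee_fin mulr_ge0 // sqrtr_ge0.
  by rewrite [RHS]integral_mkcond -FE.
rewrite FE; apply/(measurable_restrictT _ (domain_measurable c)).
apply: emeasurable_funM; last exact: density_measurable.
apply/measurable_EFinP; apply: (measurableT_comp (f := \1_A : borel M -> R)); last exact: param_measurable.
exact: measurable_indic.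
Qed.

Import HBNNSimple.

Lemma chart_integral_simple c (h : {nnsfun borel M >-> R}) : atlas c ->
  \int[dM]_(p in (chart_dom c : set (borel M))) (h p)%:E =
  \int[m]_(t in domain c) ((h (param c t))%:E * (density c (iota t))%:E).
Proof.
move=> hc; have md : measurable (chart_dom c : set (borel M)) by apply: borel_open; exact: chart_dom_open.
have mD := domain_measurable c.
transitivity (\int[dM]_(p in (chart_dom c : set (borel M))) (\sum_(y \in range h) (y * \1_(h @^-1` [set y]) p)%:E)).
  by apply: eq_integral => p _; rewrite fimfunE -fsumEFin.
rewrite ge0_integral_fsum //; last 2 first.
- move=> y; apply/measurable_EFinP; apply: measurable_funM => //; apply: measurable_indic.
- by move=> y p _; exact: nnfun_muleindic_ge0.
transitivity (\int[m]_(t in domain c) (\sum_(y \in range h) ((y * \1_(h @^-1` [set y]) (param c t))%:E * (density c (iota t))%:E))); last first.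
  apply: eq_integral => t _; rewrite fimfunE -fsumEFin // ge0_mule_fsuml // => y.
  exact: nnfun_muleindic_ge0.
have mi y : measurable_fun (domain c) (fun t => (\1_(h @^-1` [set y]) (param c t))%:E * (density c (iota t))%:E).
  apply: emeasurable_funM; last exact: density_measurable.
  apply/measurable_EFinP; apply: (measurableT_comp (f := \1_(h @^-1` [set y]) : borel M -> R)); last exact: param_measurable.
  exact: measurable_indic.
rewrite ge0_integral_fsum //; last 2 first.
- move=> y; rewrite (_ : (fun t => _) = (fun t => y%:E * ((\1_(h @^-1` [set y]) (param c t))%:E * (density c (iota t))%:E))).
    exact: measurable_funeM.
  by apply/funext => t; rewrite EFinM muleA.
- move=> y t _; apply: mule_ge0; last by rewrite lee_fin density_ge0.
  exact: nnfun_muleindic_ge0.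
apply: eq_fsbigr => y; rewrite inE => -[p _ hy].
have y0 : (0 <= y)%R by rewrite -hy.
have my : measurable (h @^-1` [set y]) by rewrite -[X in measurable X]setTI; exact: measurable_funP.
under eq_integral do rewrite EFinM.
rewrite ge0_integralZl_EFin //; last first.
  by apply/measurable_EFinP; apply: measurable_indic.
rewrite integral_indic // (chart_integral_indic hc my).
rewrite -ge0_integralZl_EFin //; last by move=> t _; rewrite mule_ge0 // lee_fin ?density_ge0.
by apply: eq_integral => t _; rewrite EFinM muleA.
Qed.

Lemma chart_integral_ge0 c (u : borel M -> \bar R) : atlas c -> measurable_fun setT u -> (forall p, 0 <= u p) ->
  \int[dM]_(p in (chart_dom c : set (borel M))) u p =
  \int[m]_(t in domain c) (u (param c t) * (density c (iota t))%:E).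
Proof.
move=> hc mu u0; have md : measurable (chart_dom c : set (borel M)) by apply: borel_open; exact: chart_dom_open.
have mD := domain_measurable c.
pose h := nnsfun_approx measurableT mu.
have hu p : EFin \o h^~ p @ \oo --> u p by apply: (cvg_nnsfun_approx measurableT mu (fun x _ => u0 x)).
have hmono (k l : nat) p : (k <= l)%N -> (h k p)%:E <= (h l p)%:E.
  by move=> kl; rewrite lee_fin; have /lefP := nd_nnsfun_approx measurableT mu kl; apply.
transitivity (limn (fun k => \int[dM]_(p in (chart_dom c : set (borel M))) (h k p)%:E)).
  rewrite -monotone_convergence //.
  - by apply: eq_integral => p _; apply/esym/cvg_lim => //; exact: hu.
  - by move=> k; apply/measurable_EFinP; exact: measurable_funTS.
  - by move=> k p _; rewrite lee_fin.
  - by move=> p _ k l; exact: hmono.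
under eq_fun do rewrite chart_integral_simple //.
rewrite -monotone_convergence //.
- apply: eq_integral => t _; apply/cvg_lim => //; apply: cvgeZr => //; exact: hu.
- move=> k; apply: emeasurable_funM; last exact: density_measurable.
  by apply/measurable_EFinP; apply: (measurableT_comp (f := h k : borel M -> R)); [exact: measurable_funP|exact: param_measurable].
- by move=> k t _; rewrite mule_ge0 // lee_fin ?density_ge0.
- by move=> t _ k l kl; apply: lee_wpmul2r; [rewrite lee_fin density_ge0|exact: hmono].
Qed.

Lemma chart_integral c (v : M -> R) : atlas c -> continuous v ->
  \int[dM]_(p in (chart_dom c : set (borel M))) (v p)%:E =
  \int[m]_(t in domain c) (v (param c t) * density c (iota t))%:E.
Proof.
move=> hc /borel_continuous mv; rewrite [LHS]integralE [RHS]integralE.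
have mE : measurable_fun setT (EFin \o (v : borel M -> R)) by apply/measurable_EFinP.
rewrite !chart_integral_ge0 //; last 2 first.
- exact: measurable_funeneg.
- exact: measurable_funepos.
have dr t := density_ge0 c (iota t).
congr (_ - _); apply: eq_integral => t _.
  by rewrite !funeposE -!EFin_max -EFinM maxr_pMl // mul0r.
by rewrite !funenegE -!EFinN -!EFin_max -EFinM maxr_pMl // mul0r mulNr.
Qed.

(** A null open set would make the positive density vanish almost everywhere on a coordinate box,
    which has positive measure. *)
Lemma volume_open_gt0 (U : set M) p : open U -> U p -> 0 < dM (U : set (borel M)).
Proof.
move=> oU Up; pose c := chart_at p; have hc : atlas c by exact: chart_at_atlas.
have dp : chart_dom c p by exact: chart_at_dom.
have mU := borel_open oU; have mD := domain_measurable c.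
have le : dM ((U : set (borel M)) `&` chart_dom c) <= dM (U : set (borel M)).
  apply: le_measure; rewrite ?inE //; apply: measurableI => //.
  by apply: borel_open; exact: chart_dom_open.
apply: (lt_le_trans _ le); rewrite (chart_integral_indic hc mU) lt0e; apply/andP; split; last first.
  by apply: integral_ge0 => t _; rewrite mule_ge0 // lee_fin ?density_ge0.
apply/eqP => I0; set f := (fun t => _ * _) in I0.
have mf : measurable_fun (domain c) f.
  apply: emeasurable_funM; last exact: density_measurable.
  apply/measurable_EFinP; apply: (measurableT_comp (f := \1_U : borel M -> R)); last exact: param_measurable.
  exact: measurable_indic.
have /(ae_eq_integral_abs _ mD mf) : \int[m]_(t in domain c) `|f t| = 0.
  rewrite -I0; apply: eq_integral => t _; rewrite gee0_abs // mule_ge0 // lee_fin ?density_ge0 //.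
have oDU := chart_img_openI (c := c) oU.
have /nbhs_ballP[r /= r0 rU] : nbhs (c p) (c @` (chart_dom c `&` U)) by apply: open_nbhs_nbhs; split=> //; exists p.
have [_ _ hb _] := hm; have /andP[b0 _] := hb (c p) r r0.
move=> ae0; have : m.-negligible (iota @^-1` box (c p) r).
  apply: negligibleS ae0 => t bt /=; apply/not_implyP.
  have [q [dq Uq] e] : (c @` (chart_dom c `&` U)) (iota t).
    by apply: rU; apply/rV_ballP => // i; rewrite distrC; exact: bt.
  have Dt : domain c t by exists q.
  split=> //; rewrite /f /param /density -e chart_mapK // indicE mem_set // mul1e => -[/eqP].
  rewrite sqrtr_eq0 leNgt => /negP; apply.
  have Dq : (c @` chart_dom c) (c q) by exists q.
  have sG := metric_coord_sym hc Dq; have [L LE] := cholesky sG (metric_coord_pos hc Dq).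
  rewrite lt0r -LE !det_mulmx det_tr -expr2 sqr_ge0 andbT sqrf_eq0.
  have := g_unit (fun y (Dy : (c @` chart_dom c) y) => @metric_coord_pos _ _ _ c y hc Dy) Dq.
  by rewrite -LE !unitmx_mul => /andP[]; rewrite unitmxE unitfE.
move=> /(negligibleP m (box_measurable iota_coord (c p) r)) b00.
by move: b0; rewrite b00 ltxx.
Qed.

End VolumeIntegral.

(** * Cutoff and flux *)

Lemma is_derive_comp1 {R : realType} (X : normedModType R) (g : R -> R) (f : X -> R) (x v : X) (df dg : R) :
  is_derive x v f df -> is_derive (f x) (1 : R) g dg -> is_derive x v (fun z => g (f z)) (dg * df).
Proof.
move=> [d1 <-] hg; pose l (t : R) : X := x + t *: v.
have l0 : l 0 = x by rewrite /l scale0r addr0.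
have h1 : is_derive (0 : R) (1 : R) (f \o l) ('D_v f x).
  by have := @is_derive_line R X R f x v 0; rewrite scale0r addr0; apply.
have h2 : is_derive (0 : R) (1 : R) (g \o (f \o l)) (dg * 'D_v f x).
  by apply: is_derive1_comp h1; rewrite /= l0.
have la (h : R) : l (h *: (1 : R) + 0) = h *: v + l 0.
  by rewrite l0 /l addr0 [h *: (1 : R)]mulr1 addrC.
have [e1 e2] := derive_affine (g \o f) la; rewrite l0 in e1 e2.
by case: h2 => d2 e; apply: DeriveDef; [rewrite -[derivable _ _ _]e2|rewrite -[LHS]e1].
Qed.

Lemma C1_comp1 {R : realType} n (D : set 'rV[R]_n) (g dg : R -> R) (f : 'rV[R]_n -> R) : open D -> Ck_on 1 D f ->
  (forall y, D y -> is_derive (f y) (1 : R) g (dg (f y)) /\ {for f y, continuous dg}) ->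
  Ck_on 1 D (fun y => g (f y)) /\ forall y i, D y -> partial i (fun z => g (f z)) y = dg (f y) * partial i f y.
Proof.
move=> oD hf hg.
have der y i : D y -> is_derive y (delta_mx 0 i) (fun z => g (f z)) (dg (f y) * partial i f y).
  move=> Dy; have [h _] := hg y Dy; apply: is_derive_comp1 h.
  by apply: DeriveDef => //; exact: Ck_derivable hf Dy.
have P y i (Dy : D y) := partial_eq (der y i Dy); split=> [|y i Dy]; last exact: P.
split=> [y Dy|i].
  apply: (@continuous_comp _ _ _ f g); first exact: Ck_continuous hf Dy.
  by apply: differentiable_continuous; apply/derivable1_diffP; have [[]] := hg y Dy.
split=> [y Dy|]; first by case: (der y i Dy).
have h0 : Ck_on 0 D (fun y => dg (f y)).
  split=> // y Dy; apply: (@continuous_comp _ _ _ f dg); first exact: Ck_continuous hf Dy.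
  by have [] := hg y Dy.
by apply: (Ck_ext oD) (CkM oD h0 (Ck_partial i hf)) => y Dy; rewrite P.
Qed.

Section Cutoff.
Context {R : realType}.

Definition ramp (t : R) : R := Num.max 0 t.
(** Unlike the positive part its square is of class C^1, which is the regularity that the divergence
    theorem below asks of test functions. *)
Definition pos2 (t : R) : R := ramp t ^+ 2.

Lemma ramp_continuous : continuous ramp.
Proof. by move=> t; apply: continuous_max; [exact: cst_continuous|exact: cvg_id]. Qed.

Lemma ramp_ge0 t : 0 <= ramp t. Proof. by rewrite le_max lexx. Qed.

Lemma pos2_eq0 t : t <= 0 -> pos2 t = 0.
Proof. by move=> t0; rewrite /pos2 /ramp (max_l t0) expr0n. Qed.

Lemma is_derive_pos2 (t : R) : is_derive t (1 : R) pos2 (2 * ramp t).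
Proof.
have [t0|t0|->] := ltgtP t 0.
- have -> : 2 * ramp t = 0 by rewrite /ramp max_l ?ltW // mulr0.
  have h : \forall z \near t, (cst (0 : R) : R -> R) z = pos2 z.
    by have := near_lt t0; apply: filterS => z z0; rewrite pos2_eq0 // ltW.
  exact: (near_eq_is_derive h (is_derive_cst (0 : R) t (1 : R))).
- rewrite /ramp max_r ?ltW //; apply: (near_eq_is_derive (f := fun z : R => z * z)).
    by have := near_gt t0; apply: filterS => z z0; rewrite /pos2 /ramp max_r ?ltW // expr2.
  have := is_deriveM (is_derive_id t (1 : R)) (is_derive_id t (1 : R)).
  by congr is_derive; rewrite /GRing.scale /= mulr1 mulr2n mulrDl mul1r.
have hc : (fun h : R => h^-1 *: ((pos2 \o shift 0) (h *: (1 : R)) - pos2 0)) @ (0 : R)^' --> (0 : R).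
  apply/cvgr0Pnorm_lt => e e0; near=> h.
  have h0 : h != 0 by near: h; exact: nbhs_dnbhs_neq.
  have he : `|h| < e by near: h; exact: dnbhs0_lt.
  rewrite /= addr0 [h *: (1 : R)]mulr1 (pos2_eq0 (lexx 0)) subr0.
  apply: le_lt_trans he; rewrite /pos2 /ramp; have [hp|hn] := leP h 0.
    by rewrite expr0n scaler0 normr0.
  by rewrite expr2 /GRing.scale /= mulKf.
by apply: DeriveDef; [apply/cvg_ex; exists 0|rewrite /ramp max_l // mulr0; apply/cvg_lim].
Unshelve. all: by end_near. Qed.

(** A C^1 step made of [pos2] alone, equal to 1 for [t <= 1/4] and to 0 for [t >= 1]. The factor 2
    yields the left plateau, since [2 (3/4)^2 >= 1]. *)
Definition plateau (t : R) : R := 1 - pos2 (1 - 2 * pos2 (1 - t)).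

Lemma plateau_eq0 t : 1 <= t -> plateau t = 0.
Proof.
move=> t1; rewrite /plateau (@pos2_eq0 (1 - t)) ?subr_le0 // mulr0 subr0 /pos2 /ramp max_r ?ler01 //.
by rewrite expr1n subrr.
Qed.

Lemma plateau_eq1 t : t <= 4^-1 -> plateau t = 1.
Proof.
move=> t1; rewrite /plateau (@pos2_eq0 (1 - _)) ?subr0 // subr_le0.
rewrite /pos2 /ramp max_r; nra.
Qed.

Lemma plateau_C1 n (D : set 'rV[R]_n) f : open D -> Ck_on 1 D f -> Ck_on 1 D (fun y => plateau (f y)).
Proof.
move=> oD hf; have P (g : 'rV[R]_n -> R) : Ck_on 1 D g -> Ck_on 1 D (fun y => pos2 (g y)).
  move=> hg; apply: (C1_comp1 (dg := fun t => 2 * ramp t) oD hg _).1 => y _; split; first exact: is_derive_pos2.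
  by apply: continuousM; [exact: cst_continuous|exact: ramp_continuous].
have c1 := Ck_cst 1 D (1 : R).
exact: (CkB oD c1 (P _ (CkB oD c1 (CkM oD (Ck_cst 1 D 2) (P _ (CkB oD c1 hf)))))).
Qed.

End Cutoff.

(** * The radial test function, in the variable [t = |X|^2] *)

Section Profile.
Context {R : realType}.
Variables (kappa e : R).
Hypothesis kappa_le0 : kappa <= 0.
Hypothesis e_ge0 : 0 <= e.

(** [t] times the slope of this function stays below [e] in absolute value, which offsets the factor
    [t] in the bound of the gradient term. *)
Definition log_height (t : R) : R := 1 - e * ln (1 + t).
Definition inv_sqrt (t : R) : R := (Num.sqrt (1 - kappa * t))^-1.
(** The factor [inv_sqrt] cancels the ratio of densities that multiplies every divergence below. *)
Definition profile (t : R) : R := pos2 (log_height t) * inv_sqrt t.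
Definition dprofile (t : R) : R :=
  pos2 (log_height t) * (kappa / 2 * (inv_sqrt t * inv_sqrt t * inv_sqrt t)) +
  inv_sqrt t * (2 * ramp (log_height t) * (- e * (1 + t)^-1)).

Let continuous_of_derive (f : R -> R) (t df : R) : is_derive t (1 : R) f df -> {for t, continuous f}.
Proof. by move=> [h _]; apply: differentiable_continuous; apply/derivable1_diffP. Qed.

Lemma quad_gt0 (t : R) : 0 <= t -> 0 < 1 - kappa * t.
Proof. by move=> t0; have := mulr_le0_ge0 kappa_le0 t0; lra. Qed.

Let is_derive_shift (t : R) : is_derive t (1 : R) (fun z => 1 + z) 1.
Proof.
have := @is_deriveD _ _ _ _ _ _ _ _ _ (is_derive_cst (1 : R) t (1 : R)) (is_derive_id t (1 : R)).
by rewrite add0r.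
Qed.

Lemma is_derive_log_height (t : R) : 0 <= t -> is_derive t (1 : R) log_height (- e * (1 + t)^-1).
Proof.
move=> t0; have p : 0 < 1 + t by rewrite ltr_pwDl.
have h := is_deriveMl (- e) (is_derive_comp1 (is_derive_shift t) (is_derive1_ln p)).
have := @is_deriveD _ _ _ _ _ _ _ _ _ (is_derive_cst (1 : R) t (1 : R)) h.
congr is_derive; last by rewrite add0r mulr1.
by apply/funext => z; rewrite /log_height -mulNr.
Qed.

Lemma is_derive_inv_sqrt (t : R) : 0 <= t ->
  is_derive t (1 : R) inv_sqrt (kappa / 2 * (inv_sqrt t * inv_sqrt t * inv_sqrt t)).
Proof.
move=> t0; have q0 := quad_gt0 t0; have r0 : Num.sqrt (1 - kappa * t) != 0 by rewrite gt_eqF // sqrtr_gt0.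
have hq : is_derive t (1 : R) (fun z => 1 - kappa * z) (- kappa).
  have h := is_deriveMl (- kappa) (is_derive_id t (1 : R)).
  have := @is_deriveD _ _ _ _ _ _ _ _ _ (is_derive_cst (1 : R) t (1 : R)) h.
  congr is_derive; last by rewrite add0r mulr1.
  by apply/funext => z; rewrite -mulNr.
have hs := is_derive_comp1 hq (is_derive1_sqrt q0).
apply: (is_derive_eq (is_deriveV (f := fun z => Num.sqrt (1 - kappa * z)) r0 hs)).
by rewrite /inv_sqrt /GRing.scale /=; move: r0; move: (Num.sqrt _) => r r0; field.
Qed.

Let is_derive_pos2_log (t : R) : 0 <= t ->
  is_derive t (1 : R) (fun z => pos2 (log_height z)) (2 * ramp (log_height t) * (- e * (1 + t)^-1)).
Proof. by move=> t0; exact: is_derive_comp1 (is_derive_log_height t0) (is_derive_pos2 _). Qed.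

Lemma is_derive_profile (t : R) : 0 <= t -> is_derive t (1 : R) profile (dprofile t).
Proof.
move=> t0; apply: (is_derive_eq (is_deriveM (is_derive_pos2_log t0) (is_derive_inv_sqrt t0))).
by rewrite /dprofile /GRing.scale.
Qed.

Lemma dprofile_continuous (t : R) : 0 <= t -> {for t, continuous dprofile}.
Proof.
move=> t0; have p : 0 < 1 + t by rewrite ltr_pwDl.
have c1 := continuous_of_derive (is_derive_pos2_log t0).
have c2 := continuous_of_derive (is_derive_inv_sqrt t0).
have c3 : {for t, continuous (fun z => ramp (log_height z))}.
  apply: (@continuous_comp _ _ _ log_height ramp); last exact: ramp_continuous.
  exact: continuous_of_derive (is_derive_log_height t0).
have c4 : {for t, continuous (fun z : R => (1 + z)^-1)}.
  apply: continuousV; first by rewrite gt_eqF.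
  exact: continuous_of_derive (is_derive_shift t).
have cc (a : R) : {for t, continuous (fun _ : R => a)} by exact: cst_continuous.
exact: (continuousD (continuousM c1 (continuousM (cc _) (continuousM (continuousM c2 c2) c2)))
  (continuousM c2 (continuousM (continuousM (cc _) c3) (continuousM (cc _) c4)))).
Qed.

Definition weight (t : R) : R := pos2 (log_height t) * (1 - kappa * t)^-1.

Lemma weight_continuous (t : R) : 0 <= t -> {for t, continuous weight}.
Proof.
move=> t0; apply: continuousM; first exact: continuous_of_derive (is_derive_pos2_log t0).
apply: continuousV; first by rewrite gt_eqF // quad_gt0.
by apply: continuousB; [exact: cst_continuous|apply: continuousM; [exact: cst_continuous|exact: cvg_id]].
Qed.

Lemma weight_ge0 (t : R) : 0 <= t -> 0 <= weight t.
Proof. by move=> t0; rewrite mulr_ge0 ?sqr_ge0 // invr_ge0 ltW // quad_gt0. Qed.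

(** Differentiating [inv_sqrt] costs at most the fraction [- kappa t / (1 - kappa t)] of the squared
    cutoff, which leaves [weight]. Differentiating the cutoff costs at most [4 e T], since
    [t / (1 + t) <= 1]; the 4 is the 2 of the square times the 2 in the bound on [S]. *)
Lemma weight_bound (t T S : R) : 0 <= t -> 0 <= T -> 0 <= S <= 2 * t * T ->
  T * weight t <= Num.sqrt (1 - kappa * t) * (T * profile t + dprofile t * S) + 4 * e * T.
Proof.
move=> t0 T0 /andP[S0 S1]; have q0 := quad_gt0 t0.
set r := Num.sqrt (1 - kappa * t); have r0 : 0 < r by rewrite sqrtr_gt0.
have rr : r * r = 1 - kappa * t by rewrite -expr2 sqr_sqrtr // ltW.
set g := pos2 (log_height t); have g0 : 0 <= g by exact: sqr_ge0.
set k := ramp (log_height t); have k0 : 0 <= k by exact: ramp_ge0.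
have k1 : k <= 1.
  rewrite /k /ramp ge_max ler01 /= /log_height lerBlDr lerDl mulr_ge0 // ln_ge0 // lerDl //.
pose z := (1 + t)^-1; have z0 : 0 < z by rewrite invr_gt0 ltr_pwDl.
have tz : t * z <= 1 by rewrite /z ler_pdivrMr ?mul1r ?lerDr // ltr_pwDl.
have -> : r * (T * profile t + dprofile t * S) = T * g + (g * kappa / (2 * (1 - kappa * t)) - 2 * k * e * z) * S.
  rewrite /profile /dprofile /inv_sqrt -/r -/g -/k -/z -rr; field; rewrite gt_eqF //.
have e1 : T * weight t = T * g + g * kappa / (2 * (1 - kappa * t)) * (2 * t * T).
  by rewrite /weight -/g; field; rewrite gt_eqF.
have h1 : g * kappa / (2 * (1 - kappa * t)) * (2 * t * T) <= g * kappa / (2 * (1 - kappa * t)) * S.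
  apply: ler_wnM2l S1; rewrite mulr_le0_ge0 //; first exact: mulr_ge0_le0.
  by rewrite invr_ge0 mulr_ge0 // ltW.
have h2 : 2 * k * e * z * S <= 4 * e * T.
  apply: (@le_trans _ _ (2 * k * e * z * (2 * t * T))).
    by rewrite ler_wpM2l // !mulr_ge0 // ltW.
  have -> : 2 * k * e * z * (2 * t * T) = 4 * e * T * (k * (t * z)) by ring.
  by rewrite ler_piMr ?mulr_ge0 // mulr_ile1 // mulr_ge0 // ltW.
rewrite e1 mulrBl; lra.
Qed.

End Profile.

(** * Divergence theorem and infinite integral, for a field [nf] with signed density [w] *)

Section FluxTheorem.
Context {R : realType} {n : nat} (M : riemannianManifold R n).
Variable dM : {measure set (borel M) -> \bar R}.
Hypothesis hdM : is_volume dM.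
Variables (kappa : R) (s T : M -> R).
Variables (nf : chart R n M -> 'rV[R]_n -> 'rV[R]_n) (V : chart R n M -> 'I_n -> 'rV[R]_n -> R).
Variable w : chart R n M -> 'rV[R]_n -> R.
Hypothesis kappa_le0 : kappa <= 0.
Hypothesis s_ge0 : forall p, 0 <= s p.
Hypothesis T_ge0 : forall p, 0 <= T p.
Hypothesis s_smooth : forall c, atlas c -> forall k, Ck_on k (c @` chart_dom c) (fun y => s (chart_inv c y)).
Hypothesis V_smooth : forall c, atlas c -> forall i k, Ck_on k (c @` chart_dom c) (V c i).
Hypothesis w_smooth : forall c, atlas c -> Ck_on 0 (c @` chart_dom c) (w c).
Hypothesis VE : forall c, atlas c -> forall i y, (c @` chart_dom c) y -> V c i y = w c y * nf c y 0 i.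
Hypothesis V_div : forall c, atlas c -> forall y, (c @` chart_dom c) y ->
  \sum_i partial i (V c i) y = w c y * T (chart_inv c y).
Hypothesis w_volume : forall c, atlas c -> forall y, (c @` chart_dom c) y ->
  w c y ^+ 2 = (1 - kappa * s (chart_inv c y)) * \det (metric_coord c y).
Hypothesis nf_change : forall c c', atlas c -> atlas c' -> forall y, (c @` (chart_dom c `&` chart_dom c')) y ->
  nf c y *m jac (transition c c') y = nf c' (transition c c' y).
Hypothesis nf_bound : forall c, atlas c -> forall y, (c @` chart_dom c) y ->
  0 <= \sum_i partial i (fun z => s (chart_inv c z)) y * nf c y 0 i <= 2 * s (chart_inv c y) * T (chart_inv c y).
Hypothesis s_proper : forall C, compact [set p : M | s p <= C].

Implicit Types (c : chart R n M) (psi chi : M -> R).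

Definition C1_fun psi := forall c, atlas c -> Ck_on 1 (c @` chart_dom c) (fun y => psi (chart_inv c y)).
Definition flux psi c y : R := \sum_i partial i (fun z => psi (chart_inv c z)) y * nf c y 0 i.
(** The divergence of [psi V] relative to the Riemannian density: the root is the ratio of [|w|] to
    that density. By [flux_divE] the choice of chart is immaterial. *)
Definition flux_div psi (p : M) : R :=
  Num.sqrt (1 - kappa * s p) * (T p * psi p + flux psi (chart_at p) (chart_at p p)).

Let oD c : open (c @` chart_dom c). Proof. exact: chart_img_open. Qed.

Lemma metric_det_gt0 c y : atlas c -> (c @` chart_dom c) y -> 0 < \det (metric_coord c y).
Proof.
move=> hc Dy; have [L LE] := cholesky (metric_coord_sym hc Dy) (metric_coord_pos hc Dy).
rewrite lt0r -{2}LE !det_mulmx det_tr -expr2 sqr_ge0 andbT -unitfE -unitmxE.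
exact: (g_unit (fun z (Dz : (c @` chart_dom c) z) => @metric_coord_pos _ _ _ c z hc Dz) Dy).
Qed.

Lemma conf_s_gt0 p : 0 < 1 - kappa * s p.
Proof. by have := mulr_le0_ge0 kappa_le0 (s_ge0 p); lra. Qed.

Lemma w_neq0 c y : atlas c -> (c @` chart_dom c) y -> w c y != 0.
Proof.
move=> hc Dy; have := w_volume hc Dy; have := metric_det_gt0 hc Dy; have := conf_s_gt0 (chart_inv c y).
by move=> h1 h2 h3; rewrite -sqrf_eq0 h3 mulf_neq0 ?gt_eqF.
Qed.

Lemma C1_funM psi chi : C1_fun psi -> C1_fun chi -> C1_fun (fun p => psi p * chi p).
Proof. by move=> h1 h2 c hc; exact: (CkM (@oD c) (h1 c hc) (h2 c hc)). Qed.

Lemma C1_funB psi chi : C1_fun psi -> C1_fun chi -> C1_fun (fun p => psi p - chi p).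
Proof. by move=> h1 h2 c hc; exact: (CkB (@oD c) (h1 c hc) (h2 c hc)). Qed.

Lemma flux_change psi c c' y : C1_fun psi -> atlas c -> atlas c' -> (c @` (chart_dom c `&` chart_dom c')) y ->
  flux psi c y = flux psi c' (transition c c' y).
Proof.
move=> hpsi hc hc' Dy; rewrite /flux -(nf_change hc hc' Dy).
have oO : open (c @` (chart_dom c `&` chart_dom c')) by exact: overlap_open.
have Ty : (c' @` chart_dom c') (transition c c' y) by have [p [dp _] <-] := transition_img Dy; exists p.
have h := chain_partial (@oD c') (hpsi c' hc') Ty (fun b => Ck_derivable (transition_Ck b 1 hc hc') Dy).
transitivity (\sum_i \sum_a partial i (fun z => transition c c' z 0 a) y *
    partial a (fun z => psi (chart_inv c' z)) (transition c c' y) * nf c y 0 i).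
  apply: eq_bigr => i _; rewrite -mulr_suml; congr (_ * _); rewrite -(partial_eq (h i)).
  apply: partial_near; apply: (eq_near oO) Dy => z [p [dp dp'] <-].
  by rewrite /transition !chart_mapK.
rewrite exchange_big /=; apply: eq_bigr => a _; rewrite [X in _ = _ * X]mxE mulr_sumr; apply: eq_bigr => i _.
by rewrite [jac _ _ _ _]mxE; ring.
Qed.

Lemma flux_divE psi c p : C1_fun psi -> atlas c -> chart_dom c p ->
  flux_div psi p = Num.sqrt (1 - kappa * s p) * (T p * psi p + flux psi c (c p)).
Proof.
move=> hpsi hc dp; congr (_ * (_ + _)).
have hc' : atlas (chart_at p) by exact: chart_at_atlas.
have dp' : chart_dom (chart_at p) p by exact: chart_at_dom.
rewrite (flux_change hpsi hc' hc); last by exists p.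
have -> : transition (chart_at p) c (chart_at p p) = c p by rewrite /transition chart_mapK.
by [].
Qed.

Lemma flux_coord psi c y : C1_fun psi -> atlas c -> (c @` chart_dom c) y ->
  \sum_i partial i (fun z => psi (chart_inv c z) * V c i z) y =
  w c y * (T (chart_inv c y) * psi (chart_inv c y) + flux psi c y).
Proof.
move=> hpsi hc Dy.
transitivity (\sum_i (psi (chart_inv c y) * partial i (V c i) y + V c i y * partial i (fun z => psi (chart_inv c z)) y)).
  apply: eq_bigr => i _; apply: partialM; first exact: Ck_derivable (hpsi c hc) Dy.
  exact: Ck_derivable (V_smooth hc i 1) Dy.
rewrite big_split /= -mulr_sumr (V_div hc Dy) mulrDr; congr (_ + _); first by ring.
by rewrite /flux mulr_sumr; apply: eq_bigr => i _; rewrite (VE hc i Dy); ring.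
Qed.

Lemma chart_continuous (g : M -> R) :
  (forall c, atlas c -> forall y, (c @` chart_dom c) y -> {for y, continuous (fun z => g (chart_inv c z))}) -> continuous g.
Proof.
move=> hg p; pose c := chart_at p; have dp : chart_dom c p by exact: chart_at_dom.
have od : open (chart_dom c) by exact: chart_dom_open.
apply: (continuous_near (f := (fun z => g (chart_inv c z)) \o c) od _ dp).
  by move=> q dq; rewrite /= chart_mapK.
apply: continuous_comp; first exact: chart_map_continuous.
by apply: hg; [exact: chart_at_atlas|exists p].
Qed.

Lemma flux_div_continuous psi : C1_fun psi -> continuous (flux_div psi).
Proof.
move=> hpsi; apply: chart_continuous => c hc y Dy.
have h : Ck_on 0 (c @` chart_dom c) (fun z => Num.sqrt (1 - kappa * s (chart_inv c z)) *
    ((w c z)^-1 * \sum_i partial i (fun z => psi (chart_inv c z) * V c i z) z)).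
  apply: (CkM (@oD c)).
    split=> // z Dz; apply: (@continuous_comp _ _ _ (fun z => 1 - kappa * s (chart_inv c z)) (@Num.sqrt R)); last exact: sqrt_continuous.
    exact: (Ck_continuous (CkB (@oD c) (Ck_cst 0 _ 1) (CkM (@oD c) (Ck_cst 0 _ kappa) (s_smooth hc 0))) Dz).
  apply: (CkM (@oD c)); first by apply: (CkV (@oD c)) (w_smooth hc) => z; exact: w_neq0.
  apply: (Ck_sum (@oD c)) => i _; apply: Ck_partial; apply: (CkM (@oD c)); [exact: hpsi|exact: V_smooth].
apply: (continuous_near (@oD c) _ Dy (Ck_continuous h Dy)) => z Dz.
rewrite (flux_coord hpsi hc Dz) mulKf ?w_neq0 //; case: Dz => p dp <-.
by rewrite chart_mapK // (flux_divE hpsi hc dp).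
Qed.

(** [T] is built from principal curvatures, of which no regularity is given; its continuity is read
    off from the divergence of the smooth field [V]. *)
Lemma T_continuous : continuous T.
Proof.
apply: chart_continuous => c hc y Dy.
have h : Ck_on 0 (c @` chart_dom c) (fun z => (w c z)^-1 * \sum_i partial i (V c i) z).
  apply: (CkM (@oD c)); first by apply: (CkV (@oD c)) (w_smooth hc) => z; exact: w_neq0.
  by apply: (Ck_sum (@oD c)) => i _; apply: Ck_partial; exact: V_smooth.
apply: (continuous_near (@oD c) _ Dy (Ck_continuous h Dy)) => z Dz.
by rewrite (V_div hc Dz) mulKf // w_neq0.
Qed.

Lemma flux_div_eq0 psi p : (\forall q \near p, psi q = 0) -> flux_div psi p = 0.
Proof.
move=> h; rewrite /flux_div (nbhs_singleton h) mulr0 add0r; set c := chart_at p.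
have dp : chart_dom c p by exact: chart_at_dom.
have -> : flux psi c (c p) = 0; last by rewrite mulr0.
rewrite /flux big1 // => i _.
have -> : partial i (fun z => psi (chart_inv c z)) (c p) = 0; last by rewrite mul0r.
transitivity (partial i (fun=> 0 : R) (c p)); last by rewrite partial_cst.
apply: partial_near; have := chart_img_near dp h.
by apply: filterS => y [q [dq hq] <-]; rewrite chart_mapK.
Qed.

(** * A bump function in one chart, on a ball where [w] keeps its sign *)

Section Bump.
Context d (X : measurableType d) (m : {sigma_finite_measure set X -> \bar R}) (iota : X -> 'rV[R]_n).
Hypothesis hm : lebesgue_model m iota.
Variables (c : chart R n M) (y0 : 'rV[R]_n) (r : R).
Hypothesis hc : atlas c.
Hypothesis r0 : 0 < r.
Hypothesis ball_dom : forall y, ball y0 r y -> (c @` chart_dom c) y /\ 0 < w c y * w c y0.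

Let eta := r / 2.
Let eta0 : 0 < eta. Proof. by rewrite divr_gt0. Qed.

Definition bump_quad (y : 'rV[R]_n) : R := \sum_i ((y 0 i - y0 0 i) / eta) ^+ 2.
(** Its support lies over a Euclidean ball of radius [eta = r / 2], well inside the sup-norm ball of
    radius [r]. *)
Definition bump (p : M) : R := if `[< chart_dom c p >] then plateau (bump_quad (c p)) else 0.
Let K : set 'rV[R]_n := [set y | bump_quad y <= 1].
Let KM : set M := chart_inv c @` K.

Lemma bump_quad_Ck k : Ck_on k setT bump_quad.
Proof.
apply: (Ck_sum openT) => i _.
have h : Ck_on k [set: 'rV[R]_n] (fun y => (y 0 i - y0 0 i) * eta^-1).
  by apply: (CkM openT) (Ck_cst k _ _); apply: (CkB openT) (Ck_cst k _ _); exact: Ck_coord.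
by apply: (Ck_ext openT) (CkM openT h h) => y _; rewrite expr2.
Qed.

Let quad_coord y i : K y -> `|y 0 i - y0 0 i| <= eta.
Proof.
rewrite /K /= /bump_quad (bigD1 i) //= => h.
have : ((y 0 i - y0 0 i) / eta) ^+ 2 <= 1.
  by apply: le_trans h; rewrite lerDl sumr_ge0 // => j _; exact: sqr_ge0.
rewrite -real_normK ?num_real // expr_le1 //.
by rewrite normrM normfV (gtr0_norm eta0) ler_pdivrMr // mul1r.
Qed.

Let K_ball y : K y -> ball y0 r y.
Proof.
move=> Ky; apply/rV_ballP => // i; rewrite distrC; apply: le_lt_trans (quad_coord i Ky) _.
by rewrite /eta ltr_pdivrMr // ltr_pMr // ltr1n.
Qed.

Let K_closed : closed K.
Proof.
have cq : continuous bump_quad by move=> y; exact: (Ck_continuous (bump_quad_Ck 0)).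
have -> : K = bump_quad @^-1` [set t | t <= 1] by [].
by move/continuous_closedP: cq; apply; exact: closed_le.
Qed.

Let K_compact : compact K.
Proof.
have cpt : compact [set y : 'rV[R]_n | forall j, y 0 j \in `[y0 0 j - eta, y0 0 j + eta]].
  by have := @rV_compact R n (fun j => `[y0 0 j - eta, y0 0 j + eta]%classic) (fun=> @segment_compact _ _ _); apply.
apply: subclosed_compact K_closed cpt _ => y Ky j.
by rewrite in_itv /= -ler_distl; exact: quad_coord.
Qed.

(** In a Hausdorff space the compact support is closed, so the bump extends by zero as a C^1
    function. *)
Let KM_closed : closed KM.
Proof.
apply: compact_closed; first exact: manifold_hausdorff.
apply: continuous_compact K_compact; apply: continuous_in_subspaceT => y; rewrite inE => Ky.
by apply: chart_inv_continuous; have [] := ball_dom (K_ball Ky).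
Qed.

Let out_KM p : ~ KM p -> bump p = 0.
Proof.
move=> hp; rewrite /bump; case: asboolP => // dp; apply: plateau_eq0.
rewrite leNgt; apply/negP => h; apply: hp; exists (c p); first exact: ltW.
exact: chart_mapK.
Qed.

Let out_near p psi : ~ KM p -> \forall q \near p, psi q * bump q = 0.
Proof.
move=> hp; have : nbhs p (~` KM) by apply: open_nbhs_nbhs; split=> //; rewrite openC.
by apply: filterS => q hq; rewrite out_KM // mulr0.
Qed.

Lemma bump_C1 : C1_fun bump.
Proof.
move=> c' hc'; apply: Ck_points => y [p dp' <-].
have [dp|dp] := pselect (chart_dom c p).
  exists (c' @` (chart_dom c' `&` chart_dom c)); first by exists p.
  have oO : open (c' @` (chart_dom c' `&` chart_dom c)) by exact: overlap_open.
  have h := Ck_comp oO openT (fun _ _ => I) (bump_quad_Ck 1) (fun a => transition_Ck a 1 hc' hc).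
  apply: (Ck_ext oO) (plateau_C1 oO h) => z [q [dq' dq] <-].
  by rewrite /bump /transition chart_mapK // asboolT.
have hp : ~ KM p.
  by move=> [z Kz e]; apply: dp; rewrite -e; have [[q dq <-] _] := ball_dom (K_ball Kz); rewrite chart_mapK.
have oK : open (~` KM) by rewrite openC.
exists (c' @` (chart_dom c' `&` ~` KM)); first by exists p.
have oO := chart_img_openI (c := c') oK.
apply: (Ck_ext oO) (Ck_cst 1 _ 0) => z [q [dq' dq] <-].
by rewrite chart_mapK // out_KM.
Qed.

Lemma bump_eq1 p : chart_dom c p -> c p = y0 -> \forall q \near p, bump q = 1.
Proof.
move=> dp cp; have cq : {for p, continuous (bump_quad \o c)}.
  apply: continuous_comp; first exact: chart_map_continuous.
  exact: (Ck_continuous (bump_quad_Ck 0)).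
have q0 : bump_quad y0 = 0.
  by rewrite /bump_quad big1 // => i _; rewrite subrr mul0r expr0n.
have h1 : \forall q \near p, chart_dom c q by apply: open_nbhs_nbhs; split=> //; exact: chart_dom_open.
have h2 : nbhs p (fun q => bump_quad (c q) < 4^-1).
  apply: (cq [set t | t < 4^-1]); apply: open_nbhs_nbhs; split; first exact: open_lt.
  by rewrite /= cp q0 invr_gt0.
by apply: filterS2 h1 h2 => q dq hq; rewrite /bump asboolT // plateau_eq1 // ltW.
Qed.

Section Test.
Variable psi : M -> R.
Hypothesis hpsi : C1_fun psi.

Let g := flux_div (fun p => psi p * bump p).
Let field i (y : 'rV[R]_n) : R := psi (chart_inv c y) * plateau (bump_quad y) * V c i y.
Let G y := \sum_i partial i (field i) y.

Let field_eq0 i y : ~ K y -> field i y = 0.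
Proof.
by move=> /negP; rewrite -ltNge => /ltW h; rewrite /field plateau_eq0 // mulr0 mul0r.
Qed.

Let field_near i y : ~ K y -> \forall z \near y, field i z = 0.
Proof.
move=> hy; have : nbhs y (~` K) by apply: open_nbhs_nbhs; split=> //; rewrite openC.
by apply: filterS => z; exact: field_eq0.
Qed.

Let field_C1 i : Ck_on 1 setT (field i).
Proof.
apply: Ck_points => y _; have [Dy|Dy] := pselect ((c @` chart_dom c) y).
  exists (c @` chart_dom c) => //; apply: (CkM (@oD c)); last exact: V_smooth.
  apply: (CkM (@oD c)); first exact: hpsi.
  by apply: (plateau_C1 (@oD c)); exact: Ck_sub (bump_quad_Ck 1).
have hy : ~ K y by move=> /K_ball/ball_dom[].
have oK : open (~` K) by rewrite openC.
by exists (~` K) => //; apply: (Ck_ext oK) (Ck_cst 1 _ 0) => z hz; rewrite field_eq0.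
Qed.

Let G_eq0 y : ~ K y -> G y = 0.
Proof.
move=> hy; rewrite /G big1 // => i _; transitivity (partial i (fun=> 0 : R) y); last by rewrite partial_cst.
by apply: partial_near; exact: field_near.
Qed.

Let GE y : (c @` chart_dom c) y ->
  G y = w c y * (T (chart_inv c y) * (psi (chart_inv c y) * bump (chart_inv c y)) + flux (fun p => psi p * bump p) c y).
Proof.
move=> Dy; rewrite -(flux_coord (C1_funM hpsi bump_C1) hc Dy); apply: eq_bigr => i _.
apply: partial_near; apply: (eq_near (@oD c)) Dy => z [p dp <-].
by rewrite /field /bump chart_mapK // asboolT.
Qed.

Let g_density y : (c @` chart_dom c) y ->
  g (chart_inv c y) * density c y = Num.sg (w c y0) * G y.
Proof.
move=> Dy; have [Ky|Ky] := pselect (K y); last first.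
  rewrite G_eq0 // mulr0 /g flux_div_eq0 ?mul0r //; apply: out_near => -[z Kz e]; apply: Ky.
  have [Dz _] := ball_dom (K_ball Kz).
  by have [<- _] := chart_imgK Dy; rewrite -e; have [-> _] := chart_imgK Dz.
have [_ ww] := ball_dom (K_ball Ky); rewrite GE //.
have [ey dy] := chart_imgK Dy; rewrite /g (flux_divE (C1_funM hpsi bump_C1) hc dy) ey.
have -> : Num.sg (w c y0) * (w c y * (T (chart_inv c y) * (psi (chart_inv c y) * bump (chart_inv c y)) + flux (fun p => psi p * bump p) c y)) =
  (Num.sg (w c y0) * w c y) * (T (chart_inv c y) * (psi (chart_inv c y) * bump (chart_inv c y)) + flux (fun p => psi p * bump p) c y) by exact: mulrA.
(* On the ball [w] has the sign it has at the centre, so this product is [|w|], known from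
   [w_volume]. *)
have -> : Num.sg (w c y0) * w c y = Num.sqrt (1 - kappa * s (chart_inv c y)) * density c y.
  rewrite /density -sqrtrM ?ltW ?conf_s_gt0 // -(w_volume hc Dy) sqrtr_sqr.
  have : Num.sg (w c y0) = Num.sg (w c y).
    move: ww; have [h|h|->] := ltgtP (w c y0) 0; last by rewrite mulr0 ltxx.
      by rewrite (nmulr_lgt0 _ h) => h'; rewrite !ltr0_sg.
    by rewrite (pmulr_lgt0 _ h) => h'; rewrite !gtr0_sg.
  by move=> ->; rewrite [RHS]normrEsg.
by ring.
Qed.

Let bound : R := `|y0| + r.
Let G_box (y : 'rV[R]_n) : (exists j, bound < `|y 0 j|) -> ~ K y.
Proof.
move=> [j hj] Ky; move: hj; apply/negP; rewrite -leNgt /bound.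
have h1 := quad_coord j Ky; have h2 := rV_coord_le y0 j.
have := ler_normD (y 0 j - y0 0 j) (y0 0 j); rewrite subrK => /le_trans; apply.
by rewrite addrC lerD // (le_trans h1) // /eta ler_pdivrMr // ler_peMr ?ler1n // ltW.
Qed.

Let mi i : measurable_fun setT (fun t => iota t 0 i : R). Proof. by case: hm. Qed.
Let boxfin (e : R) : 0 < e -> (m (iota @^-1` box 0 e) < +oo)%E.
Proof. by move=> e0; have [_ _ /(_ 0 e e0)/andP[]] := hm. Qed.

Let field_integrable i : m.-integrable setT (EFin \o partial i (field i) \o iota).
Proof.
apply: (box_integrable mi (B := bound)) => // [y|y hy].
  by have [_ /(_ i)[_ [h _]]] := field_C1 i; exact: h.
transitivity (partial i (fun=> 0 : R) y); last by rewrite partial_cst.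
by apply: partial_near; exact: (field_near i (G_box hy)).
Qed.

Let G_integrable : m.-integrable setT (EFin \o (fun y => Num.sg (w c y0) * G y) \o iota).
Proof.
apply: (box_integrable mi (B := bound)) => // [y|y hy]; last by rewrite G_eq0 ?mulr0 //; exact: G_box.
have h : Ck_on 0 setT (fun y => Num.sg (w c y0) * G y).
  by apply: (CkM openT); [exact: Ck_cst|apply: (Ck_sum openT) => i _; exact: Ck_partial].
exact: (Ck_continuous h).
Qed.

Let g_continuous : continuous g.
Proof. exact: (flux_div_continuous (C1_funM hpsi bump_C1)). Qed.

Let g_dom p : ~ chart_dom c p -> g p = 0.
Proof.
move=> dp; apply: flux_div_eq0; apply: out_near => -[z Kz e]; apply: dp.
by rewrite -e; have [[q dq <-] _] := ball_dom (K_ball Kz); rewrite chart_mapK.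
Qed.

Let restrict_domain (h : R -> R) : h 0 = 0 ->
  (\int[m]_(t in domain iota c) (h (g (param iota c t) * density c (iota t)))%:E =
   \int[m]_t (h (Num.sg (w c y0) * G (iota t)))%:E)%E.
Proof.
move=> h0; rewrite integral_mkcond; apply: eq_integral => t _; rewrite /patch; case: ifPn.
  by rewrite inE => Dt; rewrite /param g_density.
rewrite notin_setE => Dt; rewrite G_eq0 ?mulr0 ?h0 // => /K_ball/ball_dom[Dt' _].
exact: Dt.
Qed.

Let to_chart (v : M -> R) : (forall p, ~ chart_dom c p -> v p = 0) ->
  (\int[dM]_p (v p)%:E = \int[dM]_(p in (chart_dom c : set (borel M))) (v p)%:E)%E.
Proof.
move=> hv; rewrite [RHS]integral_mkcond; apply: eq_integral => p _; rewrite /patch; case: ifPn => //.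
by rewrite notin_setE => /hv ->.
Qed.

(** In the chart the integrand is, up to a constant sign, the Euclidean divergence of a C^1 field of
    compact support. *)
Lemma bump_flux : dM.-integrable setT (EFin \o (flux_div (fun p => psi p * bump p) : borel M -> R)) /\
  (\int[dM]_p (flux_div (fun p => psi p * bump p) p)%:E = 0)%E.
Proof.
split.
  apply/integrableP; split; first by apply/measurable_EFinP; exact: (borel_continuous g_continuous).
  have cn : continuous (fun p => `|g p|).
    by move=> p; apply: (@continuous_comp _ _ _ g (fun t : R => `|t|)); [exact: g_continuous|exact: norm_continuous].
  have := to_chart (v := fun p => `|g p|) (fun p dp => etrans (congr1 _ (g_dom dp)) (normr0 _)).
  rewrite (chart_integral hdM hm hc cn) => e.
  have /integrableP[_] := G_integrable; apply: le_lt_trans; rewrite le_eqVlt; apply/orP; left; apply/eqP.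
  rewrite [LHS]e -(restrict_domain (h := fun t => `|t|) (normr0 _)); apply: eq_integral => t _.
  have d0 : `|density c (iota t)| = density c (iota t) by apply: ger0_norm; exact: sqrtr_ge0.
  by rewrite [X in _ = X%:E]normrM d0.
rewrite -/g (to_chart g_dom) (chart_integral hdM hm hc g_continuous) (restrict_domain (h := id)) //.
transitivity (\int[m]_t ((Num.sg (w c y0))%:E * \sum_i (partial i (field i) (iota t))%:E))%E.
  by apply: eq_integral => t _; rewrite sumEFin EFinM.
rewrite integralZl //; last by apply: integrable_sum => // i _; exact: field_integrable.
rewrite integral_sum //.
rewrite big1 ?mule0 // => i _; have [_ _ _ h] := hm; apply: (h _ bound) (field_C1 i) _ => y hy.
by rewrite field_eq0 //; exact: G_box.
Qed.

End Test.

End Bump.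

(** Required for all [psi] at once, so that several such functions can be applied one after the
    other in place of a partition of unity. *)
Definition null_flux chi := C1_fun chi /\ forall psi, C1_fun psi ->
  dM.-integrable setT (EFin \o (flux_div (fun p => psi p * chi p) : borel M -> R)) /\
  (\int[dM]_p (flux_div (fun p => psi p * chi p) p)%:E = 0)%E.

Lemma null_flux_exists (p : M) : exists2 chi : M -> R, null_flux chi & nbhs p (fun q : M => chi q = 1).
Proof.
have [d [X [m [iota hm]]]] := @lebesgue_model_exists R n.
pose c := chart_at p; have hc : atlas c by exact: chart_at_atlas.
have dp : chart_dom c p by exact: chart_at_dom.
have Dp : (c @` chart_dom c) (c p) by exists p.
have h1 : nbhs (c p) (c @` chart_dom c) by apply: open_nbhs_nbhs; split=> //; exact: oD.
have cw : {for c p, continuous (fun y => w c y * w c (c p))}.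
  by apply: continuousM; [exact: Ck_continuous (w_smooth hc) Dp|exact: cst_continuous].
have h2 : nbhs (c p) (fun y => 0 < w c y * w c (c p)).
  apply: (cw [set t | 0 < t]); apply: open_nbhs_nbhs; split; first exact: open_gt.
  by rewrite /= -expr2 exprn_even_gt0 //= w_neq0.
have /nbhs_ballP[r /= r0 hr] : nbhs (c p) (fun y => (c @` chart_dom c) y /\ 0 < w c y * w c (c p)).
  exact: filterI h1 h2.
have bd y : ball (c p) r y -> (c @` chart_dom c) y /\ 0 < w c y * w c (c p) by move=> /hr.
exists (bump c (c p) r); last exact: bump_eq1.
split; first exact: (bump_C1 hc r0 bd).
by move=> psi hpsi; exact: (bump_flux hm hc r0 bd hpsi).
Qed.

Lemma flux_divD psi chi p : C1_fun psi -> C1_fun chi ->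
  flux_div (fun q => psi q + chi q) p = flux_div psi p + flux_div chi p.
Proof.
move=> h1 h2; rewrite /flux_div -mulrDr; congr (_ * _).
have hc : atlas (chart_at p) by exact: chart_at_atlas.
have Dp : (chart_at p @` chart_dom (chart_at p)) (chart_at p p) by exists p => //; exact: chart_at_dom.
rewrite addrACA -mulrDr; congr (_ + _); rewrite /flux -big_split /=; apply: eq_bigr => i _.
rewrite -mulrDl; congr (_ * _).
by apply: partialD; [exact: Ck_derivable (h1 _ hc) Dp|exact: Ck_derivable (h2 _ hc) Dp].
Qed.

(** [psi] is split as [psi chi_k + psi (1 - chi_k)]; the second term vanishes where [chi_k = 1], so
    the remaining functions cover its support. *)
Lemma flux_div_sum (k : nat) (chi : nat -> M -> R) psi : (forall j, null_flux (chi j)) -> C1_fun psi ->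
  (forall p, psi p != 0 -> exists2 j, (j < k)%N & chi j p = 1) ->
  dM.-integrable setT (EFin \o (flux_div psi : borel M -> R)) /\ (\int[dM]_p (flux_div psi p)%:E = 0)%E.
Proof.
move=> hchi; elim: k psi => [|k IH] psi hpsi cov.
  have psi0 p : psi p = 0 by apply/eqP/negP => /negP /cov[].
  have z : EFin \o (flux_div psi : borel M -> R) = cst 0%E.
    by apply/funext => p /=; rewrite flux_div_eq0 //; apply: nearW => q; exact: psi0.
  by split; [rewrite z; exact: integrable0|rewrite -[LHS]/(\int[dM]_p (EFin \o flux_div psi) p)%E z integral0].
have [hk1 hk] := hchi k; have [i1 z1] := hk psi hpsi.
have hB : C1_fun (fun p => psi p - psi p * chi k p) by exact: (C1_funB hpsi (C1_funM hpsi hk1)).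
have [i2 z2] : dM.-integrable setT (EFin \o (flux_div (fun p => psi p - psi p * chi k p) : borel M -> R)) /\
    (\int[dM]_p (flux_div (fun p => psi p - psi p * chi k p) p)%:E = 0)%E.
  apply: IH => // p hp; have [|j] := cov p.
    by apply: contra_neq hp => ->; rewrite mul0r subrr.
  rewrite ltnS leq_eqVlt => /orP[/eqP ->|jk] e; last by exists j.
  by move: hp; rewrite e mulr1 subrr eqxx.
pose f1 : borel M -> R := flux_div (fun p => psi p * chi k p).
pose f2 : borel M -> R := flux_div (fun p => psi p - psi p * chi k p).
have E : EFin \o (flux_div psi : borel M -> R) = ((EFin \o f1) \+ (EFin \o f2))%E.
  apply/funext => p; rewrite /= -EFinD /f1 /f2 -(flux_divD p (C1_funM hpsi hk1) hB).
  by congr (flux_div _ _)%:E; apply/funext => q; rewrite addrC subrK.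
split; first by rewrite E; exact: integrableD.
rewrite -[LHS]/(\int[dM]_p (EFin \o flux_div psi) p)%E E integralD //.
by rewrite [X in (X + _)%E]z1 [X in (_ + X)%E]z2 adde0.
Qed.

Theorem flux_div_zero psi (C : R) : C1_fun psi -> (forall p, psi p != 0 -> s p <= C) ->
  dM.-integrable setT (EFin \o (flux_div psi : borel M -> R)) /\ (\int[dM]_p (flux_div psi p)%:E = 0)%E.
Proof.
move=> hpsi hC.
have [chi hchi] := choice (fun p => let: ex_intro2 x h1 h2 := null_flux_exists p in ex_intro _ x (conj h1 h2)).
have := @s_proper C; rewrite compact_cover => /(_ M setT (fun p : M => interior [set q : M | chi p q = 1])).
case=> [p _|p _|F _ cov]; first exact: open_interior.
  by exists p => //; have [_ h] := hchi p.
have Fn : forall j, null_flux (chi (nth point (finmap.enum_fset F) j)) by move=> j; have [] := hchi (nth point (finmap.enum_fset F) j).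
apply: (@flux_div_sum (size (finmap.enum_fset F)) (fun j => chi (nth point (finmap.enum_fset F) j)) psi Fn hpsi) => p /hC sp.
have [q qF /interior_subset e] := cov p sp.
exists (index q (finmap.enum_fset F)); first by rewrite index_mem.
by rewrite nth_index.
Qed.

Lemma s_continuous : continuous s.
Proof. by apply: chart_continuous => c hc y Dy; exact: Ck_continuous (s_smooth hc 0) Dy. Qed.

Lemma cutoff_C1 e : 0 <= e -> C1_fun (fun p => profile kappa e (s p)).
Proof.
move=> e0 c hc; apply: (C1_comp1 (@oD c) (s_smooth hc 1) (dg := dprofile kappa e) _).1 => y Dy.
by split; [exact: is_derive_profile|exact: dprofile_continuous].
Qed.

Lemma cutoff_bound e p : 0 <= e ->
  T p * weight kappa e (s p) <= flux_div (fun p => profile kappa e (s p)) p + 4 * e * T p.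
Proof.
move=> e0; pose c := chart_at p; have hc : atlas c by exact: chart_at_atlas.
have dp : chart_dom c p by exact: chart_at_dom.
have Dp : (c @` chart_dom c) (c p) by exists p.
rewrite (flux_divE (cutoff_C1 e0) hc dp).
have -> : flux (fun p => profile kappa e (s p)) c (c p) =
    dprofile kappa e (s p) * \sum_i partial i (fun z => s (chart_inv c z)) (c p) * nf c (c p) 0 i.
  rewrite mulr_sumr; apply: eq_bigr => i _; rewrite mulrA; congr (_ * _).
  have h y (Dy : (c @` chart_dom c) y) : is_derive (s (chart_inv c y)) (1 : R) (profile kappa e) (dprofile kappa e (s (chart_inv c y)))
      /\ {for s (chart_inv c y), continuous (dprofile kappa e)}.
    by split; [exact: is_derive_profile|exact: dprofile_continuous].
  by rewrite ((C1_comp1 (@oD c) (s_smooth hc 1) h).2 _ i Dp) chart_mapK.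
apply: weight_bound => //.
by have := nf_bound hc Dp; rewrite chart_mapK.
Qed.

Let meas (f : M -> R) : continuous f -> measurable_fun setT (EFin \o (f : borel M -> R)).
Proof. by move=> cf; apply/measurable_EFinP; exact: borel_continuous. Qed.

Lemma weight_s_continuous e : 0 <= e -> continuous (fun p => T p * weight kappa e (s p)).
Proof.
move=> e0 p; have c1 : {for p, continuous T} by exact: T_continuous.
have c2 : {for p, continuous (fun q => weight kappa e (s q))}.
  by apply: (@continuous_comp _ _ _ s (weight kappa e)); [exact: s_continuous|exact: weight_continuous].
exact: (continuousM c1 c2).
Qed.

Lemma weighted_integral e : 0 < e -> dM.-integrable setT (EFin \o (T : borel M -> R)) ->
  (\int[dM]_p (T p * weight kappa e (s p))%:E <= (4 * e)%:E * \int[dM]_p (T p)%:E)%E.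
Proof.
move=> e0 iT; have e0' := ltW e0.
have [i1 z1] : dM.-integrable setT (EFin \o (flux_div (fun p => profile kappa e (s p)) : borel M -> R)) /\
   (\int[dM]_p (flux_div (fun p => profile kappa e (s p)) p)%:E = 0)%E.
  (* The profile vanishes as soon as [1 + s >= exp (1 / e)]. *)
  apply: (@flux_div_zero _ (expR e^-1)); first exact: cutoff_C1.
  move=> p; apply: contra_neqT; rewrite -ltNge => h; rewrite /profile pos2_eq0 ?mul0r //.
  have s0 := s_ge0 p; have p0 : 0 < 1 + s p by rewrite ltr_pwDl.
  rewrite /log_height subr_le0 -ler_pdivrMl // mulr1 -(expRK e^-1) ler_ln ?posrE ?expR_gt0 //.
  by apply: (le_trans (ltW h)); rewrite lerDr.
have i2 := integrableZl measurableT (4 * e) iT.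
apply: (@le_trans _ _ (\int[dM]_p ((flux_div (fun p => profile kappa e (s p)) p)%:E + (4 * e)%:E * (T p)%:E))%E).
  apply: ge0_le_integral => //.
  - by move=> p _; rewrite lee_fin mulr_ge0 // weight_ge0.
  - exact: (meas (weight_s_continuous e0')).
  - by apply: measurable_int; exact: (integrableD measurableT i1 i2).
  - by move=> p _; rewrite -EFinM -EFinD lee_fin; exact: cutoff_bound.
by rewrite (integralD measurableT i1 i2) z1 add0e (integralZl measurableT iT).
Qed.

(** If the integral [I] were finite, the weighted integral would be at most [4 e I]. On a fixed open
    set around a point where [T] is positive, however, the weighted integrand stays above [delta]
    for all small [e]. *)
Theorem flux_infinite : (exists p, T p != 0) -> (\int[dM]_p (T p)%:E = +oo)%E.
Proof.
move=> [p1 Tp1]; apply/eqP; apply: contraT; rewrite -ltey => fin.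
have iT : dM.-integrable setT (EFin \o (T : borel M -> R)).
  apply/integrableP; split; first exact: (meas T_continuous).
  by under eq_integral => p _ do rewrite /= ger0_norm //.
have I0 : (0 <= \int[dM]_p (T p)%:E)%E by apply: integral_ge0 => p _; rewrite lee_fin.
have [I IE] : exists I : R, (\int[dM]_p (T p)%:E)%E = I%:E.
  by exists (fine (\int[dM]_p (T p)%:E)%E); rewrite fineK // ge0_fin_numE.
have {}I0 : 0 <= I by rewrite -lee_fin -IE.
have t0 : 0 < T p1 by rewrite lt0r Tp1 T_ge0.
pose U : set M := [set p | T p1 / 2 < T p] `&` [set p | s p < s p1 + 1].
have oU : open U.
  by apply: openI; [apply: (open_comp (f := T)) (@open_gt _ _) => p _; exact: T_continuous
    |apply: (open_comp (f := s)) (@open_lt _ _) => p _; exact: s_continuous].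
have Up1 : U p1 by split=> /=; [rewrite ltr_pdivrMr // ltr_pMr // ltr1n|rewrite ltrDl].
have [d [X [m [iota hm]]]] := @lebesgue_model_exists R n.
have uU := volume_open_gt0 hdM hm oU Up1; have mU := borel_open oU.
have L0 : 0 < ln (2 + s p1) by rewrite ln_gt0 //; have := s_ge0 p1; lra.
have Q0 : 0 < 1 - kappa * (s p1 + 1) by apply: quad_gt0 => //; rewrite addr_ge0.
(* The three factors bound from below, on [U], the function [T], the squared cutoff when
   [log_height >= 1/2], and [1 / (1 - kappa s)]. *)
pose delta := T p1 / 2 * (4^-1 * (1 - kappa * (s p1 + 1))^-1).
have delta0 : 0 < delta by rewrite !mulr_gt0 ?invr_gt0.
have key e : 0 < e -> e * ln (2 + s p1) <= 2^-1 -> (delta%:E * dM (U : set (borel M)) <= (4 * e * I)%:E)%E.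
  move=> e0 eL; have := weighted_integral e0 iT; rewrite IE -EFinM; apply: le_trans.
  have mh := meas (weight_s_continuous (ltW e0)).
  have h0 p : (0 <= (T p * weight kappa e (s p))%:E)%E by rewrite lee_fin mulr_ge0 // weight_ge0.
  apply: (@le_trans _ _ (\int[dM]_(p in (U : set (borel M))) (T p * weight kappa e (s p))%:E)%E).
    rewrite -(integral_cst dM mU); apply: ge0_le_integral => //.
    - by move=> p _; rewrite lee_fin ltW.
    - exact: measurable_funTS.
    - move=> p [/= h1 h2]; rewrite lee_fin; have s0 := s_ge0 p; have qp := quad_gt0 kappa_le0 s0.
      apply: ler_pM; [by rewrite divr_ge0 // ltW|by rewrite mulr_ge0 // invr_ge0 ltW|exact: ltW|].
      apply: ler_pM; [by []|by rewrite invr_ge0 ltW| |].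
        have hl : 2^-1 <= log_height e (s p).
          have : e * ln (1 + s p) <= e * ln (2 + s p1).
            apply: ler_wpM2l; first exact: ltW.
            by rewrite ler_ln ?posrE ?ltr_pwDl //; lra.
          by rewrite /log_height; lra.
        rewrite /pos2 /ramp max_r; last by lra.
        by move: hl; move: (log_height _ _) => a ha; nra.
      rewrite lef_pV2 ?posrE // lerD2l lerN2 ler_wnM2l // ltW //.
  by apply: ge0_subset_integral => //.
have Le : (2 * ln (2 + s p1))^-1 * ln (2 + s p1) <= 2^-1.
  by rewrite invfM mulrAC -mulrA divff ?mulr1 // gt_eqF.
have e1 : 0 < (2 * ln (2 + s p1))^-1 by rewrite invr_gt0 mulr_gt0.
(* The estimate [key] for one admissible [e] already shows that [U] has finite volume. *)
have uf : dM (U : set (borel M)) \is a fin_num.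
  rewrite ge0_fin_numE; last exact: ltW.
  have := key _ e1 Le; case: (dM (U : set (borel M))) uU => [a| |] //= _; rewrite ?ltry //.
  by rewrite gt0_muley ?lte_fin.
have [v vE] : exists v, dM (U : set (borel M)) = v%:E by exists (fine (dM (U : set (borel M)))); rewrite fineK.
rewrite vE lte_fin in uU; rewrite vE in key.
(* The second bound gives [4 e I < delta v], against [key]; adding 1 to [I] covers [I = 0]. *)
pose e := Num.min (2 * ln (2 + s p1))^-1 (delta * v / (8 * (I + 1))).
have I1 : 0 < I + 1 by rewrite ltr_pwDr.
have e0 : 0 < e by rewrite lt_min e1 /=; apply: divr_gt0; exact: mulr_gt0.
have eL : e * ln (2 + s p1) <= 2^-1.
  by apply: le_trans Le; apply: ler_wpM2r; [exact: ltW|rewrite ge_min lexx].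
have := key e e0 eL; rewrite -EFinM lee_fin => h1.
have h2 : e * (8 * (I + 1)) <= delta * v by rewrite -ler_pdivlMr ?mulr_gt0 // ge_min lexx orbT.
have h4 : 0 <= e * I by rewrite mulr_ge0 // ltW.
suff : 0 < (0 : R) by rewrite ltxx.
move: (delta * v) h1 h2 => dv h1 h2; lra.
Qed.

End FluxTheorem.

Lemma Ck_sqn {R : realType} n q (D : set 'rV[R]_n) (X : 'rV[R]_n -> 'rV[R]_q) k : open D ->
  (forall a, Ck_on k D (fun y => X y 0 a)) -> Ck_on k D (fun y => sqn (X y)).
Proof.
move=> oD hX; apply: (Ck_ext oD) (_ : Ck_on k D (fun y => \sum_a X y 0 a * X y 0 a)) => [y _|].
  by rewrite sqn_sum; apply: eq_bigr => a _; rewrite expr2.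
by apply: (Ck_sum oD) => a _; exact: CkM.
Qed.

(** Stated for all real [C]: the enclosing box uses [|C| + 1], which also serves when the set is
    empty. *)
Lemma sqn_ball_compact {R : realType} q (C : R) : compact [set v : 'rV[R]_q | sqn v <= C].
Proof.
have cq : continuous (@sqn R q).
  by move=> v; exact: (Ck_continuous (Ck_sqn openT (fun a => Ck_coord 0 setT a))).
have cB : compact [set v : 'rV[R]_q | forall a, v 0 a \in `[- (`|C| + 1), `|C| + 1]].
  by have := @rV_compact R q (fun=> `[- (`|C| + 1), `|C| + 1]%classic) (fun=> @segment_compact _ _ _); apply.
apply: subclosed_compact cB _.
  have -> : [set v : 'rV[R]_q | sqn v <= C] = (@sqn R q) @^-1` [set t | t <= C] by [].
  by move/continuous_closedP: cq; apply; exact: closed_le.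
move=> v /= hv a; rewrite in_itv /=.
have h1 : v 0 a ^+ 2 <= `|C|.
  apply: le_trans (le_trans hv (ler_norm C)); rewrite sqn_sum (bigD1 a) //= lerDl.
  by rewrite sumr_ge0 // => b _; exact: sqr_ge0.
have h2 := normr_ge0 C; move: (v 0 a) h1 h2 => t; move: `|C| => D *.
by apply/andP; split; nra.
Qed.
Theorem theoremB (R : realType) (n r : nat) (kappa : R)
  (Q : riemannianManifold R n.+1) (M : riemannianManifold R n)
  (x : M -> Q) (N : chart R n.+1 Q -> M -> 'rV[R]_n.+1)
  (lam : 'I_n -> M -> R) (dM : {measure set (borel M) -> \bar R})
  (hQ : space_form Q kappa) (hkappa : kappa <= 0)
  (hMcomplete : riemannian_complete M)
  (hMnoncompact : ~ compact [set: M])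
  (hMorientable : orientable M)
  (himm : immersion x) (hisom : isometric x) (hproper : proper_map x)
  (hN : unit_normal_field x N)
  (hlam : principal_curvatures x N lam)
  (hdM : is_volume dM)
  (hr : (r < n)%N)
  (hSr_ge0 : forall p : M, 0 <= S_ lam r p)
  (hSr_neq0 : exists p : M, S_ lam r p != 0)
  (hSr1 : forall p : M, S_ lam r.+1 p = 0) :
  (\int[dM]_(p in [set: borel M]) (S_ lam r p)%:E)%E = +oo%E.
Proof.
case: hQ => hcomplete hsc hcurv.
have [f [p0 f0 hf]] := model_map hsc hcurv.
have fs c : atlas c -> forall a k, Ck_on k (c @` chart_dom c) (fun y => in_chart f c y 0 a).
  by move=> /hf[].
have fh c : atlas c -> forall a, hess_on (metric_coord c) kappa (c @` chart_dom c) (fun y => in_chart f c y 0 a).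
  by move=> /hf[].
have fi c : atlas c -> forall y, (c @` chart_dom c) y -> first_integral (metric_coord c) kappa (in_chart f c) y = 1%:M.
  by move=> /hf[].
have [om omE] := @coef_weights R n.+1 r (leqW hr).
(* The flux theorem is applied to [(n - r) S_r], the divergence actually computed; the positive
   factor is divided out at the end. *)
pose s p := sqn (position x f p); pose T p := (n - r)%:R * S_ lam r p.
pose w c y := \det (chart_frame x N f c y).
have nr : 0 < (n - r)%:R :> R by rewrite ltr0n subn_gt0.
have s0 p : 0 <= s p by exact: sqn_ge0.
have T0 p : 0 <= T p by rewrite mulr_ge0.
have oD (c : chart R n M) : open (c @` chart_dom c) by exact: chart_img_open.
have ss c : atlas c -> forall k, Ck_on k (c @` chart_dom c) (fun y => s (chart_inv c y)).
  by move=> hc k; exact: (Ck_sqn (oD c) (fun a => position_smooth fs himm a k hc)).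
have ws c : atlas c -> Ck_on 0 (c @` chart_dom c) (w c).
  move=> hc; apply: (Ck_det (oD c)) => a b; case: (split_ordP a) => a' ->.
    apply: (Ck_ext (oD c)) (normal_smooth fs himm hN b 0 hc) => y _.
    by rewrite col_mxEu (ord1 a').
  apply: (Ck_ext (oD c)) (Ck_partial a' (position_smooth fs himm b 1 hc)) => y _.
  by rewrite col_mxEd mxE.
have Vs c (hc : atlas c) i k := newton_flow_smooth fs himm hN om i k hc.
have Vd c (hc : atlas c) y (Dy : (c @` chart_dom c) y) :=
  newton_flow_divergence hkappa fs fh fi himm hisom hN hlam hr omE hSr_ge0 hSr1 hc Dy.
have wv c (hc : atlas c) y (Dy : (c @` chart_dom c) y) := frame_volume hkappa fs fi himm hisom hN hc Dy.
have sp C : compact [set p : M | s p <= C].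
  have cB := @sqn_ball_compact R n.+1 C.
  by have [_ hp] := hproper; exact: (hp _ (model_proper hkappa f0 fs fi hcomplete hsc cB)).
have I : (\int[dM]_(p in [set: borel M]) (T p)%:E = +oo)%E.
  apply: (flux_infinite hdM hkappa s0 T0 ss Vs ws _ Vd wv _ _ sp).
  - by move=> c hc i y Dy; exact: (newton_flowE hkappa fs fi himm hisom hN om i hc Dy).
  - by move=> c c' hc hc' y Dy; exact: (newton_field_change kappa fs himm hN om hc hc' Dy).
  - by move=> c hc y Dy; exact: (newton_field_sqn hkappa fs fh fi himm hisom hN hlam hr omE hSr_ge0 hSr1 hc Dy).
  by have [p hp] := hSr_neq0; exists p; rewrite mulf_neq0 // gt_eqF.
have mT : measurable_fun [set: borel M] (EFin \o (T : borel M -> R)).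
  apply/measurable_EFinP; apply: borel_continuous.
  exact: (T_continuous hkappa s0 Vs ws Vd wv).
transitivity (\int[dM]_(p in [set: borel M]) (((n - r)%:R^-1)%:E * (T p)%:E))%E.
  by apply: eq_integral => p _; rewrite -EFinM mulKf // gt_eqF.
have i0 : 0 <= (n - r)%:R^-1 :> R by rewrite invr_ge0 ltW.
have T0' (p : borel M) : [set: borel M] p -> (0 <= (EFin \o (T : borel M -> R)) p)%E by move=> _; rewrite lee_fin.
rewrite (ge0_integralZl_EFin dM measurableT T0' mT i0).
by rewrite I gt0_muley // lte_fin invr_gt0.
Qed.
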